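(* For every Carnot group $G$ there exists $k\in\mathbb N$ such that for every Lipschitz map $f:(G,d_G)\to L^1$ there exists a $k$-fold iterated blowup metric $\rho$ of the pullback metric $d_f$ such that $\rho(x,yz)=\rho(x,y)$ for every $x,y\in G$ and every $z\in[G,G]$.
   Context: $L^1$ denotes $L^1([0,1])$ with Lebesgue measure. A Carnot group of step $s$ is a connected, simply connected Lie group $G$ whose Lie algebra $\mathfrak g$ is stratified: $\mathfrak g=\bigoplus_{i=1}^s V_i$ with $[V_1,V_i]=V_{i+1}$ for $i<s$, $[V_1,V_s]=\{0\}$, $V_s\ne\{0\}$. The dilations $\delta_\lambda:G\to G$, $\lambda>0$, are the Lie group automorphisms with $(\delta_\lambda)_*v=\lambda^i v$ for $v\in V_i$. A scalar product is fixed on $V_1$ and extended left-invariantly to the horizontal distribution (the left-invariant subbundle of $TG$ determined by $V_1$); the Carnot metric $d_G(x,y)$ is the infimum of lengths of absolutely continuous curves from $x$ to $y$ tangent a.e. to the horizontal distribution. For $f:G\to L^1$ the pullback metric is the pseudometric $d_f(x,y)=\|f(x)-f(y)\|_{L^1}$ on $G$. For a pseudometric $d$ on $G$, $x\in G$, $r>0$, put $\frac1r S^*_{x,r}d(y,z):=\frac1r d(x\delta_r(y),x\delta_r(z))$. A pseudometric $\rho$ on $G$ is a blowup metric of $d$ at $x$ if there is a sequence of positive reals $(r_j)_j$ decreasing to $0$ such that $\rho=\lim_{j\to\infty}\frac1{r_j}S^*_{x,r_j}d$ locally uniformly on $G\times G$. A $k$-fold iterated blowup metric of $d$ is a pseudometric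 $\rho=\rho_k$ for which there are pseudometrics $\rho_0=d,\rho_1,\dots,\rho_k$ such that for each $1\le i\le k$, $\rho_i$ is a blowup metric of $\rho_{i-1}$ at some point of $G$. $[G,G]$ is the commutator subgroup. *)

(* Defs.v *)
From HB Require Import structures.
From mathcomp Require Import all_boot all_order all_algebra.
From mathcomp Require Import all_classical all_reals all_analysis.
Import Order.TTheory GRing.Theory Num.Theory.
Import numFieldNormedType.Exports.

Set Implicit Arguments.
Unset Strict Implicit.
Unset Printing Implicit Defensive.

Local Open Scope classical_set_scope.
Local Open Scope ring_scope.

(** * Smooth manifolds *)

(* C^k on an open set U: only the values of f near the points of U matter. *)
Fixpoint Ck_on (R : realType) (n k : nat) (U : set 'rV[R]_n)
    (f : 'rV[R]_n -> R) : Prop :=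
  (forall x, U x -> {for x, continuous f}) /\
  if k is k'.+1 then
    forall i : 'I_n, (forall x, U x -> derivable f x (delta_mx 0 i)) /\
                     Ck_on k' U ('D_(delta_mx 0 i) f)
  else True.

Definition smooth_on (R : realType) (m n : nat) (U : set 'rV[R]_m)
    (F : 'rV[R]_m -> 'rV[R]_n) : Prop :=
  forall (k : nat) (j : 'I_n), Ck_on k U (fun x => F x 0 j).

(* [chart_fun] is meaningful on [chart_dom] only, and [chart_inv] on the image
   of [chart_dom] only. *)
Record chart (R : realType) (n : nat) (M : Type) := Chart {
  chart_dom : set M ;
  chart_fun :> M -> 'rV[R]_n ;
  chart_inv : 'rV[R]_n -> M }.

Definition chart_img (R : realType) (n : nat) (M : Type) (c : chart R n M) :
  set 'rV[R]_n := c @` chart_dom c.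

Definition is_chart (R : realType) (n : nat) (M : topologicalType)
    (c : chart R n M) : Prop :=
  [/\ open (chart_dom c), open (chart_img c),
      {in chart_dom c, cancel c (chart_inv c)},
      {within chart_dom c, continuous c} &
      {within chart_img c, continuous (chart_inv c)}].

Definition is_atlas (R : realType) (n : nat) (M : topologicalType)
    (A : set (chart R n M)) : Prop :=
  [/\ forall c, A c -> is_chart c,
      forall x, exists2 c, A c & chart_dom c x &
      forall c d, A c -> A d ->
        smooth_on (c @` (chart_dom c `&` chart_dom d)) (d \o chart_inv c)].

Definition smooth_map (R : realType) (m n : nat) (M N : topologicalType)
    (A : set (chart R m M)) (B : set (chart R n N)) (F : M -> N) : Prop :=
  continuous F /\
  forall c d, A c -> B d ->
    smooth_on (c @` (chart_dom c `&` F @^-1` chart_dom d))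
              (d \o F \o chart_inv c).

Definition prod_chart (R : realType) (m n : nat) (M N : Type)
    (c : chart R m M) (d : chart R n N) : chart R (m + n) (M * N) :=
  Chart (chart_dom c `*` chart_dom d)
        (fun p => row_mx (c p.1) (d p.2))
        (fun v => (chart_inv c (lsubmx v), chart_inv d (rsubmx v))).

Definition prod_atlas (R : realType) (m n : nat) (M N : Type)
    (A : set (chart R m M)) (B : set (chart R n N)) :
    set (chart R (m + n) (M * N)) :=
  [set prod_chart c d | c in A & d in B].

(* The algebra C^oo(M), as a set of functions. *)
Definition smooth_fun (R : realType) (n : nat) (M : Type)
    (A : set (chart R n M)) (phi : M -> R) : Prop :=
  forall c (k : nat), A c -> Ck_on k (chart_img c) (phi \o chart_inv c).

(** * Lie groups and their Lie algebras *)

HB.mixin Record isLieGroup (R : realType) (n : nat) G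
    & Group G & Topological G := {
  lie_atlas : set (chart R n G) ;
  lie_atlasP : is_atlas lie_atlas ;
  lie_hausdorff : hausdorff_space G ;
  lie_second_countable : @second_countable G ;
  lie_mul_smooth : smooth_map (prod_atlas lie_atlas lie_atlas) lie_atlas
                     (fun p : G * G => (p.1 * p.2)%g) ;
  lie_inv_smooth : smooth_map lie_atlas lie_atlas (fun x : G => x^-1%g) }.

#[short(type="lieGroupType")]
HB.structure Definition LieGroup (R : realType) (n : nat) :=
  {G of Group G & Topological G & isLieGroup R n G}.

Section LieAlgebra.
Context {R : realType} {n : nat} {G : lieGroupType R n}.

Definition smooth (phi : G -> R) : Prop := smooth_fun (@lie_atlas R n G) phi.

Definition operator : Type := (G -> R) -> (G -> R).
HB.instance Definition _ := GRing.Lmodule.copy operator ((G -> R) -> G -> R).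

(* Smooth vector fields are the derivations of the algebra C^oo(G).  A
   derivation is encoded as an operator on all functions that takes the dummy
   value 0 off C^oo(G); this makes the representation unique, so that equality
   and the vector space operations of derivations are those of operators. *)
Definition vector_field (X : operator) : Prop :=
  [/\ forall phi, smooth phi -> smooth (X phi),
      forall phi, ~ smooth phi -> X phi = 0,
      forall (a : R) phi psi, smooth phi -> smooth psi ->
        X (a *: phi + psi) = a *: X phi + X psi &
      forall phi psi, smooth phi -> smooth psi ->
        X (phi * psi) = X phi * psi + phi * X psi].

Definition left_invariant (X : operator) : Prop :=
  forall (g : G) (phi : G -> R),
    X (phi \o (fun x => g * x)%g) = X phi \o (fun x => g * x)%g.

Definition lie_algebra : set operator :=
  [set X | vector_field X /\ left_invariant X].

Definition lie_bracket (X Y : operator) : operator :=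
  fun phi => X (Y phi) - Y (X phi).

Definition linear_subspace (A : set operator) : Prop :=
  A 0 /\ forall (a : R) X Y, A X -> A Y -> A (a *: X + Y).

(* [A, B] is the linear span of the brackets. *)
Definition bracket_space (A B : set operator) : set operator :=
  smallest linear_subspace [set lie_bracket X Y | X in A & Y in B].

(* f_* X = Y, for vector fields X and Y *)
Definition pushes_to (f : G -> G) (X Y : operator) : Prop :=
  forall phi : G -> R, X (phi \o f) = Y phi \o f.

Definition lie_automorphism (f : G -> G) : Prop :=
  {morph f : x y / (x * y)%g} /\
  exists g : G -> G, [/\ cancel f g, cancel g f,
    smooth_map (@lie_atlas R n G) (@lie_atlas R n G) f &
    smooth_map (@lie_atlas R n G) (@lie_atlas R n G) g].

(* g = V 1 (+) ... (+) V s; the values of V outside 1, ..., s are irrelevant. *)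
Definition stratification (s : nat) (V : nat -> set operator) : Prop :=
  [/\ (0 < s)%N,
      (forall i, (0 < i <= s)%N ->
         linear_subspace (V i) /\ V i `<=` lie_algebra),
      (forall X, lie_algebra X -> exists2 Y : nat -> operator,
         (forall i, (0 < i <= s)%N -> V i (Y i)) &
         X = \sum_(1 <= i < s.+1) Y i),
      (forall Y : nat -> operator,
         (forall i, (0 < i <= s)%N -> V i (Y i)) ->
         \sum_(1 <= i < s.+1) Y i = 0 ->
         forall i, (0 < i <= s)%N -> Y i = 0) &
      [/\ forall i, (0 < i < s)%N -> bracket_space (V 1%N) (V i) = V i.+1,
          bracket_space (V 1%N) (V s) = [set 0] &
          V s <> [set 0]]].

Definition scalar_product (W : set operator) (ip : operator -> operator -> R) :
    Prop :=
  [/\ forall X Y, W X -> W Y -> ip X Y = ip Y X,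
      forall (a : R) X Y Z, W X -> W Y -> W Z ->
        ip (a *: X + Y) Z = a * ip X Z + ip Y Z &
      forall X, W X -> X <> 0 -> 0 < ip X X].

End LieAlgebra.
Arguments operator {R n} G.

(** * Carnot groups *)

Definition simply_connected (R : realType) (T : topologicalType) : Prop :=
  forall c : R -> T, {within `[0, 1], continuous c} -> c 0 = c 1 ->
  exists H : R * R -> T,
    [/\ {within `[0, 1] `*` `[0, 1], continuous H},
        forall t, t \in `[0, 1] -> H (0, t) = c t,
        forall t, t \in `[0, 1] -> H (1, t) = c 0 &
        forall u, u \in `[0, 1] -> H (u, 0) = c 0 /\ H (u, 1) = c 0].

(* The dilations are uniquely determined by [carnot_dilP]: since the group is
   connected, an automorphism is determined by its action on the Lie algebra. *)
Record carnotGroup (R : realType) := CarnotGroup {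
  carnot_dim : nat ;
  carnot_lie :> lieGroupType R carnot_dim ;
  carnot_connected : connected [set: carnot_lie] ;
  carnot_simply_connected : simply_connected R carnot_lie ;
  carnot_step : nat ;
  carnot_layer : nat -> set (operator carnot_lie) ;
  carnot_stratified : stratification carnot_step carnot_layer ;
  carnot_ip : operator carnot_lie -> operator carnot_lie -> R ;
  carnot_ipP : scalar_product (carnot_layer 1) carnot_ip ;
  carnot_dil : R -> carnot_lie -> carnot_lie ;
  carnot_dilP : forall lambda : R, 0 < lambda ->
    lie_automorphism (carnot_dil lambda) /\
    forall i X, (0 < i <= carnot_step)%N -> carnot_layer i X ->
      pushes_to (carnot_dil lambda) X (lambda ^+ i *: X) }.
Arguments carnot_layer {R} _ _.

Definition absolutely_continuous (R : realType) (a b : R) (f : R -> R) : Prop :=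
  forall e : R, 0 < e -> exists2 d : R, 0 < d &
  forall (m : nat) (u v : 'I_m -> R),
    (forall i, a <= u i /\ u i <= v i /\ v i <= b) ->
    trivIset setT (fun i => [set` `]u i, v i[]) ->
    \sum_(i < m) (v i - u i) < d ->
    \sum_(i < m) `|f (v i) - f (u i)| < e.

Section CarnotMetric.
Context {R : realType} {G : carnotGroup R}.

Definition ac_curve (c : R -> G) : Prop :=
  {within `[0, 1], continuous c} /\
  forall phi : G -> R, smooth phi -> absolutely_continuous 0 1 (phi \o c).

(* c'(t) is the value at c t of the vector field X *)
Definition has_velocity (c : R -> G) (t : R) (X : operator G) : Prop :=
  forall phi : G -> R, smooth phi -> is_derive t 1 (phi \o c) (X phi (c t)).

(* A horizontal velocity at t is the value of a unique left-invariant field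
   u t in V_1, and by left invariance the norm of c'(t) is that of u t. *)
Definition horizontal_lengths (x y : G) : set (\bar R) :=
  [set l | exists (c : R -> G) (u : R -> operator G),
    [/\ ac_curve c, c 0 = x, c 1 = y,
        {ae lebesgue_measure, forall t : R, t \in `[0, 1] ->
           carnot_layer G 1 (u t) /\ has_velocity c t (u t)} &
        l = (\int[lebesgue_measure]_(t in `[0%R, 1%R])
               (Num.sqrt (carnot_ip (u t) (u t)))%:E)%E]].

(* Extended-real valued: +oo if there is no horizontal curve from x to y. *)
Definition carnot_dist (x y : G) : \bar R := ereal_inf (horizontal_lengths x y).

End CarnotMetric.

(** * Maps to L^1 and iterated blowups *)

Section L1.
Context (R : realType).

Definition lebesgue01 : {measure set (measurableTypeR R) -> \bar R} :=
  mrestr lebesgue_measure (measurable_itv `[0%R, 1%R]).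

Definition L1 : Type := LspaceType1 lebesgue01.

Definition L1_dist (f g : L1) : R :=
  fine ('N[lebesgue01]_1 [EFin \o ((f : R -> R) \- g)%R])%E.

End L1.

Section Blowup.
Context {R : realType} {G : carnotGroup R}.
Implicit Types (d rho : G -> G -> R) (x y z : G).

Definition carnot_lipschitz (f : G -> L1 R) : Prop :=
  exists2 L : R, 0 <= L &
    forall x y, ((L1_dist (f x) (f y))%:E <= L%:E * carnot_dist x y)%E.

Definition pullback_metric (f : G -> L1 R) : G -> G -> R :=
  fun x y => L1_dist (f x) (f y).

Definition pseudometric d : Prop :=
  [/\ forall x, d x x = 0, forall x y, 0 <= d x y,
      forall x y, d x y = d y x & forall x y z, d x z <= d x y + d y z].

Definition rescaled x (r : R) d : G -> G -> R :=
  fun y z => r^-1 * d (x * carnot_dil r y)%g (x * carnot_dil r z)%g.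

Definition locally_uniform_limit (d_ : nat -> G -> G -> R) rho : Prop :=
  forall p : G * G, exists2 U, nbhs p U &
    {uniform U, (fun j (q : G * G) => d_ j q.1 q.2) @ \oo -->
                (fun q : G * G => rho q.1 q.2)}.

Definition blowup_metric x d rho : Prop :=
  pseudometric rho /\
  exists r : nat -> R,
    [/\ forall j, 0 < r j, decreasing_seq r, r @ \oo --> (0 : R) &
        locally_uniform_limit (fun j => rescaled x (r j) d) rho].

Definition iterated_blowup_metric (k : nat) d rho : Prop :=
  exists rho_ : nat -> G -> G -> R,
    [/\ rho_ 0%N = d, rho_ k = rho,
        forall i, (i <= k)%N -> pseudometric (rho_ i) &
        forall i, (i < k)%N -> exists x, blowup_metric x (rho_ i) (rho_ i.+1)].

Definition is_subgroup (S : set G) : Prop :=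
  [/\ S 1%g, forall x y, S x -> S y -> S (x * y)%g & forall x, S x -> S x^-1%g].

Definition commutator_subgroup : set G :=
  smallest is_subgroup [set [~ x, y]%g | x in setT & y in setT].

End Blowup.
Arguments commutator_subgroup {R} G.

(* Main.v *)
(* One blowup suffices.  For measurable A in [0,1] the average of f over A is a
   Lipschitz function on G; tested against a weight W it has a horizontal
   derivative m(A, W) in the dual of V_1, and m has bounded variation as a
   function of (A, W).  Cut (A, W) into pieces whose total variation is almost
   maximal.  On a piece with direction u, finer cuts do not turn the derivative,
   so that moving by r v costs about r |<u, v>| |m| on average.  An element c of
   [G, G] is, for every u, a product of horizontal exponentials exp(v_i) with
   the sum of |<u, v_i>| as small as desired; hence the W-average of
   d_f(x, x delta_r(c)) is o(r).  By a Baire category argument there are a point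
   z and scales r_k -> 0 at which this holds for countably many translates and
   commutators simultaneously.  The rescaled metrics at z are equicontinuous,
   and their limit along an ultrafilter is a blowup rho with rho(y, y c) = 0 for
   c in [G, G]. *)

(* A Lipschitz map into $L^1$ may be differentiable nowhere, so no pointwise derivative of [f] is at
   hand. For two given points, however, the integral of $|f(y)-f(x)|$ over [A] is a signed
   difference of averages over two halves of [A] ([mf_split]), and averages are real functions with
   distributional horizontal derivatives. The halves depend on the points; hence sums of absolute
   derivatives are estimated uniformly over all finite cuts. Almost maximal variation replaces a
   polar decomposition of the vector measure [m]: it freezes a direction on each piece without any
   differentiation theorem for measures. These directions are not known in advance, so the words
   spelling a commutator come from a finite list that serves the whole unit ball. Flows of
   left-invariant fields are right translations, which dictates a right-invariant Haar functional;
   it is only applied to continuous functions of compact support. Baire category replaces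
   almost-everywhere arguments on [G]: small averages over every open set at some arbitrarily small
   scale are enough. *)
Require Import Defs.
From mathcomp Require Import all_boot all_order all_algebra.
From mathcomp Require Import all_classical all_reals all_analysis.
From mathcomp Require Import ring lra measurable_realfun.
Import Order.TTheory GRing.Theory Num.Theory.
Import numFieldNormedType.Exports.

Set Implicit Arguments.
Unset Strict Implicit.
Unset Printing Implicit Defensive.

Local Open Scope classical_set_scope.
Local Open Scope ring_scope.

(** * Calculus of C^k functions *)

Section CkCalculus.
Context {R : realType}.
Implicit Types (n m k : nat).

Definition Cinf n (U : set 'rV[R]_n) f := forall k, Ck_on k U f.

Lemma Ck_cont n k (U : set 'rV[R]_n) f x : Ck_on k U f -> U x -> {for x, continuous f}.
Proof. by case: k => [|k] [h _] Ux; apply: h. Qed.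

Lemma Ck_pred n k (U : set 'rV[R]_n) f : Ck_on k.+1 U f -> Ck_on k U f.
Proof.
elim: k f => [|k IH] f [h1 h2]; first by split.
by split=> // i; have [d1 d2] := h2 i; split=> //; exact: IH.
Qed.

Lemma Ck_le n k l (U : set 'rV[R]_n) f : (k <= l)%N -> Ck_on l U f -> Ck_on k U f.
Proof.
elim: l => [|l IH]; first by rewrite leqn0 => /eqP->.
by rewrite leq_eqVlt ltnS => /orP[/eqP->//|kl] /Ck_pred; exact: IH.
Qed.

Lemma Ck_derivable n k (U : set 'rV[R]_n) f x i :
  Ck_on k.+1 U f -> U x -> derivable f x (delta_mx 0 i).
Proof. by move=> [_ /(_ i)[h _]]; exact: h. Qed.

Lemma Ck_D n k (U : set 'rV[R]_n) f i :
  Ck_on k.+1 U f -> Ck_on k U ('D_(delta_mx 0 i) f).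
Proof. by move=> [_ /(_ i)[_]]. Qed.

Lemma Ck_sub n k (U V : set 'rV[R]_n) f : V `<=` U -> Ck_on k U f -> Ck_on k V f.
Proof.
move=> VU; elim: k f => [|k IH] f [h1 h2]; split=> //.
- by move=> x /VU; exact: h1.
- by move=> x /VU; exact: h1.
- move=> i; have [d1 d2] := h2 i; split; last exact: IH.
  by move=> x /VU; exact: d1.
Qed.

(** [V] need not be open: [Ck_on] differentiates the globally defined [f] and only makes demands at
    the points of the set. *)
Lemma Ck_local n k (U : set 'rV[R]_n) f :
  (forall x, U x -> exists2 V : set 'rV[R]_n, V x & Ck_on k V f) -> Ck_on k U f.
Proof.
elim: k f => [|k IH] f h; split=> //.
- by move=> x /h[V Vx [+ _]]; apply.
- by move=> x /h[V Vx [+ _]]; apply.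
- move=> i; split; first by move=> x /h[V Vx]; move/Ck_derivable; apply.
  by apply: IH => x /h[V Vx /Ck_D ?]; exists V.
Qed.

(** Openness enters because a derivative at a point of [U] sees the values nearby. On an open set
    the partial derivatives of [f] and [g] agree again, so the induction continues with them. *)
Lemma Ck_ext n k (U : set 'rV[R]_n) f g : open U -> (forall x, U x -> f x = g x) ->
  Ck_on k U f -> Ck_on k U g.
Proof.
move=> oU; have nfg (f' g' : 'rV[R]_n -> R) : (forall x, U x -> f' x = g' x) -> forall x, U x -> \near x, f' x = g' x.
  by move=> fg' x Ux; near=> y; apply: fg'; near: y; exact: open_nbhs_nbhs.
have cfg (f' g' : 'rV[R]_n -> R) : (forall x, U x -> f' x = g' x) ->
    forall x, U x -> {for x, continuous f'} -> {for x, continuous g'}.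
  move=> fg' x Ux E; change (g' @ x --> g' x); rewrite -(fg' _ Ux).
  by apply: cvg_trans E; exact: (near_eq_cvg (nfg _ _ fg' _ Ux)).
elim: k f g => [|k IH] f g fg [h1 h2].
  by split=> // x Ux; exact: (cfg _ _ fg _ Ux (h1 _ Ux)).
split; first by move=> x Ux; exact: (cfg _ _ fg _ Ux (h1 _ Ux)).
move=> i; have [d1 d2] := h2 i.
split.
  move=> x Ux; apply: (near_eq_derivable (nfg _ _ fg _ Ux)); exact: d1.
apply: IH d2 => x Ux; exact: (near_eq_derive _ (nfg _ _ fg _ Ux)).
Unshelve. all: by end_near. Qed.

Lemma Cinf_cont n (U : set 'rV[R]_n) f x : Cinf U f -> U x -> {for x, continuous f}.
Proof. by move/(_ 0%N)/Ck_cont; exact. Qed.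

Lemma Cinf_derivable n (U : set 'rV[R]_n) f x i :
  Cinf U f -> U x -> derivable f x (delta_mx 0 i).
Proof. by move/(_ 1%N)/Ck_derivable; exact. Qed.

Lemma Cinf_D n (U : set 'rV[R]_n) f i : Cinf U f -> Cinf U ('D_(delta_mx 0 i) f).
Proof. by move=> h k; apply: Ck_D; exact: h. Qed.

Lemma Cinf_sub n (U V : set 'rV[R]_n) f : V `<=` U -> Cinf U f -> Cinf V f.
Proof. by move=> VU h k; apply: Ck_sub VU _; exact: h. Qed.

Lemma Cinf_ext n (U : set 'rV[R]_n) f g : open U -> (forall x, U x -> f x = g x) ->
  Cinf U f -> Cinf U g.
Proof. by move=> oU fg h k; apply: Ck_ext fg _; [|exact: h]. Qed.

Lemma Ck_cst n k (U : set 'rV[R]_n) (a : R) : Ck_on k U (fun _ => a).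
Proof.
elim: k a => [|k IH] a; split=> //; try by move=> x _; apply: (@cst_continuous 'rV[R]_n R a).
move=> i; split; first by move=> x _; exact: (derivable_cst a x).
have -> : 'D_(delta_mx 0 i) (fun _ : 'rV[R]_n => a) = (fun _ => 0).
  by apply/funext => x; apply: derive_cst.
exact: IH.
Qed.

Lemma Ck_coord n k (U : set 'rV[R]_n) j : Ck_on k U (fun x => x 0 j).
Proof.
have dc i x : is_derive x (delta_mx 0 i) (fun x : 'rV[R]_n => x 0 j) (i == j)%:R.
  have h : (fun h => h^-1 *: (((h *: delta_mx 0 i + x) : 'rV[R]_n) 0 j - x 0 j))
       @ 0^' --> ((i == j)%:R : R).
    apply: (cvg_trans _ (cvg_cst ((i == j)%:R : R) (F := 0^'))).
    apply: (@near_eq_cvg _ _ (0 : R)^'); near=> h.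
    rewrite !mxE addrK ?eqxx /= eq_sym /GRing.scale /= mulrA mulVf ?mul1r//.
    by near: h; exact: nbhs_dnbhs_neq.
  apply: DeriveDef; first by apply/cvg_ex; eexists; exact: h.
  by rewrite /derive; apply/cvg_lim.
case: k => [|k]; split=> //; try by move=> x _; exact: (@coord_continuous R 1 n 0 j x).
move=> i; split; first by move=> x _; by case: (dc i x).
have -> : 'D_(delta_mx 0 i) (fun x : 'rV[R]_n => x 0 j) = (fun _ => (i == j)%:R).
  by apply/funext => x; case: (dc i x) => _ ->.
exact: Ck_cst.
Unshelve. all: by end_near. Qed.

Lemma Ck_add n k (U : set 'rV[R]_n) f g : open U ->
  Ck_on k U f -> Ck_on k U g -> Ck_on k U (fun x => f x + g x).
Proof.
move=> oU; elim: k f g => [|k IH] f g hf hg.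
  by split=> // x Ux; exact: (continuousD (Ck_cont hf Ux) (Ck_cont hg Ux)).
split; first by move=> x Ux; exact: (continuousD (Ck_cont hf Ux) (Ck_cont hg Ux)).
move=> i; split.
  by move=> x Ux; exact: (derivableD (Ck_derivable hf Ux) (Ck_derivable hg Ux)).
apply: (@Ck_ext _ _ _ (fun x => 'D_(delta_mx 0 i) f x + 'D_(delta_mx 0 i) g x)) => //.
  by move=> x Ux; rewrite deriveD//; [exact: (Ck_derivable hf Ux)|exact: (Ck_derivable hg Ux)].
by apply: IH; exact: Ck_D.
Qed.

Lemma Ck_mul n k (U : set 'rV[R]_n) f g : open U ->
  Ck_on k U f -> Ck_on k U g -> Ck_on k U (fun x => f x * g x).
Proof.
move=> oU; elim: k f g => [|k IH] f g hf hg.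
  by split=> // x Ux; exact: (continuousM (Ck_cont hf Ux) (Ck_cont hg Ux)).
split; first by move=> x Ux; exact: (continuousM (Ck_cont hf Ux) (Ck_cont hg Ux)).
move=> i; split.
  by move=> x Ux; exact: (derivableM (Ck_derivable hf Ux) (Ck_derivable hg Ux)).
apply: (@Ck_ext _ _ _ (fun x => f x * 'D_(delta_mx 0 i) g x + g x * 'D_(delta_mx 0 i) f x)) => //.
  by move=> x Ux; rewrite deriveM//; [exact: (Ck_derivable hf Ux)|exact: (Ck_derivable hg Ux)].
by apply: Ck_add => //; apply: IH; by [exact: Ck_pred|exact: Ck_D].
Qed.

Lemma Ck_scale n k (U : set 'rV[R]_n) a f : open U ->
  Ck_on k U f -> Ck_on k U (fun x => a * f x).
Proof. by move=> oU hf; apply: Ck_mul => //; exact: Ck_cst. Qed.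

Lemma Ck_opp n k (U : set 'rV[R]_n) f : open U ->
  Ck_on k U f -> Ck_on k U (fun x => - f x).
Proof.
move=> oU hf; apply: (@Ck_ext _ _ _ (fun x => -1 * f x)) => //; last exact: Ck_scale.
by move=> x _; rewrite mulN1r.
Qed.

Lemma Ck_sum n k (U : set 'rV[R]_n) (I : Type) (r : seq I) (F : I -> 'rV[R]_n -> R) :
  open U -> (forall i, Ck_on k U (F i)) -> Ck_on k U (fun x => \sum_(i <- r) F i x).
Proof.
move=> oU hF; elim: r => [|i r IH].
  apply: (@Ck_ext _ _ _ (fun x => 0)) => //; last exact: Ck_cst.
  by move=> x _; rewrite big_nil.
apply: (@Ck_ext _ _ _ (fun x => F i x + \sum_(j <- r) F j x)) => //; last exact: Ck_add.
by move=> x _; rewrite big_cons.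
Qed.

Lemma Ck_inv n k (U : set 'rV[R]_n) f : open U -> (forall x, U x -> f x != 0) ->
  Ck_on k U f -> Ck_on k U (fun x => (f x)^-1).
Proof.
move=> oU f0; elim: k => [|k IH] hf.
  by split=> // x Ux; exact: (continuousV (f0 _ Ux) (Ck_cont hf Ux)).
split; first by move=> x Ux; exact: (continuousV (f0 _ Ux) (Ck_cont hf Ux)).
move=> i; split.
  by move=> x Ux; exact: (derivableV (f0 _ Ux) (Ck_derivable hf Ux)).
apply: (@Ck_ext _ _ _ (fun x => -1 * ((f x)^-1 * (f x)^-1 * 'D_(delta_mx 0 i) f x))) => //.
  move=> x Ux; rewrite deriveV//; [|exact: f0|exact: (Ck_derivable hf Ux)].
  by rewrite /GRing.scale /= mulN1r mulNr -expr2 exprVn.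
have hI := IH (Ck_pred hf).
by apply: Ck_scale => //; apply: Ck_mul => //; [exact: Ck_mul|exact: Ck_D].
Qed.

End CkCalculus.

(** * Mean value theorem and strict differentiability *)

Section MVTn.
Context {R : realType}.
Local Notation e_ i := (delta_mx 0 i).

Lemma coord_norm_le n (v : 'rV[R]_n) i : `|v 0 i| <= `|v|.
Proof.
rewrite {2}/Num.norm /= mx_normrE.
exact: (le_bigmax _ (fun ij : 'I_1 * 'I_n => `|v ij.1 ij.2|) (0, i)).
Qed.

Lemma rV_norm_le n (v : 'rV[R]_n) e : 0 <= e -> (forall i, `|v 0 i| <= e) -> `|v| <= e.
Proof.
move=> e0 h; rewrite /Num.norm /= mx_normrE; apply: bigmax_le => // -[i j] _ /=.
by rewrite ord1.
Qed.

Lemma ball_rVP n (p x : 'rV[R]_n) r :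
  ball p r x <-> 0 < r /\ forall j, `|p 0 j - x 0 j| < r.
Proof.
split=> [[r0 h]|[r0 h]]; first by split=> // j; exact: h.
by split=> // i j; rewrite ord1; exact: h.
Qed.

Lemma is_derive_line n (f : 'rV[R]_n -> R) (x v : 'rV[R]_n) (s : R) :
  derivable f (s *: v + x) v -> is_derive s 1 (fun t => f (t *: v + x)) ('D_v f (s *: v + x)).
Proof.
move=> df.
have E : (fun h : R => h^-1 *: ((fun t => f (t *: v + x)) (h *: (1 : R) + s) - f (s *: v + x)))
  = (fun h : R => h^-1 *: (f (h *: v + (s *: v + x)) - f (s *: v + x))).
  by apply/funext => h; rewrite addrA -scalerDl /GRing.scale/= mulr1.
apply: DeriveDef; first by rewrite /derivable E; exact: df.
by rewrite /derive E.
Qed.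

Lemma MVT_line n (f : 'rV[R]_n -> R) (x v : 'rV[R]_n) (a b : R) : a <= b ->
  (forall s, a <= s <= b -> derivable f (s *: v + x) v) ->
  exists2 s, a <= s <= b & f (b *: v + x) - f (a *: v + x) = 'D_v f (s *: v + x) * (b - a).
Proof.
move=> ab h.
have [||s sab ->] := @MVT_segment R (fun t => f (t *: v + x)) (fun t => 'D_v f (t *: v + x)) a b ab.
- move=> s; rewrite in_itv /= => /andP[a1 b1]; apply: is_derive_line; apply: h.
  by rewrite !ltW.
- apply: derivable_within_continuous => s; rewrite in_itv /= => /h hs.
  by case: (is_derive_line hs).
- by exists s.
Qed.

(* The mean value theorem is applied along the coordinate path from [y] to [y'],
   which stays in the (sup-norm) ball. *)
Lemma MVT_ball n (f : 'rV[R]_n -> R) (p y y' : 'rV[R]_n) r :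
  (forall x i, ball p r x -> derivable f x (e_ i)) -> ball p r y -> ball p r y' ->
  exists c : 'I_n -> 'rV[R]_n, (forall i, ball p r (c i)) /\
    f y' - f y = \sum_(i < n) (y' 0 i - y 0 i) * 'D_(e_ i) f (c i).
Proof.
move=> df /ball_rVP[r0 hy] /ball_rVP[_ hy'].
pose h (k : nat) : 'rV[R]_n := \row_j (if (j < k)%N then y' 0 j else y 0 j).
have hn : h n = y' by apply/rowP => j; rewrite !mxE ltn_ord.
have h0 : h 0%N = y by apply/rowP => j; rewrite !mxE.
have step (i : 'I_n) : exists c, ball p r c /\
    f (h i.+1) - f (h i) = (y' 0 i - y 0 i) * 'D_(e_ i) f c.
  pose x : 'rV[R]_n := \row_j (if j == i then 0 else h i 0 j).
  have E1 : h i.+1 = y' 0 i *: e_ i + x.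
    apply/rowP => j; rewrite !mxE eqxx /=; case: (eqVneq j i) => [->|ji].
      by rewrite ltnS leqnn mulr1 addr0.
    by rewrite mulr0 add0r ltnS leq_eqVlt (negbTE (ji : j != i :> nat)).
  have E0 : h i = y 0 i *: e_ i + x.
    apply/rowP => j; rewrite !mxE eqxx /=; case: (eqVneq j i) => [->|ji].
      by rewrite ltnn mulr1 addr0.
    by rewrite mulr0 add0r.
  have inb s : `|p 0 i - s| < r -> ball p r (s *: e_ i + x).
    move=> hs; apply/ball_rVP; split=> // j; rewrite !mxE eqxx /=.
    case: (eqVneq j i) => [->|ji]; first by rewrite mulr1 addr0.
    by rewrite mulr0 add0r; case: ifP.
  have conv (a b s : R) : `|p 0 i - a| < r -> `|p 0 i - b| < r -> a <= s <= b -> `|p 0 i - s| < r.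
    rewrite !ltr_norml => /andP[a1 a2] /andP[b1 b2] /andP[s1 s2]; apply/andP; split; lra.
  rewrite E1 E0; case: (leP (y 0 i) (y' 0 i)) => [yy|/ltW yy].
    have [|s sab ->] := @MVT_line n f x (e_ i) _ _ yy.
      by move=> s sab; apply/df/inb/(conv _ _ _ (hy i) (hy' i)).
    exists (s *: e_ i + x); rewrite mulrC; split=> //.
    exact/inb/(conv _ _ _ (hy i) (hy' i)).
  have [|s sab E] := @MVT_line n f x (e_ i) _ _ yy.
    by move=> s sab; apply/df/inb/(conv _ _ _ (hy' i) (hy i)).
  exists (s *: e_ i + x); split; first exact/inb/(conv _ _ _ (hy' i) (hy i)).
  by apply: oppr_inj; rewrite opprB E -mulNr opprB mulrC.
have [c hc] := choice step.
exists c; split=> [i|]; first by case: (hc i).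
under eq_bigr => i _ do rewrite -(hc i).2.
by rewrite -(big_mkord xpredT (fun i => f (h i.+1) - f (h i))) telescope_sumr// hn h0.
Qed.

Lemma Ck_cont_D_near n k (U : set 'rV[R]_n) f x i (e : R) : open U -> Ck_on k.+1 U f -> U x ->
  0 < e -> \forall y \near x, `|'D_(e_ i) f x - 'D_(e_ i) f y| < e.
Proof.
move=> oU hf Ux e0; have /= h := Ck_cont (Ck_D i hf) Ux.
by have /cvgrPdist_lt := h; apply.
Qed.

(** Strict differentiability: the remainder is small relative to the distance of two moving points,
    not only to the distance from [x]. This two-point form yields Lipschitz bounds and, where the
    derivative vanishes, contraction estimates for the group law. *)
Lemma C1_strict n (U : set 'rV[R]_n) f x (e : R) : open U -> Ck_on 1 U f -> U x -> 0 < e ->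
  exists2 r, 0 < r & ball x r `<=` U /\ forall y y', ball x r y -> ball x r y' ->
   `|f y' - f y - \sum_(i < n) (y' 0 i - y 0 i) * 'D_(e_ i) f x| <= e * `|y' - y|.
Proof.
move=> oU hf Ux e0.
(* Each of the [n] coordinates gets an equal share of [e]; dividing by [n.+1] also covers
   [n = 0]. *)
have e1 : 0 < e / n.+1%:R by rewrite divr_gt0.
have : \forall y \near x, U y /\ forall i : 'I_n, `|'D_(e_ i) f x - 'D_(e_ i) f y| < e / n.+1%:R.
  apply: filterI; first exact: open_nbhs_nbhs.
  apply: (@filter_forall _ _ (fun (i : 'I_n) y =>
    `|'D_(e_ i) f x - 'D_(e_ i) f y| < e / n.+1%:R) (nbhs x)) => i.
  exact: (Ck_cont_D_near i oU hf Ux e1).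
move=> /nbhs_ballP[r /= r0 hr]; exists r => //; split; first by move=> y /hr[].
move=> y y' hy hy'.
have [|c [bc ->]] := @MVT_ball n f x y y' r _ hy hy'.
  by move=> z i /hr[Uz _]; exact: (Ck_derivable hf Uz).
rewrite -sumrB; under eq_bigr do rewrite -mulrBr.
apply: (le_trans (ler_norm_sum _ _ _)).
apply: (@le_trans _ _ (\sum_(i < n) `|y' - y| * (e / n.+1%:R))).
  apply: ler_sum => i _; rewrite normrM ler_pM//.
    have -> : y' 0 i - y 0 i = (y' - y) 0 i by rewrite !mxE.
    exact: coord_norm_le.
  by rewrite distrC; have [_ /(_ i)/ltW] := hr _ (bc i).
have E : e / n.+1%:R * n%:R <= e by rewrite mulrAC ler_pdivrMr // ler_pM2l// ler_nat.
by rewrite sumr_const card_ord -[leLHS]mulr_natr -mulrA [leRHS]mulrC ler_wpM2l.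
Qed.

End MVTn.

Section Chain.
Context {R : realType}.
Local Notation e_ i := (delta_mx 0 i).

Lemma is_derive_rV (V : normedModType R) n (F : V -> 'rV[R]_n) (x v : V) (a : 'rV[R]_n) :
  (forall j, is_derive x v (fun z => F z 0 j) (a 0 j)) -> is_derive x v F a.
Proof.
move=> h; have dF : derivable F x v.
  by apply/derivable_mxP => i j; rewrite ord1; case: (h j).
apply: DeriveDef => //; rewrite derive_mx//; apply/rowP => j; rewrite !mxE.
by case: (h j).
Qed.

(** The inner map only has a directional derivative at [x], which suffices: the two-point estimate
    [C1_strict] for [f] is applied to [F x] and [F (h *: v + x)] and divided by [h], while the
    difference quotient [q h] stays bounded by [|a| + 1]. *)
Lemma is_derive_comp_rV (V : normedModType R) n (U : set 'rV[R]_n) f (F : V -> 'rV[R]_n)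
    (x v : V) (a : 'rV[R]_n) : open U -> Ck_on 1 U f -> U (F x) -> is_derive x v F a ->
  is_derive x v (f \o F) (\sum_(j < n) a 0 j * 'D_(e_ j) f (F x)).
Proof.
move=> oU hf UFx [dF aE].
pose q (h : R) := h^-1 *: (F (h *: v + x) - F x).
have qa : q h @[h --> 0^'] --> a by rewrite -aE; exact: dF.
have Fc : F (h *: v + x) @[h --> 0^'] --> F x.
  have : (h *: q h + F x) @[h --> (0 : R)^'] --> 0 *: a + F x.
    apply: cvgD; last exact: cvg_cst.
    by apply: cvgZ => //; apply: cvg_within_filter; exact: cvg_id.
  rewrite scale0r add0r; apply: cvg_trans; apply: near_eq_cvg; near=> h.
  rewrite /q scalerA mulfV ?scale1r ?subrK//.
  by near: h; exact: nbhs_dnbhs_neq.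
suff L : (fun h : R => h^-1 *: ((f \o F) (h *: v + x) - (f \o F) x)) @ 0^' -->
    (\sum_(j < n) a 0 j * 'D_(e_ j) f (F x) : R).
  by apply: DeriveDef; [apply/cvg_ex; eexists; exact: L|rewrite /derive; exact/cvg_lim].
apply/cvgrPdist_lt => e e0.
pose A := `|a| + 1 : R.
have A0 : 0 < A by rewrite ltr_pwDr.
have e2 : 0 < e / 2 / A by rewrite !divr_gt0.
have [r r0 [_ hr]] := C1_strict oU hf UFx e2.
pose M := \sum_(j < n) `|'D_(e_ j) f (F x)| + 1.
have M0 : 0 < M by rewrite ltr_wpDl// sumr_ge0.
have e3 : 0 < e / 2 / M by rewrite !divr_gt0.
near=> h.
have h0 : h != 0 by near: h; exact: nbhs_dnbhs_neq.
have qA : `|q h| <= A.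
  have : `|a - q h| < 1 by near: h; move/cvgrPdist_lt: qa; apply.
  move=> /ltW; have := ler_normB a (a - q h); rewrite opprB addrC subrK /A; lra.
have B1 : ball (F x) r (F (h *: v + x)).
  by near: h; have /cvg_ball := Fc; apply.
have B0 : ball (F x) r (F x) by exact: ballxx.
have := hr _ _ B0 B1.
have -> : F (h *: v + x) - F x = h *: q h by rewrite /q scalerA mulfV// scale1r.
have -> : \sum_(i < n) (F (h *: v + x) 0 i - F x 0 i) * 'D_(e_ i) f (F x) =
   h * \sum_(j < n) (q h) 0 j * 'D_(e_ j) f (F x).
  by rewrite mulr_sumr; apply: eq_bigr => j _; rewrite /q !mxE !mulrA mulfV// mul1r.
have S' : `|\sum_(j < n) a 0 j * 'D_(e_ j) f (F x) -
     \sum_(j < n) (q h) 0 j * 'D_(e_ j) f (F x)| < e / 2.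
  have aq : `|a - q h| < e / 2 / M by near: h; move/cvgrPdist_lt: qa; apply.
  rewrite -sumrB; apply: (le_lt_trans (ler_norm_sum _ _ _)).
  apply: (@le_lt_trans _ _ (\sum_(j < n) `|a - q h| * `|'D_(e_ j) f (F x)|)).
    apply: ler_sum => j _; rewrite -mulrBl normrM ler_wpM2r//.
    by have := coord_norm_le (a - q h) j; rewrite !mxE.
  rewrite -mulr_sumr; move: aq; rewrite ltr_pdivlMr//; apply: le_lt_trans.
  by rewrite ler_wpM2l// /M lerDl.
move: S'; set s1 := \sum_(j < n) _; set s2 := \sum_(j < n) _ => S' K.
rewrite /GRing.scale /=.
have {}K : `|h^-1 * (f (F (h *: v + x)) - f (F x)) - s2| <= e / 2.
  have -> : h^-1 * (f (F (h *: v + x)) - f (F x)) - s2 =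
     h^-1 * (f (F (h *: v + x)) - f (F x) - h * s2).
    by rewrite [RHS]mulrBr [h^-1 * (h * _)]mulrA mulVf// mul1r.
  rewrite normrM normfV ler_pdivrMl ?normr_gt0//.
  apply: (le_trans K); rewrite normrZ mulrCA ler_pM2l ?normr_gt0//.
  by rewrite mulrAC ler_pdivrMr// ler_wpM2l// ltW// divr_gt0.
have := ler_distD s2 s1 (h^-1 * (f (F (h *: v + x)) - f (F x))).
by rewrite [`|s2 - _|]distrC; lra.
Unshelve. all: by end_near. Qed.

Lemma derivable_rV_coord (V : normedModType R) n (F : V -> 'rV[R]_n) (x v : V) (a : 'rV[R]_n) j :
  is_derive x v F a -> is_derive x v (fun z => F z 0 j) (a 0 j).
Proof.
move=> [dF aE]; apply: DeriveDef; first by move/derivable_mxP : dF; apply.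
by rewrite -aE derive_mx// mxE.
Qed.

Lemma Ck_comp m n k (U : set 'rV[R]_m) (V : set 'rV[R]_n) (F : 'rV[R]_m -> 'rV[R]_n) f :
  open U -> open V -> (forall x, U x -> V (F x)) ->
  (forall j, Ck_on k U (fun x => F x 0 j)) -> Ck_on k V f -> Ck_on k U (f \o F).
Proof.
move=> oU oV UV.
have Fcont l : (forall j, Ck_on l U (fun x => F x 0 j)) -> forall x, U x -> {for x, continuous F}.
  move=> hF x Ux; change (F @ x --> F x).
  apply/(@cvgrPdist_le R _ _ (nbhs x) (nbhs_filter x)) => e e0.
  have H : \forall y \near x, forall j, `|F x 0 j - F y 0 j| < e.
    apply: (@filter_forall _ _ (fun (j : 'I_n) y => `|F x 0 j - F y 0 j| < e) (nbhs x) (nbhs_filter x)) => j.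
    by have /= hc := Ck_cont (hF j) Ux; have /cvgrPdist_lt := hc; apply.
  near=> y; apply: rV_norm_le (ltW e0) _ => j; rewrite !mxE; apply/ltW.
  by move: j; near: y.
elim: k f => [|k IH] f hF hf.
  split=> // x Ux; apply: continuous_comp; first exact: Fcont Ux.
  by apply: Ck_cont hf _; exact: UV.
have D1 i x : U x -> is_derive x (e_ i) (f \o F)
    (\sum_(j < n) 'D_(e_ i) (fun x => F x 0 j) x * 'D_(e_ j) f (F x)).
  move=> Ux; pose a : 'rV[R]_n := \row_j 'D_(e_ i) (fun x => F x 0 j) x.
  have -> : \sum_(j < n) 'D_(e_ i) (fun x => F x 0 j) x * 'D_(e_ j) f (F x) =
      \sum_(j < n) a 0 j * 'D_(e_ j) f (F x) by apply: eq_bigr => j _; rewrite mxE.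
  have hf1 : Ck_on 1 V f by apply: Ck_le hf.
  apply: (is_derive_comp_rV oV hf1 (UV _ Ux)); apply: is_derive_rV => j; rewrite mxE.
  apply: derivableP; exact: (Ck_derivable (hF j) Ux).
split.
  move=> x Ux; apply: continuous_comp; first exact: Fcont Ux.
  by apply: Ck_cont hf _; exact: UV.
move=> i; split; first by move=> x Ux; case: (D1 i x Ux).
apply: (@Ck_ext _ _ _ _ (fun x =>
   \sum_(j < n) 'D_(e_ i) (fun x => F x 0 j) x * ('D_(e_ j) f \o F) x)) => //.
  by move=> x Ux; case: (D1 i x Ux).
apply: Ck_sum => // j; apply: Ck_mul => //; first exact: Ck_D.
by apply: IH; [move=> l; exact: Ck_pred|exact: Ck_D].
Unshelve. all: by end_near. Qed.
End Chain.

(** * Quadratic bounds and symmetry of second derivatives *)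

Section Quad.
Context {R : realType}.
Local Notation e_ i := (delta_mx 0 i).

Lemma C1_lip n (U : set 'rV[R]_n) f x : open U -> Ck_on 1 U f -> U x ->
  exists r C, [/\ 0 < r, 0 <= C, ball x r `<=` U & forall y y', ball x r y -> ball x r y' ->
   `|f y' - f y| <= C * `|y' - y|].
Proof.
move=> oU hf Ux; have [r r0 [rU hr]] := C1_strict oU hf Ux ltr01.
exists r, (1 + \sum_(i < n) `|'D_(e_ i) f x|); split=> //.
  by rewrite addr_ge0// sumr_ge0.
move=> y y' hy hy'; have := hr _ _ hy hy'; rewrite mul1r => h.
rewrite mulrDl mul1r mulr_suml.
have : `|\sum_(i < n) (y' 0 i - y 0 i) * 'D_(e_ i) f x| <=
    \sum_(i < n) `|'D_(e_ i) f x| * `|y' - y|.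
  apply: (le_trans (ler_norm_sum _ _ _)); apply: ler_sum => i _.
  rewrite normrM mulrC ler_wpM2l//.
  by have := coord_norm_le (y' - y) i; rewrite !mxE.
move: h; set s := \sum_(i < n) _; set t := \sum_(i < n) _ => h1 h2.
by have := ler_normD (f y' - f y - s) s; rewrite subrK; lra.
Qed.

Lemma C1_lip_rV m n (U : set 'rV[R]_m) (F : 'rV[R]_m -> 'rV[R]_n) x :
  open U -> (forall j, Ck_on 1 U (fun x => F x 0 j)) -> U x ->
  exists r C, [/\ 0 < r, 0 <= C, ball x r `<=` U & forall y y', ball x r y -> ball x r y' ->
   `|F y' - F y| <= C * `|y' - y|].
Proof.
move=> oU hF Ux.
have hr0 (j : 'I_n) : exists r, exists C, [/\ 0 < r, 0 <= C & forall y y',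
    ball x r y -> ball x r y' -> `|F y' 0 j - F y 0 j| <= C * `|y' - y|].
  have [r [C [r0 C0 _ h]]] := C1_lip oU (hF j) Ux.
  by exists r, C.
have [r hr] := choice hr0.
have [C hC] := choice hr.
have [r1 r10 r1U] : exists2 r1, 0 < r1 & ball x r1 `<=` U.
  by have /nbhs_ballP[r1 /= r10 ?] := open_nbhs_nbhs (conj oU Ux); exists r1.
pose r' := \big[Order.min/r1]_j r j.
have r'r j : r' <= r j by exact: bigmin_le.
have C0 : 0 <= \sum_j C j by apply: sumr_ge0 => j _; case: (hC j).
exists r', (\sum_j C j); split=> //.
- by apply: lt_bigmin => // j _; case: (hC j).
- by apply: subset_trans r1U => y; apply: le_ball; exact: bigmin_le_id.
move=> y y' hy hy'; apply: rV_norm_le => [|j]; first by rewrite mulr_ge0.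
rewrite !mxE; have [_ Cj h] := hC j.
apply: (le_trans (h _ _ (le_ball (r'r j) hy) (le_ball (r'r j) hy'))).
rewrite ler_wpM2r// (bigD1 j)//= lerDl sumr_ge0// => i _; by case: (hC i).
Qed.

Lemma is_derive_lsub m n (g : 'rV[R]_(m + n) -> R) x y i :
  derivable g (row_mx x y) (e_ (lshift n i)) ->
  is_derive x (e_ i) (fun x => g (row_mx x y)) ('D_(e_ (lshift n i)) g (row_mx x y)).
Proof.
move=> dg.
have E : (fun h : R => h^-1 *: (g (row_mx (h *: e_ i + x) y) - g (row_mx x y))) =
   (fun h : R => h^-1 *: (g (h *: e_ (lshift n i) + row_mx x y) - g (row_mx x y))).
  apply/funext => h; congr (_ *: (g _ - _)); apply/rowP => j; rewrite !mxE.
  case: splitP => k hk; rewrite ?mxE ?eqxx /=.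
    congr (_ * (_ : bool)%:R + _); apply/eqP/eqP => [<-|/(congr1 val)/= ji].
      exact/val_inj.
    by apply/val_inj; rewrite /= -hk.
  have -> : (j == lshift n i) = false; last by rewrite mulr0 add0r.
  by apply/negbTE/eqP => /(congr1 val) /= ji; move: (ltn_ord i); rewrite -ji hk ltnNge leq_addr.
by apply: DeriveDef; [rewrite /derivable /= E|rewrite /derive /= E].
Qed.

Lemma is_derive_rsub m n (g : 'rV[R]_(m + n) -> R) x y i :
  derivable g (row_mx x y) (e_ (rshift m i)) ->
  is_derive y (e_ i) (fun y => g (row_mx x y)) ('D_(e_ (rshift m i)) g (row_mx x y)).
Proof.
move=> dg.
have E : (fun h : R => h^-1 *: (g (row_mx x (h *: e_ i + y)) - g (row_mx x y))) =
   (fun h : R => h^-1 *: (g (h *: e_ (rshift m i) + row_mx x y) - g (row_mx x y))).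
  apply/funext => h; congr (_ *: (g _ - _)); apply/rowP => j; rewrite !mxE.
  case: splitP => k hk; rewrite ?mxE ?eqxx /=.
    have -> : (j == rshift m i) = false; last by rewrite mulr0 add0r.
    by apply/negbTE/eqP => /(congr1 val) /= ji; move: (ltn_ord k); rewrite -hk ji ltnNge leq_addr.
  congr (_ * (_ : bool)%:R + _); apply/eqP/eqP => [<-|/(congr1 val)/= ji].
    exact/val_inj.
  by apply/val_inj/(@addnI m); rewrite /= -hk.
by apply: DeriveDef; [rewrite /derivable /= E|rewrite /derive /= E].
Qed.

Lemma row_mx_norm m n (x x' : 'rV[R]_m) (y y' : 'rV[R]_n) r :
  ball x r x' -> ball y r y' -> ball (row_mx x y) r (row_mx x' y').
Proof.
move=> /ball_rVP[r0 hx] /ball_rVP[_ hy]; apply/ball_rVP; split=> // j; rewrite !mxE.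
by case: splitP => k _.
Qed.

(** The mean value theorem in the first variable leaves partial derivatives in that variable. These
    vanish when the second variable is [b], and being Lipschitz they are $O(|y-b|)$. Intended for
    the deviation of the group product from addition. *)
Lemma quad_bound m n (U : set 'rV[R]_(m + n)) g a b : open U -> Ck_on 2 U g -> U (row_mx a b) ->
  (\forall x \near a, g (row_mx x b) = 0) -> (\forall y \near b, g (row_mx a y) = 0) ->
  exists r C, [/\ 0 < r, 0 <= C & forall x y, ball a r x -> ball b r y ->
    `|g (row_mx x y)| <= C * `|x - a| * `|y - b|].
Proof.
move=> oU hg Uab /nbhs_ballP[r1 /= r10 h1] /nbhs_ballP[r2 /= r20 h2].
pose F (z : 'rV[R]_(m + n)) : 'rV[R]_m := \row_i 'D_(e_ (lshift n i)) g z.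
have [|r [C [r0 C0 rU h]]] := @C1_lip_rV _ _ U F _ oU _ Uab.
  move=> j; have -> : (fun z => F z 0 j) = 'D_(e_ (lshift n j)) g by apply/funext => z; rewrite mxE.
  exact: Ck_D.
pose r' := Num.min r (Num.min r1 r2).
have r'r : r' <= r by rewrite ge_min lexx.
have r'1 : r' <= r1 by rewrite !ge_min lexx orbT.
have r'2 : r' <= r2 by rewrite !ge_min lexx !orbT.
have r'0 : 0 < r' by rewrite !lt_min r0 r10.
exists r', (C *+ m); split=> //; first by rewrite mulrn_wge0.
move=> x y hx hy.
have dg x' y' i : ball a r' x' -> ball b r' y' -> is_derive x' (e_ i) (fun x => g (row_mx x y'))
   ('D_(e_ (lshift n i)) g (row_mx x' y')).
  move=> hx' hy'; apply: is_derive_lsub; apply: (Ck_derivable hg).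
  by apply: rU; apply: row_mx_norm; exact: le_ball r'r _ _.
have [|c [hc]] := @MVT_ball _ _ (fun x => g (row_mx x y)) a a x r' _ (ballxx _ r'0) hx.
  by move=> x' i hx'; case: (dg _ _ i hx' hy).
rewrite (h2 _ (le_ball r'2 hy)) subr0 => ->.
apply: (le_trans (ler_norm_sum _ _ _)).
have sm (z : R) : z *+ m = \sum_(i < m) z by rewrite sumr_const card_ord.
rewrite !mulrnAl sm.
apply: ler_sum => i _; rewrite normrM (mulrC C) -mulrA ler_pM//.
  by have := coord_norm_le (x - a) i; rewrite !mxE.
have -> : 'D_(e_ i) (fun x => g (row_mx x y)) (c i) = F (row_mx (c i) y) 0 i.
  by rewrite mxE; case: (dg _ _ i (hc i) hy).
have F0 : F (row_mx (c i) b) 0 i = 0.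
  rewrite mxE; have [_ <-] := dg _ _ i (hc i) (ballxx _ r'0).
  have -> : 'D_(e_ i) (fun x => g (row_mx x b)) (c i) = 'D_(e_ i) (cst 0) (c i).
    apply: near_eq_derive; near=> z; apply: h1.
    have : ball a r' z by near: z; apply: open_nbhs_nbhs; split; [exact: ball_open|exact: hc].
    exact: le_ball.
  exact: derive_cst.
have rb z y' : ball a r' z -> ball b r' y' -> ball (row_mx a b) r (row_mx z y').
  by move=> hz hy'; apply: row_mx_norm; exact: le_ball r'r _ _.
have := h _ _ (rb _ _ (hc i) (ballxx _ r'0)) (rb _ _ (hc i) hy).
have -> : row_mx (c i) y - row_mx (c i) b = row_mx 0 (y - b) by rewrite opp_row_mx add_row_mx subrr.
move=> H; have := coord_norm_le (F (row_mx (c i) y) - F (row_mx (c i) b)) i.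
have subE (u v : 'rV[R]_m) : (u - v) 0 i = u 0 i - v 0 i by rewrite !mxE.
rewrite subE F0 subr0 => H'; apply: (le_trans H').
apply: (le_trans H); rewrite ler_wpM2l//; apply: rV_norm_le => // j; rewrite !mxE.
by case: splitP => k _; rewrite ?mxE ?normr0//; have := coord_norm_le (y - b) k; rewrite !mxE.
Unshelve. all: by end_near. Qed.

(** The second difference over a small square, evaluated by two mean value theorems in either order,
    equals each mixed derivative at some nearby point; continuity of both finishes. *)
Lemma Schwarz n (U : set 'rV[R]_n) f x i j : open U -> Ck_on 2 U f -> U x ->
  'D_(e_ i) ('D_(e_ j) f) x = 'D_(e_ j) ('D_(e_ i) f) x.
Proof.
move=> oU hf Ux.
have close (X Y P Q e : R) : P = Q -> `|Y - P| < e / 2 -> `|X - Q| < e / 2 -> `|X - Y| <= e.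
  by move=> <-; rewrite !ltr_norml ler_norml => /andP[? ?] /andP[? ?]; apply/andP; split; lra.
apply/eqP; rewrite -subr_eq0 -normr_le0; apply/ler_addgt0Pr => e e0.
rewrite add0r.
have : \forall y \near x, U y /\
   (`|'D_(e_ i) ('D_(e_ j) f) x - 'D_(e_ i) ('D_(e_ j) f) y| < e / 2 /\
    `|'D_(e_ j) ('D_(e_ i) f) x - 'D_(e_ j) ('D_(e_ i) f) y| < e / 2).
  have e2 : 0 < e / 2 by rewrite divr_gt0.
  apply: filterI; first exact: open_nbhs_nbhs.
  by apply: filterI; apply: (Ck_cont_D_near _ oU (Ck_D _ hf) Ux e2).
move=> /nbhs_ballP[r /= r0 hr].
(* The two displacements of size at most [h] may point along the same axis, and [2 * h] must stay
   below [r]. *)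
pose h := r / 3; have h0 : 0 < h by rewrite divr_gt0.
have bx k l s t : 0 <= s <= h -> 0 <= t <= h -> ball x r (s *: e_ k + (t *: e_ l + x)).
  move=> /andP[s0 sh] /andP[t0 th]; apply/ball_rVP; split=> // m.
  have rh : r = 3 * h by rewrite /h mulrC divfK.
  rewrite !mxE eqxx /= ltr_norml; apply/andP.
  by case: (m == k); case: (m == l); rewrite ?mulr1n ?mulr0n ?mulr1 ?mulr0; split; lra.
have h00 : 0 <= (0 : R) <= h by rewrite lexx ltW.
have hh : 0 <= h <= h by rewrite lexx ltW.
have sw s t k l : s *: e_ k + (t *: e_ l + x) = t *: e_ l + (s *: e_ k + x) by rewrite addrCA.
have key k l : exists2 p, ball x r p & f (h *: e_ k + (h *: e_ l + x)) -
    f (h *: e_ k + (0 *: e_ l + x)) - (f (0 *: e_ k + (h *: e_ l + x)) - f (0 *: e_ k + (0 *: e_ l + x)))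
    = 'D_(e_ l) ('D_(e_ k) f) p * h * h.
  pose w s := f (s *: e_ k + (h *: e_ l + x)) - f (s *: e_ k + (0 *: e_ l + x)).
  pose dw s := 'D_(e_ k) f (s *: e_ k + (h *: e_ l + x)) - 'D_(e_ k) f (s *: e_ k + (0 *: e_ l + x)).
  have d s : 0 <= s <= h -> is_derive s 1 w (dw s).
    move=> sh; have D t : 0 <= t <= h -> is_derive s 1 (fun s => f (s *: e_ k + (t *: e_ l + x)))
       ('D_(e_ k) f (s *: e_ k + (t *: e_ l + x))).
      move=> th; apply: is_derive_line; have /hr[Uz _] := bx k l s t sh th.
      exact: (Ck_derivable hf Uz).
    exact: (is_deriveB (D _ hh) (D _ h00)).
  have [||s sh E] := @MVT_segment R w dw 0 h (ltW h0).
  - by move=> s; rewrite in_itv /= => /andP[s0 s1]; apply: d; rewrite !ltW.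
  - apply: derivable_within_continuous => s; rewrite in_itv /= => hs.
    by case: (d s hs).
  move: sh; rewrite in_itv /= => sh.
  have [|t th E'] := @MVT_line R n ('D_(e_ k) f) (s *: e_ k + x) (e_ l) 0 h (ltW h0).
    move=> t th; rewrite addrCA; have /hr[Uz _] := bx k l s t sh th.
    exact: (Ck_derivable (Ck_D k hf) Uz).
  exists (s *: e_ k + (t *: e_ l + x)); first exact: bx.
  rewrite subr0 in E E'; refine (etrans E _); congr (_ * h); rewrite /dw.
  move: E'; move: ('D_(e_ k) f) => g E'.
  by rewrite (sw s h) (sw s 0) (sw s t).
have swp (A B C D : R) : A - B - (C - D) = A - C - (B - D) by ring.
have [p bp Ep] := key i j; have [q bq Eq] := key j i.
have E : 'D_(e_ j) ('D_(e_ i) f) p = 'D_(e_ i) ('D_(e_ j) f) q.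
  apply: (mulIf (lt0r_neq0 h0)); apply: (mulIf (lt0r_neq0 h0)).
  refine (etrans (esym Ep) (etrans _ Eq)); clear Ep Eq.
  rewrite (sw h h j i) (sw h 0 j i) (sw 0 h j i) (sw 0 0 j i).
  exact: swp.
have [_ [_ H1]] := hr _ bp; have [_ [H2 _]] := hr _ bq.
exact: (close _ _ _ _ _ E H1 H2).
Qed.
End Quad.

(** * Smooth bump functions *)

Section Bump.
Context {R : realType}.
Local Notation e_ i := (delta_mx 0 i).

Lemma is_derive_lineP (V W : normedModType R) (f : V -> W) (x v : V) d :
  is_derive x v f d <-> is_derive (0 : R) 1 (fun h => f (h *: v + x)) d.
Proof.
have E : (fun h : R => h^-1 *: ((fun t : R => f (t *: v + x)) (h *: (1 : R) + 0) - f ((0 : R) *: v + x)))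
  = (fun h : R => h^-1 *: (f (h *: v + x) - f x)).
  by apply/funext => h; rewrite addr0 scale0r add0r /GRing.scale/= mulr1.
split=> -[h1 h2]; apply: DeriveDef.
- by rewrite /derivable E.
- by rewrite /derive E.
- by move: h1; rewrite /derivable E.
- by move: h2; rewrite /derive E.
Qed.

Lemma is_derive_comp1 (V : normedModType R) (q : V -> R) (g : R -> R) (x v : V) dq dg :
  is_derive x v q dq -> is_derive (q x) 1 g dg -> is_derive x v (g \o q) (dg * dq).
Proof.
move=> /is_derive_lineP hq hg; apply/is_derive_lineP.
by apply: (is_derive1_comp (f := g)) hq; rewrite scale0r add0r.
Qed.

(** The powers of $1/t$ in front of $e^{-1/t}$ make the family closed under differentiation, so
    smoothness becomes one induction over all [k]. *)
Definition flat k (t : R) := if 0 < t then t^-1 ^+ k * expR (- t^-1) else 0.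

Lemma flat_ge0 k t : 0 <= flat k t.
Proof.
rewrite /flat; case: ltP => // t0.
by rewrite mulr_ge0 ?expR_ge0// exprn_ge0// invr_ge0 ltW.
Qed.

Lemma flat_gt0 k t : 0 < t -> 0 < flat k t.
Proof. by move=> t0; rewrite /flat t0 mulr_gt0 ?expR_gt0// exprn_gt0// invr_gt0. Qed.

(** From $e^u \ge (u/m)^m$ with $m = k+2$: two powers more than the factor $t^{-k}$ consumes, so
    that the difference quotient at 0 is $O(t)$. *)
Lemma flat_small k (t : R) : 0 < t -> flat k t <= k.+2%:R ^+ k.+2 * t ^+ 2.
Proof.
move=> t0; rewrite /flat t0.
have ti : 0 < t^-1 by rewrite invr_gt0.
pose m := k.+2; have m0 : 0 < m%:R :> R by rewrite ltr0n.
have h : (t^-1 / m%:R) ^+ m <= expR t^-1.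
  have -> : expR t^-1 = expR (t^-1 / m%:R) ^+ m.
    by rewrite -expRM_natl mulrCA mulfV ?mulr1// gt_eqF.
  rewrite lerXn2r ?nnegrE ?expR_ge0 ?divr_ge0 ?ltW//.
  by apply: lt_le_trans (expR_ge1Dx _); rewrite ltrDr.
rewrite expRN ler_pdivrMr ?expR_gt0//.
apply: (@le_trans _ _ (m%:R ^+ m * t ^+ 2 * (t^-1 / m%:R) ^+ m)).
  rewrite expr_div_n {2}/m (_ : t^-1 ^+ k.+2 = t^-1 ^+ k * t^-1 ^+ 2); last by rewrite -exprD addn2.
  have : m%:R ^+ m != 0 :> R by rewrite expf_neq0// gt_eqF.
  move: (_ ^+ m) (_ ^+ k) => B A B0.
  have -> : B * t ^+ 2 * (A * t^-1 ^+ 2 / B) = A by field; rewrite B0 gt_eqF.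
  by [].
by rewrite ler_wpM2l// mulr_ge0 ?exprn_ge0// ltW.
Qed.

Lemma is_derive_flat k (t : R) : is_derive t 1 (flat k) (- k%:R * flat k.+1 t + flat k.+2 t).
Proof.
case: (ltrgtP t 0) => [tn|tp|->].
- have E : (0 : R) = - k%:R * flat k.+1 t + flat k.+2 t.
    by rewrite /flat ltNge (ltW tn) /= mulr0 addr0.
  rewrite -E; apply: (@near_eq_is_derive R R R (cst 0) _ t 1 0).
  near=> y; rewrite /flat /cst ifF//; apply/negbTE; rewrite -leNgt ltW//.
  by near: y; apply: cvgr_lt tn; exact: cvg_id.
- have tn0 : t != 0 by rewrite gt_eqF.
  apply: (@near_eq_is_derive R R R (fun s => s^-1 ^+ k * expR (- s^-1)) _ t 1).
    near=> y; rewrite /flat ifT//.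
    by near: y; apply: cvgr_gt tp; exact: cvg_id.
  have d1 : is_derive t 1 (fun s : R => s^-1) (- (t^-1 ^+ 2)).
    by have := @is_deriveV _ id t 1 1 tn0 (is_derive_id _ _); rewrite /GRing.scale/= mulr1 exprVn.
  have d2 : is_derive t 1 (fun s : R => s^-1 ^+ k) (k%:R * t^-1 ^+ k.-1 * - (t^-1 ^+ 2)).
    have := @is_deriveX _ _ _ k _ _ _ d1.
    rewrite exprfctE /GRing.scale /= => H; apply: (is_derive_eq H).
    by rewrite -mulr_natl.
  have d3 : is_derive t 1 (fun s : R => expR (- s^-1)) (expR (- t^-1) * t^-1 ^+ 2).
    have := @is_derive1_comp R expR (fun s => - s^-1) t _ _ (is_derive_expR _) (is_deriveN d1).
    by rewrite opprK.
  have := is_deriveM d2 d3; rewrite /flat tp /GRing.scale /= => H.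
  apply: (is_derive_eq H); case: k {d2 H} => [|k] /=.
    by rewrite !mul0r mulr0 oppr0 mul0r add0r addr0 expr0 mul1r mulrC.
  by rewrite !exprS; ring.
have f0 : flat k 0 = 0 by rewrite /flat ltxx.
have E : (0 : R) = - k%:R * flat k.+1 0 + flat k.+2 0.
  by rewrite /flat ltxx mulr0 addr0.
rewrite -E.
have L : h^-1 *: ((flat k \o shift 0) (h *: 1) - flat k 0) @[h --> (0:R)^'] --> (0 : R).
  apply/cvgrPdist_le => e e0.
  pose C : R := k.+2%:R ^+ k.+2.
  have C0 : 0 < C by rewrite exprn_gt0// ltr0n.
  near=> h; rewrite sub0r normrN /= f0 subr0 addr0 /GRing.scale/= mulr1 mulrC.
  have [hn|hp] := leP h 0; first by rewrite /flat ltNge hn /= mul0r normr0 ltW.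
  rewrite ger0_norm ?divr_ge0 ?flat_ge0 ?(ltW hp)// ler_pdivrMr//.
  apply: (le_trans (flat_small _ hp)); rewrite expr2 mulrA ler_pM2r//.
  rewrite -/C mulrC -ler_pdivlMr// ltW//.
  apply: (le_lt_trans (ler_norm _)); near: h; apply: dnbhs0_lt; rewrite divr_gt0//.
by apply: DeriveDef; [apply/cvg_ex; eexists; exact: L|exact/cvg_lim].
Unshelve. all: by end_near. Qed.

Lemma Ck_flat n j k (U : set 'rV[R]_n) q : open U -> Cinf U q -> Ck_on j U (flat k \o q).
Proof.
move=> oU hq.
have cont l x : U x -> {for x, continuous (flat l \o q)}.
  move=> Ux; apply: continuous_comp; first exact: Cinf_cont hq Ux.
  have [h _] := is_derive_flat l (q x).
  by apply: differentiable_continuous; apply/derivable1_diffP.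
elim: j k => [|j IH] k; first by split=> // x; exact: cont.
have d i x : U x -> is_derive x (e_ i) (flat k \o q)
    ((- k%:R * (flat k.+1 \o q) x + (flat k.+2 \o q) x) * 'D_(e_ i) q x).
  move=> Ux; apply: is_derive_comp1 (is_derive_flat _ _).
  by apply: derivableP; exact: (Cinf_derivable hq Ux).
split; first by move=> x; exact: cont.
move=> i; split; first by move=> x Ux; case: (d i x Ux).
apply: (@Ck_ext _ _ _ _ (fun x => (- k%:R * (flat k.+1 \o q) x + (flat k.+2 \o q) x) * 'D_(e_ i) q x)) => //.
  by move=> x Ux; case: (d i x Ux).
apply: Ck_mul => //; last exact: (Cinf_D i hq).
by apply: Ck_add => //; apply: Ck_scale.
Qed.

Lemma bump_rV n (p : 'rV[R]_n) r : 0 < r -> exists W : 'rV[R]_n -> R,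
  [/\ Cinf setT W, forall x, 0 <= W x <= 1,
      \forall x \near p, W x = 1 & forall x, W x != 0 -> `|x - p| <= r / 2].
Proof.
move=> r0.
(* In Euclidean norm $s = 2 - |x-p|^2/ep^2$. The bump equals 1 where $s \ge 1$ and vanishes unless
   $|x-p|^2 < 2\,ep^2$, which keeps every coordinate within $2\,ep = r/2$. *)
pose ep := r / 4; have ep0 : 0 < ep by rewrite divr_gt0.
pose q (x : 'rV[R]_n) := \sum_(i < n) (x 0 i - p 0 i) * (x 0 i - p 0 i).
pose s (x : 'rV[R]_n) := 2 + (- ep ^- 2) * q x.
pose s' (x : 'rV[R]_n) := 1 + - s x.
have oT := @openT 'rV[R]_n.
have hq k : Ck_on k setT q.
  by apply: Ck_sum => // i; apply: Ck_mul => //; apply: Ck_add => //;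
    by [exact: Ck_coord|exact: Ck_cst].
have hs k : Ck_on k setT s.
  by apply: Ck_add => //; [exact: Ck_cst|apply: Ck_scale].
have hs' k : Ck_on k setT s'.
  by apply: Ck_add => //; [exact: Ck_cst|apply: Ck_opp].
pose D x := flat 0 (s x) + flat 0 (s' x).
have D0 x : 0 < D x.
  rewrite /D; have [sx|sx] := ltP 0 (s x).
    by rewrite ltr_pwDl ?flat_gt0 ?flat_ge0.
  by rewrite ltr_wpDl ?flat_ge0// flat_gt0// /s' subr_gt0 (le_lt_trans sx).
have q0 x : 0 <= q x by apply: sumr_ge0 => i _; rewrite -expr2 sqr_ge0.
exists (fun x => flat 0 (s x) * (D x)^-1); split.
- move=> k; apply: Ck_mul => //; first exact: (Ck_flat _ _ oT hs).
  apply: Ck_inv => //; first by move=> x _; rewrite gt_eqF.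
  by apply: Ck_add => //; [exact: (Ck_flat _ _ oT hs)|exact: (Ck_flat _ _ oT hs')].
- move=> x; rewrite divr_ge0 ?flat_ge0 ?(ltW (D0 x))//= ler_pdivrMr// mul1r.
  by rewrite lerDl flat_ge0.
- have en : 0 < ep / n.+1%:R by rewrite divr_gt0.
  near=> x.
  have sx : 1 <= s x.
    have : q x <= ep ^+ 2.
      apply: (@le_trans _ _ (\sum_(i < n) (ep / n.+1%:R) ^+ 2)).
        apply: ler_sum => i _; rewrite -expr2 -[leLHS]real_normK ?num_real// lerXn2r ?nnegrE ?normr_ge0 ?(ltW en)//.
        have : ball p (ep / n.+1%:R) x by near: x; exact: nbhsx_ballx.
        by move=> /ball_rVP[_ /(_ i)]; rewrite distrC => /ltW.
      rewrite sumr_const card_ord exprMn -mulrnAr ler_piMr ?sqr_ge0// exprVn -mulr_natl.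
      rewrite ler_pdivrMr ?exprn_gt0// mul1r -natrX ler_nat.
      by rewrite (@leq_trans n.+1)// -{1}[n.+1]expn1 leq_pexp2l.
    rewrite /s mulNr; have e2 : 0 < ep ^+ 2 by rewrite exprn_gt0.
    move=> qx; have : ep ^- 2 * q x <= 1 by rewrite ler_pdivrMl// mulr1.
    by move: (_ * q x) => z; lra.
  have f0 : flat 0 (s' x) = 0.
    by rewrite /flat ifF//; apply/negbTE; rewrite -leNgt /s' subr_le0.
  by rewrite /D f0 addr0 mulfV// gt_eqF// flat_gt0// (lt_le_trans ltr01).
- move=> x Wx; apply: rV_norm_le => [|i]; first by rewrite divr_ge0 ?ltW.
  have sx : 0 < s x.
    rewrite ltNge; apply: contra_neqN Wx => sx.
    by rewrite /flat ltNge sx /= mul0r.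
  have qx : q x < 2 * ep ^+ 2.
    move: sx; rewrite /s mulNr subr_gt0 ltr_pdivrMl ?exprn_gt0//.
    by rewrite mulrC.
  have : (x 0 i - p 0 i) ^+ 2 <= q x.
    by rewrite /q (bigD1 i)//= -expr2 lerDl; apply: sumr_ge0 => j _; rewrite -expr2 sqr_ge0.
  move=> h; have {}h : (x 0 i - p 0 i) ^+ 2 < (2 * ep) ^+ 2.
    apply: (le_lt_trans h); apply: (lt_le_trans qx); have := sqr_ge0 ep.
    rewrite (_ : (2 * ep) ^+ 2 = 4 * ep ^+ 2); last by ring.
    by move: (ep ^+ 2) => z z0; lra.
  rewrite !mxE; have -> : r / 2 = 2 * ep by rewrite /ep; field.
  have ep2 : 0 <= 2 * ep by rewrite mulr_ge0// ltW.
  move: h; rewrite -[X in X < _]real_normK ?num_real// ltr_pXn2r ?nnegrE//.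
  exact: ltW.
Unshelve. all: by end_near. Qed.
End Bump.

(** * Hadamard's lemma *)

Section Hadamard.
Context {R : realType}.
Local Notation e_ i := (delta_mx 0 i).
Local Notation mu := (@lebesgue_measure R).

Definition intv (F : R -> R) : R := \int[mu]_(s in `[0, 1]) F s.

Let cont01 (F : R -> R) := {within `[0, 1], continuous F}.

Lemma mu01 : fine (mu `[0, 1]%classic) = 1.
Proof. by have /= -> := @lebesgue_measure_itv R `[0, 1]; rewrite lte_fin ltr01 /= subr0. Qed.

Lemma intv_int F : cont01 F -> mu.-integrable `[0, 1] (EFin \o F).
Proof. by move=> h; apply: continuous_compact_integrable => //; exact: segment_compact. Qed.

(** One estimate for two uses: with [h = 0] it gives continuity of a parameter integral, with [h] an
    increment it gives its derivative. *)
Lemma intv_approx F G H h M : cont01 F -> cont01 G -> cont01 H ->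
  (forall s, 0 <= s <= 1 -> `|F s - G s - h * H s| <= M) ->
  `|intv F - intv G - h * intv H| <= M.
Proof.
move=> cF cG cH hM.
have m01 : measurable (`[0, 1]%classic : set (measurableTypeR R)) by exact: measurable_itv.
have iF := intv_int cF; have iG := intv_int cG; have iH := intv_int cH.
have cH' : cont01 (fun s => h * H s).
  by move=> x; apply: continuousM; [exact: cst_continuous|exact: cH].
have cFG : cont01 (fun s => F s - G s) by move=> x; apply: (continuousB (cF x) (cG x)).
have cK : cont01 (fun s => F s - G s - h * H s).
  by move=> x; apply: (continuousB (cFG x) (cH' x)).
have iH' := intv_int cH'; have iFG := intv_int cFG; have iK := intv_int cK.
rewrite /intv -RintegralZl// -RintegralB// -RintegralB//.
have K := le_normr_Rintegral m01 iK.
apply: (le_trans K).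
have iM : mu.-integrable `[0, 1] (EFin \o (cst M)).
  apply: (intv_int); apply: continuous_subspaceT => x; exact: cvg_cst.
have iN : mu.-integrable `[0, 1] (EFin \o (fun s => `|F s - G s - h * H s|)).
  exact: (integrable_norm iK).
have : \int[mu]_(s in `[0, 1]) `|F s - G s - h * H s| <= \int[mu]_(s in `[0, 1]) M.
  by apply: le_Rintegral => // s /=; rewrite in_itv /=; exact: hM.
move=> /le_trans; apply.
by rewrite Rintegral_cst// mu01 mulr1.
Qed.

Lemma ball_seg n (p x : 'rV[R]_n) r s : ball p r x -> 0 <= s <= 1 -> ball p r (p + s *: (x - p)).
Proof.
move=> /ball_rVP[r0 h] /andP[s0 s1]; apply/ball_rVP; split=> // j.
rewrite !mxE opprD addNKr normrN normrM (ger0_norm s0).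
by apply: le_lt_trans (h j); rewrite distrC ler_piMl.
Qed.

Lemma C1_lip_ball n (p : 'rV[R]_n) r r1 f : Ck_on 1 (ball p r) f -> 0 < r1 -> r1 < r ->
  exists2 C, 0 <= C & forall y y', ball p r1 y -> ball p r1 y' -> `|f y' - f y| <= C * `|y' - y|.
Proof.
move=> hf r10 r1r.
have sub : closed_ball p r1 `<=` (ball p r : set 'rV[R]_n).
  exact: closed_ball_subset.
have cK : compact (closed_ball p r1 : set 'rV[R]_n).
  apply: bounded_closed_compact; last exact: closed_ball_closed.
  rewrite closed_ballE//; exists (`|p| + r1); split; first exact: num_real.
  move=> M hM y /= hy; apply/ltW; apply: le_lt_trans hM.
  by have := ler_normB p (p - y); rewrite subKr; move: hy => /=; rewrite /closed_ball_ /=; lra.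
have bd (i : 'I_n) : exists M, forall y, ball p r1 y -> `|'D_(e_ i) f y| <= M.
  have : compact (('D_(e_ i) f) @` closed_ball p r1).
    apply: continuous_compact => //; apply: continuous_in_subspaceT => x.
    rewrite inE => /sub bx; exact: (Ck_cont (Ck_D i hf) bx).
  move=> /compact_bounded[M [_ hM]]; exists (M + 1) => y by1.
  apply: hM; first by rewrite ltrDl.
  by exists y => //; exact: subset_closed_ball.
have [M hM] := choice bd.
exists (\sum_i `|M i|); first by rewrite sumr_ge0.
move=> y y' hy hy'.
have [|c [hc ->]] := @MVT_ball _ _ f p y y' r1 _ hy hy'.
  by move=> x i bx; apply: (Ck_derivable hf); apply: le_ball bx; exact: ltW.
apply: (le_trans (ler_norm_sum _ _ _)); rewrite mulr_suml; apply: ler_sum => i _.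
rewrite normrM mulrC ler_pM//; last by have := coord_norm_le (y' - y) i; rewrite !mxE.
by apply: (le_trans (hM i _ (hc i))); exact: ler_norm.
Qed.

Lemma MVT_line0 n (f : 'rV[R]_n -> R) (x v : 'rV[R]_n) (t : R) :
  (forall s, `|s| <= `|t| -> derivable f (s *: v + x) v) ->
  exists2 s, `|s| <= `|t| & f (t *: v + x) - f x = 'D_v f (s *: v + x) * t.
Proof.
move=> h; have [t0|/ltW t0] := leP 0 t.
  have [|s /andP[s0 st] E] := @MVT_line R n f x v 0 t t0.
    by move=> s /andP[s0 st]; apply: h; rewrite !ger0_norm.
  exists s; first by rewrite !ger0_norm.
  by move: E; rewrite scale0r add0r subr0.
have [|s /andP[s0 st] E] := @MVT_line R n f x v t 0 t0.
  by move=> s /andP[s0 st]; apply: h; rewrite !ler0_norm// lerN2.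
exists s; first by rewrite !ler0_norm// lerN2.
by apply: oppr_inj; rewrite opprB -mulrN; move: E; rewrite scale0r add0r sub0r.
Qed.

Lemma intv_lin F H h : cont01 F -> cont01 H ->
  intv (fun s => F s + h * H s) = intv F + h * intv H.
Proof.
move=> cF cH; apply/eqP; rewrite -subr_eq0 opprD addrA -normr_le0.
apply: intv_approx => //; last first.
  by move=> s _; rewrite (_ : _ - _ - _ = 0) ?normr0//; ring.
move=> x; apply: (continuousD (cF x)); apply: continuousM; last exact: cH.
exact: cst_continuous.
Qed.

Lemma intv_sum (I : Type) (r : seq I) (a : I -> R) (G : I -> R -> R) :
  (forall i, cont01 (G i)) ->
  cont01 (fun s => \sum_(i <- r) a i * G i s) /\
  intv (fun s => \sum_(i <- r) a i * G i s) = \sum_(i <- r) a i * intv (G i).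
Proof.
move=> cG; elim: r => [|i r [IHc IH]].
  have -> : (fun s => \sum_(i <- [::]) a i * G i s) = cst 0.
    by apply/funext => s; rewrite big_nil.
  split; first by move=> x; exact: cst_continuous.
  by rewrite big_nil /intv Rintegral_cst ?mul0r//; exact: measurable_itv.
have -> : (fun s => \sum_(j <- i :: r) a j * G j s) =
    (fun s => \sum_(j <- r) a j * G j s + a i * G i s).
  by apply/funext => s; rewrite big_cons addrC.
split; last by rewrite intv_lin// IH big_cons addrC.
move=> x; apply: (continuousD (IHc x)); apply: continuousM; last exact: cG.
exact: cst_continuous.
Qed.

Section Param.
Variables (n : nat) (p : 'rV[R]_n) (r : R).
Hypothesis r0 : 0 < r.
Local Notation B := (ball p r : set 'rV[R]_n).
Let seg x s := p + s *: (x - p) : 'rV[R]_n.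
(** The weight $s^a$ is there because each derivative in [x] produces a factor [s]; the family is
    thus closed under differentiation. *)
Definition param_int a (psi : 'rV[R]_n -> R) x := intv (fun s => s ^+ a * psi (p + s *: (x - p))).

Lemma seg_cont a psi x : Cinf B psi -> B x -> cont01 (fun s => s ^+ a * psi (seg x s)).
Proof.
move=> hpsi Bx; apply: continuous_in_subspaceT => s; rewrite inE /= in_itv /= => hs.
have h1 : {for s, continuous (fun s : R => s ^+ a)} by exact: exprn_continuous.
have h3 : {for s, continuous (fun s : R => seg x s)}.
  apply: (continuousD (f := cst p) (g := fun s : R => s *: (x - p))); first exact: cst_continuous.
  exact: scalel_continuous.
have h2 : {for s, continuous (psi \o seg x)}.
  by apply: continuous_comp; [exact: h3|exact: (Cinf_cont hpsi (ball_seg Bx hs))].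
exact: (continuousM h1 h2).
Qed.

Lemma ball_shrink x : B x -> exists r1, [/\ 0 < r1, r1 < r & ball p r1 x].
Proof.
move=> /ball_rVP[_ h].
pose m := \big[Order.max/0]_i `|p 0 i - x 0 i|.
have mr : m < r by apply: bigmax_lt.
have m0 : 0 <= m by exact: bigmax_ge_id.
exists ((m + r) / 2); split; [lra|lra|].
apply/ball_rVP; split; first lra.
move=> j; have : `|p 0 j - x 0 j| <= m by exact: le_bigmax.
lra.
Qed.

Lemma param_cont a psi x : Cinf B psi -> B x -> {for x, continuous (param_int a psi)}.
Proof.
move=> hpsi Bx; have [r1 [r10 r1r b1]] := ball_shrink Bx.
have [C C0 hC] := C1_lip_ball (hpsi 1%N) r10 r1r.
apply/(@cvgrPdist_le R _ _ (nbhs x) (nbhs_filter x)) => e e0.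
have eC : 0 < e / (C + 1) by rewrite divr_gt0// ltr_wpDl.
near=> y.
have b1y : ball p r1 y.
  by near: y; apply: open_nbhs_nbhs; split=> //; exact: ball_open.
have By : B y by apply: le_ball b1y; exact: ltW.
have := @intv_approx (fun s => s ^+ a * psi (seg x s)) (fun s => s ^+ a * psi (seg y s))
   (fun s => s ^+ a * psi (seg x s)) 0 (C * `|x - y|) (@seg_cont a _ _ hpsi Bx) (@seg_cont a _ _ hpsi By)
   (@seg_cont a _ _ hpsi Bx).
rewrite mul0r subr0 => K; apply: (le_trans (K _)).
  move=> s /[dup] hs /andP[s0 s1]; rewrite mul0r subr0 -mulrBr normrM.
  have sa : 0 <= s ^+ a <= 1 by rewrite exprn_ge0//= exprn_ile1.
  case/andP: sa => sa0 sa1; rewrite (ger0_norm sa0).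
  apply: (le_trans (ler_wpM2l sa0 (hC _ _ (ball_seg b1y hs) (ball_seg b1 hs)))).
  have -> : p + s *: (x - p) - (p + s *: (y - p)) = s *: (x - y).
    by rewrite opprD addrACA subrr add0r -scalerBr opprB addrA subrK.
  rewrite normrZ (ger0_norm s0) [leLHS](_ : _ = C * (s ^+ a * s * `|x - y|)); last by ring.
  by rewrite ler_wpM2l// ler_piMl// mulr_ile1.
have : ball x (e / (C + 1)) y by near: y; exact: (nbhsx_ballx x _ eC).
rewrite -ball_normE /=.
rewrite ltr_pdivlMr ?ltr_wpDl// => h; apply: ltW; apply: le_lt_trans h.
by rewrite mulrC ler_wpM2l// lerDl.
Unshelve. all: by end_near. Qed.

(** The error $C h^2$ is uniform in [s] and therefore survives integration. Moving [x] by [h] along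
    an axis moves the point of the segment by [s * h], which is where the extra factor [s] comes
    from. *)
Lemma param_quot a psi x i r1 C h : Cinf B psi -> r1 < r -> 0 <= C ->
  (forall y y', ball p r1 y -> ball p r1 y' ->
     `|'D_(e_ i) psi y' - 'D_(e_ i) psi y| <= C * `|y' - y|) ->
  (forall t, `|t| <= `|h| -> ball p r1 (t *: e_ i + x)) ->
  forall s, 0 <= s <= 1 -> `|s ^+ a * psi (seg (h *: e_ i + x) s) - s ^+ a * psi (seg x s) -
      h * (s ^+ a.+1 * 'D_(e_ i) psi (seg x s))| <= C * h ^+ 2.
Proof.
move=> hpsi r1r C0 hC hb s /[dup] hs /andP[s0 s1].
have sh0 : 0 <= C * h ^+ 2 by rewrite mulr_ge0// sqr_ge0.
(* At [s = 0] the terms cancel or vanish; the general case divides by [s]. *)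
have [->|sn0] := eqVneq s 0.
  by rewrite /seg !scale0r subrr exprS !mul0r mulr0 subrr normr0.
have sp : 0 < s by rewrite lt0r sn0.
have segE t : seg (t *: e_ i + x) s = (s * t) *: e_ i + seg x s.
  by rewrite /seg -addrA scalerDr scalerA addrCA.
have bt t : `|t| <= `|s * h| -> ball p r1 (t *: e_ i + seg x s).
  move=> th; have -> : t = s * (t / s) by rewrite mulrC divfK.
  rewrite -segE; apply: ball_seg => //; apply: hb.
  by rewrite normrM normfV ler_pdivrMr ?normr_gt0// mulrC -normrM.
have bB z : ball p r1 z -> B z by apply: le_ball; exact: ltW.
have [|t th E] := @MVT_line0 n psi (seg x s) (e_ i) (s * h).
  by move=> t /bt/bB Bt; exact: (Cinf_derivable hpsi Bt).
have b0 : ball p r1 (seg x s) by have := bt 0; rewrite scale0r add0r normr0; apply.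
have := hC _ _ b0 (bt _ th); rewrite addrK normrZ segE.
pose D' := 'D_(e_ i) psi (t *: e_ i + seg x s); rewrite -/D' in E *.
pose D := 'D_(e_ i) psi (seg x s); rewrite -/D.
have -> : s ^+ a * psi ((s * h) *: e_ i + seg x s) - s ^+ a * psi (seg x s) - h * (s ^+ a.+1 * D) =
    s ^+ a.+1 * (h * (D' - D)).
  by rewrite -mulrBr E exprS; ring.
move: D D' {E} => D D' H.
rewrite normrM ger0_norm ?exprn_ge0//.
have e1 : `|e_ i : 'rV[R]_n| <= 1.
  by apply: rV_norm_le => // j; rewrite !mxE; case: (_ && _); rewrite ?normr1 ?normr0.
have H2 : `|D' - D| <= C * `|h|.
  apply: (le_trans H); apply: ler_wpM2l => //.
  apply: (@le_trans _ _ `|t|); first by rewrite ler_piMr.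
  by apply: (le_trans th); rewrite normrM (ger0_norm s0) ler_piMl//.
rewrite normrM; apply: (@le_trans _ _ (`|h| * `|D' - D|)).
  by rewrite ler_piMl ?mulr_ge0//; exact: exprn_ile1.
by rewrite -real_normK ?num_real// expr2 mulrCA; apply: ler_wpM2l.
Qed.

Lemma param_derive a psi x i : Cinf B psi -> B x ->
  is_derive x (e_ i) (param_int a psi) (param_int a.+1 ('D_(e_ i) psi) x).
Proof.
move=> hpsi Bx; have [r1 [r10 r1r b1]] := ball_shrink Bx.
have [C C0 hC] := C1_lip_ball (Cinf_D i hpsi 1%N) r10 r1r.
have [d d0 hd] : exists2 d, 0 < d & ball x d `<=` ball p r1.
  have : nbhs x (ball p r1) by apply: open_nbhs_nbhs; split=> //; exact: ball_open.
  by move/nbhs_ballP => [d /= d0 hd]; exists d.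
have L : h^-1 *: ((param_int a psi \o shift x) (h *: e_ i) - param_int a psi x) @[h --> (0:R)^']
   --> (param_int a.+1 ('D_(e_ i) psi) x : R).
  apply/cvgrPdist_le => e e0; near=> h.
  have h0 : h != 0 by near: h; exact: nbhs_dnbhs_neq.
  have hb t : `|t| <= `|h| -> ball p r1 (t *: e_ i + x).
    move=> th; apply: hd; rewrite -ball_normE /= opprD addrCA subrr addr0 normrN normrZ.
    have hdl : `|h| < d by near: h; exact: dnbhs0_lt.
    apply: le_lt_trans hdl; apply: le_trans th; rewrite ler_piMr//.
    by apply: rV_norm_le => // j; rewrite !mxE; case: (_ && _); rewrite ?normr1 ?normr0.
  rewrite /= /GRing.scale /=; set y := _ + x.
  have b1y : ball p r1 y by exact: hb.
  have By : B y by apply: le_ball b1y; exact: ltW.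
  have K := @intv_approx (fun s => s ^+ a * psi (seg y s)) (fun s => s ^+ a * psi (seg x s))
   (fun s => s ^+ a.+1 * 'D_(e_ i) psi (seg x s)) h (C * h ^+ 2) (@seg_cont a _ _ hpsi By)
   (@seg_cont a _ _ hpsi Bx) (@seg_cont a.+1 _ _ (Cinf_D i hpsi) Bx).
  have {}K := K (@param_quot a psi x i r1 C h hpsi r1r C0 hC hb).
  have he : C * `|h| < e.
    have : `|h| < e / (C + 1) by near: h; apply: dnbhs0_lt; rewrite divr_gt0// ltr_wpDl.
    rewrite ltr_pdivlMr ?ltr_wpDl// => he; apply: le_lt_trans he.
    by rewrite mulrC ler_wpM2l// lerDl.
  have {}K : `|param_int a psi y - param_int a psi x - h * param_int a.+1 ('D_(e_ i) psi) x| <= C * h ^+ 2 := K.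
  move: K.
  move: (param_int a psi y) (param_int a psi x) (param_int a.+1 ('D_(e_ i) psi) x) => Iy Ix I' K.
  have -> : I' - h^-1 * (Iy - Ix) = - (h^-1 * (Iy - Ix - h * I')) by field.
  rewrite normrN normrM normfV ler_pdivrMl ?normr_gt0//.
  apply: (le_trans K); rewrite -real_normK ?num_real// expr2 mulrCA; apply: ler_wpM2l => //.
  exact: ltW.
by apply: DeriveDef; [apply/cvg_ex; eexists; exact: L|exact/cvg_lim].
Unshelve. all: by end_near. Qed.

Lemma param_Ck k a psi : Cinf B psi -> Ck_on k B (param_int a psi).
Proof.
elim: k a psi => [|k IH] a psi hpsi; first by split=> // x; exact: param_cont.
split; first by move=> x; exact: param_cont.
move=> i; split; first by move=> x Bx; case: (param_derive a i hpsi Bx).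
apply: (@Ck_ext _ _ _ _ (param_int a.+1 ('D_(e_ i) psi))); first exact: ball_open.
  by move=> x Bx; case: (param_derive a i hpsi Bx).
exact/IH/Cinf_D.
Qed.

(** Integrating the derivative of [f] along the segment from [p] to [x] produces the factors $g_i(x)
    = \int_0^1 D_i f(p+s(x-p))\,ds$. *)
Lemma Hadamard f : Cinf B f -> exists g : 'I_n -> 'rV[R]_n -> R,
  (forall i, Cinf B (g i) /\ g i p = 'D_(e_ i) f p) /\
  forall x, B x -> f x = f p + \sum_(i < n) (x 0 i - p 0 i) * g i x.
Proof.
move=> hf; exists (fun i => param_int 0 ('D_(e_ i) f)); split.
  move=> i; split; first by move=> k; apply: param_Ck; exact: Cinf_D.
  rewrite /param_int; have -> : (fun s => s ^+ 0 * 'D_(e_ i) f (p + s *: (p - p))) = cst ('D_(e_ i) f p).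
    by apply/funext => s; rewrite expr0 mul1r subrr scaler0 addr0.
  by rewrite /intv Rintegral_cst ?mu01 ?mulr1//; exact: measurable_itv.
move=> x Bx.
have dseg s : is_derive s (1 : R) (seg x) (x - p).
  apply: is_derive_rV => j.
  have -> : (fun s => seg x s 0 j) = (fun s => p 0 j + s * (x 0 j - p 0 j)).
    by apply/funext => t; rewrite !mxE.
  have := is_deriveD (is_derive_cst (p 0 j) s 1)
    (is_deriveM (is_derive_id s 1) (is_derive_cst (x 0 j - p 0 j) s 1)).
  by move=> H; apply: (is_derive_eq H); rewrite !mxE /GRing.scale /= mulr0 !add0r mulr1.
pose G i s := 'D_(e_ i) f (seg x s).
have cG i : cont01 (G i).
  have := @seg_cont 0 _ _ (Cinf_D i hf) Bx.
  by congr (cont01 _); apply/funext => s; rewrite expr0 mul1r.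
have [cS ES] := intv_sum (index_enum 'I_n) (fun i => x 0 i - p 0 i) cG.
have dphi (s : R) : 0 <= s <= 1 -> is_derive s (1 : R) (f \o seg x)
   (\sum_(i < n) (x 0 i - p 0 i) * G i s).
  move=> hs.
  have oB : open B by exact: ball_open.
  have := @is_derive_comp_rV R _ n B f (seg x) s 1 (x - p) oB (hf 1%N) (ball_seg Bx hs) (dseg s).
  by move=> H; apply: (is_derive_eq H); apply: eq_bigr => j _; rewrite !mxE.
have cphi (s : R) : 0 <= s <= 1 -> {for s, continuous (f \o seg x)}.
  move=> hs; have [h _] := dphi s hs.
  by apply: differentiable_continuous; apply/derivable1_diffP.
have := @continuous_FTC2 R (fun s => \sum_(i < n) (x 0 i - p 0 i) * G i s) (f \o seg x) 0 1 ltr01 cS.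
have -> : (f \o seg x) 1 = f x by rewrite /= /seg scale1r addrC subrK.
have -> : (f \o seg x) 0 = f p by rewrite /= /seg scale0r addr0.
move=> FTC.
have {}FTC : intv (fun s => \sum_(i < n) (x 0 i - p 0 i) * G i s) = f x - f p.
  rewrite /intv /Rintegral FTC//.
    split; first by move=> s; rewrite in_itv /= => /andP[s0 s1]; case: (dphi s); rewrite ?ltW.
      by apply: cvg_at_right_filter; apply: cphi; rewrite lexx ler01.
    by apply: cvg_at_left_filter; apply: cphi; rewrite lexx ler01.
  move=> s; rewrite in_itv /= => /andP[s0 s1]; rewrite derive1E.
  by case: (dphi s); rewrite ?ltW.
rewrite -[LHS](subrK (f p)) -FTC ES addrC; congr (_ + _); apply: eq_bigr => i _.
by congr (_ * intv _); apply/funext => s; rewrite expr0 mul1r.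
Qed.
End Param.
End Hadamard.

(** * Smooth functions on Lie groups *)

Section LieSmooth.
Context {R : realType} {n : nat} {G : lieGroupType R n}.
Local Notation A := (@lie_atlas R n G).
Implicit Types (c d e : chart R n G) (phi psi : G -> R).

Lemma lie_chart c : A c -> is_chart c.
Proof. by have [h _ _] := @lie_atlasP R n G; exact: h. Qed.

Lemma lie_cover (x : G) : exists2 c, A c & chart_dom c x.
Proof. by have [_ h _] := @lie_atlasP R n G; exact: h. Qed.

Lemma chart_domo c : A c -> open (chart_dom c).
Proof. by move=> /lie_chart[]. Qed.

Lemma chart_imgo c : A c -> open (chart_img c).
Proof. by move=> /lie_chart[]. Qed.

Lemma chartK c x : A c -> chart_dom c x -> chart_inv c (c x) = x.
Proof. by move=> /lie_chart[_ _ h _ _] dx; apply: h; rewrite inE. Qed.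

Lemma chart_imgP c x : chart_dom c x -> chart_img c (c x).
Proof. by exists x. Qed.

Lemma chart_inv_dom c u : A c -> chart_img c u -> chart_dom c (chart_inv c u).
Proof. by move=> Ac [x dx <-]; rewrite chartK. Qed.

Lemma chart_invK c u : A c -> chart_img c u -> c (chart_inv c u) = u.
Proof. by move=> Ac [x dx <-]; rewrite chartK. Qed.

Lemma chart_cont c x : A c -> chart_dom c x -> {for x, continuous c}.
Proof.
move=> Ac dx; have [od _ _ h _] := lie_chart Ac.
by move: h; rewrite continuous_open_subspace// => h; apply: h; rewrite inE.
Qed.

Lemma chart_inv_cont c u : A c -> chart_img c u -> {for u, continuous (chart_inv c)}.
Proof.
move=> Ac dx; have [_ oi _ _ h] := lie_chart Ac.
by move: h; rewrite continuous_open_subspace// => h; apply: h; rewrite inE.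
Qed.

Lemma open_preim (T U : topologicalType) (F : T -> U) (O : set T) (V : set U) :
  open O -> (forall x, O x -> {for x, continuous F}) -> open V -> open (O `&` F @^-1` V).
Proof.
move=> oO cF oV; rewrite openE => x [Ox Vx]; apply: filterI; first exact: open_nbhs_nbhs.
by apply: (cF x Ox); exact: open_nbhs_nbhs.
Qed.

Lemma chart_sub_open c (O : set G) : A c -> open O -> open (chart_img c `&` chart_inv c @^-1` O).
Proof.
by move=> Ac oO; apply: open_preim => //; [exact: chart_imgo|move=> u; exact: chart_inv_cont].
Qed.

Lemma chart_sub_openE c (O : set G) : A c ->
  c @` (chart_dom c `&` O) = chart_img c `&` chart_inv c @^-1` O.
Proof.
move=> Ac; apply/seteqP; split=> u.
  by move=> [x [dx Ox] <-]; split; [exists x|rewrite /= chartK].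
by move=> [[x dx <-]] /=; rewrite chartK// => Ox; exists x.
Qed.

(** A local notion of smoothness, demanded in every chart around the point; it allows functions
    defined by cases to be treated point by point. *)
Definition smat phi x := forall c, A c -> chart_dom c x -> exists V : set 'rV[R]_n,
  [/\ open V, V (c x), V `<=` chart_img c & Cinf V (phi \o chart_inv c)].

Lemma smoothP phi : smooth phi <-> forall x, smat phi x.
Proof.
split=> [h x c Ac dx|h c k Ac].
  by exists (chart_img c); split=> //; [exact: chart_imgo|exists x|move=> k; exact: h].
apply: Ck_local => u [x dx <-]; have [V [_ Vx _ hV]] := h x c Ac dx.
by exists V.
Qed.

Lemma smooth_at phi x : smooth phi -> smat phi x.
Proof. by move/smoothP; exact. Qed.

Lemma open_ball_rV m (V : set 'rV[R]_m) u : open V -> V u -> exists2 r, 0 < r & ball u r `<=` V.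
Proof.
by move=> oV Vu; have /nbhs_ballP[r /= r0 h] := open_nbhs_nbhs (conj oV Vu); exists r.
Qed.

Lemma Cinf_comp m l (U : set 'rV[R]_m) (V : set 'rV[R]_l) (F : 'rV[R]_m -> 'rV[R]_l) f :
  open U -> open V -> (forall x, U x -> V (F x)) ->
  (forall j, Cinf U (fun x => F x 0 j)) -> Cinf V f -> Cinf U (f \o F).
Proof.
by move=> oU oV UV hF hf k; apply: (Ck_comp oU oV UV) => // j; exact: hF.
Qed.

Lemma Cinf_rV_cont m l (U : set 'rV[R]_m) (F : 'rV[R]_m -> 'rV[R]_l) x : U x ->
  (forall j, Cinf U (fun x => F x 0 j)) -> {for x, continuous F}.
Proof.
move=> Ux hF; apply/(@cvgrPdist_le R _ _ (nbhs x) (nbhs_filter x)) => e e0.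
have H : \forall y \near x, forall j, `|F x 0 j - F y 0 j| < e.
  apply: (@filter_forall _ _ (fun (j : 'I_l) y => `|F x 0 j - F y 0 j| < e) (nbhs x) (nbhs_filter x)) => j.
  by have /= hc := Cinf_cont (hF j) Ux; have /cvgrPdist_lt := hc; apply.
near=> y; apply: rV_norm_le (ltW e0) _ => j; rewrite !mxE; apply/ltW.
by move: j; near: y.
Unshelve. all: by end_near. Qed.

Lemma smat_comp m (U : set 'rV[R]_m) (F : 'rV[R]_m -> G) phi u :
  open U -> U u -> (forall v, U v -> {for v, continuous F}) ->
  (forall c, A c -> smooth_on (U `&` F @^-1` chart_dom c) (c \o F)) ->
  smat phi (F u) -> exists V, [/\ open V, V u, V `<=` U & Cinf V (phi \o F)].
Proof.
move=> oU Uu cF hF sphi; have [c Ac dc] := lie_cover (F u).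
have [V [oV Vu VI hV]] := sphi c Ac dc.
pose U1 := U `&` F @^-1` chart_dom c.
have oU1 : open U1 by apply: open_preim => //; exact: chart_domo.
have sF j : Cinf U1 (fun v => (c \o F) v 0 j) by move=> k; exact: hF.
have oW : open (U1 `&` (c \o F) @^-1` V).
  by apply: (open_preim oU1 _ oV) => v Uv; exact: (Cinf_rV_cont Uv sF).
exists (U1 `&` (c \o F) @^-1` V); split=> //; first by move=> v [[]].
have : Cinf (U1 `&` (c \o F) @^-1` V) ((phi \o chart_inv c) \o (c \o F)).
  apply: (Cinf_comp oW oV) => //; first by move=> v [].
  by move=> j; apply: Cinf_sub (sF j) => v [].
by apply: Cinf_ext => // v [[_ dv] _]; rewrite /= chartK.
Qed.

(** Transition maps are smooth, so one chart around the point decides. *)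
Lemma smat1 c phi x V : A c -> chart_dom c x -> open V -> V (c x) -> V `<=` chart_img c ->
  Cinf V (phi \o chart_inv c) -> smat phi x.
Proof.
move=> Ac dx oV Vx VI hV d Ad ddx.
pose U := chart_img d `&` chart_inv d @^-1` chart_dom c.
have oU : open U by apply: chart_sub_open => //; exact: chart_domo.
have sT j : Cinf U (fun v => (c \o chart_inv d) v 0 j).
  move=> k; rewrite /U -chart_sub_openE//.
  by have [_ _ h] := @lie_atlasP R n G; exact: (h _ _ Ad Ac).
have oW : open (U `&` (c \o chart_inv d) @^-1` V).
  by apply: (open_preim oU _ oV) => v Uv; exact: (Cinf_rV_cont Uv sT).
exists (U `&` (c \o chart_inv d) @^-1` V); split=> //.
- by split; [split; [exists x|rewrite /= chartK]|rewrite /= chartK].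
- by move=> v [[]].
have : Cinf (U `&` (c \o chart_inv d) @^-1` V) ((phi \o chart_inv c) \o (c \o chart_inv d)).
  apply: (Cinf_comp oW oV) => //; first by move=> v [].
  by move=> j; apply: Cinf_sub (sT j) => v [].
by apply: Cinf_ext => // v [[_ dv] _]; rewrite /= chartK.
Qed.

Lemma smat_near phi psi x : (\forall y \near x, phi y = psi y) -> smat phi x -> smat psi x.
Proof.
move=> H; have := H; rewrite /prop_near1 nbhsE => -[B [oB Bx] hB] sphi c Ac dx.
have [V [oV Vx VI hV]] := sphi c Ac dx.
have oW : open (V `&` (chart_img c `&` chart_inv c @^-1` B)).
  by apply: openI => //; exact: chart_sub_open.
exists (V `&` (chart_img c `&` chart_inv c @^-1` B)); split=> //.
- by split=> //; split; [exists x|rewrite /= chartK].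
- by move=> v [/VI].
apply: (Cinf_ext oW _ (Cinf_sub _ hV)); first by move=> v [_ [_ /hB]].
by move=> v [].
Qed.

Lemma smooth_cst a : smooth (fun _ : G => a).
Proof. by move=> c k Ac; exact: Ck_cst. Qed.

Lemma smooth_add phi psi : smooth phi -> smooth psi -> smooth (fun x => phi x + psi x).
Proof. by move=> h1 h2 c k Ac; apply: Ck_add; [exact: chart_imgo|exact: h1|exact: h2]. Qed.

Lemma smooth_mul phi psi : smooth phi -> smooth psi -> smooth (fun x => phi x * psi x).
Proof. by move=> h1 h2 c k Ac; apply: Ck_mul; [exact: chart_imgo|exact: h1|exact: h2]. Qed.

Lemma smooth_scale a phi : smooth phi -> smooth (fun x => a * phi x).
Proof. by move=> h1; apply: smooth_mul => //; exact: smooth_cst. Qed.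

Lemma smooth_opp phi : smooth phi -> smooth (fun x => - phi x).
Proof. by move=> h1 c k Ac; apply: Ck_opp; [exact: chart_imgo|exact: h1]. Qed.

Lemma smooth_sum (I : Type) (r : seq I) (F : I -> G -> R) :
  (forall i, smooth (F i)) -> smooth (fun x => \sum_(i <- r) F i x).
Proof.
by move=> h c k Ac; apply: (@Ck_sum _ _ _ _ _ _ (fun i => F i \o chart_inv c)) => [|i];
  [exact: chart_imgo|exact: h].
Qed.

Lemma smooth_cont phi : smooth phi -> continuous phi.
Proof.
move=> h x; have [c Ac dx] := lie_cover x.
have hc : {for x, continuous ((phi \o chart_inv c) \o c)}.
  apply: continuous_comp; first exact: chart_cont.
  by apply: Ck_cont (h c 0%N Ac) _; exists x.
have E : (phi \o chart_inv c \o c) x = phi x by rewrite /= chartK.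
change (phi @ x --> phi x); rewrite -E; apply: cvg_trans hc.
apply: near_eq_cvg; near=> y; rewrite /= chartK//.
by near: y; apply: open_nbhs_nbhs; split=> //; exact: chart_domo.
Unshelve. all: by end_near. Qed.

Lemma map_cont (F : G -> G) : smooth_map A A F -> continuous F. Proof. by case. Qed.

Lemma smat_map (F : G -> G) phi x : smooth_map A A F -> smat phi (F x) -> smat (phi \o F) x.
Proof.
move=> [cF sF] sphi c Ac dx.
have [||||V [oV Vx VI hV]] := @smat_comp n (chart_img c) (F \o chart_inv c) phi (c x) (chart_imgo Ac).
- by exists x.
- by move=> v Iv; apply: continuous_comp; [exact: chart_inv_cont|exact: cF].
- move=> d Ad; have := sF c d Ac Ad.
  by rewrite chart_sub_openE.
- by rewrite /= chartK.
by exists V.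
Qed.

Lemma smooth_comp_map (F : G -> G) phi : smooth_map A A F -> smooth phi -> smooth (phi \o F).
Proof. by move=> hF /smoothP h; apply/smoothP => x; apply: smat_map hF _; exact: h. Qed.

Lemma mul_cont : continuous (fun p : G * G => (p.1 * p.2)%g).
Proof. by have [] := @lie_mul_smooth R n G. Qed.

Lemma inv_cont : continuous (fun x : G => x^-1%g).
Proof. by have [] := @lie_inv_smooth R n G. Qed.

Lemma lsub_cont (p q : nat) : continuous (@lsubmx R 1 p q).
Proof.
move=> w; apply: (@Cinf_rV_cont _ _ setT) => // j k.
have -> : (fun x : 'rV[R]_(p + q) => (lsubmx x) 0 j) = (fun x => x 0 (lshift q j)).
  by apply/funext => x; rewrite mxE.
exact: Ck_coord.
Qed.

Lemma rsub_cont (p q : nat) : continuous (@rsubmx R 1 p q).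
Proof.
move=> w; apply: (@Cinf_rV_cont _ _ setT) => // j k.
have -> : (fun x : 'rV[R]_(p + q) => (rsubmx x) 0 j) = (fun x => x 0 (rshift p j)).
  by apply/funext => x; rewrite mxE.
exact: Ck_coord.
Qed.

(** In product charts the multiplication is a function of one row vector of length [n + n].
    Euclidean calculus, in particular partial derivatives in either factor and their symmetry,
    thereby applies to the group law. *)
Lemma mul_smooth c d phi g h : A c -> A d -> chart_dom c g -> chart_dom d h -> smat phi (g * h)%g ->
  exists V : set 'rV[R]_(n + n), [/\ open V, V (row_mx (c g) (d h)),
    (forall w, V w -> chart_img c (lsubmx w) /\ chart_img d (rsubmx w)) &
    Cinf V (fun w => phi (chart_inv c (lsubmx w) * chart_inv d (rsubmx w))%g)].
Proof.
move=> Ac Ad dg dh sphi.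
pose U := [set w : 'rV[R]_(n + n) | chart_img c (lsubmx w) /\ chart_img d (rsubmx w)].
pose F (w : 'rV[R]_(n + n)) := (chart_inv c (lsubmx w) * chart_inv d (rsubmx w))%g.
have oU : open U.
  have -> : U = (setT `&` (@lsubmx R 1 n n) @^-1` chart_img c) `&`
                (setT `&` (@rsubmx R 1 n n) @^-1` chart_img d).
    by apply/seteqP; split=> w /=; [move=> []|move=> [[_ ?] [_ ?]]].
  by apply: openI; apply: open_preim; do ?exact: openT; do ?exact: chart_imgo;
    move=> w _; [exact: lsub_cont|exact: rsub_cont].
have cF w : U w -> {for w, continuous F}.
  move=> [w1 w2].
  have hc : {for w, continuous (chart_inv c \o @lsubmx R 1 n n)}.
    by apply: continuous_comp; [exact: lsub_cont|exact: chart_inv_cont].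
  have hd : {for w, continuous (chart_inv d \o @rsubmx R 1 n n)}.
    by apply: continuous_comp; [exact: rsub_cont|exact: chart_inv_cont].
  have h1 : {for w, continuous (fun w => ((chart_inv c \o @lsubmx R 1 n n) w, (chart_inv d \o @rsubmx R 1 n n) w))}.
    exact: (cvg_pair hc hd).
  exact: (continuous_comp h1 (@mul_cont _)).
have UE : U = chart_img (prod_chart c d).
  apply/seteqP; split=> w.
    move=> [[x dx xE] [y dy yE]]; exists (x, y) => //=.
    by rewrite xE yE hsubmxK.
  by move=> [[x y] [/= dx dy] <-]; rewrite /U /= row_mxKl row_mxKr; split; [exists x|exists y].
have Uu : U (row_mx (c g) (d h)) by rewrite /U /= row_mxKl row_mxKr; split; [exists g|exists h].
have [||V [oV Vu VU hV]] := @smat_comp (n + n) U F phi _ oU Uu cF.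
- move=> e Ae; have [_ sm] := @lie_mul_smooth R n G.
  have Acd : prod_atlas A A (prod_chart c d) by exists c => //; exists d.
  have := sm _ _ Acd Ae; congr smooth_on.
  apply/seteqP; split=> w.
    move=> [[x y] [/= [dx dy] mxy] <-]; split; first by rewrite UE; exists (x, y).
    by rewrite /= /F row_mxKl row_mxKr !chartK.
  move=> [[[x dx xE] [y dy yE]]]; rewrite /F /= -xE -yE !chartK// => hxy.
  by exists (x, y) => //=; rewrite xE yE hsubmxK.
- by rewrite /F row_mxKl row_mxKr !chartK.
by exists V; split=> // w /VU.
Qed.

Lemma Cinf_row_l p q (x : 'rV[R]_p) j (U : set 'rV[R]_q) : Cinf U (fun y : 'rV[R]_q => (row_mx x y) 0 j).
Proof.
move=> k; case: (split_ordP j) => i ->.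
  have -> : (fun y : 'rV_q => (row_mx x y) 0 (lshift q i)) = (fun=> x 0 i).
    by apply/funext => y; rewrite row_mxEl.
  exact: Ck_cst.
have -> : (fun y : 'rV_q => (row_mx x y) 0 (rshift p i)) = (fun y => y 0 i).
  by apply/funext => y; rewrite row_mxEr.
exact: Ck_coord.
Qed.

Lemma Cinf_row_r p q (y : 'rV[R]_q) j (U : set 'rV[R]_p) : Cinf U (fun x : 'rV[R]_p => (row_mx x y) 0 j).
Proof.
move=> k; case: (split_ordP j) => i ->.
  have -> : (fun x : 'rV_p => (row_mx x y) 0 (lshift q i)) = (fun x => x 0 i).
    by apply/funext => x; rewrite row_mxEl.
  exact: Ck_coord.
have -> : (fun x : 'rV_p => (row_mx x y) 0 (rshift p i)) = (fun=> y 0 i).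
  by apply/funext => x; rewrite row_mxEr.
exact: Ck_cst.
Qed.

Lemma smooth_L g phi : smooth phi -> smooth (fun x => phi (g * x)%g).
Proof.
move=> /smoothP h; apply/smoothP => x c Ac dx; have [d Ad dg] := lie_cover g.
have [V [oV Vu VI hV]] := mul_smooth Ad Ac dg dx (h _).
have oW : open (setT `&` row_mx (d g) @^-1` V).
  apply: open_preim; [exact: openT| |exact: oV].
  by move=> y _; apply: (@Cinf_rV_cont _ _ setT) => // j; exact: Cinf_row_l.
exists (setT `&` row_mx (d g) @^-1` V); split=> //.
  by move=> v [_ /VI]; rewrite row_mxKr => -[].
have : Cinf (setT `&` row_mx (d g) @^-1` V)
   ((fun w => phi (chart_inv d (lsubmx w) * chart_inv c (rsubmx w))%g) \o row_mx (d g)).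
  by apply: (Cinf_comp oW oV) => // [v []//|j]; exact: Cinf_row_l.
by apply: Cinf_ext => // v _; rewrite /= row_mxKl row_mxKr chartK.
Qed.

Lemma smooth_R g phi : smooth phi -> smooth (fun x => phi (x * g)%g).
Proof.
move=> /smoothP h; apply/smoothP => x c Ac dx; have [d Ad dg] := lie_cover g.
have [V [oV Vu VI hV]] := mul_smooth Ac Ad dx dg (h _).
have oW : open (setT `&` (row_mx^~ (d g)) @^-1` V).
  apply: open_preim; [exact: openT| |exact: oV].
  by move=> y _; apply: (@Cinf_rV_cont _ _ setT) => // j; exact: Cinf_row_r.
exists (setT `&` (row_mx^~ (d g)) @^-1` V); split=> //.
  by move=> v [_ /VI]; rewrite row_mxKl => -[].
have : Cinf (setT `&` (row_mx^~ (d g)) @^-1` V)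
   ((fun w => phi (chart_inv c (lsubmx w) * chart_inv d (rsubmx w))%g) \o (row_mx^~ (d g))).
  by apply: (Cinf_comp oW oV) => // [v []//|j]; exact: Cinf_row_r.
by apply: Cinf_ext => // v _; rewrite /= row_mxKl row_mxKr chartK.
Qed.

(** A Euclidean bump is transported by a chart and extended by 0. The extension is smooth off the
    chart because the compact set [K] carrying it is closed, the group being Hausdorff. *)
Lemma bump_G (O : set G) x : open O -> O x -> exists W : G -> R, exists K : set G,
  [/\ smooth W, forall y, 0 <= W y <= 1, \forall y \near x, W y = 1, compact K &
      K `<=` O /\ forall y, ~ K y -> W y = 0].
Proof.
move=> oO Ox; have [c Ac dx] := lie_cover x.
have oI : open (chart_img c `&` chart_inv c @^-1` O) by exact: chart_sub_open.
have [|r r0 hr] := @open_ball_rV _ _ (c x) oI; first by split; [exists x|rewrite /= chartK].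
have [b [sb b01 b1 b0]] := bump_rV (c x) r0.
pose C := [set u : 'rV[R]_n | `|u - c x| <= r / 2].
have CI u : C u -> chart_img c u /\ O (chart_inv c u).
  move=> Cu; apply: hr; rewrite -ball_normE /= distrC; apply: le_lt_trans Cu _.
  by rewrite ltr_pdivrMr// ltr_pMr// ltr1n.
have cC : compact C.
  have -> : C = closed_ball (c x) (r / 2).
    rewrite closed_ballE ?divr_gt0//; apply/seteqP; split=> u;
    by rewrite /C /closed_ball_ /= distrC.
  apply: bounded_closed_compact; last exact: closed_ball_closed.
  rewrite closed_ballE ?divr_gt0//; exists (`|c x| + r); split; first exact: num_real.
  move=> M hM y /= hy; apply/ltW; apply: le_lt_trans hM.
  have := ler_normB (c x) (c x - y); rewrite subKr; move: hy; rewrite /closed_ball_ /=.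
  by move: `|_ - _| `|y| `|c x| => a1 a2 a3 ? ?; lra.
pose K := chart_inv c @` C.
have cK : compact K.
  apply: continuous_compact => //; apply: continuous_in_subspaceT => u; rewrite inE => /CI[Iu _].
  exact: chart_inv_cont.
have KO : K `<=` O by move=> y [u /CI[_ ?] <-].
pose W y := if pselect (chart_dom c y) then b (c y) else 0.
have W0 y : ~ K y -> W y = 0.
  rewrite /W; case: pselect => // dy nK; apply: contra_notP nK => /eqP/b0 h.
  by exists (c y) => //; rewrite chartK.
have clK : closed K by apply: compact_closed => //; exact: lie_hausdorff.
exists W, K; split=> //.
- apply/smoothP => y; have [dy|ndy] := pselect (chart_dom c y).
    apply: (@smat1 c _ _ (chart_img c)) => //; [exact: chart_imgo|by exists y|].
    apply: Cinf_ext (Cinf_sub _ sb) => //; first exact: chart_imgo.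
    by move=> u Iu; rewrite /= /W; case: pselect => //; [rewrite chart_invK|case; exact: chart_inv_dom].
  apply: (@smat_near (fun=> 0)); last exact/smooth_at/smooth_cst.
  near=> z; apply/esym/W0; near: z; apply: open_nbhs_nbhs; split; first exact: closed_openC.
  by move=> [u /CI[Iu _] uy]; apply: ndy; rewrite -uy; exact: chart_inv_dom.
- by move=> y; rewrite /W; case: pselect => dy /=; [exact: b01|rewrite lexx ler01].
- have dn : \forall y \near x, chart_dom c y by apply: open_nbhs_nbhs; split=> //; exact: chart_domo.
  have := chart_cont Ac dx b1; apply: filterS2 dn => y dy /= by1.
  by rewrite /W; case: pselect.
Unshelve. all: by end_near. Qed.
End LieSmooth.

(** * Left-invariant fields as tangent vectors *)

Section LieVec.
Context {R : realType} {n : nat} {G : lieGroupType R n}.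
Local Notation A := (@lie_atlas R n G).
Local Notation e_ i := (delta_mx 0 i).
Implicit Types (phi psi : G -> R) (X Y : operator G).
Variable c : chart R n G.
Hypothesis (Ac : A c) (dc : chart_dom c 1%g).
Local Notation p := (c 1%g).

(** Derivations act on globally smooth functions only. The cut-off [W] turns any function smooth on
    a coordinate ball into such a function without changing it near 1. *)
Lemma cut_exists : exists r (W : G -> R), [/\ 0 < r, ball p r `<=` chart_img c, smooth W, W 1%g = 1 &
  (\forall y \near (1%g : G), W y = 1) /\
  (forall h, Cinf (ball p r) h -> smooth (fun y => W y * h (c y))) /\
  forall y, W y != 0 -> chart_dom c y /\ ball p r (c y)].
Proof.
have [r r0 rI] := open_ball_rV (chart_imgo Ac) (chart_imgP dc).
have oO : open (chart_dom c `&` c @^-1` ball p r).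
  apply: open_preim; [exact: chart_domo|by move=> x; exact: chart_cont|exact: ball_open].
have [|W [K [sW W01 W1 cK [KO W0]]]] := @bump_G R n G _ 1%g oO; first by split=> //; exact: ballxx.
exists r, W; split=> //; first exact: nbhs_singleton W1.
split=> //; split=> [h hh|]; last first.
  by move=> y Wy; apply: KO; apply: contrapT => /W0; move/eqP: Wy.
apply/smoothP => y; have [Ky|nKy] := pselect (K y).
  have [dy by_] := KO _ Ky.
  apply: (@smat1 R n G c _ _ (ball p r)) => //; first exact: ball_open.
  have hW : Cinf (ball p r) (W \o chart_inv c).
    by apply: (Cinf_sub rI) => k; exact: sW.
  have oB : open (ball p r : set 'rV[R]_n) by exact: ball_open.
  apply: (@Cinf_ext _ _ _ (fun u => (W \o chart_inv c) u * h u)) => //.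
    by move=> u /rI Iu; rewrite /= chart_invK.
  by move=> k; apply: Ck_mul.
have clK : closed K by apply: compact_closed => //; exact: lie_hausdorff.
apply: (@smat_near _ _ _ (fun=> 0)); last exact/smooth_at/smooth_cst.
near=> z; rewrite W0 ?mul0r//; near: z; apply: open_nbhs_nbhs; split=> //.
exact: closed_openC.
Unshelve. all: by end_near. Qed.

(** The derivative of [phi] at 1 along the tangent vector with coordinates [a] in the chart [c]. *)
Definition tv phi (a : 'rV[R]_n) : R := \sum_(i < n) a 0 i * 'D_(e_ i) (phi \o chart_inv c) p.

Lemma tv_derivable phi i : smooth phi -> derivable (phi \o chart_inv c) p (e_ i).
Proof. by move=> s; apply: (Ck_derivable (s c 1%N Ac)); exact: chart_imgP. Qed.

Lemma tvD phi psi a : smooth phi -> smooth psi -> tv (fun x => phi x + psi x) a = tv phi a + tv psi a.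
Proof.
move=> h1 h2; rewrite /tv -big_split /=; apply: eq_bigr => i _.
rewrite -mulrDr; congr (_ * _).
by rewrite -deriveD//; exact: tv_derivable.
Qed.

Lemma tv_cst k a : tv (fun=> k) a = 0.
Proof.
rewrite /tv big1// => i _.
by rewrite (_ : _ \o _ = cst k)// derive_cst mulr0.
Qed.

Lemma tvM phi psi a : smooth phi -> smooth psi ->
  tv (fun x => phi x * psi x) a = tv phi a * psi 1%g + phi 1%g * tv psi a.
Proof.
move=> h1 h2; rewrite /tv mulr_suml mulr_sumr -big_split /=; apply: eq_bigr => i _.
have -> : (fun x => phi x * psi x) \o chart_inv c = (phi \o chart_inv c) * (psi \o chart_inv c) by [].
rewrite deriveM; [|exact: tv_derivable|exact: tv_derivable].
by rewrite /GRing.scale /= chartK//; ring.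
Qed.

Lemma tv_scale k phi a : smooth phi -> tv (fun x => k * phi x) a = k * tv phi a.
Proof. by move=> h; rewrite (tvM _ (smooth_cst k) h) tv_cst mul0r add0r. Qed.

Lemma tv_lin phi k a b : tv phi (k *: a + b) = k * tv phi a + tv phi b.
Proof.
rewrite /tv mulr_sumr -big_split /=; apply: eq_bigr => i _.
by rewrite !mxE mulrDl mulrA.
Qed.

Definition cutr := projT1 (cid cut_exists).
Definition cutW := projT1 (cid (projT2 (cid cut_exists))).
Lemma cutP : [/\ 0 < cutr, ball p cutr `<=` chart_img c, smooth cutW, cutW 1%g = 1 &
  (\forall y \near (1%g : G), cutW y = 1) /\
  (forall h, Cinf (ball p cutr) h -> smooth (fun y => cutW y * h (c y))) /\
  forall y, cutW y != 0 -> chart_dom c y /\ ball p cutr (c y)].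
Proof. exact: (projT2 (cid (projT2 (cid cut_exists)))). Qed.

(** Chart coordinates centred at 1, cut off so as to become globally smooth functions. *)
Definition xi (j : 'I_n) : G -> R := fun y => cutW y * (c y 0 j - p 0 j).

Lemma xi_smooth j : smooth (xi j).
Proof.
have [r0 rI sW W1 [Wn [h hd]]] := cutP.
have oB : open (ball p cutr : set 'rV[R]_n) by exact: ball_open.
apply: (h (fun u => u 0 j - p 0 j)).
move=> k; apply: Ck_add => //; [exact: Ck_coord|exact: Ck_cst].
Qed.

Lemma xi1 j : xi j 1%g = 0. Proof. by rewrite /xi subrr mulr0. Qed.

Lemma xi_near : \forall y \near (1%g : G), chart_dom c y /\ forall j, xi j y = c y 0 j - p 0 j.
Proof.
have [r0 rI sW W1 [Wn [h hd]]] := cutP.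
near=> y; have Wy : cutW y = 1 by near: y.
split; last by move=> j; rewrite /xi Wy mul1r.
by near: y; apply: open_nbhs_nbhs; split=> //; exact: chart_domo.
Unshelve. all: by end_near. Qed.

Lemma tv_xi j a : tv (xi j) a = a 0 j.
Proof.
have cI := chart_inv_cont Ac (chart_imgP dc).
rewrite /prop_for /continuous_at chartK// in cI.
have nxi := cI _ xi_near.
have E i : 'D_(e_ i) (xi j \o chart_inv c) p = (i == j)%:R.
  transitivity ('D_(e_ i) (fun u : 'rV[R]_n => u 0 j + - p 0 j) p).
    apply: near_eq_derive; near=> u.
    have [_ /(_ j) /= ->] : chart_dom c (chart_inv c u) /\ forall j, xi j (chart_inv c u) = c (chart_inv c u) 0 j - p 0 j.
      by near: u; exact: nxi.
    rewrite chart_invK//; near: u.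
    by apply: open_nbhs_nbhs; split; [exact: chart_imgo|exact: chart_imgP].
  have := is_deriveD (derivable_rV_coord j (is_derive_id p (e_ i))) (is_derive_cst (- p 0 j) p (e_ i)).
  by case=> _ ->; rewrite addr0 mxE eqxx /= eq_sym.
rewrite /tv (bigD1 j)//= E eqxx mulr1 big1 ?addr0// => i ij.
by rewrite E (negbTE ij) mulr0.
Unshelve. all: by end_near. Qed.

Definition vec X : 'rV[R]_n := \row_j X (xi j) 1%g.

Lemma vec_lin a X Y : vec (a *: X + Y) = a *: vec X + vec Y.
Proof. by apply/rowP => j; rewrite !mxE. Qed.

Section Derivation.
Variable X : operator G.
Hypothesis hX : vector_field X.

Lemma der_add phi psi : smooth phi -> smooth psi -> X (fun x => phi x + psi x) = X phi + X psi.
Proof.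
move=> h1 h2; have [_ _ hl _] := hX; have := hl 1 phi psi h1 h2.
by rewrite !scale1r.
Qed.

Lemma der_cst k : X (fun=> k) = 0.
Proof.
have [_ _ hl hm] := hX.
have s1 := smooth_cst (G := G) 1; have s0 := smooth_cst (G := G) 0.
have X0 : X (fun=> 0) = 0.
  have := der_add s0 s0; have -> : (fun x : G => 0 + 0 : R) = (fun=> 0) by apply/funext => x; rewrite addr0.
  by move/eqP; rewrite -subr_eq0 opprD addrA subrr add0r oppr_eq0 => /eqP.
have X1 : X (fun=> 1) = 0.
  have := hm _ _ s1 s1.
  have -> : (fun x : G => 1 : R) * (fun=> 1) = (fun=> 1) by apply/funext => x; rewrite /= mulr1.
  have -> : X (fun=> 1) * (fun=> 1) = X (fun=> 1) by apply/funext => x; rewrite fctE mulr1.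
  have -> : (fun=> 1) * X (fun=> 1) = X (fun=> 1) by apply/funext => x; rewrite fctE mul1r.
  by move/eqP; rewrite -subr_eq0 opprD addrA subrr add0r oppr_eq0 => /eqP.
have := hl k _ _ s1 s0.
have -> : k *: (fun x : G => 1 : R) + (fun=> 0) = (fun=> k)
  by apply/funext => x; rewrite !fctE /GRing.scale /= mulr1 addr0.
by move=> ->; rewrite X1 X0 scaler0 addr0.
Qed.

Lemma der_mul phi psi x : smooth phi -> smooth psi ->
  X (fun x => phi x * psi x) x = X phi x * psi x + phi x * X psi x.
Proof. by move=> h1 h2; have [_ _ _ hm] := hX; have := congr1 (fun f => f x) (hm _ _ h1 h2). Qed.

Lemma der_sum (r : seq 'I_n) (F : 'I_n -> G -> R) x : (forall i, smooth (F i)) ->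
  X (fun x => \sum_(i <- r) F i x) x = \sum_(i <- r) X (F i) x.
Proof.
move=> hF; elim: r => [|i r IH].
  have -> : (fun x => \sum_(i <- [::]) F i x) = (fun=> 0) by apply/funext => y; rewrite big_nil.
  by rewrite der_cst big_nil.
have -> : (fun x => \sum_(j <- i :: r) F j x) = (fun x => F i x + \sum_(j <- r) F j x).
  by apply/funext => y; rewrite big_cons.
rewrite der_add//; last exact: smooth_sum.
by rewrite big_cons -IH.
Qed.

(** By Hadamard's lemma [phi - phi 1] is, up to cut-offs, a sum of products of the [xi i] with
    smooth functions. The Leibniz rule at 1, where every [xi i] vanishes, leaves only the numbers
    [X (xi i) 1]. *)
Lemma der_at1 phi : smooth phi -> X phi 1%g = tv phi (vec X).
Proof.
move=> sphi; have [r0 rI sW W1 [Wn [h hd]]] := cutP.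
have hf : Cinf (ball p cutr) (phi \o chart_inv c) by apply: (Cinf_sub rI) => k; exact: sphi.
have [g [hg Hg]] := Hadamard r0 hf.
pose ga i y := cutW y * g i (c y).
have sga i : smooth (ga i) by apply: h; exact: (hg i).1.
have sW2 : smooth (fun y => cutW y * cutW y) by exact: smooth_mul.
have sphi1 : smooth (fun y => phi y + - phi 1%g) by apply: smooth_add => //; exact: smooth_cst.
(* The cut-off is squared to provide one factor for [xi i] and one for [ga i]; the identity then
   holds on the whole group. *)
have E : (fun y => (cutW y * cutW y) * (phi y + - phi 1%g)) = (fun y => \sum_(i < n) xi i y * ga i y).
  apply/funext => y; have [Wy|Wy] := eqVneq (cutW y) 0.
    rewrite Wy !mul0r big1// => i _.
    by rewrite /xi Wy !mul0r.
  have [dy by_] := hd y Wy.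
  have := Hg _ by_; rewrite /= !chartK// => ->.
  rewrite [_ + - _]addrAC subrr add0r mulr_sumr; apply: eq_bigr => i _.
  by rewrite /xi /ga; ring.
have := congr1 (fun f => X f 1%g) E; rewrite (der_mul _ sW2 sphi1) W1 mulr1 subrr mulr0 add0r mul1r.
rewrite der_add//; last exact: smooth_cst.
rewrite der_cst addr0 => ->.
rewrite der_sum; last by move=> i; apply: smooth_mul => //; exact: xi_smooth.
apply: eq_bigr => i _; rewrite (der_mul _ (xi_smooth i) (sga i)) xi1 mul0r addr0 mxE; congr (_ * _).
by rewrite /ga W1 mul1r (hg i).2.
Qed.
End Derivation.

Lemma lieE X phi g : lie_algebra X -> smooth phi -> X phi g = tv (fun x => phi (g * x)%g) (vec X).
Proof.
move=> [vX lX] sphi; rewrite -(der_at1 vX); last exact: smooth_L.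
by have := congr1 (fun f => f 1%g) (lX g phi); rewrite /= mulg1.
Qed.

Lemma lie_vec_inj X Y : lie_algebra X -> lie_algebra Y -> vec X = vec Y -> X = Y.
Proof.
move=> lX lY E; apply/funext => phi; apply/funext => g.
have [s|ns] := pselect (smooth phi); first by rewrite (lieE g lX s) (lieE g lY s) E.
by have [_ -> // _ _] := lX.1; have [_ -> // _ _] := lY.1.
Qed.

(** As a function of [g] this is a combination of partial derivatives of $(g,x) \mapsto \phi(gx)$ in
    the second variable, restricted to $x = 1$. *)
Lemma tv_smooth phi a : smooth phi -> smooth (fun g => tv (fun x => phi (g * x)%g) a).
Proof.
move=> sphi; apply: smooth_sum => i; apply: smooth_scale; apply/smoothP => g d Ad dg.
have sat : smat phi (g * 1)%g by exact: smooth_at.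
have [V [oV Vu VI hV]] := mul_smooth Ad Ac dg dc sat.
have oW : open (setT `&` (row_mx^~ p) @^-1` V).
  apply: open_preim; [exact: openT| |exact: oV].
  by move=> y _; apply: (@Cinf_rV_cont _ _ _ setT) => // j; exact: Cinf_row_r.
exists (setT `&` (row_mx^~ p) @^-1` V); split=> //.
  by move=> v [_ /VI]; rewrite row_mxKl => -[].
have : Cinf (setT `&` (row_mx^~ p) @^-1` V) ('D_(e_ (rshift n i))
   (fun w => phi (chart_inv d (lsubmx w) * chart_inv c (rsubmx w))%g) \o (row_mx^~ p)).
  apply: (Cinf_comp oW oV) => // [v []//|j|]; [exact: Cinf_row_r|exact: Cinf_D].
apply: Cinf_ext => // v [_ Vv] /=.
have dV := Cinf_derivable (i := rshift n i) hV Vv.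
have [_ <-] := is_derive_rsub dV.
by congr ('D_(e_ i) _ p); apply/funext => y; rewrite /= row_mxKl row_mxKr.
Qed.

Lemma smooth_Liff g phi : smooth (phi \o (fun x => g * x)%g) <-> smooth phi.
Proof.
split=> [h|]; last exact: smooth_L.
have := smooth_L g^-1%g h; congr smooth; apply/funext => x /=.
by rewrite mulVKg.
Qed.

(** Together with [lie_vec_inj] this identifies the Lie algebra with row vectors. The value 0 off
    smooth functions, demanded by [vector_field], is compatible with left invariance because
    translations also preserve non-smoothness ([smooth_Liff]). *)
Lemma lie_of_vec a : exists2 X, lie_algebra X & vec X = a.
Proof.
pose X : operator G := fun phi => if pselect (smooth phi) then (fun g => tv (fun x => phi (g * x)%g) a) else 0.
have XE phi : smooth phi -> X phi = fun g => tv (fun x => phi (g * x)%g) a.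
  by rewrite /X; case: pselect.
have X0 phi : ~ smooth phi -> X phi = 0 by rewrite /X; case: pselect.
exists X; last first.
  apply/rowP => j; rewrite mxE XE; last exact: xi_smooth.
  rewrite -[RHS]tv_xi; congr (tv _ a); by apply/funext => x; rewrite mul1g.
split; first split => //.
- by move=> phi s; rewrite XE//; exact: tv_smooth.
- move=> k phi psi s1 s2; rewrite !XE//; last by apply: smooth_add => //; exact: smooth_scale.
  apply/funext => g; rewrite !fctE; have s1g := smooth_L g s1; have s2g := smooth_L g s2.
  have := tvD a (smooth_scale k s1g) s2g; rewrite tv_scale//.
- move=> phi psi s1 s2; rewrite !XE//; last exact: smooth_mul.
  apply/funext => g; rewrite !fctE; have s1g := smooth_L g s1; have s2g := smooth_L g s2.
  by have := tvM a s1g s2g; rewrite mulg1.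
move=> g phi; have [s|ns] := pselect (smooth phi).
  rewrite !XE//; last exact/smooth_Liff.
  apply/funext => h /=; congr (tv _ a); by apply/funext => x /=; rewrite mulgA.
by rewrite !X0//; rewrite smooth_Liff.
Qed.
End LieVec.

(** * One-parameter subgroups *)

Section Dyadic.
Context {R : realType}.
Definition dy k : R := (2 ^+ k)^-1.
Lemma dy0 k : 0 < dy k. Proof. by rewrite invr_gt0 exprn_gt0. Qed.
Lemma dyM k : (2 ^ k)%:R * dy k = 1. Proof. by rewrite natrX mulfV// expf_neq0. Qed.
Lemma dyMM k (x y : R) : x * (2 ^ k)%:R * (dy k * y) = x * y.
Proof. by rewrite mulrA -[x * _ * dy k]mulrA dyM mulr1. Qed.
Lemma dyS k : dy k.+1 = dy k / 2. Proof. by rewrite /dy exprS invfM mulrC. Qed.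
Lemma dy_norm k n (a : 'rV[R]_n) : `|dy k *: a| = dy k * `|a|.
Proof. by rewrite normrZ gtr0_norm// dy0. Qed.
Lemma dy_le1 k : dy k <= 1.
Proof. by rewrite invf_le1 ?exprn_gt0// exprn_ege1// ler1n. Qed.

Lemma dyD k m : dy (k + m) = dy k * dy m.
Proof. by rewrite /dy exprD invfM. Qed.
Lemma dy_lt e : 0 < e -> exists k, dy k < e.
Proof.
move=> e0; exists (Num.bound e^-1).
have h : e^-1 < (Num.bound e^-1)%:R by apply: archi_boundP; rewrite invr_ge0 ltW.
rewrite /dy -[ltRHS]invrK ltf_pV2 ?posrE ?invr_gt0 ?exprn_gt0//.
by apply: lt_le_trans h _; rewrite -natrX ler_nat ltnW// ltn_expl.
Qed.
Lemma dy_lim (x y K : R) : (forall k, x <= y + K * dy k) -> x <= y.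
Proof.
move=> h; apply/ler_addgt0Pr => e e0.
have [k hk] := @dy_lt (e / (`|K| + 1)) (divr_gt0 e0 (ltr_wpDl (normr_ge0 _) ltr01)).
apply: (le_trans (h k)); rewrite lerD2l.
move: hk; rewrite ltr_pdivlMr ?ltr_wpDl// => /ltW; apply: le_trans.
rewrite mulrC ler_wpM2l ?(ltW (dy0 k))//.
by apply: (le_trans (ler_norm K)); rewrite lerDl.
Qed.
Lemma cauchy_geom n (u : nat -> 'rV[R]_n) (K : R) : 0 <= K ->
  (forall k, `|u k.+1 - u k| <= K * dy k) ->
  exists l : 'rV[R]_n, forall k, `|l - u k| <= 2 * K * dy k.
Proof.
move=> K0 h.
(* Keeping the subtracted term [2 * K * dy (k + m)] is what makes the induction on [m] close. *)
have tl k m : `|u (k + m)%N - u k| <= 2 * K * dy k - 2 * K * dy (k + m).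
  elim: m => [|m IH]; first by rewrite addn0 !subrr normr0.
  have t := ler_distD (u (k + m)%N) (u (k + m).+1) (u k).
  rewrite addnS; apply: (le_trans t); apply: (le_trans (lerD (h _) IH)).
  rewrite dyS; move: (dy k) (dy (k + m)) => a b; lra.
have tl' k m : `|u (k + m)%N - u k| <= 2 * K * dy k.
  apply: (le_trans (tl k m)); rewrite gerBl !mulr_ge0//; exact: ltW (dy0 _).
have cu : cvgn u.
  apply/cauchy_cvgP/cauchy_exP => e e0.
  have K1 : 0 < 2 * K + 1 by rewrite ltr_wpDl// mulr_ge0.
  have [k hk] := dy_lt (divr_gt0 e0 K1).
  exists (u k); exists k => // m /= km.
  rewrite /= -ball_normE /= -(subnKC km) distrC.
  apply: (le_lt_trans (tl' _ _)); move: hk; rewrite ltr_pdivlMr//; apply: le_lt_trans.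
  by rewrite mulrC ler_wpM2l ?(ltW (dy0 k))// lerDl.
exists (limn u) => k; apply/ler_addgt0Pr => e e0.
have : \forall m \near \oo, `|limn u - u m| < e by move/cvgrPdist_lt: cu; apply.
move=> [N _ hN]; have := hN (k + N)%N (leq_addl _ _).
have := tl' k N; have := ler_distD (u (k + N)%N) (limn u) (u k).
move: `|_ - _| `|_ - _| `|_ - _| => a b d *; lra.
Qed.
End Dyadic.
(* [Xi] is a chart centred at 1 with inverse [io], and [locp] holds on its
   domain.  In the chart the product is [x + y] up to [C |x| |y|], so that
   dyadic powers [io (2^-k a) ^ (2^k)] converge geometrically. *)
Section LocalGroup.
Context {R : realType} {n : nat} {G : groupType}.
Variables (Xi : G -> 'rV[R]_n) (io : 'rV[R]_n -> G) (rho C : R).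
Definition locp x := io (Xi x) = x.
Definition near1 r x := locp x /\ `|Xi x| < r.
Hypotheses (rho0 : 0 < rho) (C0 : 0 <= C) (Crho : C * rho <= 1).
Hypothesis Xi1 : Xi 1%g = 0.
Hypothesis Ha : forall x y, near1 rho x -> near1 rho y ->
  locp (x * y)%g /\ `|Xi (x * y)%g - Xi x - Xi y| <= C * `|Xi x| * `|Xi y|.
Hypothesis Hb : forall x x' y y', near1 rho x -> near1 rho x' -> near1 rho y -> near1 rho y' ->
  `|Xi (x * y)%g - Xi (x' * y')%g| <= 2 * (`|Xi x - Xi x'| + `|Xi y - Xi y'|).
Hypothesis Hc : forall x, near1 rho x -> locp x^-1%g /\ `|Xi x^-1%g + Xi x| <= C * `|Xi x| * `|Xi x|.
Hypothesis Hd : forall u, `|u| < rho -> Xi (io u) = u.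

Lemma loc1 : locp 1%g.
Proof.
have h : near1 rho (io 0) by split; rewrite /locp Hd ?normr0.
have [h1 h2] := Ha h h.
move: h2; rewrite Hd ?normr0// mulr0 !subr0 normr_le0 => /eqP h3.
move: h1; rewrite /locp h3 => h4.
rewrite /locp Xi1; have := congr1 (fun x => (io 0)^-1 * x)%g h4.
by rewrite mulVg mulKg => <-.
Qed.

Lemma near1_1 : near1 rho 1%g. Proof. by split; [exact: loc1|rewrite Xi1 normr0]. Qed.

Lemma locp_inj x y : locp x -> locp y -> Xi x = Xi y -> x = y.
Proof. by move=> lx ly E; rewrite -lx -ly E. Qed.

(** Each further factor adds at most [2 * |Xi x|]: the product is additive up to
    [C * |Xi (x ^+ M)| * |Xi x|], and [C * rho <= 1]. The condition on [2 * M * mu] keeps all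
    intermediate powers in the domain. *)
Lemma pow_small x M mu : locp x -> `|Xi x| <= mu -> 2 * M%:R * mu < rho ->
  near1 rho (x ^+ M)%g /\ `|Xi (x ^+ M)%g| <= 2 * M%:R * `|Xi x|.
Proof.
move=> lx xmu; have mu0 : 0 <= mu by exact: le_trans xmu.
elim: M => [|M IH] h.
  by rewrite expg0; split; [exact: near1_1|rewrite Xi1 normr0 mulr0 mul0r].
have h' : 2 * M%:R * mu < rho.
  by apply: le_lt_trans h; rewrite ler_wpM2r// ler_wpM2l// ler_nat.
have [nM bM] := IH h'.
have nx : near1 rho x.
  split=> //; apply: le_lt_trans xmu _; apply: le_lt_trans h.
  by rewrite ler_peMl// -natrM ler1n.
rewrite expgSr; have [lM hM] := Ha nM nx.
have K : `|Xi (x ^+ M * x)%g| <= 2 * M.+1%:R * `|Xi x|.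
  have t2 := ler_normD (Xi (x ^+ M)%g) (Xi x).
  have t3 : C * `|Xi (x ^+ M)%g| * `|Xi x| <= `|Xi x|.
    rewrite ler_piMl//; apply: le_trans Crho; apply: ler_wpM2l => //.
    by case: nM => _ /ltW.
  have E : Xi (x ^+ M * x)%g - Xi (x ^+ M)%g - Xi x + (Xi (x ^+ M)%g + Xi x) = Xi (x ^+ M * x)%g.
    by apply/rowP => l; rewrite !mxE; ring.
  have t4 := ler_normD (Xi (x ^+ M * x)%g - Xi (x ^+ M)%g - Xi x) (Xi (x ^+ M)%g + Xi x).
  rewrite E in t4; clear E.
  rewrite -[M.+1%:R]natr1; move: hM t2 t3 t4 bM.
  move: `|Xi x| `|Xi (x ^+ M)%g| `|Xi (x ^+ M * x)%g| `|_ - _| `|_ + _| => a b d e f.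
  by move=> *; lra.
split=> //; split=> //; apply: le_lt_trans K _; apply: le_lt_trans h.
by rewrite ler_wpM2l// mulr_ge0.
Qed.

Lemma pow_lin x M mu : locp x -> `|Xi x| <= mu -> 2 * M%:R * mu < rho ->
  `|Xi (x ^+ M)%g - M%:R *: Xi x| <= 2 * C * M%:R ^+ 2 * `|Xi x| ^+ 2.
Proof.
move=> lx xmu; have mu0 : 0 <= mu by exact: le_trans xmu.
elim: M => [|M IH] h.
  by rewrite expg0 Xi1 scale0r subrr normr0 expr0n /= mulr0 mul0r.
have h' : 2 * M%:R * mu < rho.
  by apply: le_lt_trans h; rewrite ler_wpM2r// ler_wpM2l// ler_nat.
have [nM bM] := pow_small lx xmu h'.
have nx : near1 rho x.
  split=> //; apply: le_lt_trans xmu _; apply: le_lt_trans h.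
  by rewrite ler_peMl// -natrM ler1n.
rewrite expgSr; have [lM hM] := Ha nM nx.
have E : Xi (x ^+ M * x)%g - M.+1%:R *: Xi x = (Xi (x ^+ M * x)%g - Xi (x ^+ M)%g - Xi x) +
   (Xi (x ^+ M)%g - M%:R *: Xi x).
  rewrite -natr1 scalerDl scale1r opprD [- _ - Xi x]addrC !addrA; congr (_ - _).
  by rewrite addrAC subrK.
rewrite E; apply: (le_trans (ler_normD _ _)).
have {}IH := IH h'; move: IH hM bM; rewrite -[M.+1%:R]natr1.
have a0 : 0 <= `|Xi x| by [].
have m0 : 0 <= M%:R :> R by [].
move: a0; move: (`|Xi (x ^+ M)%g - _|) (`|_ - Xi x|) `|Xi (x ^+ M)%g| `|Xi x| m0 => u v b a m0 a0.
move: (M%:R) m0 => m m0 h1 h2 h3.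
have h4 : C * b * a <= C * (2 * m * a) * a by rewrite ler_wpM2r// ler_wpM2l.
have h5 : 0 <= C * a ^+ 2 by rewrite mulr_ge0// sqr_ge0.
have h6 : 0 <= C * a ^+ 2 * m by rewrite mulr_ge0.
rewrite (_ : 2 * C * (m + 1) ^+ 2 * a ^+ 2 = 2 * C * m ^+ 2 * a ^+ 2 + 4 * (C * a ^+ 2 * m) + 2 * (C * a ^+ 2)); last by ring.
rewrite (_ : C * (2 * m * a) * a = 2 * (C * a ^+ 2 * m)) in h4; last by ring.
lra.
Qed.

(** Telescoping over the mixed products $x^i y^{M-i}$. Exchanging one letter uses the Lipschitz
    bound [Hb] twice, whence the constant $4 = 2 \cdot 2$. *)
Lemma pow_stab x y M mu : locp x -> locp y -> `|Xi x| <= mu -> `|Xi y| <= mu -> 2 * M%:R * mu < rho ->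
  `|Xi (x ^+ M)%g - Xi (y ^+ M)%g| <= 4 * M%:R * `|Xi x - Xi y|.
Proof.
move=> lx ly xmu ymu h; have mu0 : 0 <= mu by exact: le_trans xmu.
have small k : (k <= M)%N -> 2 * k%:R * mu < rho.
  by move=> kM; apply: le_lt_trans h; rewrite ler_wpM2r// ler_wpM2l// ler_nat.
have [->|M0] := posnP M; first by rewrite !expg0 subrr normr0 mulr_ge0.
have nn z : locp z -> `|Xi z| <= mu -> near1 rho z.
  move=> lz zmu; split=> //; apply: le_lt_trans zmu _; apply: le_lt_trans (small _ M0).
  by rewrite mulr1 ler_peMl// ler1n.
have nx := nn _ lx xmu; have ny := nn _ ly ymu.
have step i : (i < M)%N -> `|Xi (x ^+ i.+1 * y ^+ (M - i.+1))%g - Xi (x ^+ i * y ^+ (M - i))%g| <=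
    4 * `|Xi x - Xi y|.
  move=> iM; pose j := (M - i.+1)%N.
  have -> : (M - i = j.+1)%N by rewrite subnSK.
  have jM : (j.+1 <= M)%N by rewrite /j subnSK// leq_subr.
  have -> : (x ^+ i.+1 * y ^+ j = x ^+ i * (x * y ^+ j))%g by rewrite expgSr mulgA.
  rewrite (expgS y).
  have [nyj byj] := pow_small ly ymu (small _ (ltnW jM)).
  have [nxi _] := pow_small lx xmu (small _ (ltnW iM)).
  have nz z : near1 rho z -> `|Xi z| <= mu -> near1 rho (z * y ^+ j)%g.
    move=> hz zmu; have [lz bz] := Ha hz nyj; split=> //.
    have t3 : C * `|Xi z| * `|Xi (y ^+ j)%g| <= `|Xi z|.
      rewrite mulrAC ler_piMl//; apply: le_trans Crho; apply: ler_wpM2l => //.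
      by case: nyj => _ /ltW.
    have E : Xi (z * y ^+ j)%g = (Xi (z * y ^+ j)%g - Xi z - Xi (y ^+ j)%g) + (Xi z + Xi (y ^+ j)%g).
      by apply/rowP => l; rewrite !mxE; ring.
    rewrite E; apply: le_lt_trans (ler_normD _ _) _.
    have t2 := ler_normD (Xi z) (Xi (y ^+ j)%g).
    have t5 : 2 * j%:R * `|Xi y| <= 2 * j%:R * mu by rewrite ler_wpM2l// mulr_ge0.
    have := small _ jM; rewrite -[j.+1%:R]natr1 mulrDr mulrDl mulr1.
    move: bz t3 t2 byj t5 zmu; move: `|_ - Xi (y ^+ j)%g| `|_ + _| `|Xi (y ^+ j)%g| `|Xi z| (_ * `|Xi y|) (_ * mu) => a1 a2 a3 a4 a5 a6.
    by move=> *; lra.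
  have k1 := Hb nxi nxi (nz _ nx xmu) (nz _ ny ymu).
  have k2 := Hb nx ny nyj nyj.
  move: k1 k2; rewrite !subrr !normr0 add0r addr0.
  move: `|_ - _| `|_ - _| `|_ - _| => a1 a2 a3 *; lra.
have tele i : (i <= M)%N -> `|Xi (x ^+ i * y ^+ (M - i))%g - Xi (y ^+ M)%g| <= 4 * i%:R * `|Xi x - Xi y|.
  elim: i => [_|i IH iM].
    by rewrite expg0 mul1g subn0 subrr normr0 mulr0 mul0r.
  have := IH (ltnW iM); have := step _ iM.
  have := ler_distD (Xi (x ^+ i * y ^+ (M - i))%g) (Xi (x ^+ i.+1 * y ^+ (M - i.+1))%g) (Xi (y ^+ M)%g).
  rewrite -[i.+1%:R]natr1 mulrDr mulrDl mulr1.
  move: `|_ - _| `|_ - _| `|_ - _| (4 * `|_ - _|) (4 * _ * _) => a1 a2 a3 a4 a5 *; lra.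
by have := tele M (leqnn M); rewrite subnn expg0 mulg1.
Qed.

(** By [pow_stab] a power of order $2^k$ amplifies differences at most by $4 \cdot 2^k$, so two
    elements coincide once they have $2^k$-th roots at distance $o(2^{-k})$. The proofs of [ex_nat],
    [ex_opp] and [osg_unique] compare such roots. *)
Lemma uniq_lim x y : (forall e, 0 < e -> exists k x' y' mu, [/\ locp x', locp y', `|Xi x'| <= mu, `|Xi y'| <= mu &
    [/\ 2 * (2 ^ k)%:R * mu < rho, x = (x' ^+ (2 ^ k))%g, y = (y' ^+ (2 ^ k))%g & (2 ^ k)%:R * `|Xi x' - Xi y'| <= e]]) ->
  x = y.
Proof.
move=> h; have [k [x' [y' [mu [lx ly xm ym [hm xE yE _]]]]]] := h 1 ltr01.
have [[lx' _] _] := pow_small lx xm hm; have [[ly' _] _] := pow_small ly ym hm.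
apply: locp_inj; rewrite ?xE ?yE//; rewrite -xE -yE.
apply/eqP; rewrite -subr_eq0 -normr_le0; apply/ler_addgt0Pr => e e0.
have e4 : 0 < e / 4 by rewrite divr_gt0.
have [k2 [x2 [y2 [mu2 [lx2 ly2 xm2 ym2 [hm2 xE2 yE2 hk]]]]]] := h _ e4.
have := pow_stab lx2 ly2 xm2 ym2 hm2; rewrite -xE2 -yE2 -mulrA add0r.
by move=> /le_trans; apply; move: hk; lra.
Qed.

Definition qk (a : 'rV[R]_n) k := (io (dy k *: a) ^+ (2 ^ k))%g.
Lemma dy_small k (a : 'rV[R]_n) : 2 * `|a| < rho -> `|dy k *: a| < rho.
Proof.
move=> h; rewrite dy_norm; apply: le_lt_trans h.
by rewrite ler_wpM2r//; apply: le_trans (dy_le1 k) _; rewrite ler1n.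
Qed.

Lemma io_dy k (a : 'rV[R]_n) : 2 * `|a| < rho -> locp (io (dy k *: a)) /\ Xi (io (dy k *: a)) = dy k *: a.
Proof. by move=> h; have E := Hd (dy_small k h); rewrite /locp E. Qed.

Lemma qk_small a k : 2 * `|a| < rho -> near1 rho (qk a k) /\ `|Xi (qk a k)| <= 2 * `|a|.
Proof.
move=> h; have [l E] := io_dy k h.
have [||n1 n2] := @pow_small _ (2 ^ k) (dy k * `|a|) l.
- by rewrite E dy_norm.
- by rewrite dyMM.
split=> //; apply: (le_trans n2).
by rewrite E dy_norm -mulrA [X in _ * X]mulrA dyM mul1r.
Qed.

(** Both approximants are $2^k$-th powers. Their bases, the square of the point at $2^{-k-1}a$ and
    the point at $2^{-k}a$, differ by $O(4^{-k})$, and the power costs a factor of order $2^k$. *)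
Lemma qk_step a k : 4 * `|a| < rho -> `|Xi (qk a k.+1) - Xi (qk a k)| <= C * `|a| ^+ 2 * dy k.
Proof.
move=> h4; have h : 2 * `|a| < rho by apply: le_lt_trans h4; rewrite ler_wpM2r// ler_nat.
have [l E] := io_dy k h; have [l' E'] := io_dy k.+1 h.
have n' : near1 rho (io (dy k.+1 *: a)) by split=> //; rewrite E'; exact: dy_small.
have [l2 b2] := Ha n' n'.
pose z := (io (dy k.+1 *: a) * io (dy k.+1 *: a))%g.
have d0 := dy0 (R := R) k; have d1 := dy_le1 (R := R) k; have a0 : 0 <= `|a| by [].
have E2 : dy k.+1 *: a + dy k.+1 *: a = dy k *: a.
  by rewrite -scalerDl dyS; congr (_ *: _); field.
have bz : `|Xi z - dy k *: a| <= C * (dy k / 2 * `|a|) ^+ 2.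
  rewrite -E2 opprD addrA; rewrite E' in b2; apply: (le_trans b2).
  by rewrite dy_norm dyS -mulrA -expr2.
have Ca : C * `|a| <= 1.
  apply: le_trans Crho; rewrite ler_wpM2l//; apply/ltW; apply: le_lt_trans h.
  by rewrite ler_peMl// ler1n.
have bz2 : C * (dy k / 2 * `|a|) ^+ 2 <= dy k * `|a|.
  rewrite (_ : C * _ = (C * `|a|) * (dy k * (dy k * `|a|) / 4)); last by field.
  apply: (@le_trans _ _ (dy k * (dy k * `|a|) / 4)).
    by rewrite ler_piMl// divr_ge0// !mulr_ge0// ltW.
  have d2 : 0 <= dy k * `|a| by rewrite mulr_ge0// ltW.
  rewrite ler_pdivrMr// [leRHS]mulrC; apply: ler_pM => //; [exact: ltW|].
  by apply: le_trans d1 _; rewrite ler1n.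
have zs : `|Xi z| <= dy k * `|a| * 2.
  have := ler_normD (Xi z - dy k *: a) (dy k *: a); rewrite subrK dy_norm.
  move: bz bz2; move: `|Xi z| `|_ - _| (C * _) (dy k * `|a|) => b1 b2' b3 b4 *; lra.
have -> : qk a k.+1 = (z ^+ (2 ^ k))%g.
  by rewrite /qk /z -expg2 -expgnA expnS.
have hz : `|Xi (z ^+ (2 ^ k))%g - Xi (qk a k)| <= 4 * (2 ^ k)%:R * `|Xi z - Xi (io (dy k *: a))|.
  apply: (@pow_stab _ _ _ (dy k * `|a| * 2) l2 l zs).
    by rewrite E dy_norm ler_peMr ?ler1n// mulr_ge0// ltW.
  rewrite -[dy k * _ * 2]mulrA dyMM.
  by rewrite (_ : 2 * (`|a| * 2) = 4 * `|a|)//; ring.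
rewrite E in hz; apply: (le_trans hz).
have p0 : 0 <= 4 * (2 ^ k)%:R :> R by rewrite mulr_ge0.
apply: (le_trans (ler_wpM2l p0 bz)).
have -> : C * (dy k / 2 * `|a|) ^+ 2 = dy k * (C * `|a| ^+ 2 * dy k / 4) by field.
rewrite dyMM [leLHS]mulrC divfK//.
Qed.

Lemma le4 (a b : 'rV[R]_n) : `|b| <= `|a| -> 4 * `|a| < rho -> 4 * `|b| < rho.
Proof. by move=> ba; apply: le_lt_trans; rewrite ler_wpM2l. Qed.

Lemma le42 (a : 'rV[R]_n) : 4 * `|a| < rho -> 2 * `|a| < rho.
Proof. by apply: le_lt_trans; rewrite ler_wpM2r// ler_nat. Qed.

(** The bound on [a] sits under the existential so that the limit can be chosen as a total function
    of [a]. *)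
Lemma exL_ex a : exists l, 4 * `|a| < rho -> forall k, `|l - Xi (qk a k)| <= 2 * (C * `|a| ^+ 2) * dy k.
Proof.
have [h|h] := ltP (4 * `|a|) rho; last by exists 0.
have K0 : 0 <= C * `|a| ^+ 2 by rewrite mulr_ge0// sqr_ge0.
have [l hl] := @cauchy_geom R n (fun k => Xi (qk a k)) _ K0 (fun k => qk_step k h).
by exists l.
Qed.

Definition exL a := projT1 (cid (exL_ex a)).
Definition ex a := io (exL a).

Lemma exLP a k : 4 * `|a| < rho -> `|exL a - Xi (qk a k)| <= 2 * (C * `|a| ^+ 2) * dy k.
Proof. by move=> h; exact: (projT2 (cid (exL_ex a)) h). Qed.

Lemma exL_lin a : 4 * `|a| < rho -> `|exL a - a| <= 2 * (C * `|a| ^+ 2).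
Proof.
move=> h; have := exLP 0 h; have [_ E] := io_dy 0 (le42 h).
have d0 : dy 0 = 1 :> R by rewrite /dy expr0 invr1.
by rewrite /qk expn0 expg1 E d0 mulr1 scale1r.
Qed.

Lemma exL_small a : 4 * `|a| < rho -> `|exL a| <= 2 * `|a|.
Proof.
move=> h; apply: (@dy_lim _ _ _ (2 * (C * `|a| ^+ 2))) => k.
have := exLP k h; have [_ h2] := qk_small k (le42 h).
have := ler_normD (exL a - Xi (qk a k)) (Xi (qk a k)); rewrite subrK.
by move: h2; move: `|exL a| `|_ - _| `|Xi _| (2 * `|a|) => *; lra.
Qed.

Lemma exP a : 4 * `|a| < rho -> locp (ex a) /\ Xi (ex a) = exL a.
Proof.
move=> h; have E : Xi (ex a) = exL a by apply: Hd; apply: le_lt_trans (exL_small h) (le42 h).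
by split=> //; rewrite /locp E.
Qed.

Lemma ex_near a : 4 * `|a| < rho -> near1 rho (ex a).
Proof.
move=> h; have [l E] := exP h; split=> //; rewrite E.
exact: le_lt_trans (exL_small h) (le42 h).
Qed.

Lemma ex0 : ex 0 = 1%g.
Proof.
have h : 4 * `|0 : 'rV[R]_n| < rho by rewrite normr0 mulr0.
have [l E] := exP h; apply: locp_inj => //; first exact: loc1.
rewrite E Xi1; apply/eqP; rewrite -normr_le0.
by have := exL_small h; rewrite normr0 mulr0.
Qed.

Lemma exLip a b : 4 * `|a| < rho -> 4 * `|b| < rho -> `|exL a - exL b| <= 4 * `|a - b|.
Proof.
move=> ha hb; apply: (@dy_lim _ _ _ (2 * (C * `|a| ^+ 2) + 2 * (C * `|b| ^+ 2))) => k.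
have [la Ea] := io_dy k (le42 ha); have [lb Eb] := io_dy k (le42 hb).
pose mu := dy k * Num.max `|a| `|b|.
have st := @pow_stab _ _ (2 ^ k) mu la lb.
have d0 := dy0 (R := R) k.
have := st _ _ _; rewrite Ea Eb !dy_norm -scalerBr normrZ gtr0_norm//.
have -> : 4 * (2 ^ k)%:R * (dy k * `|a - b|) = 4 * `|a - b|.
  by rewrite mulrA -[4 * _ * dy k]mulrA dyM mulr1.
rewrite /mu !ler_pM2l// !le_max !lexx orbT => /(_ isT isT).
rewrite (_ : 2 * (2 ^ k)%:R * (dy k * Num.max `|a| `|b|) = 2 * Num.max `|a| `|b|); last first.
  by rewrite mulrA -[2 * _ * dy k]mulrA dyM mulr1.
have -> : 2 * Num.max `|a| `|b| < rho by rewrite maxr_pMr// gt_max !le42.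
move=> /(_ isT).
have := exLP k ha; have := exLP k hb.
have := ler_distD (Xi (qk a k)) (exL a) (exL b).
have := ler_distD (Xi (qk b k)) (Xi (qk a k)) (exL b).
rewrite [`|Xi (qk b k) - exL b|]distrC -/(qk a k) -/(qk b k).
move: (2 * (C * `|a| ^+ 2)) (2 * (C * `|b| ^+ 2)) (dy k) => c1 c2 d.
rewrite (_ : (c1 + c2) * d = c1 * d + c2 * d); last by rewrite mulrDl.
move: (c1 * d) (c2 * d) `|exL a - exL b| `|exL a - _| `|exL b - _| `|_ - exL b| `|_ - _| => *; lra.
Qed.

Lemma ex_sq a : 4 * `|a| < rho -> ex a = (ex (2^-1 *: a) ^+ 2)%g.
Proof.
move=> h; have h2 : 4 * `|2^-1 *: a| < rho.
  by apply: le4 h; rewrite normrZ ger0_norm// ler_piMl// invf_le1// ler1n.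
have [l E] := exP h; have [l2 E2] := exP h2; have n2 := ex_near h2.
have [l3 _] := Ha n2 n2.
apply: locp_inj => //; rewrite expg2 E; apply/eqP; rewrite -subr_eq0 -normr_le0.
apply: (@dy_lim _ _ _ (2 * (C * `|a| ^+ 2) + 8 * (C * `|2^-1 *: a| ^+ 2))) => k.
have qE : qk a k.+1 = (qk (2^-1 *: a) k * qk (2^-1 *: a) k)%g.
  by rewrite /qk -expg2 -expgnA -expnSr scalerA -dyS.
have nq := (qk_small k (le42 h2)).1.
have := Hb nq n2 nq n2; rewrite -qE.
have := exLP k.+1 h; have := exLP k h2; rewrite E2 [`|Xi (qk (2^-1 *: a) k) - _|]distrC.
have := ler_distD (Xi (qk a k.+1)) (exL a) (Xi (ex (2^-1 *: a) * ex (2^-1 *: a))%g).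
have d0 := dy0 (R := R) k.
have : 2 * (C * `|a| ^+ 2) * dy k.+1 <= 2 * (C * `|a| ^+ 2) * dy k.
  by rewrite ler_wpM2l ?mulr_ge0 ?sqr_ge0// dyS ler_pdivrMr// ler_peMr ?ler1n// ltW.
rewrite [(_ + _) * dy k]mulrDl.
move: (2 * (C * `|a| ^+ 2) * dy k) (2 * (C * `|a| ^+ 2) * dy k.+1) => c1 c2.
rewrite (_ : 8 * (C * `|2^-1 *: a| ^+ 2) * dy k = 4 * (2 * (C * `|2^-1 *: a| ^+ 2) * dy k)); last by ring.
move: (2 * (C * `|2^-1 *: a| ^+ 2) * dy k) => c3.
move: `|exL a - Xi (qk a k.+1)| `|exL a - _| `|exL _ - _| `|_ - _| => *; lra.
Qed.

Lemma ex_pow a k : 4 * `|a| < rho -> ex a = (ex (dy k *: a) ^+ (2 ^ k))%g.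
Proof.
move=> h; elim: k => [|k IH]; first by rewrite /dy expr0 invr1 scale1r expn0 expg1.
rewrite IH expnS expgnA; congr (_ ^+ _)%g.
rewrite dyS [dy k / 2]mulrC -scalerA; apply: ex_sq.
by apply: le4 h; rewrite dy_norm ler_piMl// dy_le1.
Qed.

(** Compared on $2^k$-th roots: in the chart both [ex (dy k *: (j%:R *: b))] and the [j]-th power of
    [ex (dy k *: b)] equal $2^{-k} j b$ up to $O(4^{-k})$, by [exL_lin] and [pow_lin]. *)
Lemma ex_nat j b : 16 * j%:R * `|b| < rho -> ex (j%:R *: b) = (ex b ^+ j)%g.
Proof.
have [->|j0] := posnP j; first by rewrite scale0r ex0 expg0.
move=> h; have j1 : 1 <= j%:R :> R by rewrite ler1n.
have hj : 16 * (j%:R * `|b|) < rho by rewrite mulrA.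
have b0 : 0 <= `|b| by [].
have bj : `|b| <= j%:R * `|b| by rewrite ler_peMl.
have nj : `|j%:R *: b| = j%:R * `|b| by rewrite normrZ normr_nat.
have hb4 : 4 * `|b| < rho by move: bj hj; move: `|b| (_ * `|b|) b0 => *; lra.
have hjb4 : 4 * `|j%:R *: b| < rho.
  by rewrite nj; move: bj hj; move: `|b| (_ * `|b|) b0 => *; lra.
apply: uniq_lim => e e0.
(* Here 12 = 2 + 2 + 8: two quadratic errors from [exL_lin], and one from [pow_lin] at an argument
   bounded by [2 * (dy k * |b|)]. *)
pose K := 12 * (C * (j%:R * `|b|) ^+ 2).
have K1 : 0 < K + 1 by rewrite ltr_wpDl// !mulr_ge0// sqr_ge0.
have [k hk] := dy_lt (divr_gt0 e0 K1); have d0 := dy0 (R := R) k; have d1 := dy_le1 (R := R) k.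
have db : `|dy k *: b| = dy k * `|b| by rewrite dy_norm.
have dbb : dy k * `|b| <= `|b| by rewrite ler_piMl.
have dbj : `|dy k *: (j%:R *: b)| = dy k * (j%:R * `|b|) by rewrite dy_norm nj.
have hdb4 : 4 * `|dy k *: b| < rho by apply: le4 hb4; rewrite db.
have hdj4 : 4 * `|dy k *: (j%:R *: b)| < rho.
  by apply: le4 hjb4; rewrite dy_norm ler_piMl.
have [l1 E1] := exP hdj4; have [l2 E2] := exP hdb4.
pose y := (ex (dy k *: b) ^+ j)%g.
have sb : `|Xi (ex (dy k *: b))| <= 2 * (dy k * `|b|) by rewrite E2 -db; exact: exL_small.
have hy : 2 * j%:R * (2 * (dy k * `|b|)) < rho.
  rewrite (_ : _ * _ = dy k * (4 * (j%:R * `|b|))); last by ring.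
  have j2 : 0 <= 4 * (j%:R * `|b|) by rewrite !mulr_ge0.
  have : dy k * (4 * (j%:R * `|b|)) <= 4 * (j%:R * `|b|) by rewrite ler_piMl.
  by move: hj; move: (j%:R * `|b|) (dy k * _) => *; lra.
have [[ly _] by_] := pow_small l2 sb hy; have ylin := pow_lin l2 sb hy.
exists k, (ex (dy k *: (j%:R *: b))), y, (4 * (dy k * (j%:R * `|b|))); split=> //.
- rewrite E1; apply: (le_trans (exL_small hdj4)); rewrite dbj ler_wpM2r ?ler_nat//.
  by rewrite !mulr_ge0// ltW.
- apply: (le_trans by_); apply: (le_trans (ler_wpM2l _ sb)); first by rewrite mulr_ge0.
  by rewrite le_eqVlt; apply/orP; left; apply/eqP; ring.
split.
- rewrite [4 * (dy k * _)]mulrCA dyMM; apply: le_lt_trans hj.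
  have : 0 <= j%:R * `|b| by rewrite mulr_ge0.
  by move: (_ * `|b|) => x; lra.
- exact: ex_pow.
- by rewrite /y (ex_pow k hb4) expgnAC.
have t1 := exL_lin hdj4; have t2 := exL_lin hdb4; rewrite -E1 in t1; rewrite -E2 in t2.
pose z := ex (dy k *: b); rewrite -/z -/y in t2 ylin sb *.
have tri : `|Xi (ex (dy k *: (j%:R *: b))) - Xi y| <= `|Xi (ex (dy k *: (j%:R *: b))) - dy k *: (j%:R *: b)| +
   (j%:R * `|Xi z - dy k *: b| + `|Xi y - j%:R *: Xi z|).
  have -> : j%:R * `|Xi z - dy k *: b| = `|j%:R *: (Xi z - dy k *: b)| by rewrite normrZ normr_nat.
  have -> : Xi (ex (dy k *: (j%:R *: b))) - Xi y = (Xi (ex (dy k *: (j%:R *: b))) - dy k *: (j%:R *: b)) -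
     (j%:R *: (Xi z - dy k *: b) + (Xi y - j%:R *: Xi z)).
    by apply/rowP => i; rewrite !mxE; ring.
  apply: (le_trans (ler_normB _ _)); rewrite lerD2l; exact: ler_normD.
have y2 : `|Xi y - j%:R *: Xi z| <= 2 * C * j%:R ^+ 2 * (2 * (dy k * `|b|)) ^+ 2.
  apply: (le_trans ylin); rewrite ler_wpM2l ?mulr_ge0 ?sqr_ge0//.
  by rewrite lerXn2r ?nnegrE// !mulr_ge0// ltW.
have z2 : j%:R * `|Xi z - dy k *: b| <= 2 * (C * (dy k * (j%:R * `|b|)) ^+ 2).
  apply: (le_trans (ler_wpM2l (ler0n R j) t2)); rewrite db.
  rewrite (_ : 2 * (C * (dy k * (j%:R * `|b|)) ^+ 2) = j%:R * (j%:R * (2 * (C * (dy k * `|b|) ^+ 2)))); last by ring.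
  rewrite ler_wpM2l// ler_peMl//.
  by apply: mulr_ge0 => //; apply: mulr_ge0 => //; exact: sqr_ge0.
rewrite dbj in t1.
have fin : `|Xi (ex (dy k *: (j%:R *: b))) - Xi y| <= K * (dy k * dy k).
  apply: (le_trans tri); apply: (@le_trans _ _ (2 * (C * (dy k * (j%:R * `|b|)) ^+ 2) +
    (2 * (C * (dy k * (j%:R * `|b|)) ^+ 2) + 2 * C * j%:R ^+ 2 * (2 * (dy k * `|b|)) ^+ 2))).
    by apply: lerD => //; exact: lerD.
  by rewrite le_eqVlt; apply/orP; left; apply/eqP; rewrite /K; ring.
apply: (le_trans (ler_wpM2l (ler0n R _) fin)).
rewrite [K * (_ * _)]mulrCA -[(2 ^ k)%:R]mul1r dyMM mul1r; move: hk; rewrite ltr_pdivlMr// mulrC => /ltW; apply: le_trans.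
by rewrite mulrDl lerDl mul1r ltW.
Qed.

Lemma ex_opp b : 16 * `|b| < rho -> ex (- b) = (ex b)^-1%g.
Proof.
move=> h; have b0 : 0 <= `|b| by [].
have hb4 : 4 * `|b| < rho by move: h b0; move: `|b| => *; lra.
have hnb4 : 4 * `|- b| < rho by rewrite normrN.
apply: uniq_lim => e e0.
pose K := 8 * (C * `|b| ^+ 2).
have K1 : 0 < K + 1 by rewrite ltr_wpDl// !mulr_ge0// sqr_ge0.
have [k hk] := dy_lt (divr_gt0 e0 K1); have d0 := dy0 (R := R) k; have d1 := dy_le1 (R := R) k.
have db : `|dy k *: b| = dy k * `|b| by rewrite dy_norm.
have hdb4 : 4 * `|dy k *: b| < rho by apply: le4 hb4; rewrite db ler_piMl.
have hdn4 : 4 * `|dy k *: - b| < rho by rewrite scalerN normrN.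
have [l1 E1] := exP hdn4; have [l2 E2] := exP hdb4; have n2 := ex_near hdb4.
have [ly yb] := Hc n2.
have sb : `|Xi (ex (dy k *: b))| <= 2 * (dy k * `|b|) by rewrite E2 -db; exact: exL_small.
pose z := ex (dy k *: b); rewrite -/z in yb sb ly n2 *.
have dB : 0 <= dy k * `|b| by rewrite mulr_ge0// ltW.
have yb2 : `|Xi z^-1%g + Xi z| <= `|Xi z|.
  apply: (le_trans yb); rewrite ler_piMl//; apply: le_trans Crho; rewrite ler_wpM2l// ltW//.
  by case: n2.
exists k, (ex (dy k *: - b)), z^-1%g, (6 * (dy k * `|b|)); split=> //.
- rewrite E1; apply: (le_trans (exL_small hdn4)); rewrite scalerN normrN db.
  by rewrite ler_wpM2r// ler_nat.
- have := ler_normB (Xi z^-1%g + Xi z) (Xi z); rewrite addrK.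
  by move: yb2 sb dB; move: `|Xi z^-1%g| `|_ + _| `|Xi z| (dy k * `|b|) => *; lra.
split.
- rewrite [6 * (dy k * _)]mulrCA dyMM; apply: le_lt_trans h.
  by rewrite mulrA ler_wpM2r// -natrM ler_nat.
- exact: ex_pow.
- by rewrite expVgn /z -(ex_pow k hb4).
have t1 := exL_lin hdn4; have t2 := exL_lin hdb4; rewrite -E1 scalerN normrN opprK db in t1.
rewrite -E2 -/z db in t2.
have fin : `|Xi (ex (dy k *: - b)) - Xi z^-1%g| <= K * (dy k * dy k).
  have -> : Xi (ex (dy k *: - b)) - Xi z^-1%g = (Xi (ex (- (dy k *: b))) + dy k *: b) + (Xi z - dy k *: b)
     - (Xi z^-1%g + Xi z).
    by rewrite scalerN; apply/rowP => i; rewrite !mxE; ring.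
  have y2 : `|Xi z^-1%g + Xi z| <= C * (2 * (dy k * `|b|)) ^+ 2.
    apply: (le_trans yb); rewrite -mulrA -expr2 ler_wpM2l//.
    by rewrite lerXn2r ?nnegrE// mulr_ge0.
  apply: (le_trans (ler_normB _ _)); apply: (le_trans (lerD (ler_normD _ _) y2)).
  apply: (@le_trans _ _ (2 * (C * (dy k * `|b|) ^+ 2) + 2 * (C * (dy k * `|b|) ^+ 2) + C * (2 * (dy k * `|b|)) ^+ 2)).
    by rewrite lerD2r; exact: lerD.
  by rewrite le_eqVlt; apply/orP; left; apply/eqP; rewrite /K; ring.
apply: (le_trans (ler_wpM2l (ler0n R _) fin)).
rewrite [K * (_ * _)]mulrCA -[(2 ^ k)%:R]mul1r dyMM mul1r; move: hk; rewrite ltr_pdivlMr// mulrC => /ltW; apply: le_trans.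
by rewrite mulrDl lerDl mul1r ltW.
Qed.

(** Truncating [s] and [t] to the multiples [i * dy k] and [j * dy k] reduces the claim to natural
    multiples of one vector ([ex_nat]); the truncation errors are at most [dy k] and pass through
    the Lipschitz bounds [Hb] and [exLip]. *)
Lemma ex_add a s t : 0 <= s -> 0 <= t -> 16 * (s + t) * `|a| < rho ->
  (ex (s *: a) * ex (t *: a))%g = ex ((s + t) *: a).
Proof.
move=> s0 t0 h; have a0 : 0 <= `|a| by [].
have le4' u : 0 <= u -> u <= s + t -> 4 * `|u *: a| < rho.
  move=> u0 us; apply: le_lt_trans h; rewrite normrZ ger0_norm// mulrA ler_wpM2r//.
  by apply: ler_pM => //; rewrite ler_nat.
have hs : 4 * `|s *: a| < rho by apply: le4' => //; rewrite lerDl.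
have ht : 4 * `|t *: a| < rho by apply: le4' => //; rewrite lerDr.
have hst : 4 * `|(s + t) *: a| < rho by apply: le4' => //; rewrite addr_ge0.
have [ls Es] := exP hs; have [lt Et] := exP ht; have [lst Est] := exP hst.
have ns := ex_near hs; have nt := ex_near ht.
have [lm _] := Ha ns nt.
apply: locp_inj => //; apply/eqP; rewrite -subr_eq0 -normr_le0.
(* Any constant would do; the estimate ends with 24 = 2 (4 + 4) + 4 times 2. *)
apply: (@dy_lim _ _ _ (40 * `|a|)) => k; rewrite add0r.
have d0 := dy0 (R := R) k.
have dyi : (2 ^ k)%:R * dy k = 1 :> R by exact: dyM.
pose i := Num.truncn (s * 2 ^+ k); pose j := Num.truncn (t * 2 ^+ k).
have tr (u : R) : 0 <= u -> (Num.truncn (u * 2 ^+ k))%:R * dy k <= u /\ u - dy k <= (Num.truncn (u * 2 ^+ k))%:R * dy k.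
  move=> u0; have p0 : 0 < 2 ^+ k :> R by rewrite exprn_gt0.
  have /andP[h1 h2] := @truncn_itv R (u * 2 ^+ k) (mulr_ge0 u0 (ltW p0)).
  rewrite /dy; split; first by rewrite ler_pdivrMr.
  rewrite lerBlDr -[X in _ + X]mul1r -mulrDl ler_pdivlMr//.
  by rewrite natr1 ltW.
have [i1 i2] := tr s s0; have [j1 j2] := tr t t0; rewrite -/i -/j in i1 i2 j1 j2.
have i0 : 0 <= i%:R * dy k := mulr_ge0 (ler0n R i) (ltW d0).
have j0 : 0 <= j%:R * dy k := mulr_ge0 (ler0n R j) (ltW d0).
pose b := dy k *: a.
have bn (l : nat) : l%:R *: b = (l%:R * dy k) *: a by rewrite /b scalerA.
have key (l : nat) : l%:R * dy k <= s + t -> ex (l%:R *: b) = (ex b ^+ l)%g.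
  move=> hl; apply: ex_nat; apply: le_lt_trans h; rewrite /b dy_norm.
  by rewrite -mulrA [X in _ * X]mulrA -[leRHS]mulrA ler_wpM2l// ler_wpM2r.
have his : i%:R * dy k <= s + t by apply: le_trans i1 _; rewrite lerDl.
have hjt : j%:R * dy k <= s + t by apply: le_trans j1 _; rewrite lerDr.
have hij : (i + j)%:R * dy k <= s + t by rewrite natrD mulrDl lerD.
have E : (ex (i%:R *: b) * ex (j%:R *: b))%g = ex ((i + j)%:R *: b).
  by rewrite !key// -expgnDr.
rewrite !bn in E.
have h1 := le4' _ i0 his; have h2 := le4' _ j0 hjt.
have h3 : 4 * `|((i + j)%:R * dy k) *: a| < rho.
  by apply: le4' => //; rewrite mulr_ge0// ltW.
have B := Hb ns (ex_near h1) nt (ex_near h2); rewrite E in B.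
have [_ E1] := exP h1; have [_ E2] := exP h2; have [_ E3] := exP h3.
rewrite E1 E2 E3 Es Et in B.
have nrm (u v : R) : v - dy k <= u -> u <= v -> `|v *: a - u *: a| <= dy k * `|a|.
  by move=> uv vu; rewrite -scalerBl normrZ ler_wpM2r// ger0_norm ?subr_ge0// lerBlDr addrC -lerBlDr.
have nrm2 (u v : R) : v - 2 * dy k <= u -> u <= v -> `|u *: a - v *: a| <= 2 * (dy k * `|a|).
  by move=> uv vu; rewrite -scalerBl normrZ mulrA ler_wpM2r// ler0_norm ?subr_le0// opprB lerBlDr addrC -lerBlDr.
have L1 := exLip hs h1; have L2 := exLip ht h2; have L3 := exLip h3 hst.
have N1 := nrm _ _ i2 i1; have N2 := nrm _ _ j2 j1.
have N3 : `|((i + j)%:R * dy k) *: a - (s + t) *: a| <= 2 * (dy k * `|a|).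
  apply: nrm2 => //; rewrite natrD [(i%:R + _) * _]mulrDl; apply: le_trans (lerD i2 j2).
  by rewrite le_eqVlt; apply/orP; left; apply/eqP; ring.
have n4 : 0 <= 4 :> R by [].
have M1 := le_trans L1 (ler_wpM2l n4 N1); have M2 := le_trans L2 (ler_wpM2l n4 N2).
have M3 := le_trans L3 (ler_wpM2l n4 N3).
rewrite Est; apply: (le_trans (ler_distD (exL (((i + j)%:R * dy k) *: a)) _ _)).
apply: (le_trans (lerD (le_trans B (ler_wpM2l (ler0n R 2) (lerD M1 M2))) M3)).
rewrite -[40 * _ * _]mulrA [`|a| * dy k]mulrC; move: (mulr_ge0 (ltW d0) a0).
move: (dy k * `|a|) => d dge; rewrite [leLHS](_ : _ = 24 * d); last by ring.
by rewrite ler_wpM2r// ler_nat.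
Qed.

Lemma gK (b : 'rV[R]_n) : exists k, 16 * `|dy k *: b| < rho.
Proof.
have p : 0 < 16 * `|b| + 1 by rewrite ltr_wpDl// mulr_ge0.
have [k hk] := dy_lt (divr_gt0 rho0 p); exists k; rewrite dy_norm.
move: hk; rewrite ltr_pdivlMr// mulrDr mulr1 mulrCA; apply: le_lt_trans.
by rewrite lerDl ltW// dy0.
Qed.

(** The exponential beyond the small ball: scale down into it, then raise to the power $2^k$. By
    [gEE] every admissible [k] gives the same value. *)
Definition gE b := let k := projT1 (cid (gK b)) in (ex (dy k *: b) ^+ (2 ^ k))%g.

Lemma le16 (b : 'rV[R]_n) : 16 * `|b| < rho -> 4 * `|b| < rho.
Proof. by apply: le_lt_trans; rewrite ler_wpM2r// ler_nat. Qed.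

Lemma gEE b k : 4 * `|dy k *: b| < rho -> gE b = (ex (dy k *: b) ^+ (2 ^ k))%g.
Proof.
rewrite /gE; case: cid => l /= /le16 hl hk.
have mono i m : 4 * `|dy i *: b| < rho -> (ex (dy (i + m) *: b) ^+ (2 ^ (i + m)) = ex (dy i *: b) ^+ (2 ^ i))%g.
  move=> h; rewrite (ex_pow m h) scalerA mulrC -dyD expnD mulnC expgnA.
  by rewrite -!expgnA.
by rewrite -(mono l k hl) -(mono k l hk) addnC.
Qed.

Lemma gE_ex b : 4 * `|b| < rho -> gE b = ex b.
Proof.
have d0 : dy 0 = 1 :> R by rewrite /dy expr0 invr1.
by move=> h; rewrite (@gEE b 0) d0 scale1r// expn0 expg1.
Qed.

Lemma gE_opp b : gE (- b) = (gE b)^-1%g.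
Proof.
have [k hk] := gK b; have h4 := le16 hk.
by rewrite (gEE h4) (@gEE (- b) k) scalerN ?normrN// ex_opp// expVgn.
Qed.

Lemma gE_add a s t : 0 <= s -> 0 <= t -> gE ((s + t) *: a) = (gE (s *: a) * gE (t *: a))%g.
Proof.
move=> s0 t0; have [k hk] := gK ((s + t) *: a).
have st0 : 0 <= s + t by rewrite addr_ge0.
have le u : 0 <= u -> u <= s + t -> 4 * `|dy k *: (u *: a)| < rho.
  move=> u0 us; apply: le16; apply: le_lt_trans hk; rewrite ler_wpM2l// !dy_norm.
  rewrite ler_wpM2l ?(ltW (dy0 _))// !normrZ ler_wpM2r// !ger0_norm//.
have h1 : 4 * `|dy k *: (s *: a)| < rho by apply: le => //; rewrite lerDl.
have h2 : 4 * `|dy k *: (t *: a)| < rho by apply: le => //; rewrite lerDr.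
have h3 : 4 * `|dy k *: ((s + t) *: a)| < rho by apply: le.
rewrite (gEE h1) (gEE h2) (gEE h3).
have sw u : dy k *: (u *: a) = u *: (dy k *: a) by rewrite !scalerA mulrC.
rewrite !sw.
have hh : 16 * (s + t) * `|dy k *: a| < rho.
  by move: hk; rewrite sw normrZ ger0_norm// mulrA.
have cm : commute (ex (s *: (dy k *: a))) (ex (t *: (dy k *: a))).
  by rewrite /commute ex_add// ex_add// 1?addrC// addrC.
by rewrite -expgMn// ex_add.
Qed.

Lemma gE_hom a s t : gE ((s + t) *: a) = (gE (s *: a) * gE (t *: a))%g.
Proof.
pose g u := gE (u *: a).
have gN u : g (- u) = (g u)^-1%g by rewrite /g scaleNr gE_opp.
have gD u v : 0 <= u -> 0 <= v -> g (u + v) = (g u * g v)%g by exact: gE_add.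
rewrite -[gE _]/(g (s + t)) -[gE (s *: a)]/(g s) -[gE (t *: a)]/(g t).
have [s0|s0] := leP 0 s; have [t0|t0] := leP 0 t; first exact: gD.
- have [st|st] := leP 0 (s + t).
    have := gD (s + t) (- t) st _; rewrite oppr_ge0 ltW// addrK => /(_ isT) ->.
    by rewrite gN mulgVK.
  have := gD (- (s + t)) s _ s0; rewrite oppr_ge0 ltW// => /(_ isT).
  rewrite (_ : - (s + t) + s = - t); last by ring.
  by rewrite !gN => /(congr1 (fun x => x^-1)%g); rewrite invgM !invgK => ->; rewrite mulVKg.
- have [st|st] := leP 0 (s + t).
    have := gD (- s) (s + t) _ st; rewrite oppr_ge0 ltW// => /(_ isT).
    rewrite (_ : - s + (s + t) = t); last by ring.
    by rewrite gN => ->; rewrite mulVKg.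
  have := gD t (- (s + t)) t0 _; rewrite oppr_ge0 ltW// => /(_ isT).
  rewrite (_ : t + - (s + t) = - s); last by ring.
  by rewrite !gN => /(congr1 (fun x => x^-1)%g); rewrite invgM !invgK => ->; rewrite mulgVK.
have [s1 t1] : 0 <= - s /\ 0 <= - t by rewrite !oppr_ge0 !ltW.
have := gD _ _ t1 s1; rewrite -opprD !gN => /(congr1 (fun x => x^-1)%g).
by rewrite invgM !invgK [t + s]addrC.
Qed.

Definition is_osg (gam : R -> G) := forall s t, gam (s + t) = (gam s * gam t)%g.

Lemma osg0 gam : is_osg gam -> gam 0 = 1%g.
Proof. by move=> h; have := h 0 0; rewrite addr0 => /(congr1 (fun x => (gam 0)^-1 * x)%g); rewrite mulKg mulVg. Qed.

Lemma osgX gam t k : is_osg gam -> gam (k%:R * t) = (gam t ^+ k)%g.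
Proof.
move=> h; elim: k => [|k IH]; first by rewrite mul0r expg0 osg0.
by rewrite -natr1 mulrDl mul1r h IH expgSr.
Qed.

Lemma osg_dy gam (t : R) k : is_osg gam -> gam t = (gam (dy k * t)%R ^+ (2 ^ k))%g.
Proof. by move=> h; rewrite -osgX// mulrA dyM mul1r. Qed.

Lemma exp_exists : exists Exp : 'rV[R]_n -> G,
  (forall a, is_osg (fun t => Exp (t *: a))) /\
  forall b, 4 * `|b| < rho -> near1 rho (Exp b) /\ `|Xi (Exp b) - b| <= 2 * (C * `|b| ^+ 2).
Proof.
exists gE; split; first by move=> a s t; exact: gE_hom.
move=> t h; rewrite gE_ex//; split; first exact: ex_near.
by have [_ ->] := exP h; exact: exL_lin.
Qed.

(** The clause [locp] makes the reading in the chart faithful: off the chart domain the values of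
    [Xi] mean nothing. *)
Definition tangent (gam : R -> G) a := forall e, 0 < e -> exists2 d, 0 < d &
  forall t, `|t| < d -> locp (gam t) /\ `|Xi (gam t) - t *: a| <= e * `|t|.

(** A one-parameter subgroup at time [t] is the $2^k$-th power of its value at $2^{-k}t$, and the
    common tangent forces these roots to be at distance $o(2^{-k})$. Times [t] beyond the small
    range follow by one more dyadic power. *)
Lemma osg_unique a g1 g2 : is_osg g1 -> is_osg g2 -> tangent g1 a -> tangent g2 a ->
  g1 =1 g2.
Proof.
move=> o1 o2 t1 t2.
have small t : 2 * (`|t| * (`|a| + 1)) < rho -> g1 t = g2 t.
  move=> ht; apply: uniq_lim => e e0.
  (* The bound 1 keeps the roots in the domain; the other makes $2^k$ times their distance at most
     [e]. *)
  pose e' := Num.min 1 (e / (2 * (`|t| + 1))).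
  have T0 : 0 < 2 * (`|t| + 1) by rewrite mulr_gt0// ltr_wpDl.
  have e'0 : 0 < e' by rewrite lt_min ltr01 divr_gt0.
  have [d1 d10 h1] := t1 _ e'0; have [d2 d20 h2] := t2 _ e'0.
  have d0 : 0 < Num.min d1 d2 / (`|t| + 1) by rewrite divr_gt0 ?lt_min ?d10// ltr_wpDl.
  have [k hk] := dy_lt d0.
  have kt : `|dy k * t| < Num.min d1 d2.
    rewrite normrM gtr0_norm ?dy0//; move: hk; rewrite ltr_pdivlMr ?ltr_wpDl//.
    by apply: le_lt_trans; rewrite ler_wpM2l ?(ltW (dy0 _))// lerDl.
  move: kt; rewrite lt_min => /andP[k1 k2].
  have [l1 b1] := h1 _ k1; have [l2 b2] := h2 _ k2.
  have nt : `|dy k * t| = dy k * `|t| by rewrite normrM gtr0_norm// dy0.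
  have e1 : e' * `|dy k * t| <= `|dy k * t| by rewrite ler_piMl// ge_min lexx.
  have bnd g : `|Xi (g (dy k * t)) - (dy k * t) *: a| <= e' * `|dy k * t| -> `|Xi (g (dy k * t))| <= dy k * (`|t| * (`|a| + 1)).
    move=> hg; have := ler_normD (Xi (g (dy k * t)) - (dy k * t) *: a) ((dy k * t) *: a).
    rewrite subrK normrZ; move: hg e1; rewrite nt.
    rewrite (_ : dy k * (`|t| * (`|a| + 1)) = dy k * `|t| * `|a| + dy k * `|t|); last by ring.
    move: `|_ - _| `|Xi _| (dy k * `|t| * `|a|) => u1 u2 u3.
    by move: (dy k * `|t|) => u4; move: (e' * u4) => *; lra.
  exists k, (g1 (dy k * t)), (g2 (dy k * t)), (dy k * (`|t| * (`|a| + 1))); split; [by []|by []|exact: bnd|exact: bnd|].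
  split; [by rewrite dyMM|exact: osg_dy|exact: osg_dy|].
  have t3 := ler_distD ((dy k * t) *: a) (Xi (g1 (dy k * t))) (Xi (g2 (dy k * t))).
  rewrite [`|_ *: a - Xi (g2 _)|]distrC in t3.
  have t4 : `|Xi (g1 (dy k * t)) - Xi (g2 (dy k * t))| <= dy k * (2 * (e' * `|t|)).
    apply: (le_trans t3); apply: (le_trans (lerD b1 b2)); rewrite nt.
    by rewrite le_eqVlt; apply/orP; left; apply/eqP; ring.
  apply: (le_trans (ler_wpM2l (ler0n R _) t4)); rewrite -[(2 ^ k)%:R]mul1r dyMM mul1r.
  have : e' <= e / (2 * (`|t| + 1)) by rewrite ge_min lexx orbT.
  rewrite ler_pdivlMr//; apply: le_trans; rewrite mulrCA ler_wpM2l ?(ltW e'0)//.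
  by rewrite ler_wpM2l// lerDl.
move=> t; have p : 0 < 2 * (`|t| * (`|a| + 1)) + 1 by rewrite ltr_wpDl// !mulr_ge0// addr_ge0.
have [k hk] := dy_lt (divr_gt0 rho0 p).
rewrite (osg_dy t k o1) (osg_dy t k o2) small// normrM (gtr0_norm (dy0 _)).
move: hk; rewrite ltr_pdivlMr// mulrDr mulr1 -mulrA [2 * (dy k * _)]mulrCA; apply: le_lt_trans.
by rewrite lerDl ltW// dy0.
Qed.
End LocalGroup.

Section RealDeriv.
Context {R : realType}.
Implicit Types (f : R -> R) (l x : R).
(** The form as a linear approximation, in which [h = 0] needs no exclusion. *)
Lemma is_deriveP f x l : is_derive x 1 f l <-> forall e, 0 < e -> exists2 d, 0 < d &
  forall h, `|h| < d -> `|f (x + h) - f x - h * l| <= e * `|h|.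
Proof.
split=> [[df fl] e e0|H].
- have : (fun h : R => h^-1 *: (f (h *: 1 + x) - f x)) @ 0^' --> l by rewrite -fl.
  move=> /cvgrPdist_le /(_ _ e0) /nbhs_ballP[d /= d0 hd].
  exists d => // h hd'; have [->|h0] := eqVneq h 0.
    by rewrite addr0 subrr mul0r subrr normr0 mulr0.
  have := hd h; rewrite -ball_normE /= sub0r normrN => /(_ hd' h0).
  rewrite /GRing.scale /= mulr1 [h + x]addrC => hh.
  have -> : f (x + h) - f x - h * l = - (h * (l - h^-1 * (f (x + h) - f x))).
    by rewrite mulrBr mulrA mulfV// mul1r opprB.
  by rewrite normrN normrM mulrC ler_wpM2r.
have cv : (fun h : R => h^-1 *: (f (h *: 1 + x) - f x)) @ 0^' --> l.
  apply/cvgrPdist_le => e e0; have [d d0 hd] := H _ e0.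
  apply/nbhs_ballP; exists d => //= h; rewrite -ball_normE /= sub0r normrN => hh h0.
  have := hd _ hh; rewrite /GRing.scale /= mulr1 [h + x]addrC => h1.
  have -> : l - h^-1 * (f (x + h) - f x) = - (h^-1 * (f (x + h) - f x - h * l)).
    by rewrite [h^-1 * (_ - h * l)]mulrBr opprB mulrA mulVf// mul1r.
  rewrite normrN normrM normfV mulrC ler_pdivrMr ?normr_gt0//.
by apply: DeriveDef; [exact: cvgP cv|exact: cvg_lim cv].
Qed.

Lemma is_derive_shift f x l : is_derive x 1 f l <-> is_derive (0 : R) 1 (fun h => f (x + h)) l.
Proof. by rewrite !is_deriveP; split=> H e /H[d d0 hd]; exists d => // h /hd; rewrite add0r addr0. Qed.

Lemma fin_min n (f : 'I_n -> R) : (forall j, 0 < f j) -> exists2 r, 0 < r & forall j, r <= f j.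
Proof.
move=> f0; exists (\big[Num.min/1]_j f j).
  by elim/big_ind : _ => // a b a0 b0; rewrite lt_min a0.
by move=> j; rewrite (bigD1 j)//= ge_min lexx.
Qed.

End RealDeriv.

(** * The group law in a chart at the identity *)

Section LieLocal.
Context {R : realType} {n : nat} {G : lieGroupType R n}.
Local Notation A := (@lie_atlas R n G).
Local Notation e_ i := (delta_mx 0 i).
Implicit Types (phi psi : G -> R) (X Y : operator G) (x y : G).
Variable c : chart R n G.
Hypothesis (Ac : A c) (dc : chart_dom c 1%g).
Local Notation p := (c 1%g).
Local Notation xi := (xi Ac dc).

Definition Xi (x : G) : 'rV[R]_n := c x - p.
Definition io (u : 'rV[R]_n) : G := chart_inv c (u + p).
Local Notation nr := (near1 Xi io).
Local Notation lc := (locp Xi io).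

Lemma Xi1 : Xi 1%g = 0. Proof. by rewrite /Xi subrr. Qed.

Lemma lcE x : lc x <-> chart_inv c (c x) = x.
Proof. by rewrite /locp /io /Xi subrK. Qed.

Lemma lc_dom x : chart_dom c x -> lc x.
Proof. by move=> dx; apply/lcE; exact: chartK. Qed.

Lemma nr_ball r x : nr r x -> 0 < r /\ ball p r (c x).
Proof.
move=> [_ xr]; split; first exact: le_lt_trans xr.
by rewrite -ball_normE /= distrC.
Qed.

Lemma nr_le r s x : r <= s -> nr r x -> nr s x.
Proof. by move=> rs [l xr]; split=> //; exact: lt_le_trans rs. Qed.

Lemma nr_nbhs r : 0 < r -> \forall x \near (1%g : G), nr r x.
Proof.
move=> r0; near=> x; split.
  by apply: lc_dom; near: x; apply: open_nbhs_nbhs; split=> //; exact: chart_domo.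
rewrite /Xi -normrN opprB; near: x.
have /cvgrPdist_lt := chart_cont Ac dc; exact.
Unshelve. all: by end_near. Qed.

Lemma nr_sub (O : set G) : nbhs 1%g O -> exists2 r, 0 < r & forall x, nr r x -> O x.
Proof.
move=> nO; have cv := chart_inv_cont Ac (chart_imgP dc).
rewrite /prop_for /continuous_at chartK// in cv.
have /nbhs_ballP[r /= r0 hr] : nbhs p (chart_inv c @^-1` O) by exact: cv.
by exists r => // x nx; have [/lcE <- _] := nx; apply: hr; have [] := nr_ball nx.
Qed.

Lemma nr_sub2 (O : set G) : nbhs 1%g O -> exists2 r, 0 < r & forall x y, nr r x -> nr r y -> O (x * y)%g.
Proof.
move=> nO; have : nbhs ((1, 1)%g : G * G) ((fun q : G * G => (q.1 * q.2)%g) @^-1` O).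
  by apply: mul_cont; rewrite /= mulg1.
move=> [[U1 U2] /= [n1 n2] h12].
have [r1 r10 h1] := nr_sub n1; have [r2 r20 h2] := nr_sub n2.
exists (Num.min r1 r2); first by rewrite lt_min r10.
move=> x y nx ny; apply: (h12 (x, y)); split=> /=; [apply: h1|apply: h2].
  by apply: nr_le nx; rewrite ge_min lexx.
by apply: nr_le ny; rewrite ge_min lexx orbT.
Qed.

Lemma nr_coord : exists2 r, 0 < r & forall x, nr r x -> chart_dom c x /\ forall j, xi j x = Xi x 0 j.
Proof.
have [r r0 h] := nr_sub (xi_near Ac dc); exists r => // x /h[dx hx]; split=> // j.
by rewrite hx /Xi !mxE.
Qed.

(** The deviation of the product from addition in coordinate [j], on the product chart. It vanishes
    along both axes near the base point, which gives the bilinear error in [lg_mul]; its gradient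
    vanishes at the base point, which gives [lg_strict]. *)
Definition gj (j : 'I_n) (w : 'rV[R]_(n + n)) : R :=
  xi j (chart_inv c (lsubmx w) * chart_inv c (rsubmx w))%g
  + (- (w 0 (lshift n j) - p 0 j) + - (w 0 (rshift n j) - p 0 j)).

Lemma gj_smooth j : exists V : set 'rV[R]_(n + n), [/\ open V, V (row_mx p p) & Cinf V (gj j)].
Proof.
have [V [oV Vp _ hV]] := mul_smooth Ac Ac dc dc (smooth_at (x := (1 * 1)%g) (xi_smooth Ac dc j)).
exists V; split=> // k.
have hc (i : 'I_(n + n)) (b : R) : Ck_on k V (fun w => - (w 0 i - b)).
  apply: Ck_opp => //; exact: (Ck_add oV (Ck_coord k V i) (Ck_cst k V (- b))).
exact: (Ck_add oV (hV k) (Ck_add oV (hc _ _) (hc _ _))).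
Qed.

Lemma gjE j u v : gj j (row_mx u v) = xi j (chart_inv c u * chart_inv c v)%g - (u 0 j - p 0 j) - (v 0 j - p 0 j).
Proof. by rewrite /gj row_mxKl row_mxKr row_mxEl row_mxEr addrA. Qed.

Lemma gj0 j : \forall u \near p, gj j (row_mx u p) = 0 /\ gj j (row_mx p u) = 0.
Proof.
have cv := chart_inv_cont Ac (chart_imgP dc).
rewrite /prop_for /continuous_at chartK// in cv.
near=> u; have hu : chart_dom c (chart_inv c u) /\ forall j, xi j (chart_inv c u) = c (chart_inv c u) 0 j - p 0 j.
  by near: u; exact: (cv _ (xi_near Ac dc)).
have Iu : chart_img c u.
  by near: u; apply: open_nbhs_nbhs; split; [exact: chart_imgo|exact: chart_imgP].
rewrite !gjE chartK// mulg1 mul1g hu.2 chart_invK// !subrr; split; ring.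
Unshelve. all: by end_near. Qed.

Lemma gj_bound j : exists r C, [/\ 0 < r, 0 <= C & forall u v, ball p r u -> ball p r v ->
  `|gj j (row_mx u v)| <= C * `|u - p| * `|v - p|].
Proof.
have [V [oV Vp hV]] := gj_smooth j.
apply: quad_bound oV (hV 2%N) Vp _ _.
- by apply: filterS (gj0 j) => u [].
- by apply: filterS (gj0 j) => u [].
Qed.

Lemma gj_D0 j i : 'D_(e_ i) (gj j) (row_mx p p) = 0.
Proof.
have [V [oV Vp hV]] := gj_smooth j.
have dg := Ck_derivable (hV 1%N) Vp.
case: (split_ordP i) => k ->.
- have [_ <-] := is_derive_lsub (dg (lshift n k)).
  rewrite (@near_eq_derive _ _ _ _ (fun=> 0))//; last by apply: filterS (gj0 j) => u [].
  exact: derive_cst.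
- have [_ <-] := is_derive_rsub (dg (rshift n k)).
  rewrite (@near_eq_derive _ _ _ _ (fun=> 0))//; last by apply: filterS (gj0 j) => u [].
  exact: derive_cst.
Qed.

Lemma row_mx_dist (u u' v v' : 'rV[R]_n) : `|row_mx u' v' - row_mx u v| <= `|u' - u| + `|v' - v|.
Proof.
apply: rV_norm_le; first by rewrite addr_ge0.
move=> i; rewrite opp_row_mx add_row_mx; case: (split_ordP i) => k ->.
  by rewrite row_mxEl; apply: le_trans (coord_norm_le _ _) _; rewrite lerDl.
by rewrite row_mxEr; apply: le_trans (coord_norm_le _ _) _; rewrite lerDr.
Qed.

Lemma gj_strict j e : 0 < e -> exists2 r, 0 < r & forall u v u' v', ball p r u -> ball p r v ->
  ball p r u' -> ball p r v' ->
  `|gj j (row_mx u' v') - gj j (row_mx u v)| <= e * (`|u' - u| + `|v' - v|).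
Proof.
move=> e0; have [V [oV Vp hV]] := gj_smooth j.
have [r r0 [_ h]] := C1_strict oV (hV 1%N) Vp e0; exists r => // u v u' v' hu hv hu' hv'.
have := h _ _ (row_mx_norm hu hv) (row_mx_norm hu' hv').
rewrite big1 ?subr0; last by move=> i _; rewrite gj_D0 mulr0.
by move=> /le_trans; apply; rewrite ler_wpM2l ?(ltW e0)//; exact: row_mx_dist.
Qed.

Lemma gj_Xi : exists2 r, 0 < r & forall x y, nr r x -> nr r y -> chart_dom c (x * y)%g /\
  forall j, gj j (row_mx (c x) (c y)) = (Xi (x * y)%g - Xi x - Xi y) 0 j.
Proof.
have [r r0 h] := nr_coord; have [s s0 hs] := nr_sub2 (nr_nbhs r0).
exists s => // x y nx ny; have [d E] := h _ (hs _ _ nx ny); split=> // j.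
have [/lcE lx _] := nx; have [/lcE ly _] := ny.
by rewrite gjE lx ly E /Xi !mxE.
Qed.

Lemma lg_mul : exists r C, [/\ 0 < r, 0 <= C & forall x y, nr r x -> nr r y ->
  lc (x * y)%g /\ `|Xi (x * y)%g - Xi x - Xi y| <= C * `|Xi x| * `|Xi y|].
Proof.
have [r r0 hr] := gj_Xi.
have /fin_all_exists[q /fin_all_exists[C hC]] := gj_bound.
have [s s0 hs] := @fin_min R n q (fun j => let: And3 h _ _ := hC j in h).
have C0 j : 0 <= C j by case: (hC j).
exists (Num.min r s), (\sum_j C j); split; first by rewrite lt_min r0.
  exact: sumr_ge0.
move=> x y nx ny.
have nx1 : nr r x by apply: nr_le nx; rewrite ge_min lexx.
have ny1 : nr r y by apply: nr_le ny; rewrite ge_min lexx.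
have [d E] := hr _ _ nx1 ny1; split; first exact: lc_dom.
apply: rV_norm_le; first by rewrite !mulr_ge0// sumr_ge0.
move=> j; rewrite -E; have [_ _ h] := hC j.
have bb z : nr (Num.min r s) z -> ball p (q j) (c z).
  move=> nz; have [] := @nr_ball (q j) z _ => //.
  by apply: nr_le nz; rewrite ge_min (hs j) orbT.
apply: le_trans (h _ _ (bb _ nx) (bb _ ny)) _.
by rewrite /Xi -!mulrA ler_wpM2r ?mulr_ge0// (bigD1 j)//= lerDl sumr_ge0.
Qed.

Lemma lg_strict e : 0 < e -> exists2 r, 0 < r & forall x x' y y', nr r x -> nr r x' -> nr r y -> nr r y' ->
  `|(Xi (x * y)%g - Xi x - Xi y) - (Xi (x' * y')%g - Xi x' - Xi y')| <= e * (`|Xi x - Xi x'| + `|Xi y - Xi y'|).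
Proof.
move=> e0; have [r r0 hr] := gj_Xi.
have /fin_all_exists2[q q0 hq] := fun j => gj_strict j e0.
have [s s0 hs] := fin_min q0.
exists (Num.min r s); first by rewrite lt_min r0.
move=> x x' y y' nx nx' ny ny'.
have rr z : nr (Num.min r s) z -> nr r z by move=> nz; apply: nr_le nz; rewrite ge_min lexx.
have [_ E] := hr _ _ (rr _ nx) (rr _ ny); have [_ E'] := hr _ _ (rr _ nx') (rr _ ny').
apply: rV_norm_le; first by rewrite mulr_ge0 ?addr_ge0// ltW.
move=> j; have bb z : nr (Num.min r s) z -> ball p (q j) (c z).
  move=> nz; have [] := @nr_ball (q j) z _ => //.
  by apply: nr_le nz; rewrite ge_min (hs j) orbT.
have := hq j _ _ _ _ (bb _ nx') (bb _ ny') (bb _ nx) (bb _ ny).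
have XB z z' : Xi z - Xi z' = c z - c z' by rewrite /Xi opprB addrA subrK.
rewrite -!XB E E'; apply: le_trans; rewrite le_eqVlt; apply/orP; left; apply/eqP.
by congr (`|_|); rewrite !mxE.
Qed.

Lemma lg_lip : exists2 r, 0 < r & forall x x' y y', nr r x -> nr r x' -> nr r y -> nr r y' ->
  `|Xi (x * y)%g - Xi (x' * y')%g| <= 2 * (`|Xi x - Xi x'| + `|Xi y - Xi y'|).
Proof.
have [r r0 h] := lg_strict ltr01; exists r => // x x' y y' nx nx' ny ny'.
have := h _ _ _ _ nx nx' ny ny'.
have -> : Xi (x * y)%g - Xi x - Xi y - (Xi (x' * y')%g - Xi x' - Xi y') =
  (Xi (x * y)%g - Xi (x' * y')%g) - ((Xi x - Xi x') + (Xi y - Xi y')).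
  by apply/rowP => j; rewrite !mxE; ring.
have t1 := ler_normB (Xi (x * y)%g - Xi (x' * y')%g) ((Xi x - Xi x') + (Xi y - Xi y')).
have := ler_normD (Xi x - Xi x') (Xi y - Xi y').
have := ler_normD (Xi (x * y)%g - Xi (x' * y')%g - ((Xi x - Xi x') + (Xi y - Xi y'))) ((Xi x - Xi x') + (Xi y - Xi y')).
rewrite subrK mul1r; move: `|Xi (x * y)%g - Xi (x' * y')%g| `|_ - (_ + _)| `|_ + _| => u v w.
by move: `|_ - _| `|_ - _| => *; lra.
Qed.

(** The estimate of [lg_mul] for $x x^{-1} = 1$. The radius makes $C|x| \le 1/2$, so the error is
    absorbed and $|x^{-1}| \le 2|x|$. *)
Lemma lg_inv : exists r C, [/\ 0 < r, 0 <= C & forall x, nr r x ->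
  lc x^-1%g /\ `|Xi x^-1%g + Xi x| <= C * `|Xi x| * `|Xi x|].
Proof.
have [r [C [r0 C0 h]]] := lg_mul.
have C1 : 0 < 2 * C + 1 by rewrite ltr_wpDl// mulr_ge0.
pose s := Num.min r (2 * C + 1)^-1.
have s0 : 0 < s by rewrite lt_min r0 invr_gt0.
have sr : s <= r by rewrite ge_min lexx.
have Cs : C * s <= 2^-1.
  have sC : s <= (2 * C + 1)^-1 by rewrite ge_min lexx orbT.
  apply: le_trans (ler_wpM2l C0 sC) _; rewrite ler_pdivrMr//; lra.
have : nbhs (1%g : G) [set x | nr s x^-1%g].
  by apply: (@inv_cont R n G 1%g); rewrite /= invg1; exact: nr_nbhs.
move=> /nr_sub[t t0 ht]; exists (Num.min s t), (2 * C); split.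
- by rewrite lt_min s0.
- by rewrite mulr_ge0.
move=> x nx; have nx1 : nr s x by apply: nr_le nx; rewrite ge_min lexx.
have ni : nr s x^-1%g by apply: ht; apply: nr_le nx; rewrite ge_min lexx orbT.
split; first by case: ni.
have [_] := h _ _ (nr_le sr nx1) (nr_le sr ni).
rewrite mulgV Xi1 sub0r -opprD normrN [Xi x + _]addrC => h1.
have h2 : C * `|Xi x| <= 2^-1.
  by apply: le_trans Cs; rewrite ler_wpM2l//; case: nx1 => _ /ltW.
have h3 : `|Xi x^-1%g| <= 2 * `|Xi x|.
  have := ler_normB (Xi x^-1%g + Xi x) (Xi x); rewrite addrK.
  have := ler_wpM2r (normr_ge0 (Xi x^-1%g)) h2; move: h1.
  move: (C * `|Xi x| * _) `|_ + _| => u v; move: `|Xi x| `|Xi _| => *; lra.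
apply: (le_trans h1); have Cx : 0 <= C * `|Xi x| by rewrite mulr_ge0.
apply: (le_trans (ler_wpM2l Cx h3)).
by rewrite le_eqVlt; apply/orP; left; apply/eqP; ring.
Qed.

Lemma exp_local : exists rho C (Exp : 'rV[R]_n -> G), [/\ 0 < rho, 0 <= C,
  forall a, is_osg (fun t => Exp (t *: a)),
  (forall b, `|b| < rho -> lc (Exp b) /\ `|Xi (Exp b) - b| <= C * `|b| ^+ 2) &
  forall a g1 g2, is_osg g1 -> is_osg g2 -> tangent Xi io g1 a -> tangent Xi io g2 a -> g1 =1 g2].
Proof.
have [r1 [C1 [r10 C10 h1]]] := lg_mul; have [r2 r20 h2] := lg_lip.
have [r3 [C3 [r30 C30 h3]]] := lg_inv.
have [r4 r40 h4] : exists2 r4, 0 < r4 & ball p r4 `<=` chart_img c.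
  by apply: open_ball_rV; [exact: chart_imgo|exact: chart_imgP].
pose C := C1 + C3; have C0 : 0 <= C by rewrite addr_ge0.
pose rho := Num.min (Num.min r1 r2) (Num.min (Num.min r3 r4) (C + 1)^-1).
have rho0 : 0 < rho by rewrite !lt_min r10 r20 r30 r40 invr_gt0 ltr_wpDl.
have [q1 q2 q3 q4 q5] : [/\ rho <= r1, rho <= r2, rho <= r3, rho <= r4 & rho <= (C + 1)^-1].
  by rewrite /rho !ge_min !lexx !orbT.
have Crho : C * rho <= 1.
  apply: le_trans (ler_wpM2l C0 q5) _; rewrite ler_pdivrMr ?ltr_wpDl//; lra.
have Ha x y : nr rho x -> nr rho y -> lc (x * y)%g /\ `|Xi (x * y)%g - Xi x - Xi y| <= C * `|Xi x| * `|Xi y|.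
  move=> nx ny; have [l b] := h1 _ _ (nr_le q1 nx) (nr_le q1 ny); split=> //.
  by apply: (le_trans b); rewrite -!mulrA ler_wpM2r ?mulr_ge0// lerDl.
have Hc x : nr rho x -> lc x^-1%g /\ `|Xi x^-1%g + Xi x| <= C * `|Xi x| * `|Xi x|.
  move=> nx; have [l b] := h3 _ (nr_le q3 nx); split=> //.
  by apply: (le_trans b); rewrite -!mulrA ler_wpM2r ?mulr_ge0// lerDr.
have Hb x x' y y' : nr rho x -> nr rho x' -> nr rho y -> nr rho y' ->
    `|Xi (x * y)%g - Xi (x' * y')%g| <= 2 * (`|Xi x - Xi x'| + `|Xi y - Xi y'|).
  by move=> *; apply: h2; apply: (nr_le q2).
have Hd u : `|u| < rho -> Xi (io u) = u.
  move=> ur; rewrite /Xi /io chart_invK// ?addrK//; apply: h4.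
  rewrite -ball_normE /= opprD addrA addrAC subrr sub0r normrN.
  exact: lt_le_trans q4.
have [Exp [E1 E2]] := exp_exists rho0 C0 Crho Xi1 Ha Hb Hc Hd.
exists (rho / 4), (2 * C), Exp; split=> //.
- by rewrite divr_gt0.
- by rewrite mulr_ge0.
- move=> b hb; have [|n1 n2] := E2 b; first by rewrite mulrC -ltr_pdivlMr.
  by split; [case: n1|rewrite -mulrA].
- move=> a g1 g2; exact: (osg_unique rho0 C0 Crho Xi1 Ha Hb Hd).
Qed.

Lemma mulL_cont (g : G) : continuous (fun x => g * x)%g.
Proof.
move=> x; apply: (@continuous_comp _ _ _ (fun x : G => (g, x)) (fun q : G * G => (q.1 * q.2)%g)).
  exact: (cvg_pair (cvg_cst _) (@cvg_id _ _)).
exact: mul_cont.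
Qed.

Lemma mulR_cont (g : G) : continuous (fun x => x * g)%g.
Proof.
move=> x; apply: (@continuous_comp _ _ _ (fun x : G => (x, g)) (fun q : G * G => (q.1 * q.2)%g)).
  exact: (cvg_pair (@cvg_id _ _) (cvg_cst _)).
exact: mul_cont.
Qed.

Lemma tangent_cvg (gam : R -> G) a : tangent Xi io gam a -> gam t @[t --> 0] --> (1%g : G).
Proof.
move=> tg O /nr_sub[r r0 hr]; have [d d0 hd] := tg 1 ltr01.
have q0 : 0 < `|a| + 1 by rewrite ltr_wpDl.
apply/nbhs_ballP; exists (Num.min d (r / (`|a| + 1))) => /=.
  by rewrite lt_min d0 divr_gt0.
move=> t; rewrite -ball_normE /= sub0r normrN lt_min => /andP[td tr].
apply: hr; have [l b] := hd _ td; split=> //.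
move: tr; rewrite ltr_pdivlMr//; apply: le_lt_trans.
have := ler_normD (Xi (gam t) - t *: a) (t *: a); rewrite subrK normrZ => /le_trans; apply.
by rewrite mulrDr mulr1 addrC lerD2l -[leRHS]mul1r.
Qed.

Lemma osg_cont gam a : is_osg gam -> tangent Xi io gam a -> continuous gam.
Proof.
move=> og tg t.
have -> : gam = (fun x => gam t * x)%g \o (gam \o (fun s => s - t)).
  by apply/funext => s /=; rewrite -og addrC subrK.
apply: continuous_comp; last exact: mulL_cont.
have h : (fun s : R => s - t) @ t --> (0 : R).
  by rewrite -(subrr t); apply: cvgB; [exact: cvg_id|exact: cvg_cst].
have := cvg_comp _ _ h (tangent_cvg tg).
have E : (gam \o (fun s => s - t)) t = 1%g by rewrite /= subrr (osg0 og).
by rewrite -E.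
Qed.

Lemma tangent_derive (gam : R -> G) a phi : gam 0 = 1%g -> tangent Xi io gam a -> smooth phi ->
  is_derive (0 : R) 1 (phi \o gam) (tv c phi a).
Proof.
move=> g0 tg sphi; pose F t := Xi (gam t) + p.
have dF : is_derive (0 : R) 1 F a.
  apply: is_derive_rV => j; apply/is_deriveP => e e0; have [d d0 hd] := tg e e0.
  exists d => // h /hd[_ b]; apply: le_trans b.
  have := coord_norm_le (Xi (gam h) - h *: a) j; rewrite /F add0r g0 Xi1 !mxE.
  by rewrite add0r addrK.
have F0 : F 0 = p by rewrite /F g0 Xi1 add0r.
have UF : chart_img c (F 0) by rewrite F0; exact: chart_imgP.
have := is_derive_comp_rV (chart_imgo Ac) (sphi c 1%N Ac) UF dF; rewrite F0.
move=> /is_deriveP H; apply/is_deriveP => e e0.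
have [d d0 hd] := H e e0; have [d' d'0 hd'] := tg 1 ltr01.
exists (Num.min d d'); first by rewrite lt_min d0.
move=> h; rewrite lt_min => /andP[/hd + /hd'[l _]].
rewrite /= !add0r F0 g0 chartK//.
by have -> : chart_inv c (F h) = gam h by exact: l.
Qed.

Lemma osg_derive gam a phi (g : G) (t : R) : is_osg gam -> tangent Xi io gam a -> smooth phi ->
  is_derive t 1 (fun s => phi (g * gam s)%g) (tv c (fun x => phi (g * gam t * x)%g) a).
Proof.
move=> og tg sphi; apply/is_derive_shift.
have -> : (fun h => phi (g * gam (t + h)%R)%g) = (fun x => phi (g * gam t * x)%g) \o gam.
  by apply/funext => h; rewrite /= og mulgA.
by apply: tangent_derive => //; [exact: osg0|exact: smooth_L].
Qed.

(** Continuity at 0 brings the curve into the region where the cut-off functions [xi j] are the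
    chart coordinates; derivatives of finitely many scalar functions then give tangency. *)
Lemma derive_tangent (gam : R -> G) (a : 'rV[R]_n) : gam 0 = 1%g -> gam t @[t --> 0] --> (1%g : G) ->
  (forall j, is_derive (0 : R) 1 (xi j \o gam) (a 0 j)) -> tangent Xi io gam a.
Proof.
move=> g0 gc dj e e0.
have [r r0 hr] := nr_coord.
have /nbhs_ballP[d1 /= d10 h1] : nbhs (0 : R) (gam @^-1` (nr r)) by apply: gc; exact: nr_nbhs.
have /fin_all_exists2[q q0 hq] : forall j, exists2 d, 0 < d & forall h, `|h| < d ->
    `|xi j (gam h) - h * a 0 j| <= e * `|h|.
  move=> j; have /is_deriveP/(_ e e0)[d d0 hd] := dj j; exists d => // h /hd /=.
  by rewrite add0r g0 xi1 subr0.
have [s s0 hs] := fin_min q0.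
exists (Num.min d1 s); first by rewrite lt_min d10.
move=> t; rewrite lt_min => /andP[t1 ts].
have nt : nr r (gam t) by apply: h1; rewrite -ball_normE /= sub0r normrN.
split; first by case: nt.
apply: rV_norm_le; first by rewrite mulr_ge0// ltW.
move=> j; have [_ E] := hr _ nt; have := hq j t (lt_le_trans ts (hs j)).
by rewrite E !mxE.
Qed.

Lemma lip_ac (f df : R -> R) (B : R) : (forall t : R, is_derive t 1 f (df t)) ->
  (forall t : R, 0 <= t <= 1 -> `|df t| <= B) -> absolutely_continuous 0 1 f.
Proof.
move=> hf hB e e0.
have B0 : 0 <= B by apply: le_trans (hB 0 _); rewrite ?normr_ge0 ?lexx ?ler01.
have B1 : 0 < B + 1 by rewrite ltr_wpDl.
exists (e / (B + 1)); first by rewrite divr_gt0.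
move=> m u v huv _; rewrite ltr_pdivlMr// => hs.
apply: le_lt_trans hs; rewrite mulr_suml; apply: ler_sum => i _.
have [u0 [uv v1]] := huv i.
have cf : continuous f by move=> t; apply: differentiable_continuous; apply/derivable1_diffP; case: (hf t).
have [t + ->] := @MVT_segment R f df (u i) (v i) uv (fun t _ => hf t) (continuous_subspaceT cf).
rewrite in_itv /= => /andP[t1 t2]; rewrite normrM mulrC [`|v i - u i|]ger0_norm ?subr_ge0// ler_wpM2l ?subr_ge0//.
by apply: le_trans (hB t _) _; [rewrite (le_trans u0 t1) (le_trans t2 v1)|rewrite lerDl].
Qed.

Lemma osg_velocity gam X (g : G) (t : R) phi : is_osg gam -> lie_algebra X -> tangent Xi io gam (vec Ac dc X) ->
  smooth phi -> is_derive t 1 (phi \o (fun s => g * gam s)%g) (X phi (g * gam t)%g).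
Proof. by move=> og lX tg sphi; rewrite (lieE Ac dc)//; exact: osg_derive. Qed.

Lemma osg_ac gam X (g : G) phi : is_osg gam -> lie_algebra X -> tangent Xi io gam (vec Ac dc X) ->
  smooth phi -> absolutely_continuous 0 1 (phi \o (fun s => g * gam s)%g).
Proof.
move=> og lX tg sphi.
pose df t := X phi (g * gam t)%g.
have cdf : continuous df.
  move=> t; apply: (@continuous_comp _ _ _ (fun s => g * gam s)%g (X phi)).
    by apply: (@continuous_comp _ _ _ gam (fun x => g * x)%g); [exact: osg_cont tg _|exact: mulL_cont].
  by apply: smooth_cont; case: lX => -[h _ _ _] _; exact: h.
have [t0 _ ht0] : exists2 t0, t0 \in `[0, 1] & forall t, t \in `[0, 1] -> `|df t| <= `|df t0|.
  apply: (@EVT_max R (fun t => `|df t|)) => //.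
  apply: continuous_subspaceT => t.
  by apply: (@continuous_comp _ _ _ df (fun x : R => `|x|)); [exact: cdf|exact: norm_continuous].
apply: (@lip_ac _ df `|df t0|).
  by move=> t; exact: osg_velocity.
by move=> t t01; apply: ht0; rewrite in_itv.
Qed.
End LieLocal.

Section LieLin.
Context {R : realType} {n : nat} {G : lieGroupType R n}.
Implicit Types (phi psi : G -> R) (X Y : operator G) (x y : G).

Lemma lie_lin (a : R) X Y : lie_algebra X -> lie_algebra Y -> lie_algebra (a *: X + Y).
Proof.
move=> [[X1 X2 X3 X4] X5] [[Y1 Y2 Y3 Y4] Y5]; split; last first.
  by move=> g phi; rewrite -[LHS]/(a *: X (phi \o _) + Y (phi \o _)) X5 Y5.
split.
- move=> phi s; rewrite -[_ phi]/((fun x => a * X phi x + Y phi x)).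
  by apply: smooth_add; [apply: smooth_scale; exact: X1|exact: Y1].
- by move=> phi s; rewrite -[LHS]/(a *: X phi + Y phi) X2// Y2// scaler0 addr0.
- move=> b phi psi s1 s2; rewrite -[LHS]/(a *: X _ + Y _) X3// Y3//.
  apply/funext => x.
  rewrite -[LHS]/(a * (b * X phi x + X psi x) + (b * Y phi x + Y psi x)).
  by rewrite -[RHS]/(b * (a * X phi x + Y phi x) + (a * X psi x + Y psi x)); ring.
- move=> phi psi s1 s2; rewrite -[LHS]/(a *: X _ + Y _) X4// Y4//.
  apply/funext => x.
  rewrite -[LHS]/(a * (X phi x * psi x + phi x * X psi x) + (Y phi x * psi x + phi x * Y psi x)).
  by rewrite -[RHS]/((a * X phi x + Y phi x) * psi x + phi x * (a * X psi x + Y psi x)); ring.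
Qed.

Lemma lie0 : lie_algebra (0 : operator G).
Proof.
split; last by [].
split=> //.
- by move=> phi _; exact: (@smooth_cst R n G 0).
- by move=> a phi psi _ _; rewrite -[LHS]/(0 : G -> R) scaler0 addr0.
- by move=> phi psi _ _; rewrite -[LHS]/(0 : G -> R) mul0r mulr0 addr0.
Qed.

Lemma subspace_sum (V : set (operator G)) (I : Type) (r : seq I) (k : I -> R) (F : I -> operator G) :
  linear_subspace V -> (forall i, V (F i)) -> V (\sum_(i <- r) k i *: F i).
Proof.
move=> [V0 VL] VF; elim: r => [|i r IH]; first by rewrite big_nil.
by rewrite big_cons; exact: VL.
Qed.
End LieLin.

(** * Horizontal exponentials *)

Section Carnot.
Context {R : realType} {G : carnotGroup R}.
Local Notation n := (carnot_dim G).
Local Notation A := (@lie_atlas R n G).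
Local Notation e_ i := (delta_mx 0 i).
Implicit Types (phi psi : G -> R) (X Y : operator G) (x y : G).
Variable c : chart R n G.
Hypothesis (Ac : A c) (dc : chart_dom c 1%g).
Local Notation xi := (xi Ac dc).
Local Notation vec := (vec Ac dc).
Local Notation V := (carnot_layer G).

Lemma vec0 : vec 0 = 0. Proof. by apply/rowP => j; rewrite !mxE. Qed.

Lemma vec_sum (I : Type) (r : seq I) (k : I -> R) (F : I -> operator G) :
  vec (\sum_(i <- r) k i *: F i) = \sum_(i <- r) k i *: vec (F i).
Proof.
elim: r => [|i r IH]; first by rewrite !big_nil vec0.
by rewrite !big_cons vec_lin IH.
Qed.

(** The [B i] are the first-layer components of the left-invariant fields [Z i] with
    [vec (Z i) = e_ i]. Writing [X] in the [Z i] and comparing first-layer components gives the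
    formula. The [B i] span the layer but need not be independent. *)
Lemma layer_basis : exists B : 'I_n -> operator G, (forall i, V 1%N (B i)) /\
  forall X, V 1%N X -> X = \sum_i (vec X) 0 i *: B i.
Proof.
have [s0 hV hdec huniq _] := carnot_stratified G.
have s1 : (0 < 1 <= carnot_step G)%N by rewrite s0.
have /fin_all_exists2[Z Zl Zv] : forall i : 'I_n, exists2 X, lie_algebra X & vec X = e_ i.
  by move=> i; exact: lie_of_vec.
have /fin_all_exists2[Y hY EY] := fun i => hdec _ (Zl i).
exists (fun i => Y i 1%N); split=> [i|X VX]; first exact: hY.
have [lin1 sub1] := hV _ s1.
have EX : X = \sum_i (vec X) 0 i *: Z i.
  apply: (@lie_vec_inj R n G c Ac dc); first exact: sub1.
    by apply: subspace_sum => //; split; [exact: lie0|exact: lie_lin].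
  rewrite vec_sum {1}[vec X]row_sum_delta; apply: eq_bigr => i _.
  by rewrite Zv.
(* The layer components of $X - \sum_i x_i Z_i = 0$, where [X] itself is placed in layer 1;
   uniqueness of the decomposition makes each of them vanish. *)
pose W j := (if j == 1%N then X else 0) + \sum_i (- (vec X) 0 i) *: Y i j.
have VW j : (0 < j <= carnot_step G)%N -> V j (W j).
  move=> hj; have [linj _] := hV _ hj; rewrite /W -[X in X + _]scale1r.
  apply: linj.2; first by case: eqP => [->|_] //; exact: linj.1.
  by apply: subspace_sum => // i; exact: hY.
have W0 : \sum_(1 <= j < (carnot_step G).+1) W j = 0.
  rewrite big_split /= exchange_big /=.
  rewrite big_nat_recl// eqxx big1_seq ?addr0; last first.
    by case=> [|j]; rewrite mem_index_iota.
  rewrite {1}EX -big_split big1 //= => i _.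
  by rewrite -scaler_sumr -EY scaleNr subrr.
have := huniq _ VW W0 _ s1; rewrite /W eqxx => /eqP; rewrite addr_eq0 => /eqP {1}->.
by rewrite -sumrN; apply: eq_bigr => i _; rewrite scaleNr opprK.
Qed.

Definition Bb := projT1 (cid layer_basis).
(** Horizontal fields are parametrised, redundantly, by all row vectors of length [n], so that no
    basis of the first layer has to be chosen. *)
Definition PI (v : 'rV[R]_n) : operator G := \sum_i v 0 i *: Bb i.
Definition av v := vec (PI v).

Lemma lin1 : linear_subspace (V 1%N) /\ V 1%N `<=` lie_algebra.
Proof. by have [s0 hV _ _ _] := carnot_stratified G; apply: hV; rewrite s0. Qed.
Lemma Bb_layer i : V 1%N (Bb i). Proof. exact: (projT2 (cid layer_basis)).1. Qed.
Lemma PI_layer v : V 1%N (PI v).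
Proof. by apply: subspace_sum => //; [exact: lin1.1|exact: Bb_layer]. Qed.
Lemma PI_lie v : lie_algebra (PI v). Proof. exact: lin1.2 _ (PI_layer v). Qed.
Lemma PI_onto X : V 1%N X -> X = PI (vec X). Proof. exact: (projT2 (cid layer_basis)).2. Qed.
Lemma PI_lin k v w : PI (k *: v + w) = k *: PI v + PI w.
Proof.
rewrite /PI scaler_sumr -big_split; apply: eq_bigr => i _.
by rewrite !mxE scalerDl scalerA.
Qed.
Lemma av_lin k v w : av (k *: v + w) = k *: av v + av w.
Proof. by rewrite /av PI_lin vec_lin. Qed.
Lemma av0 : av 0 = 0.
Proof. by have := av_lin 1 0 0; rewrite !scale1r addr0 => /eqP; rewrite eq_sym -subr_eq0 addrK => /eqP. Qed.
Lemma avZ k v : av (k *: v) = k *: av v.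
Proof. by have := av_lin k v 0; rewrite !addr0 av0 addr0. Qed.
Lemma avD v w : av (v + w) = av v + av w.
Proof. by have := av_lin 1 v w; rewrite !scale1r. Qed.

Lemma ip_bound : exists2 K, 0 <= K & forall v, Num.sqrt (carnot_ip (PI v) (PI v)) <= K * `|v|.
Proof.
have [ipC ipL ipP] := carnot_ipP G; have [l0 lL] := lin1.1.
have ip0 Z : V 1%N Z -> carnot_ip 0 Z = 0.
  move=> hZ; have := ipL 1 0 0 Z l0 l0 hZ; rewrite scaler0 addr0 mul1r => /eqP.
  by rewrite eq_sym -subr_eq0 addrK => /eqP.
have ipS v Z : V 1%N Z -> carnot_ip (PI v) Z = \sum_i v 0 i * carnot_ip (Bb i) Z.
  move=> hZ; rewrite /PI; elim: (index_enum _) => [|i r IH]; first by rewrite !big_nil ip0.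
  rewrite !big_cons ipL ?IH//; first exact: Bb_layer.
  by apply: subspace_sum => //; exact: Bb_layer.
pose K2 := \sum_i \sum_j `|carnot_ip (Bb j) (Bb i)|.
have K20 : 0 <= K2 by apply: sumr_ge0 => i _; exact: sumr_ge0.
exists (Num.sqrt K2); first exact: sqrtr_ge0.
move=> v; have h : carnot_ip (PI v) (PI v) <= K2 * `|v| ^+ 2.
  rewrite ipS; last exact: PI_layer.
  rewrite mulr_suml; apply: ler_sum => i _.
  rewrite ipC; [|exact: Bb_layer|exact: PI_layer].
  rewrite ipS; last exact: Bb_layer.
  rewrite mulr_suml mulr_sumr; apply: ler_sum => j _.
  apply: le_trans (ler_norm _) _; rewrite !normrM mulrA mulrC ler_wpM2l//.
  by rewrite expr2; apply: ler_pM => //; exact: coord_norm_le.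
have q : 0 <= K2 * `|v| ^+ 2 by rewrite mulr_ge0// sqr_ge0.
apply: (le_trans (ler_wsqrtr h)); rewrite sqrtrM// sqrtr_sqr.
by rewrite normr_id.
Qed.

Variables (rho C : R) (Exp : 'rV[R]_n -> G).
Hypotheses (rho0 : 0 < rho) (C0 : 0 <= C).
Hypothesis Eosg : forall a, is_osg (fun t => Exp (t *: a)).
Hypothesis Eloc : forall b, `|b| < rho -> locp (Xi c) (io c) (Exp b) /\ `|Xi c (Exp b) - b| <= C * `|b| ^+ 2.
Hypothesis Euniq : forall a g1 g2, is_osg g1 -> is_osg g2 ->
  tangent (Xi c) (io c) g1 a -> tangent (Xi c) (io c) g2 a -> g1 =1 g2.

Lemma Exp_tangent a : tangent (Xi c) (io c) (fun t => Exp (t *: a)) a.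
Proof.
move=> e e0; pose d := Num.min (rho / (`|a| + 1)) (e / (C * `|a| ^+ 2 + 1)).
have a1 : 0 < `|a| + 1 by rewrite ltr_wpDl.
have c1 : 0 < C * `|a| ^+ 2 + 1 by rewrite ltr_wpDl// mulr_ge0// sqr_ge0.
exists d; first by rewrite lt_min !divr_gt0.
move=> t; rewrite lt_min !ltr_pdivlMr// => /andP[t1 t2].
have [|l b] := Eloc (b := t *: a).
  rewrite normrZ; apply: le_lt_trans t1; rewrite ler_wpM2l// lerDl//.
split=> //; apply: (le_trans b); rewrite normrZ exprMn.
have -> : C * (`|t| ^+ 2 * `|a| ^+ 2) = `|t| * (C * `|a| ^+ 2) * `|t| by ring.
rewrite ler_wpM2r//; apply: le_trans (ltW t2).
by rewrite ler_wpM2l// lerDl.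
Qed.

Definition E v := Exp (av v).

Lemma E_osg v : is_osg (fun t => E (t *: v)).
Proof. by move=> s t; rewrite /E !avZ; exact: Eosg. Qed.

Lemma E_tangent v : tangent (Xi c) (io c) (fun t => E (t *: v)) (av v).
Proof.
by move=> e /(Exp_tangent (av v))[d d0 hd]; exists d => // t /hd; rewrite /E avZ.
Qed.

Lemma E0 : E 0 = 1%g.
Proof. by have := osg0 (E_osg 0); rewrite scaler0. Qed.

Lemma E_opp v : E (- v) = (E v)^-1%g.
Proof.
have := E_osg v 1 (- 1); rewrite subrr scale0r scaleN1r scale1r E0.
by move=> /(congr1 (fun x => (E v)^-1 * x)%g); rewrite mulg1 mulKg.
Qed.

Lemma E_add s t v : E ((s + t) *: v) = (E (s *: v) * E (t *: v))%g.
Proof. exact: E_osg. Qed.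

Lemma dil_morph r : 0 < r -> {morph (carnot_dil r : G -> G) : x y / (x * y)%g}.
Proof. by case/(@carnot_dilP _ G) => -[]. Qed.

Lemma dil1 r : 0 < r -> carnot_dil r (1%g : G) = 1%g.
Proof.
move=> /dil_morph h; have := h 1%g 1%g; rewrite mulg1 => /(congr1 (fun x => (carnot_dil r 1)^-1 * x)%g).
by rewrite mulKg mulVg.
Qed.

Lemma dil_smooth r : 0 < r -> smooth_map A A (carnot_dil r).
Proof. by case/(@carnot_dilP _ G) => -[_ [g []]]. Qed.

Lemma dil_cont r : 0 < r -> continuous (carnot_dil r : G -> G).
Proof. by move=> /dil_smooth/map_cont. Qed.

(** The dilated one-parameter subgroup is again one, and the action of the dilation on layer 1 gives
    it the tangent [av (r *: v)]; uniqueness concludes. *)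
Lemma dil_E r v : 0 < r -> carnot_dil r (E v) = E (r *: v).
Proof.
move=> r0.
have : (carnot_dil r \o (fun t => E (t *: v))) =1 (fun t => E (t *: (r *: v))).
  apply: (@Euniq (av (r *: v))); [|exact: E_osg| |exact: E_tangent].
    by move=> s t /=; rewrite E_osg dil_morph.
  apply: (@derive_tangent R n G c Ac dc (fun t => carnot_dil r (E (t *: v))) (av (r *: v))); first by rewrite /= scale0r E0 dil1.
    have h := tangent_cvg Ac dc (E_tangent v).
    apply: (cvg_comp _ _ h); rewrite -{2}(dil1 r0); exact: dil_cont.
  move=> j; have g0 : E (0 *: v) = 1%g by rewrite scale0r E0.
  have := tangent_derive Ac dc g0 (E_tangent v) (smooth_comp_map (dil_smooth r0) (xi_smooth Ac dc j)).
  have -> : tv c (xi j \o carnot_dil r) (av v) = av (r *: v) 0 j; last by [].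
  have := lieE Ac dc 1%g (PI_lie v) (smooth_comp_map (dil_smooth r0) (xi_smooth Ac dc j)).
  rewrite (_ : (fun x => _) = xi j \o carnot_dil r); last by apply/funext => x; rewrite mul1g.
  move=> <-; have [_ pt] := carnot_dilP G r0.
  have s0 : (0 < 1 <= carnot_step G)%N by have [-> _ _ _ _] := carnot_stratified G.
  rewrite (pt 1%N _ s0 (PI_layer v)) /= dil1// expr1 avZ.
  by rewrite /av !mxE.
by move=> /(_ 1) /=; rewrite !scale1r.
Qed.

(** The curve $t \mapsto x E(tv)$ on $[0,1]$ is horizontal with the constant velocity field [PI v],
    so its length is the norm of that field. *)
Lemma E_dist : exists2 K, 0 <= K & forall x v, (carnot_dist x (x * E v)%g <= (K * `|v|)%:E)%E.
Proof.
have [K K0 hK] := ip_bound; exists K => // x v.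
apply: (@le_trans _ _ (Num.sqrt (carnot_ip (PI v) (PI v)))%:E); last by rewrite lee_fin.
apply: ereal_inf_lbound.
exists (fun t => x * E (t *: v))%g, (fun=> PI v); split.
- split; last by move=> phi sphi; exact: (osg_ac x (@E_osg v) (PI_lie v) (@E_tangent v) sphi).
  have cc : continuous (fun t : R => (x * E (t *: v))%g).
    have cE : continuous (fun t : R => E (t *: v)).
      exact: (osg_cont Ac dc (@E_osg v) (@E_tangent v)).
    move=> t; exact: (continuous_comp (cE t) (@mulL_cont R n G x _)).
  exact: continuous_subspaceT.
- by rewrite scale0r E0 mulg1.
- by rewrite scale1r.
- apply: aeW => t _; split; first exact: PI_layer.
  by move=> phi sphi; exact: (osg_velocity x t (@E_osg v) (PI_lie v) (@E_tangent v) sphi).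
rewrite integral_cst//; rewrite -[X in X = _]mule1; congr (_ * _)%E.
transitivity (lebesgue_measure ([set` `[0%R, 1%R]] : set R)); last by [].
by rewrite lebesgue_measure_itv /= lte_fin ltr01 oppr0 adde0.
Qed.
End Carnot.

(** * Adjoint action *)

Section Ad.
Context {R : realType} {G : carnotGroup R}.
Local Notation n := (carnot_dim G).
Local Notation A := (@lie_atlas R n G).
Local Notation e_ i := (delta_mx 0 i).
Implicit Types (phi psi : G -> R) (X Y : operator G) (x y h : G).
Variable c : chart R n G.
Hypothesis (Ac : A c) (dc : chart_dom c 1%g).
Local Notation p := (c 1%g).
Local Notation xi := (xi Ac dc).
Local Notation vec := (vec Ac dc).
Local Notation lc := (locp (Xi c) (io c)).
Variables (rho C : R) (Exp : 'rV[R]_n -> G).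
Hypotheses (rho0 : 0 < rho) (C0 : 0 <= C).
Hypothesis Eosg : forall a, is_osg (fun t => Exp (t *: a)).
Hypothesis Eloc : forall b, `|b| < rho -> lc (Exp b) /\ `|Xi c (Exp b) - b| <= C * `|b| ^+ 2.
Hypothesis Euniq : forall a (g1 g2 : R -> G), is_osg g1 -> is_osg g2 ->
  tangent (Xi c) (io c) g1 a -> tangent (Xi c) (io c) g2 a -> g1 =1 g2.

Lemma is_derive_near0 (f : R -> R) l e : is_derive (0 : R) 1 f l -> 0 < e ->
  \forall t \near (0 : R), `|f t - f 0 - t * l| <= e * `|t|.
Proof.
move=> /is_deriveP h e0; have [d d0 hd] := h _ e0.
apply/nbhs_ballP; exists d => // t; rewrite -ball_normE /= sub0r normrN => /hd.
by rewrite add0r.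
Qed.

Definition cj h x := (h * x * h^-1)%g.

Lemma smooth_cj h phi : smooth phi -> smooth (phi \o cj h).
Proof.
move=> s; have := smooth_L h (smooth_R h^-1%g s).
by congr (smooth _); apply/funext.
Qed.

(** The adjoint action of [h] in the coordinates [vec]. *)
Definition vAd h (a : 'rV[R]_n) : 'rV[R]_n := \row_j tv c (xi j \o cj h) a.

Lemma vAd_lin h k a b : vAd h (k *: a + b) = k *: vAd h a + vAd h b.
Proof. by apply/rowP => j; rewrite !mxE tv_lin. Qed.

Lemma cj_cont h : continuous (cj h).
Proof.
move=> x; exact: (continuous_comp (@mulL_cont R n G h x) (@mulR_cont R n G h^-1%g _)).
Qed.

Lemma cj1 h : cj h 1%g = 1%g. Proof. by rewrite /cj mulg1 mulgV. Qed.
Lemma cjM h x y : cj h (x * y)%g = (cj h x * cj h y)%g.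
Proof. by rewrite /cj !mulgA mulgVK. Qed.

Lemma Exp0 : Exp 0 = 1%g.
Proof. by have := osg0 (Eosg 0); rewrite scaler0. Qed.

Let Etan := Exp_tangent rho0 C0 Eloc.

Lemma Exp_conj h a t : cj h (Exp (t *: a)) = Exp (t *: vAd h a).
Proof.
have : (fun t => cj h (Exp (t *: a))) =1 (fun t => Exp (t *: vAd h a)).
  apply: (@Euniq (vAd h a)); [|exact: Eosg| |exact: Etan].
    by move=> s t' /=; rewrite Eosg cjM.
  apply: (@derive_tangent R n G c Ac dc (fun t => cj h (Exp (t *: a)))).
  - by rewrite scale0r Exp0 cj1.
  - apply: (cvg_comp _ _ (tangent_cvg Ac dc (Etan a))).
    by rewrite -{2}(cj1 h); exact: cj_cont.
  move=> j; rewrite mxE; have g0 : Exp (0 *: a) = 1%g by rewrite scale0r Exp0.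
  exact: (tangent_derive Ac dc g0 (Etan a) (smooth_cj h (xi_smooth Ac dc j))).
exact.
Qed.

Lemma tv_conj h phi a : smooth phi -> tv c (phi \o cj h) a = tv c phi (vAd h a).
Proof.
move=> s; have g0 b : Exp (0 *: b) = 1%g by rewrite scale0r Exp0.
have [_ d1] := tangent_derive Ac dc (g0 _) (Etan a) (smooth_cj h s).
have [_ d2] := tangent_derive Ac dc (g0 _) (Etan (vAd h a)) s.
have e : (phi \o cj h) \o (fun t : R => Exp (t *: a)) = phi \o (fun t => Exp (t *: vAd h a)).
  by apply/funext => t /=; rewrite Exp_conj.
exact: (etrans (esym d1) (etrans (congr1 (fun f : R -> R => 'D_1 f 0) e) d2)).
Qed.

Lemma vAd_comp h (g : G) a : vAd (h * g)%g a = vAd h (vAd g a).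
Proof.
apply/rowP => j; rewrite [RHS]mxE -tv_conj; last exact/smooth_cj/xi_smooth.
rewrite mxE; congr (tv c _ a); apply/funext => x /=.
by rewrite /cj invgM !mulgA.
Qed.

Lemma vAd1 a : vAd 1%g a = a.
Proof.
apply/rowP => j; rewrite mxE -(tv_xi Ac dc j a); congr (tv c _ a).
by apply/funext => x /=; rewrite /cj mul1g invg1 mulg1.
Qed.

Section Bracket.
Variables (X Y : operator G).
Hypotheses (lX : lie_algebra X) (lY : lie_algebra Y).
Local Notation a := (vec X).
Local Notation b := (vec Y).
Local Notation gam t := (Exp (t *: vec X)).

Definition Nj j (w : 'rV[R]_(n + n)) : R := xi j (chart_inv c (lsubmx w) * chart_inv c (rsubmx w))%g.

Lemma Nj_smooth j : exists W : set 'rV[R]_(n + n), [/\ open W, W (row_mx p p) & Cinf W (Nj j)].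
Proof.
have [W [oW Wp _ hW]] := mul_smooth Ac Ac dc dc (smooth_at (x := (1 * 1)%g) (xi_smooth Ac dc j)).
by exists W.
Qed.

(** The matrix of the differential at 1 of right translation by [gam t], read through the functions
    [xi j]; [Zij] is its derivative at [t = 0]. *)
Definition Pij i j t := 'D_(e_ i) ((fun x => xi j (x * gam t)%g) \o chart_inv c) p.
Definition Zij i j := \sum_k a 0 k * 'D_(e_ (rshift n k)) ('D_(e_ (lshift n i)) (Nj j)) (row_mx p p).

Lemma NjE j u v : Nj j (row_mx u v) = xi j (chart_inv c u * chart_inv c v)%g.
Proof. by rewrite /Nj row_mxKl row_mxKr. Qed.

Lemma gam_near : \forall t \near (0 : R), chart_inv c (c (gam t)) = gam t.
Proof.
have [d d0 hd] := Etan a ltr01; apply/nbhs_ballP; exists d => // t.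
by rewrite -ball_normE /= sub0r normrN => /hd[/lcE].
Qed.

Lemma gam_deriv : is_derive (0 : R) 1 (fun t => c (gam t)) a.
Proof.
have g0 : gam 0 = 1%g by rewrite scale0r Exp0.
apply: is_derive_rV => j; apply/is_deriveP => e e0; have [d d0 hd] := Etan a e0.
exists d => // h /hd[_]; apply: le_trans.
have := coord_norm_le (Xi c (gam h) - h *: a) j; apply: le_trans.
by rewrite add0r g0 /Xi !mxE.
Qed.

Lemma row_deriv : is_derive (0 : R) 1 (fun t => row_mx p (c (gam t)) : 'rV[R]_(n + n)) (row_mx 0 a).
Proof.
apply: is_derive_rV => k; case: (split_ordP k) => i ->.
  rewrite row_mxEl mxE (_ : (fun _ => _) = fun=> p 0 i); last by apply/funext => t; rewrite row_mxEl.
  exact: is_derive_cst.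
rewrite row_mxEr (_ : (fun _ => _) = fun t => c (gam t) 0 i); last by apply/funext => t; rewrite row_mxEr.
exact: derivable_rV_coord gam_deriv.
Qed.

Lemma Pij_deriv i j : is_derive (0 : R) 1 (Pij i j) (Zij i j).
Proof.
have g0 : gam 0 = 1%g by rewrite scale0r Exp0.
have [W [oW Wp hW]] := Nj_smooth j.
have E0 : row_mx p (c (gam 0)) = row_mx p p :> 'rV_(n + n) by rewrite g0.
have W0 : W (row_mx p (c (gam 0))) by rewrite E0.
have := @is_derive_comp_rV R _ _ W _ (fun t : R => row_mx p (c (gam t)) : 'rV[R]_(n + n)) 0 1 _ oW (Ck_D (lshift n i) (hW 2%N)) W0 row_deriv.
have gen (D : 'I_(n + n) -> R) : \sum_k (row_mx 0 a) 0 k * D k = \sum_k a 0 k * D (rshift n k).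
  rewrite big_split_ord /= big1 ?add0r; last by move=> k _; rewrite row_mxEl mxE mul0r.
  by apply: eq_bigr => k _; rewrite row_mxEr.
rewrite (gen (fun k => 'D_(e_ k) ('D_(e_ (lshift n i)) (Nj j)) (row_mx p (c (gam 0))))) E0.
rewrite -/(Zij i j).
have nW : \forall t \near (0 : R), W (row_mx p (c (gam t))).
  have [dF _] := row_deriv.
  have cF : {for (0 : R), continuous (fun t : R => row_mx p (c (gam t)) : 'rV[R]_(n + n))}.
    by apply: differentiable_continuous; apply/derivable1_diffP.
  by apply: cF; rewrite /= E0; exact: open_nbhs_nbhs.
have key : \forall t \near (0 : R), ('D_(e_ (lshift n i)) (Nj j) \o (fun t => row_mx p (c (gam t)))) t = Pij i j t.
  near=> t; have Wt : W (row_mx p (c (gam t))) by near: t.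
  have it : chart_inv c (c (gam t)) = gam t by near: t; exact: gam_near.
  have [_] := is_derive_lsub (Ck_derivable (i := lshift n i) (hW 1%N) Wt).
  have e : (fun u : 'rV[R]_n => Nj j (row_mx u (c (gam t)))) = (fun x => xi j (x * gam t)%g) \o chart_inv c.
    by apply/funext => u; rewrite NjE it.
  by move=> d; exact: (etrans (esym d) (congr1 (fun f : 'rV[R]_n -> R => 'D_(e_ i) f p) e)).
move=> /is_deriveP H; apply/is_deriveP => e e0; have [d d0 hd] := H e e0.
move: key => /nbhs_ballP[d' /= d'0 hd'].
exists (Num.min d d'); first by rewrite lt_min d0.
move=> h; rewrite lt_min => /andP[h1 h2]; have := hd _ h1.
have bh : ball (0 : R) d' (0 + h) by rewrite [X in ball _ _ X]add0r -ball_normE /= sub0r normrN.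
have qh : _ = Pij i j (0 + h) := hd' _ bh.
have q0 : _ = Pij i j 0 := hd' 0 (ballxx _ d'0).
by rewrite -qh -q0.
Unshelve. all: by end_near. Qed.

(** Differentiating the product in its right factor along [a] and then in its left factor gives the
    mixed derivatives of [Zij] in the opposite order; Schwarz identifies them. *)
Lemma XxiE i j : 'D_(e_ i) ((X (xi j)) \o chart_inv c) p = Zij i j.
Proof.
have [W [oW Wp hW]] := Nj_smooth j.
have nW : \forall u \near p, W (row_mx u p).
  have [r r0 hr] := open_ball_rV oW Wp.
  apply/nbhs_ballP; exists r => // u hu; apply: hr; apply: row_mx_norm => //.
  exact: ballxx.
pose f u := \sum_k a 0 k * 'D_(e_ (rshift n k)) (Nj j) (row_mx u p).
have -> : 'D_(e_ i) ((X (xi j)) \o chart_inv c) p = 'D_(e_ i) f p.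
  apply: near_eq_derive; near=> u; have Wu : W (row_mx u p) by near: u.
  rewrite /= (lieE Ac dc)//; last exact: xi_smooth.
  apply: eq_bigr => k _; congr (_ * _).
  have [_ d] := is_derive_rsub (Ck_derivable (i := rshift n k) (hW 1%N) Wu).
  have e : (fun x => xi j (chart_inv c u * x)%g) \o chart_inv c = (fun y : 'rV[R]_n => Nj j (row_mx u y)).
    by apply/funext => v; rewrite NjE.
  exact: (etrans (congr1 (fun f : 'rV[R]_n -> R => 'D_(e_ k) f p) e) d).
have df k : is_derive p (e_ i) (fun u => a 0 k * 'D_(e_ (rshift n k)) (Nj j) (row_mx u p))
    (a 0 k * 'D_(e_ (lshift n i)) ('D_(e_ (rshift n k)) (Nj j)) (row_mx p p)).
  have d1 := is_derive_lsub (Ck_derivable (i := lshift n i) (Ck_D (rshift n k) (hW 2%N)) Wp).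
  exact: (is_deriveZ (a 0 k) d1).
have := is_derive_sum df.
rewrite (_ : \sum_(k < n) _ = f); last by apply/funext => u; rewrite /f fct_sumE.
move=> [_ d]; apply: (etrans d); apply: eq_bigr => k _.
exact: (congr1 (fun z => a 0 k * z) (Schwarz (lshift n i) (rshift n k) oW (hW 2%N) Wp)).
Unshelve. all: by end_near. Qed.

Lemma Pij0 i j : Pij i j 0 = (i == j)%:R.
Proof.
have gen (D : 'I_n -> R) : \sum_k (e_ i : 'rV[R]_n) 0 k * D k = D i.
  rewrite (bigD1 i)//= mxE !eqxx mul1r big1 ?addr0// => k ki.
  by rewrite mxE eqxx /= (negbTE ki) mul0r.
have e : (fun x => xi j (x * gam 0)%g) = xi j.
  by apply/funext => x; rewrite scale0r Exp0 mulg1.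
rewrite /Pij e; transitivity (tv c (xi j) (e_ i)); first by rewrite /tv gen.
by rewrite tv_xi mxE eqxx eq_sym.
Qed.

(** At [gam t] the left-invariant field [Y] is the right translate of the tangent vector
    $\mathrm{Ad}(\mathrm{gam}\,t)Y$ at 1. *)
Lemma vAd_P j t : Y (xi j) (gam t) = \sum_i (vAd (gam t) b) 0 i * Pij i j t.
Proof.
rewrite (lieE Ac dc)//; last exact: xi_smooth.
rewrite (_ : (fun x => _) = (fun x => xi j (x * gam t)%g) \o cj (gam t)); last first.
  by apply/funext => x; rewrite /= /cj mulgVK.
by rewrite tv_conj//; apply/smooth_R/xi_smooth.
Qed.

Lemma vec_bracket j : vec (lie_bracket X Y) 0 j = tv c (Y (xi j)) a - \sum_i b 0 i * Zij i j.
Proof.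
have sX : smooth (X (xi j)) by case: lX => -[h _ _ _] _; apply/h/xi_smooth.
have sY : smooth (Y (xi j)) by case: lY => -[h _ _ _] _; apply/h/xi_smooth.
rewrite mxE -[lie_bracket X Y _ _]/(X (Y (xi j)) 1%g - Y (X (xi j)) 1%g).
rewrite (der_at1 Ac dc lX.1)// (der_at1 Ac dc lY.1)//; congr (_ - _).
by apply: eq_bigr => i _; rewrite XxiE.
Qed.

(** The formula $\frac{d}{dt}\mathrm{Ad}(\exp tX)Y = [X,Y]$ at $t = 0$. By [vAd_P] the increment $w
    = \mathrm{Ad}(\exp tX)Y - Y$ is known only implicitly, through the matrix [Pij] close to the
    identity; the term of [w] against [Pij] minus the identity is absorbed. *)
Lemma ad_deriv e : 0 < e -> \forall t \near (0 : R),
  `|vAd (gam t) b - b - t *: vec (lie_bracket X Y)| <= e * `|t|.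
Proof.
move=> e0; set z := vec (lie_bracket X Y).
have g0 : gam 0 = 1%g by rewrite scale0r Exp0.
pose M := \sum_i `|b 0 i| + 1.
have M0 : 0 < M by rewrite ltr_wpDl// sumr_ge0.
pose e1 := Num.min 1 (e / 4) / M.
have e10 : 0 < e1 by rewrite divr_gt0// lt_min ltr01 divr_gt0.
(* The bound 1/2 gives the a priori estimate [|w| <= 2 * (|t| * (|z| + 1))]; the other bound then
   makes the absorbed term at most [e / 2 * |t|]. *)
pose eta := Num.min (2^-1) (e / (4 * (`|z| + 1))) / n.+1%:R.
have z1 : 0 < `|z| + 1 by rewrite ltr_wpDl.
have eta0 : 0 < eta by rewrite divr_gt0// lt_min invr_gt0 ltr0n divr_gt0// mulr_gt0.
have sY j : smooth (Y (xi j)) by case: lY => -[h _ _ _] _; apply/h/xi_smooth.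
have dQ j := tangent_derive Ac dc g0 (Etan a) (sY j).
near=> t.
have hQ j : `|Y (xi j) (gam t) - b 0 j - t * tv c (Y (xi j)) a| <= e1 * `|t|.
  have -> : b 0 j = (Y (xi j) \o (fun t => gam t)) 0 by rewrite /= g0 mxE.
  move: j; near: t; apply: filter_forall => j; exact: (is_derive_near0 (dQ j) e10).
have hP i j : `|Pij i j t - (i == j)%:R - t * Zij i j| <= e1 * `|t|.
  rewrite -Pij0; move: i j; near: t; apply: filter_forall => i; apply: filter_forall => j.
  exact: (is_derive_near0 (Pij_deriv i j) e10).
have hP2 i j : `|Pij i j t - (i == j)%:R| <= eta.
  rewrite -Pij0 distrC; move: i j; near: t; apply: filter_forall => i; apply: filter_forall => j.
  have cP : {for (0 : R), continuous (Pij i j)}.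
    by apply: differentiable_continuous; apply/derivable1_diffP; case: (Pij_deriv i j).
  by move/cvgrPdist_le : cP => /(_ _ eta0).
pose w := vAd (gam t) b - b.
have hw j : w 0 j - t * z 0 j = (Y (xi j) (gam t) - b 0 j - t * tv c (Y (xi j)) a)
   - \sum_i b 0 i * (Pij i j t - (i == j)%:R - t * Zij i j) - \sum_i w 0 i * (Pij i j t - (i == j)%:R).
  have dl (u : 'rV[R]_n) : \sum_i u 0 i * (i == j)%:R = u 0 j.
    rewrite (bigD1 j)//= eqxx mulr1 big1 ?addr0// => i ij.
    by rewrite (negbTE ij) mulr0.
  have -> : \sum_i b 0 i * (Pij i j t - (i == j)%:R - t * Zij i j) =
    \sum_i b 0 i * Pij i j t - b 0 j - t * \sum_i b 0 i * Zij i j.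
    rewrite -[b 0 j]dl mulr_sumr -!sumrB; apply: eq_bigr => i _; ring.
  have -> : \sum_i w 0 i * (Pij i j t - (i == j)%:R) =
    (Y (xi j) (gam t) - \sum_i b 0 i * Pij i j t) - w 0 j.
    rewrite vAd_P -[w 0 j]dl -!sumrB; apply: eq_bigr => i _.
    by rewrite /w !mxE; ring.
  by rewrite /z vec_bracket; ring.
have m0 : 0 <= Num.min 1 (e / 4) by rewrite le_min ler01 ltW// divr_gt0.
have m5 : 0 <= n.+1%:R * eta by rewrite mulr_ge0// ltW.
have bw : `|w - t *: z| <= Num.min 1 (e / 4) * `|t| + n.+1%:R * eta * `|w|.
  apply: rV_norm_le.
    by rewrite addr_ge0// mulr_ge0.
  move=> j; have e2 (u v : 'rV[R]_n) : (u - t *: v) 0 j = u 0 j - t * v 0 j by rewrite !mxE.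
  rewrite e2 hw; apply: le_trans (ler_normB _ _) _; apply: lerD.
    apply: le_trans (ler_normB _ _) _.
    have s1 : `|\sum_i b 0 i * (Pij i j t - (i == j)%:R - t * Zij i j)| <= (\sum_i `|b 0 i|) * (e1 * `|t|).
      apply: le_trans (ler_norm_sum _ _ _) _; rewrite mulr_suml; apply: ler_sum => i _.
      by rewrite normrM ler_wpM2l.
    apply: le_trans (lerD (hQ j) s1) _.
    rewrite -[X in X + _]mul1r -mulrDl [1 + _]addrC -/M /e1 mulrA [M * _]mulrC divfK ?gt_eqF//.
  apply: le_trans (ler_norm_sum _ _ _) _.
  apply: (@le_trans _ _ (\sum_(i < n) eta * `|w|)).
    apply: ler_sum => i _; rewrite normrM mulrC.
    by apply: ler_pM => //; exact: coord_norm_le.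
  rewrite sumr_const card_ord -[_ *+ n]mulr_natl mulrA ler_wpM2r// ler_wpM2r ?(ltW eta0)//.
  by rewrite ler_nat.
have m1 : Num.min 1 (e / 4) <= 1 by rewrite ge_min lexx.
have m2 : Num.min 1 (e / 4) <= e / 4 by rewrite ge_min lexx orbT.
have m3 : n.+1%:R * eta <= 2^-1 by rewrite /eta mulrC divfK ?pnatr_eq0// ge_min lexx.
have m4 : n.+1%:R * eta * (`|z| + 1) <= e / 4.
  rewrite /eta mulrC; rewrite [n.+1%:R * _]mulrC divfK ?pnatr_eq0//.
  have : Num.min 2^-1 (e / (4 * (`|z| + 1))) <= e / (4 * (`|z| + 1)) by rewrite ge_min lexx orbT.
  move=> /(ler_wpM2l (ltW z1)) /le_trans; apply.
  by rewrite le_eqVlt; apply/orP; left; apply/eqP; field; rewrite gt_eqF.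
have tw : `|w| <= `|w - t *: z| + `|t| * `|z|.
  by have := ler_normD (w - t *: z) (t *: z); rewrite subrK normrZ.
move: bw m5 m1 m2 m3 m4 tw (normr_ge0 t) (normr_ge0 w) (normr_ge0 z); rewrite -/w.
move: `|w - _| `|w| `|z| `|t| (Num.min 1 (e / 4)) (n.+1%:R * eta) => u W0 Z T k1 k2.
move=> bw k20 m1 m2 m3 m4 tw T0 W00 Z0.
have q1 : k1 * T <= T by rewrite ler_piMl.
have q2 : k2 * W0 <= 2^-1 * W0 by rewrite ler_wpM2r.
have q3 : W0 <= 2 * (T * (Z + 1)) by rewrite mulrDr mulr1; move: q1 q2 bw tw; move: (k1 * T) (k2 * W0) (T * Z) => *; lra.
have q4 : k1 * T <= e / 4 * T by rewrite ler_wpM2r.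
have q5 : k2 * W0 <= 2 * (T * (k2 * (Z + 1))).
  by apply: (le_trans (ler_wpM2l k20 q3)); rewrite le_eqVlt; apply/orP; left; apply/eqP; ring.
have q6 : T * (k2 * (Z + 1)) <= T * (e / 4) by rewrite ler_wpM2l.
have q7 : 0 <= e * T by rewrite mulr_ge0// ltW.
move: q4 q5 q6 q7 bw; rewrite [T * (e / 4)]mulrC mulrAC.
by move: (e * T) (T * (k2 * _)) (k1 * T) (k2 * W0) => *; lra.
Unshelve. all: by end_near. Qed.
End Bracket.
End Ad.

(** * Chow's theorem *)

Section Basis.
Context {F : fieldType} {n : nat}.
(** As long as fewer than [n] rows are chosen, they annihilate some nonzero column [l]; a row of [S]
    that does not annihilate [l] is independent of them. *)
Lemma pick_rows (S : 'rV[F]_n -> Prop) :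
  (forall l : 'cV[F]_n, (forall a, S a -> a *m l = 0) -> l = 0) ->
  forall k, (k <= n)%N -> exists M : 'M[F]_(k, n), (forall i, S (row i M)) /\ row_free M.
Proof.
move=> hS; elim=> [|k IH] kn.
  exists 0; split; first by case.
  by rewrite /row_free mxrank0.
have [M [MS Mf]] := IH (ltnW kn).
have [l [l0 Ml]] : exists l : 'cV[F]_n, l != 0 /\ M *m l = 0.
  have : cokermx M != 0.
    rewrite -mxrank_eq0 mxrank_coker; move: Mf; rewrite /row_free => /eqP ->.
    by rewrite subn_eq0 -ltnNge.
  move=> /matrix0Pn[i [j hij]]; exists (col j (cokermx M)); split.
    by apply/eqP => /matrixP/(_ i 0); rewrite [LHS]mxE [RHS]mxE => /eqP; rewrite (negbTE hij).
  by rewrite colE mulmxA mulmx_coker mul0mx.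
have [s [Ss sl]] : exists s, S s /\ s *m l != 0.
  apply: contrapT => h; move/eqP: l0; apply; apply: hS => a Sa.
  by apply: contrapT => /eqP al; apply: h; exists a.
rewrite -addn1; exists (col_mx M s); split.
  move=> i; case: (split_ordP i) => j ->; first by rewrite rowKu.
  by rewrite rowKd row_id.
apply: inj_row_free => w; rewrite -[w]hsubmxK mul_row_col => e.
have r0 : rsubmx w = 0.
  have := congr1 (fun A => A *m l) e; rewrite mulmxDl -!mulmxA Ml mulmx0 add0r mul0mx.
  rewrite [rsubmx w]mx11_scalar mul_scalar_mx => /eqP; rewrite scaler_eq0 (negbTE sl) orbF.
  by move=> /eqP ->; rewrite raddf0.
have l0' : lsubmx w = 0.
  by apply: (row_free_inj Mf); rewrite mul0mx -[RHS]e r0 mul0mx addr0.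
by rewrite r0 l0' row_mx0.
Qed.
End Basis.

Section Contr.
Context {R : realType} {n : nat}.
(** The increments form a geometric series bounded by [2 * |T 0|], so the iterates from 0 never
    leave the region where [T] contracts. *)
Lemma contr_fix (T : 'rV[R]_n -> 'rV[R]_n) r :
  (forall u u', `|u| < r -> `|u'| < r -> `|T u - T u'| <= 2^-1 * `|u - u'|) ->
  2 * `|T 0| < r -> exists l, `|l| <= 2 * `|T 0| /\ T l = l.
Proof.
move=> hT hr; set K := `|T 0| in hr *; have K0 : 0 <= K by exact: normr_ge0.
pose u k := iter k T 0.
have hu k : `|u k| <= 2 * K - 2 * K * dy k /\ `|u k.+1 - u k| <= K * dy k.
  have d0 : dy 0 = 1 :> R by rewrite /dy expr0 invr1.
  have r0 : 0 < r by apply: le_lt_trans hr; rewrite mulr_ge0.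
  elim: k => [|k [IH1 IH2]].
    by rewrite d0 !mulr1 subrr /u /= subr0 normr0.
  have h1 : `|u k.+1| <= 2 * K - 2 * K * dy k.+1.
    have := ler_normD (u k.+1 - u k) (u k); rewrite subrK => /le_trans; apply.
    apply: (le_trans (lerD IH2 IH1)); rewrite dyS.
    by rewrite le_eqVlt; apply/orP; left; apply/eqP; field.
  split=> //; have lt j : `|u j| <= 2 * K - 2 * K * dy j -> `|u j| < r.
    move=> h; apply: le_lt_trans h _; apply: le_lt_trans hr.
    by rewrite gerBl !mulr_ge0// ltW// dy0.
  apply: (le_trans (hT _ _ (lt _ h1) (lt _ IH1))); rewrite dyS mulrA mulrC.
  by rewrite ler_wpM2r.
have [l hl] := @cauchy_geom R n u K K0 (fun k => (hu k).2).
have d0 : dy 0 = 1 :> R by rewrite /dy expr0 invr1.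
have ln : `|l| <= 2 * K by have := hl 0%N; rewrite /u /= subr0 d0 mulr1.
have lr : `|l| < r by apply: le_lt_trans ln hr.
exists l; split=> //; apply/eqP; rewrite -subr_eq0 -normr_le0.
apply: (@dy_lim _ _ _ (4 * K)) => k; rewrite add0r.
have ur : `|u k| < r.
  apply: le_lt_trans (hu k).1 _; apply: le_lt_trans hr.
  by rewrite gerBl !mulr_ge0// ltW// dy0.
have h1 := hT _ _ lr ur; have h2 := hl k; have h3 := hl k.+1.
have t := ler_distD (u k.+1) (T l) l; apply: (le_trans t).
rewrite [`|u k.+1 - l|]distrC; rewrite dyS in h3.
rewrite -[T (u k)]/(u k.+1) in h1.
move: h1 h2 h3; have -> : 2 * K * (dy k / 2) = K * dy k by field.
rewrite -!mulrA; have : 0 <= K * dy k by rewrite mulr_ge0// ltW// dy0.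
move: (K * dy k) `|T l - _| `|l - _| `|l - _| => *; lra.
Qed.
End Contr.

Section Chow.
Context {R : realType} {G : carnotGroup R}.
Local Notation n := (carnot_dim G).
Local Notation A := (@lie_atlas R n G).
Local Notation e_ i := (delta_mx 0 i).
Implicit Types (phi psi : G -> R) (X Y : operator G) (x y h : G).
Variable c : chart R n G.
Hypothesis (Ac : A c) (dc : chart_dom c 1%g).
Local Notation p := (c 1%g).
Local Notation xi := (xi Ac dc).
Local Notation vec := (vec Ac dc).
Local Notation V := (carnot_layer G).
Local Notation PI := (PI Ac dc).
Local Notation av := (av Ac dc).
Local Notation lc := (locp (Xi c) (io c)).
Local Notation nr := (near1 (Xi c) (io c)).
Variables (rho C : R) (Exp : 'rV[R]_n -> G).
Hypotheses (rho0 : 0 < rho) (C0 : 0 <= C).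
Hypothesis Eosg : forall a, is_osg (fun t => Exp (t *: a)).
Hypothesis Eloc : forall b, `|b| < rho -> lc (Exp b) /\ `|Xi c (Exp b) - b| <= C * `|b| ^+ 2.
Hypothesis Euniq : forall a (g1 g2 : R -> G), is_osg g1 -> is_osg g2 ->
  tangent (Xi c) (io c) g1 a -> tangent (Xi c) (io c) g2 a -> g1 =1 g2.
Local Notation E := (E Ac dc Exp).
Local Notation vAd := (vAd Ac dc).
Local Notation cj := (cj (G := G)).

Definition PE (s : seq 'rV[R]_n) : G := foldr (fun v g => (E v * g)%g) 1%g s.
Lemma PE_cat s1 s2 : PE (s1 ++ s2) = (PE s1 * PE s2)%g.
Proof. by elim: s1 => [|v s IH] /=; rewrite ?mul1g// IH mulgA. Qed.
Lemma PE_rev s : PE (rev [seq - v | v <- s]) = (PE s)^-1%g.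
Proof.
elim: s => [|v s IH] /=; first by rewrite invg1.
rewrite rev_cons -cats1 PE_cat IH /= mulg1 invgM; congr (_ * _)%g.
exact: E_opp Eosg _.
Qed.

Section Gen.
(** [T] restricts the letters of words. All vectors give Chow's theorem; the restricted form serves
    for letters that are orthogonal or parallel to a direction [u]. *)
Variable T : 'rV[R]_n -> Prop.
Hypothesis Tscal : forall k v, T v -> T (k *: v).
Hypothesis Tspan : forall v, exists v1 v2, [/\ T v1, T v2 & v = v1 + v2].
Definition HT x := exists s, (forall v, v \in s -> T v) /\ PE s = x.

Lemma HTM x y : HT x -> HT y -> HT (x * y)%g.
Proof.
move=> [s [sT <-]] [t [tT <-]]; exists (s ++ t); split; last exact: PE_cat.
by move=> v; rewrite mem_cat => /orP[/sT|/tT].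
Qed.
Lemma HTV x : HT x -> HT x^-1%g.
Proof.
move=> [s [sT <-]]; exists (rev [seq - v | v <- s]); split; last exact: PE_rev.
move=> v; rewrite mem_rev => /mapP[w /sT Tw ->]; rewrite -scaleN1r; exact: Tscal.
Qed.
Lemma HT1 : HT 1%g. Proof. by exists [::]. Qed.
Lemma HTE v : T v -> HT (E v).
Proof. by move=> Tv; exists [:: v]; split; [move=> w; rewrite inE => /eqP->|rewrite /= mulg1]. Qed.

Section Span.
Variable l : 'cV[R]_n.
Hypothesis hl : forall h v, HT h -> T v -> vAd h (av v) *m l = 0.

(* Differentiating [Ad (h * exp (t X)) Y] at t = 0 shows that this set is stable
   under brackets with the first layer, hence it is the whole Lie algebra. *)
Definition Bset : set (operator G) := [set Y | lie_algebra Y /\ forall h, HT h -> vAd h (vec Y) *m l = 0].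

Lemma vAdZ h k a : vAd h (k *: a) = k *: vAd h a.
Proof.
have z : vAd h 0 = 0.
  by have := vAd_lin Ac dc h 1 0 0; rewrite !scale1r addr0 => /eqP; rewrite eq_sym -subr_eq0 addrK => /eqP.
by have := vAd_lin Ac dc h k a 0; rewrite z !addr0.
Qed.
Lemma vAdD h a b : vAd h (a + b) = vAd h a + vAd h b.
Proof. by have := vAd_lin Ac dc h 1 a b; rewrite !scale1r. Qed.

Lemma Bset_lin : linear_subspace Bset.
Proof.
split.
  split; first exact: lie0.
  by move=> h _; rewrite vec0 -(scale0r (0 : 'rV[R]_n)) vAdZ scale0r mul0mx.
move=> k X Y [lX hX] [lY hY]; split; first exact: lie_lin.
by move=> h Hh; rewrite vec_lin vAd_lin mulmxDl -scalemxAl hX// hY// scaler0 addr0.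
Qed.

Lemma Bset1 X : V 1%N X -> Bset X.
Proof.
move=> VX; split; first exact: (@lin1 R G).2 _ VX.
move=> h Hh; rewrite (PI_onto Ac dc VX) -/(av _).
have [v1 [v2 [T1 T2 ->]]] := Tspan (vec X).
by rewrite avD vAdD mulmxDl !hl// addr0.
Qed.

Lemma Bset_bracket1 v Y : T v -> Bset Y -> forall h, HT h ->
  vAd h (vec (lie_bracket (PI v) Y)) *m l = 0.
Proof.
move=> Tv [lY hY] h Hh; set z := vec _.
pose lam (a : 'rV[R]_n) := (vAd h a *m l) 0 0.
have lamD a b : lam (a + b) = lam a + lam b by rewrite /lam vAdD mulmxDl mxE.
have lamZ k a : lam (k *: a) = k * lam a by rewrite /lam vAdZ -scalemxAl mxE.
have lam0 : lam 0 = 0 by rewrite -(scale0r (0 : 'rV[R]_n)) lamZ mul0r.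
pose K := \sum_i `|lam (e_ i)|.
have lamB a : `|lam a| <= K * `|a|.
  have -> : lam a = \sum_i a 0 i * lam (e_ i).
    rewrite {1}[a]row_sum_delta; elim: (index_enum _) => [|i r IH]; first by rewrite !big_nil lam0.
    by rewrite !big_cons lamD lamZ IH.
  apply: le_trans (ler_norm_sum _ _ _) _; rewrite mulr_suml; apply: ler_sum => i _.
  by rewrite normrM mulrC ler_wpM2l//; exact: coord_norm_le.
have K0 : 0 <= K by apply: sumr_ge0.
suff z0 : lam z = 0 by apply/matrixP => i j; rewrite !ord1 [RHS]mxE.
apply/eqP; rewrite -normr_le0; apply/ler_addgt0Pr => e e0; rewrite add0r.
have e1 : 0 < e / (K + 1) by rewrite divr_gt0// ltr_wpDl.
have /nbhs_ballP[d /= d0 hd] := ad_deriv Ac dc rho0 C0 Eosg Eloc Euniq (PI_lie Ac dc v) lY e1.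
have bt : ball (0 : R) d (d / 2) by rewrite -ball_normE /= sub0r normrN ger0_norm ?divr_ge0 ?ltW// ltr_pdivrMr// ltr_pMr// ltr1n.
have := hd _ bt; set t := d / 2; set w := vAd _ _ - vec Y - t *: _ => hw.
have t0 : 0 < t by rewrite divr_gt0.
have lw : lam w = - (t * lam z).
  rewrite /w lamD -scaleNr lamZ lamD -[- vec Y]scaleN1r lamZ mulNr -/z.
  have -> : lam (vec Y) = 0 by rewrite /lam hY// mxE.
  have -> : lam (vAd (Exp (t *: av v)) (vec Y)) = 0; last by rewrite mulr0 subr0 add0r mulNr.
  rewrite /lam -(vAd_comp Ac dc rho0 C0 Eosg Eloc Euniq) hY ?mxE//.
  apply: HTM => //; have := HTE (Tscal t Tv); by rewrite /E avZ.
have : t * `|lam z| <= K * (e / (K + 1) * t).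
  rewrite -[t in t * `|_|](ger0_norm (ltW t0)) -normrM -normrN -lw.
  apply: le_trans (lamB w) _; rewrite ler_wpM2l//; by move: hw; rewrite [`|t|]ger0_norm// ltW.
rewrite mulrA [X in _ <= X]mulrC ler_pM2l// => /le_trans; apply.
rewrite mulrCA ler_piMr ?(ltW e0)// ler_pdivrMr ?ltr_wpDl// mul1r lerDl//.
Qed.

(** Differentiation only reaches brackets with a letter of [T]; a general field of the first layer
    is a sum of two such, by [Tspan]. *)
Lemma Bset_bracket X Y : V 1%N X -> Bset Y -> lie_algebra (lie_bracket X Y) -> Bset (lie_bracket X Y).
Proof.
move=> VX hY lXY; split=> // h Hh.
have [v1 [v2 [T1 T2 e]]] := Tspan (vec X).
have -> : vec (lie_bracket X Y) = vec (lie_bracket (PI v1) Y) + vec (lie_bracket (PI v2) Y).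
  have EX : X = PI v1 + PI v2.
    rewrite {1}(PI_onto Ac dc VX) e; have := PI_lin Ac dc 1 v1 v2.
    by rewrite !scale1r.
  have s j W : lie_algebra W -> smooth (W (xi j)) by case=> -[q _ _ _] _; apply/q/xi_smooth.
  apply/rowP => j; rewrite !mxE.
  rewrite -[LHS]/(X (Y (xi j)) 1%g - Y (X (xi j)) 1%g).
  rewrite -[X in _ = X + _]/(PI v1 (Y (xi j)) 1%g - Y (PI v1 (xi j)) 1%g).
  rewrite -[X in _ = _ + X]/(PI v2 (Y (xi j)) 1%g - Y (PI v2 (xi j)) 1%g).
  have -> : X (Y (xi j)) 1%g = PI v1 (Y (xi j)) 1%g + PI v2 (Y (xi j)) 1%g by rewrite EX.
  have -> : X (xi j) = fun x => PI v1 (xi j) x + PI v2 (xi j) x by rewrite EX.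
  have lY := hY.1; rewrite (der_add lY.1); [|exact/s/PI_lie|exact/s/PI_lie].
  rewrite -[(_ + _ : G -> R) 1%g]/(Y (PI v1 (xi j)) 1%g + Y (PI v2 (xi j)) 1%g).
  ring.
by rewrite vAdD mulmxDl !Bset_bracket1// addr0.
Qed.

Lemma Bset_layer i : (0 < i <= carnot_step G)%N -> V i `<=` Bset.
Proof.
have [_ hV _ _ [hbr _ _]] := carnot_stratified G.
elim: i => // -[_ _|i IH /andP[_ hi]]; first exact: Bset1.
have iS : (0 < i.+1 < carnot_step G)%N by rewrite hi.
have VB := IH (ltnW hi).
rewrite -(hbr _ iS) => Z; apply.
split; first exact: Bset_lin.
move=> _ [X VX [Y VY <-]]; apply: Bset_bracket => //; first exact: VB.
have [_] : linear_subspace (V i.+2) /\ V i.+2 `<=` lie_algebra by apply: hV.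
apply; rewrite -(hbr _ iS); move=> W [_ hW]; apply: hW.
by exists X => //; exists Y.
Qed.

Lemma span_zero : l = 0.
Proof.
have [_ _ hdec _ _] := carnot_stratified G.
have ha (a : 'rV[R]_n) : a *m l = 0.
  have [X lX <-] := lie_of_vec Ac dc a.
  have [Y hY ->] := hdec _ lX.
  have BX : Bset (\sum_(1 <= i < (carnot_step G).+1) Y i).
    rewrite big_seq_cond; elim/big_ind: _.
    - exact: Bset_lin.1.
    - by move=> x y bx by_; have := Bset_lin.2 1 _ _ bx by_; rewrite scale1r.
    move=> i; rewrite mem_index_iota andbT ltnS => hi; exact: (Bset_layer hi (hY _ hi)).
  by have := BX.2 _ HT1; rewrite (vAd1 Ac dc).
apply/colP => i; have := ha (e_ i); rewrite -rowE => /rowP/(_ 0).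
by rewrite !mxE.
Qed.
End Span.

(** A column annihilating all conjugated letters is 0 by [span_zero], so [pick_rows] finds [n]
    independent tangent vectors among these conjugates. *)
Lemma basis_words : exists (hs : 'I_n -> G) (vs : 'I_n -> 'rV[R]_n), (forall i, HT (hs i) /\ T (vs i)) /\
  (\matrix_i vAd (hs i) (av (vs i))) \in unitmx.
Proof.
have [M [MS Mf]] := @pick_rows R n (fun a => exists h v, [/\ HT h, T v & a = vAd h (av v)])
  (fun l hl => span_zero (fun h v Hh Tv => hl _ (ex_intro _ h (ex_intro _ v (And3 Hh Tv erefl))))) n (leqnn n).
have /fin_all_exists[hs /fin_all_exists[vs hv]] := MS.
exists hs, vs; split; first by move=> i; have [] := hv i.
rewrite (_ : \matrix_i _ = M) -?row_free_unit//.
by apply/row_matrixP => i; rewrite rowK; have [_ _ ->] := hv i.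
Qed.

Fixpoint PP (b : nat -> 'rV[R]_n) (t : nat -> R) m : G :=
  if m is m'.+1 then (PP b t m' * Exp (t m' *: b m'))%g else 1%g.

Lemma PP_near b m s : 0 < s -> exists2 r, 0 < r & forall t, (forall i, (i < m)%N -> `|t i| < r) -> nr s (PP b t m).
Proof.
elim: m s => [|m IH] s s0.
  exists 1 => // t _; split; last by rewrite Xi1 normr0.
  by apply: (lc_dom Ac).
have [q q0 hq] := nr_sub2 Ac dc (nr_nbhs Ac dc s0).
have [r r0 hr] := IH _ q0.
have : nbhs (0 : R) [set u | nr q (Exp (u *: b m))].
  by apply: (tangent_cvg Ac dc (Exp_tangent rho0 C0 Eloc (b m))); exact: nr_nbhs.
move=> /nbhs_ballP[d /= d0 hd]; exists (Num.min r d); first by rewrite lt_min r0.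
move=> t ht; apply: hq.
  by apply: hr => i im; have := ht i (ltnW im); rewrite lt_min => /andP[].
apply: hd; rewrite -ball_normE /= sub0r normrN.
by have := ht m (ltnSn m); rewrite lt_min => /andP[].
Qed.

Lemma Exp_strict b e : 0 < e -> exists2 r, 0 < r & forall s s', `|s| < r -> `|s'| < r ->
  `|Xi c (Exp (s *: b)) - Xi c (Exp (s' *: b)) - (s - s') *: b| <= e * `|s - s'|.
Proof.
move=> e0; have b1 : 0 < `|b| + 1 by rewrite ltr_wpDl.
have e1 : 0 < e / 2 / (`|b| + 1) by rewrite !divr_gt0.
have [q q0 hq] := lg_strict Ac dc e1.
have tg := Exp_tangent rho0 C0 Eloc b.
have : nbhs (0 : R) [set u | nr q (Exp (u *: b))].
  by apply: (tangent_cvg Ac dc tg); exact: nr_nbhs.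
move=> /nbhs_ballP[d /= d0 hd].
have e20 : 0 < Num.min 1 (e / 2) by rewrite lt_min ltr01 divr_gt0.
have [d2 d20 hd2] := tg _ e20.
exists (Num.min d d2 / 2); first by rewrite divr_gt0// lt_min d0.
move=> s s' hs hs'; pose m := Num.min d d2.
have hss : `|s - s'| < m.
  apply: le_lt_trans (ler_normB _ _) _; move: hs hs'; rewrite -/m.
  by move: `|s| `|s'| => *; lra.
have m2 : m / 2 <= m by rewrite ler_pdivrMr// ler_peMr ?ler1n// /m le_min !ltW.
have nx u : `|u| < m -> nr q (Exp (u *: b)).
  rewrite /m lt_min => /andP[u1 _]; apply: hd.
  by rewrite -ball_normE /= sub0r normrN.
have n1 : nr q 1%g by split; [exact: (lc_dom Ac)|rewrite Xi1 normr0].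
have := hq _ _ _ _ (nx s' (lt_le_trans hs' m2)) (nx s' (lt_le_trans hs' m2)) (nx _ hss) n1.
have es : s' + (s - s') = s by rewrite addrC subrK.
rewrite -Eosg es mulg1 Xi1 !subr0 !subrr normr0 subr0 add0r => h1.
have /hd2[_ h2] : `|s - s'| < d2 by move: hss; rewrite /m lt_min => /andP[].
have h3 : Num.min 1 (e / 2) * `|s - s'| <= `|s - s'| by rewrite ler_piMl// ge_min lexx.
have h4 : Num.min 1 (e / 2) * `|s - s'| <= e / 2 * `|s - s'| by rewrite ler_wpM2r// ge_min lexx orbT.
set y := Xi c (Exp ((s - s') *: b)) in h1 h2 *.
have h5 : `|y| <= `|s - s'| * (`|b| + 1).
  have := ler_normD (y - (s - s') *: b) ((s - s') *: b); rewrite subrK normrZ => /le_trans; apply.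
  by rewrite mulrDr mulr1 addrC lerD2l; apply: le_trans h2 h3.
have h6 : e / 2 / (`|b| + 1) * `|y| <= e / 2 * `|s - s'|.
  apply: (le_trans (ler_wpM2l (ltW e1) h5)).
  by rewrite [`|s - s'| * _]mulrC mulrA divfK ?gt_eqF.
have -> : Xi c (Exp (s *: b)) - Xi c (Exp (s' *: b)) - (s - s') *: b =
  (Xi c (Exp (s *: b)) - Xi c (Exp (s' *: b)) - y) + (y - (s - s') *: b).
  by rewrite addrA subrK.
apply: (le_trans (ler_normD _ _)); apply: (le_trans (lerD (le_trans h1 h6) (le_trans h2 h4))).
by rewrite -mulrDl -splitr.
Qed.

(** Strict differentiability at 0 of a product of one-parameter subgroups, with linear part $\sum_i
    t_i b_i$. The two-point form is what makes the iteration of [chow_near] contract. *)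
Lemma PP_strict b m e : 0 < e -> exists2 r, 0 < r & forall t t',
  (forall i, (i < m)%N -> `|t i| < r /\ `|t' i| < r) ->
  `|Xi c (PP b t m) - Xi c (PP b t' m) - \sum_(i < m) (t i - t' i) *: b i| <= e * \sum_(i < m) `|t i - t' i|.
Proof.
elim: m e => [|m IH] e e0.
  by exists 1 => // t t' _; rewrite !big_ord0 !subr0 subrr normr0 mulr0.
have e2 : 0 < e / 2 by rewrite divr_gt0.
pose K := \sum_(i < m) `|b i| + `|b m| + e / 2.
have K0 : 0 < K by rewrite ltr_wpDl// addr_ge0// sumr_ge0.
have e10 : 0 < e / 2 / K by rewrite divr_gt0.
have [q q0 hq] := lg_strict Ac dc e10.
have [r1 r10 h1] := IH _ e2; have [r2 r20 h2] := Exp_strict (b m) e2.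
have [r3 r30 h3] := PP_near b m q0.
have : nbhs (0 : R) [set u | nr q (Exp (u *: b m))].
  by apply: (tangent_cvg Ac dc (Exp_tangent rho0 C0 Eloc (b m))); exact: nr_nbhs.
move=> /nbhs_ballP[r4 /= r40 h4].
pose r := Num.min (Num.min r1 r2) (Num.min r3 r4).
exists r; first by rewrite !lt_min r10 r20 r30.
have lr (x : R) : x < r -> [/\ x < r1, x < r2, x < r3 & x < r4].
  by rewrite !lt_min -!andbA => /and4P[].
move=> t t' ht.
have [hm hm'] := ht m (ltnSn m); have [_ a2 _ a4] := lr _ hm; have [_ a2' _ a4'] := lr _ hm'.
have hi i : (i < m)%N -> `|t i| < r /\ `|t' i| < r by move=> im; apply: ht; exact: ltnW.
have b1 := h1 t t' (fun i im => let: conj p1 p2 := hi i im in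
  conj (let: And4 z _ _ _ := lr _ p1 in z) (let: And4 z _ _ _ := lr _ p2 in z)).
have b2 := h2 _ _ a2 a2'.
have n1 := h3 t (fun i im => let: And4 _ _ z _ := lr _ (hi i im).1 in z).
have n2 := h3 t' (fun i im => let: And4 _ _ z _ := lr _ (hi i im).2 in z).
have bb u : `|u| < r4 -> nr q (Exp (u *: b m)).
  by move=> u4; apply: h4; rewrite -ball_normE /= sub0r normrN.
have b3 := hq _ _ _ _ n1 n2 (bb _ a4) (bb _ a4').
rewrite !big_ord_recr /=.
set P := PP b t m in b1 n1 b3 *; set P' := PP b t' m in b1 n2 b3 *.
set Q := Exp (t m *: b m) in b2 b3 *; set Q' := Exp (t' m *: b m) in b2 b3 *.
set S := \sum_(i < m) `|t i - t' i| in b1 *; set T1 := \sum_(i < m) _ *: _ in b1 *.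
set T2 := (t m - t' m) *: b m in b2 *; set D := `|t m - t' m| in b2 *.
have S0 : 0 <= S by exact: sumr_ge0.
have D0 : 0 <= D by exact: normr_ge0.
have c1 : `|Xi c P - Xi c P'| <= (\sum_(i < m) `|b i| + e / 2) * S.
  have := ler_normD (Xi c P - Xi c P' - T1) T1; rewrite subrK => /le_trans; apply.
  rewrite mulrDl addrC; apply: lerD => //.
  apply: (le_trans (ler_norm_sum _ _ _)); rewrite /S mulr_sumr; apply: ler_sum => i _.
  rewrite normrZ mulrC ler_wpM2r// (bigD1 i)//= lerDl sumr_ge0//.
have c2 : `|Xi c Q - Xi c Q'| <= (`|b m| + e / 2) * D.
  have := ler_normD (Xi c Q - Xi c Q' - T2) T2; rewrite subrK => /le_trans; apply.
  by rewrite mulrDl addrC; apply: lerD => //; rewrite normrZ mulrC.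
have -> : Xi c (P * Q)%g - Xi c (P' * Q')%g - (T1 + T2) =
  (Xi c (P * Q)%g - Xi c P - Xi c Q - (Xi c (P' * Q')%g - Xi c P' - Xi c Q')) +
  ((Xi c P - Xi c P' - T1) + (Xi c Q - Xi c Q' - T2)).
  by apply/rowP => j; rewrite !mxE; ring.
apply: (le_trans (ler_normD _ _)).
apply: (le_trans (lerD b3 (le_trans (ler_normD _ _) (lerD b1 b2)))).
have c3 : `|Xi c P - Xi c P'| + `|Xi c Q - Xi c Q'| <= K * (S + D).
  rewrite mulrDr; apply: lerD.
    by apply: (le_trans c1); rewrite ler_wpM2r// /K addrAC lerDl.
  by apply: (le_trans c2); rewrite ler_wpM2r// /K -addrA lerDr sumr_ge0.
have := ler_wpM2l (ltW e10) c3; rewrite mulrA divfK ?gt_eqF// => c4.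
by apply: (le_trans (lerD c4 (lexx _))); rewrite -mulrDr -mulrDl -splitr.
Qed.

Section Solve.
Variable M : 'M[R]_n.
Hypothesis Mu : M \in unitmx.
(** Indexing by natural numbers, with value 0 out of range, fits the recursion of [PP]. *)
Definition tn (u : 'rV[R]_n) i : R := if insub i is Some k then u 0 (k : 'I_n) else 0.
Definition bn i : 'rV[R]_n := if insub i is Some k then row (k : 'I_n) M else 0.
Lemma tnE u (k : 'I_n) : tn u k = u 0 k. Proof. by rewrite /tn valK. Qed.
Lemma bnE (k : 'I_n) : bn k = row k M. Proof. by rewrite /bn valK. Qed.
Definition Phi u := PP bn (tn u) n.

Lemma mulmx_bound (N : 'M[R]_n) : exists2 K, 0 <= K & forall v : 'rV[R]_n, `|v *m N| <= K * `|v|.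
Proof.
exists (\sum_i `|row i N|); first exact: sumr_ge0.
move=> v; rewrite mulmx_sum_row; apply: (le_trans (ler_norm_sum _ _ _)).
rewrite mulr_suml; apply: ler_sum => i _; rewrite normrZ mulrC ler_wpM2l//.
exact: coord_norm_le.
Qed.

(** Inverse function theorem by the simplified Newton iteration $u \mapsto u - (\Phi(u) - y)M^{-1}$
    in the chart: [Phi] is strictly differentiable at 0 with derivative [M]. *)
Lemma chow_near r : 0 < r -> \forall y \near (1%g : G), exists u, `|u| <= r /\ y = Phi u.
Proof.
move=> r0; have [K K0 hK] := mulmx_bound (invmx M).
(* [K] bounds the inverse of [M] and [n.+1] compares the sum of coordinates with the sup norm; the
   contraction factor becomes at most 1/2. *)
pose e := (2 * (K + 1) * n.+1%:R)^-1.
have K1 : 0 < K + 1 by rewrite ltr_wpDl.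
have e0 : 0 < e by rewrite invr_gt0 !mulr_gt0.
have [r1 r10 h1] := PP_strict bn n e0.
have [s0 [_ s00 hs0]] : exists s0, [/\ True, 0 < s0 & forall x y, nr s0 x -> nr s0 y -> Xi c x = Xi c y -> x = y].
  by exists 1; split=> // x y [lx _] [ly _] E; rewrite -lx -ly E.
have [r2 r20 h2] := PP_near bn n s00.
pose q := Num.min r (Num.min r1 r2).
have q0 : 0 < q by rewrite !lt_min r0 r10.
have tb u i : (i < n)%N -> `|u| < q -> `|tn u i| < q.
  move=> hi; apply: le_lt_trans; rewrite -[i]/(val (Ordinal hi)) tnE; exact: coord_norm_le.
pose w := Num.min s0 (q / (2 * (K + 1))).
have w0 : 0 < w by rewrite lt_min s00 divr_gt0// mulr_gt0.
near=> y; have ny : nr w y by near: y; exact: nr_nbhs.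
pose F u := u - (Xi c (Phi u) - Xi c y) *m invmx M.
have TT u u' : `|u| < q -> `|u'| < q -> `|F u - F u'| <= 2^-1 * `|u - u'|.
  move=> uq uq'.
  have := h1 (tn u) (tn u') _; rewrite -/(Phi u) -/(Phi u') => /(_ _)/wrap[].
    move=> i hi; have a := tb _ _ hi uq; have a' := tb _ _ hi uq'.
    by move: a a'; rewrite !lt_min => /and3P[_ ? _] /and3P[_ ? _].
  have -> : \sum_(i < n) (tn u i - tn u' i) *: bn i = (u - u') *m M.
    by rewrite mulmx_sum_row; apply: eq_bigr => i _; rewrite !tnE bnE !mxE.
  have sb : \sum_(i < n) `|tn u i - tn u' i| <= n.+1%:R * `|u - u'|.
    apply: (@le_trans _ _ (\sum_(i < n) `|u - u'|)).
      by apply: ler_sum => i _; rewrite !tnE; have := coord_norm_le (u - u') i; rewrite !mxE.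
    by rewrite sumr_const card_ord -[_ *+ n]mulr_natl ler_wpM2r// ler_nat.
  move=> hh; have -> : F u - F u' = - ((Xi c (Phi u) - Xi c (Phi u') - (u - u') *m M) *m invmx M).
    rewrite /F [in RHS]mulmxBl mulmxK// !mulmxBl.
    move: (c (Phi u) *m _) (c (Phi u') *m _) (c y *m _) (p *m _) => z1 z2 z3 z4.
    by apply/rowP => j; rewrite !mxE; ring.
  rewrite normrN; apply: (le_trans (hK _)).
  apply: (le_trans (ler_wpM2l K0 (le_trans hh (ler_wpM2l (ltW e0) sb)))).
  rewrite !mulrA ler_wpM2r// /e !invfM -!mulrA [n.+1%:R^-1 * _]mulVf ?pnatr_eq0// mulr1 mulrCA.
  by rewrite ler_piMr// ler_pdivrMr// mul1r lerDl.
have P0 : Phi 0 = 1%g.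
  rewrite /Phi; have h m : PP bn (tn 0) m = 1%g; last exact: h.
  elim: m => //= m ->; rewrite mul1g /tn.
  by case: insub => [k|]; rewrite ?mxE scale0r (Exp0 Eosg).
have T0 : `|F 0| <= K * `|Xi c y|.
  by rewrite /F P0 Xi1 !sub0r mulNmx opprK.
have T1 : 2 * `|F 0| < q.
  have [_] := ny; rewrite lt_min => /andP[_]; rewrite ltr_pdivlMr ?mulr_gt0// => hy.
  apply: le_lt_trans hy; rewrite mulrC [2 * _]mulrC mulrA ler_wpM2r//.
  by apply: le_trans T0 _; rewrite mulrC ler_wpM2l// lerDl.
have [l [ln lT]] := contr_fix TT T1.
have lq := le_lt_trans ln T1.
exists l; split.
  by apply/ltW; move: lq; rewrite lt_min => /andP[].
have np : nr s0 (Phi l).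
  by apply: h2 => i hi; have := tb _ _ hi lq; rewrite !lt_min => /and3P[].
apply: hs0 => //; first by apply: nr_le ny; rewrite ge_min lexx.
move: lT => /eqP; rewrite /F eq_sym -subr_eq0 opprB addrCA subrr addr0 => /eqP z.
by have := congr1 (mulmx^~ M) z; rewrite /= mulmxKV// mul0mx => /eqP; rewrite subr_eq0 => /eqP.
Unshelve. all: by end_near. Qed.
End Solve.

Lemma HT_Phi (hs : 'I_n -> G) (vs : 'I_n -> 'rV[R]_n) u : (forall i, HT (hs i) /\ T (vs i)) ->
  HT (Phi (\matrix_i vAd (hs i) (av (vs i))) u).
Proof.
move=> hv; rewrite /Phi; set M := \matrix_i _.
suff h m : (m <= n)%N -> HT (PP (bn M) (tn u) m) by exact: h.
elim: m => [|m IH] mn; first exact: HT1.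
apply: HTM; first by apply: IH; exact: ltnW.
rewrite -[m]/(val (Ordinal mn)) bnE tnE rowK -(Exp_conj Ac dc rho0 C0 Eosg Eloc Euniq).
set i := Ordinal mn; have [Hi Ti] := hv i.
apply: HTM; last exact: HTV.
by apply: HTM => //; have := HTE (Tscal (u 0 i) Ti); rewrite /E avZ.
Qed.

(** The subgroup of words contains a neighbourhood of 1, hence is open and closed in a connected
    group. *)
Lemma HT_full x : HT x.
Proof.
have [hs [vs [hv Mu]]] := basis_words.
have n1 : \forall y \near (1%g : G), HT y.
  by apply: filterS (chow_near Mu ltr01) => y [u [_ ->]]; exact: HT_Phi.
have nx y : \forall z \near (y : G), HT (y^-1 * z)%g.
  have := @mulL_cont R n G y^-1%g y; rewrite /continuous_at mulVg; apply.
  exact: n1.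
have oH : open (HT : set G).
  rewrite openE => y Hy; apply: filterS (nx y) => z Hz.
  by rewrite -[z](mulVKg y); exact: HTM.
have cH : closed (HT : set G).
  rewrite -openC openE => y nHy; apply: filterS (nx y) => z Hz Hz'.
  by apply: nHy; rewrite -[y](mulgK (y^-1 * z)%g) mulVKg; apply: HTM => //; exact: HTV.
have HTT : (HT : set G) = setT.
  apply: (carnot_connected (c := G)); first by exists 1%g; exact: HT1.
    by exists (HT : set G) => //; rewrite setTI.
  by exists (HT : set G) => //; rewrite setTI.
by rewrite -[HT x]/((HT : set G) x) HTT.
Qed.
End Gen.

Definition wl (s : seq 'rV[R]_n) : R := \sum_(v <- s) `|v|.
Lemma wl_cat s1 s2 : wl (s1 ++ s2) = wl s1 + wl s2. Proof. exact: big_cat. Qed.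
Lemma wl_rev s : wl (rev [seq - v | v <- s]) = wl s.
Proof.
rewrite /wl (perm_big _ (permEl (perm_rev _))) big_map.
by apply: eq_bigr => v _; rewrite normrN.
Qed.
Lemma wl_ge0 s : 0 <= wl s. Proof. exact: sumr_ge0. Qed.

Lemma PE_full x : exists s, PE s = x.
Proof.
have [] := @HT_full (fun=> True) (fun _ _ _ => I) _ x; last by move=> s [_ <-]; exists s.
by move=> v; exists v, 0; rewrite addr0.
Qed.

(** Each factor of [Phi] is a letter conjugated by a fixed word. Only the letter varies, and its
    length is bounded since the coefficients are at most 1. *)
Lemma words_bounded : exists2 K, 0 < K & \forall y \near (1%g : G), exists s, PE s = y /\ wl s <= K.
Proof.
have Ts : forall v : 'rV[R]_n, exists v1 v2, [/\ (fun=> True) v1, (fun=> True) v2 & v = v1 + v2].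
  by move=> v; exists v, 0; rewrite addr0.
have [hs [vs [hv Mu]]] := @basis_words (fun=> True) (fun _ _ _ => I) Ts.
have /fin_all_exists[sh Esh] := fun i => PE_full (hs i).
pose K0 := \sum_i (2 * wl (sh i) + `|vs i|).
have K00 : 0 <= K0 by apply: sumr_ge0 => i _; rewrite addr_ge0// mulr_ge0// wl_ge0.
exists (n%:R * K0 + 1); first by rewrite ltr_wpDl// mulr_ge0.
have cn := chow_near Mu ltr01; near=> y; have [u [u1 ->]] : exists u : 'rV[R]_n, `|u| <= 1 /\ y = Phi (\matrix_i vAd (hs i) (av (vs i))) u by near: y.
suff h m : (m <= n)%N -> exists s, PE s = PP (bn (\matrix_i vAd (hs i) (av (vs i)))) (tn u) m /\ wl s <= m%:R * K0.
  by have [s [Es ws]] := h n (leqnn n); exists s; split=> //; apply: le_trans ws _; rewrite lerDl.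
elim: m => [|m IH] mn; first by exists [::]; rewrite /wl big_nil mul0r.
have [s [Es ws]] := IH (ltnW mn); pose i := Ordinal mn.
exists (s ++ (sh i ++ (u 0 i *: vs i) :: rev [seq - v | v <- sh i])); split.
  rewrite PE_cat Es /= -[m]/(val i) bnE tnE rowK -(Exp_conj Ac dc rho0 C0 Eosg Eloc Euniq).
  by congr (_ * _)%g; rewrite PE_cat /= PE_rev Esh /cj /E avZ mulgA.
rewrite -natr1 mulrDl mul1r wl_cat lerD// wl_cat {2}/wl big_cons -/(wl _) wl_rev.
rewrite /K0 (bigD1 i)//= normrZ.
have b0 : 0 <= \sum_(j < n | j != i) (2 * wl (sh j) + `|vs j|).
  by apply: sumr_ge0 => j _; rewrite addr_ge0// mulr_ge0// wl_ge0.
have u2 : `|u 0 i| * `|vs i| <= `|vs i|.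
  by rewrite ler_piMl//; apply: le_trans u1; exact: coord_norm_le.
by move: b0 u2; move: (`|u 0 i| * `|vs i|) => a2; move: (wl (sh i)) `|vs i| => a1 a3; move: (\sum_(j < n | _) _) => a4 *; lra.
Unshelve. all: by end_near. Qed.

Lemma dil_PE r s : 0 < r -> carnot_dil r (PE s) = PE [seq r *: v | v <- s].
Proof.
move=> r0; elim: s => [|v s IH] /=; first exact: dil1.
by rewrite (dil_morph r0) IH (dil_E Ac dc rho0 C0 Eosg Eloc Euniq _ r0).
Qed.

(** Dilations scale the letters of a word, and words reach every element; the composition law thus
    reduces to scalars. *)
Lemma dil_comp r1 r2 x : 0 < r1 -> 0 < r2 -> carnot_dil r1 (carnot_dil r2 x) = carnot_dil (r1 * r2) x.
Proof.
move=> h1 h2; have [s <-] := PE_full x; rewrite !dil_PE// ?mulr_gt0// -map_comp.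
by congr PE; apply: eq_map => v /=; rewrite scalerA.
Qed.

Lemma dil_id x : carnot_dil 1 x = x.
Proof.
have [s <-] := PE_full x; rewrite dil_PE//; congr PE.
by rewrite -[RHS]map_id; apply: eq_map => v; rewrite scale1r.
Qed.

(** The dilation of ratio [e / K] shrinks words of length at most [K] to length at most [e], and its
    inverse is continuous at 1. *)
Lemma small_words e : 0 < e -> \forall y \near (1%g : G), exists s, PE s = y /\ wl s <= e.
Proof.
move=> e0; have [K K0 hK] := words_bounded.
have r0 : 0 < e / K by rewrite divr_gt0.
have ri : 0 < (e / K)^-1 by rewrite invr_gt0.
have := @dil_cont R G _ ri 1%g; rewrite /continuous_at dil1// => /(_ _ hK) hh.
near=> y; have [s [Es ws]] : exists s, PE s = carnot_dil (e / K)^-1 y /\ wl s <= K by near: y.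
exists [seq (e / K) *: v | v <- s]; split.
  by rewrite -dil_PE// Es dil_comp// divff ?gt_eqF// dil_id.
rewrite /wl big_map; under eq_bigr do rewrite normrZ gtr0_norm//.
by rewrite -mulr_sumr -/(wl s) mulrAC ler_pdivrMr// ler_wpM2l ?(ltW e0).
Unshelve. all: by end_near. Qed.
End Chow.

(** * Nilpotency *)

Section Nilp.
Context {R : realType} {G : carnotGroup R}.
Local Notation n := (carnot_dim G).
Local Notation A := (@lie_atlas R n G).
Implicit Types (phi psi : G -> R) (X Y : operator G) (x y h : G).
Variable c : chart R n G.
Hypothesis (Ac : A c) (dc : chart_dom c 1%g).
Local Notation p := (c 1%g).
Local Notation xi := (xi Ac dc).
Local Notation av := (av Ac dc).
Local Notation lc := (locp (Xi c) (io c)).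
Local Notation nr := (near1 (Xi c) (io c)).
Variables (rho C : R) (Exp : 'rV[R]_n -> G).
Hypotheses (rho0 : 0 < rho) (C0 : 0 <= C).
Hypothesis Eosg : forall a, is_osg (fun t => Exp (t *: a)).
Hypothesis Eloc : forall b, `|b| < rho -> lc (Exp b) /\ `|Xi c (Exp b) - b| <= C * `|b| ^+ 2.
Hypothesis Euniq : forall a (g1 g2 : R -> G), is_osg g1 -> is_osg g2 ->
  tangent (Xi c) (io c) g1 a -> tangent (Xi c) (io c) g2 a -> g1 =1 g2.
Local Notation E := (E Ac dc Exp).

Lemma commgE (H : groupType) (x y : H) : [~ x, y]%g = (x^-1 * y^-1 * (x * y))%g.
Proof. by rewrite commgEl conjgE !mulgA. Qed.

Lemma nr_inv s : 0 < s -> exists2 r, 0 < r & forall x, nr r x -> nr s x^-1%g.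
Proof.
move=> s0; apply: (nr_sub Ac dc (O := [set x | nr s x^-1%g])).
by apply: (@inv_cont R n G 1%g); rewrite /= invg1; exact: nr_nbhs.
Qed.

(** Read off from $yx[x,y] = xy$: both products are additive up to $O(|x||y|)$, and the radius makes
    the remaining error at most half of $|[x,y]|$, which is absorbed. *)
Lemma comm_bound : exists r D, [/\ 0 < r, 0 <= D & forall x y, nr r x -> nr r y ->
  lc [~ x, y]%g /\ `|Xi c [~ x, y]%g| <= D * `|Xi c x| * `|Xi c y|].
Proof.
have [r1 [C1 [r10 C10 h1]]] := lg_mul Ac dc.
have C11 : 0 < 2 * C1 + 1 by rewrite ltr_wpDl// mulr_ge0.
pose s := Num.min r1 (2 * C1 + 1)^-1.
have s0 : 0 < s by rewrite lt_min r10 invr_gt0.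
have [q q0 hq] := nr_sub2 Ac dc (nr_nbhs Ac dc s0).
have [q1 q10 hq1] := nr_sub2 Ac dc (nr_nbhs Ac dc q0).
have [q2 q20 hq2] := nr_inv q10.
pose r := Num.min (Num.min r1 q) (Num.min q1 q2).
have lr x : nr r x -> [/\ nr r1 x, nr q x, nr q1 x & nr q2 x].
  by move=> nx; split; apply: nr_le nx; rewrite !ge_min lexx ?orbT.
exists r, (4 * C1); split.
- by rewrite !lt_min r10 q0 q10.
- by rewrite mulr_ge0.
move=> x y /lr[x1 x2 x3 x4] /lr[y1 y2 y3 y4].
have nz : nr s [~ x, y]%g.
  by rewrite commgE; apply: hq; [apply: hq1; exact: hq2|exact: hq1].
split; first by case: nz.
set z := [~ x, y]%g in nz *.
have E1 : (y * x * z = x * y)%g by rewrite /z commgE !mulgA mulgK mulgV mul1g.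
have nyx : nr s (y * x)%g by exact: hq.
have sr : s <= r1 by rewrite ge_min lexx.
have [_ b1] := h1 _ _ x1 y1; have [_ b2] := h1 _ _ y1 x1.
have [_ b3] := h1 _ _ (nr_le sr nyx) (nr_le sr nz).
rewrite E1 in b3.
have b4 : C1 * `|Xi c (y * x)%g| <= 2^-1.
  have [_ /ltW h] := nyx; apply: (le_trans (ler_wpM2l C10 h)).
  have : s <= (2 * C1 + 1)^-1 by rewrite ge_min lexx orbT.
  move=> /(ler_wpM2l C10) /le_trans; apply; rewrite ler_pdivrMr//; lra.
have b5 := ler_wpM2r (normr_ge0 (Xi c z)) b4.
have t : `|Xi c z| <= (`|Xi c (x * y)%g - Xi c x - Xi c y| + `|Xi c (y * x)%g - Xi c y - Xi c x|) +
   `|Xi c (x * y)%g - Xi c (y * x)%g - Xi c z|.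
  have e : Xi c z = (Xi c (x * y)%g - Xi c x - Xi c y) - (Xi c (y * x)%g - Xi c y - Xi c x) -
    (Xi c (x * y)%g - Xi c (y * x)%g - Xi c z).
    by apply/rowP => j; rewrite !mxE; ring.
  rewrite {1}e; apply: (le_trans (ler_normB _ _)); apply: lerD => //; exact: ler_normB.
move: b1 b2 b3 b5 t; rewrite [C1 * `|Xi c y| * _]mulrAC -[4 * C1 * _ * _]mulrA -[4 * C1 * _]mulrA -[C1 * _ * `|Xi c y|]mulrA.
move: (C1 * (`|Xi c x| * `|Xi c y|)) (C1 * `|Xi c (y * x)%g| * _) => u1 u2.
move: `|Xi c (x * y)%g - Xi c x - _| `|Xi c (y * x)%g - Xi c y - _| `|_ - Xi c z| `|Xi c z| => *; lra.
Qed.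

Definition lnc v0 vs : G := foldl (fun g v => [~ g, E v]%g) (E v0) vs.
Lemma lnc_rcons v0 vs v : lnc v0 (rcons vs v) = [~ lnc v0 vs, E v]%g.
Proof. by rewrite /lnc -cats1 foldl_cat. Qed.

Lemma E_small v : exists D d, [/\ 0 <= D, 0 < d & forall t, 0 < t < d -> lc (E (t *: v)) /\ `|Xi c (E (t *: v))| <= D * t].
Proof.
have [d d0 hd] := E_tangent Ac dc rho0 C0 Eloc v ltr01.
exists (`|av v| + 1), d; split=> //.
move=> t /andP[t0 td]; have [|l b] := hd t; first by rewrite gtr0_norm.
split=> //; have := ler_normD (Xi c (E (t *: v)) - t *: av v) (t *: av v).
rewrite subrK normrZ gtr0_norm// in b * => /le_trans; apply.
by rewrite mulrDl addrC; apply: lerD => //; rewrite mulrC.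
Qed.

(** By [comm_bound] orders of smallness add up: a commutator of $q$ letters of size $t$ is
    $O(t^q)$. *)
Lemma lnc_small v0 vs : exists D d, [/\ 0 <= D, 0 < d & forall t, 0 < t < d ->
  lc (lnc (t *: v0) [seq t *: v | v <- vs]) /\
  `|Xi c (lnc (t *: v0) [seq t *: v | v <- vs])| <= D * t ^+ (size vs).+1].
Proof.
elim/last_ind: vs => [|vs v [D [d [D0 d0 hd]]]].
  by have [D [d [D0 d0 h]]] := E_small v0; exists D, d; split=> // t /h.
have [D1 [d1 [D10 d10 h1]]] := E_small v.
have [r [D2 [r0 D20 h2]]] := comm_bound.
pose q := Num.min 1 (r / (D + D1 + 1)).
have DD : 0 < D + D1 + 1 by rewrite ltr_wpDl// addr_ge0.
have q0 : 0 < q by rewrite lt_min ltr01 divr_gt0.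
exists (D2 * D * D1), (Num.min (Num.min d d1) q); split; first by rewrite !mulr_ge0.
  by rewrite lt_min q0 andbT lt_min d0 d10.
move=> t /andP[t0]; rewrite !lt_min => /andP[/andP[td td1] /andP[t1 tr]].
rewrite map_rcons lnc_rcons size_rcons.
have [|l b] := hd t; first by rewrite t0.
have [|l1 b1] := h1 t; first by rewrite t0.
have tr2 : (D + D1 + 1) * t < r by rewrite mulrC -ltr_pdivlMr.
have tS : t ^+ (size vs).+1 <= t by rewrite exprS ler_piMr ?(ltW t0)// exprn_ile1// ltW.
have n1 : nr r (lnc (t *: v0) [seq t *: v | v <- vs]).
  split=> //; apply: le_lt_trans b _; apply: le_lt_trans tr2.
  apply: (le_trans (ler_wpM2l D0 tS)); rewrite ler_wpM2r ?(ltW t0)//.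
  by rewrite -addrA lerDl addr_ge0.
have n2 : nr r (E (t *: v)).
  split=> //; apply: le_lt_trans b1 _; apply: le_lt_trans tr2.
  by rewrite ler_wpM2r ?(ltW t0)// addrAC lerDr addr_ge0.
have [l2 b2] := h2 _ _ n1 n2; split=> //; apply: (le_trans b2).
rewrite exprSr; have -> : D2 * D * D1 * (t ^+ (size vs).+1 * t) = D2 * (D * t ^+ (size vs).+1) * (D1 * t) by ring.
by apply: ler_pM => //; [rewrite mulr_ge0|rewrite ler_wpM2l].
Qed.

Lemma dil_lnc r v0 vs : 0 < r -> carnot_dil r (lnc v0 vs) = lnc (r *: v0) [seq r *: v | v <- vs].
Proof.
move=> r0; have dE := dil_E Ac dc rho0 C0 Eosg Eloc Euniq _ r0.
have dV x : carnot_dil r x^-1%g = (carnot_dil r x)^-1%g.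
  have := dil_morph r0 x x^-1%g; rewrite mulgV dil1// => /(congr1 (fun y => (carnot_dil r x)^-1 * y)%g).
  by rewrite mulg1 mulKg.
elim/last_ind: vs => [|vs v IH]; first exact: dE.
rewrite map_rcons !lnc_rcons -IH -dE !commgE.
by rewrite !(dil_morph r0) !dV.
Qed.

Lemma dil2_lip : exists r K, [/\ 0 < r, 0 <= K & forall x, nr r x -> `|Xi c (carnot_dil 2 x)| <= K * `|Xi c x|].
Proof.
have t0 : 0 < 2 :> R by [].
have [r1 r10 h1] := nr_coord Ac dc.
have [r2 r20 h2] : exists2 r, 0 < r & forall x, nr r x -> nr r1 (carnot_dil 2 x).
  apply: (nr_sub Ac dc (O := [set x | nr r1 (carnot_dil 2 x)])).
  by apply: (dil_cont t0); rewrite /= dil1//; exact: nr_nbhs.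
have hj j : exists r K, [/\ 0 < r, 0 <= K & forall x, nr r x -> `|xi j (carnot_dil 2 x)| <= K * `|Xi c x|].
  have sm := smooth_comp_map (dil_smooth t0) (xi_smooth Ac dc j).
  have [r [K [r0 K0 _ hK]]] := C1_lip (chart_imgo Ac) (sm c 1%N Ac) (chart_imgP dc).
  exists r, K; split=> // x nx; have [_ bx] := nr_ball nx.
  have := hK _ _ (ballxx p r0) bx.
  have [/lcE lx _] := nx.
  by rewrite /= lx chartK// dil1// xi1 subr0.
have /fin_all_exists[r /fin_all_exists[K hK]] := hj.
have [s s0 hs] := @fin_min R n r (fun j => let: And3 h _ _ := hK j in h).
have K0 j : 0 <= K j by case: (hK j).
exists (Num.min r2 s), (\sum_j K j); split; first by rewrite lt_min r20.
  exact: sumr_ge0.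
move=> x nx; have [_ E] : chart_dom c (carnot_dil 2 x) /\ forall j, xi j (carnot_dil 2 x) = Xi c (carnot_dil 2 x) 0 j.
  by apply: h1; apply: h2; apply: nr_le nx; rewrite ge_min lexx.
apply: rV_norm_le; first by rewrite mulr_ge0// sumr_ge0.
move=> j; rewrite -E; have [_ _ h] := hK j.
apply: (@le_trans _ _ (K j * `|Xi c x|)).
  by apply: h; apply: nr_le nx; rewrite ge_min (hs j) orbT.
by rewrite ler_wpM2r// (bigD1 j)//= lerDl sumr_ge0.
Qed.

(* A commutator of q + 1 letters scaled by 2^-k is O(2^-(k (q+1))), while the
   dilation by 2 is Lipschitz near 1: for large q, scaling back gives 0. *)
Lemma nilp : exists N, forall v0 vs, (N <= size vs)%N -> lnc v0 vs = 1%g.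
Proof.
have [r [K [r0 K0 hK]]] := dil2_lip.
have [N hN] : exists N, K <= 2 ^+ N.
  exists (Num.bound K); apply/ltW; apply: lt_le_trans (archi_boundP K0) _.
  by rewrite -natrX ler_nat ltnW// ltn_expl.
exists N => v0 vs Ns; set k := size vs in Ns.
have [D [d [D0 d0 hd]]] := lnc_small v0 vs; rewrite -/k in hd.
pose g i := carnot_dil (dy i) (lnc v0 vs).
have gE i : g i = lnc (dy i *: v0) [seq dy i *: v | v <- vs] by rewrite /g dil_lnc// dy0.
have DD : 0 < D + 1 by rewrite ltr_wpDl.
pose q := Num.min d (Num.min 1 (r / (D + 1))).
have q0 : 0 < q by rewrite !lt_min d0 ltr01 divr_gt0.
have [i0 hi0] := dy_lt q0.
have le1 m : dy (i0 + m) < q.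
  by apply: le_lt_trans hi0; rewrite dyD ler_piMr ?(ltW (dy0 _))// dy_le1.
have gb m : nr r (g (i0 + m)%N) /\ `|Xi c (g (i0 + m)%N)| <= D * dy (i0 + m) ^+ k.+1.
  have := le1 m; rewrite !lt_min => /and3P[a1 a2 a3].
  have [|l b] := hd (dy (i0 + m)); first by rewrite dy0.
  rewrite -gE in l b; split=> //; split=> //; apply: le_lt_trans b _.
  rewrite ltr_pdivlMr// mulrC in a3; apply: le_lt_trans a3.
  apply: ler_pM => //; [by rewrite exprn_ge0// ltW// dy0|by rewrite lerDl|].
  by rewrite exprS ler_piMr ?(ltW (dy0 _))// exprn_ile1// ?ltW// dy0.
have step m : `|Xi c (g (i0 + m)%N)| <= K * `|Xi c (g (i0 + m.+1)%N)|.
  have -> : g (i0 + m)%N = carnot_dil 2 (g (i0 + m.+1)%N).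
    rewrite /g (dil_comp Ac dc rho0 C0 Eosg Eloc Euniq)// ?dy0//; congr carnot_dil.
    by rewrite addnS dyS; field.
  exact: hK (gb _).1.
have it m : `|Xi c (g i0)| <= K ^+ m * `|Xi c (g (i0 + m)%N)|.
  elim: m => [|m IH]; first by rewrite addn0 mul1r.
  apply: (le_trans IH); rewrite exprSr -mulrA ler_wpM2l ?exprn_ge0//.
have Xi0 : Xi c (g i0) = 0.
  apply/eqP; rewrite -normr_le0; apply: (@dy_lim _ _ _ D) => m; rewrite add0r.
  apply: (le_trans (it m)); apply: (le_trans (ler_wpM2l (exprn_ge0 _ K0) (gb m).2)).
  rewrite mulrCA ler_wpM2l// dyD exprMn.
  have p1 : dy i0 ^+ k.+1 <= 1 :> R by rewrite exprn_ile1 ?dy_le1 ?(ltW (dy0 _)).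
  have p2 : 0 <= dy i0 ^+ k.+1 :> R by rewrite exprn_ge0 ?(ltW (dy0 _)).
  have p3 : K ^+ m <= (2 ^+ k) ^+ m.
    rewrite lerXn2r ?nnegrE ?exprn_ge0//; apply: (le_trans hN).
    by rewrite ler_eXn2l// ltr1n.
  have p4 : (2 ^+ k) ^+ m * dy m ^+ k.+1 = dy m :> R.
    rewrite exprSr mulrA -exprM mulnC exprM -exprMn -natrX dyM.
    by rewrite expr1n mul1r.
  have p5 : 0 <= dy m ^+ k.+1 :> R by rewrite exprn_ge0 ?(ltW (dy0 _)).
  rewrite -[leRHS]p4; apply: ler_pM => //; [by rewrite exprn_ge0|by rewrite mulr_ge0|].
  by rewrite ler_piMl.
have g1 : g i0 = 1%g.
  have [[l _] _] := gb 0%N; rewrite addn0 in l.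
  by move: l; rewrite /locp Xi0 /io add0r chartK.
have := congr1 (carnot_dil (2 ^+ i0)) g1; rewrite /g.
rewrite (dil_comp Ac dc rho0 C0 Eosg Eloc Euniq) ?exprn_gt0 ?dy0//.
by rewrite -natrX dyM (dil_id Ac dc rho0 C0 Eosg Eloc Euniq) dil1// natrX exprn_gt0.
Qed.
End Nilp.

(** * Words representing commutators *)

Section Words.
Context {R : realType} {n : nat} {H : groupType}.
Variable E : 'rV[R]_n -> H.
Implicit Types (v w : 'rV[R]_n) (x y z : H).
Definition word_prod (s : seq 'rV[R]_n) : H := foldr (fun v g => (E v * g)%g) 1%g s.
Definition left_comm v0 vs : H := foldl (fun g v => [~ g, E v]%g) (E v0) vs.
Hypothesis Eadd : forall v s t, E ((s + t) *: v) = (E (s *: v) * E (t *: v))%g.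
Hypothesis Efull : forall T : 'rV[R]_n -> Prop, (forall k v, T v -> T (k *: v)) ->
  (forall v, exists v1 v2, [/\ T v1, T v2 & v = v1 + v2]) ->
  forall x, exists s, (forall v, v \in s -> T v) /\ word_prod s = x.
Hypothesis Enilp : exists N, forall v0 vs, (N <= size vs)%N -> left_comm v0 vs = 1%g.

Lemma Eg0 : E 0 = 1%g.
Proof.
have := Eadd 0 0 0; rewrite !scaler0 => /(congr1 (fun x => (E 0)^-1 * x)%g).
by rewrite mulKg mulVg => <-.
Qed.
Lemma Eg_opp v : E (- v) = (E v)^-1%g.
Proof.
have := Eadd v 1 (- 1); rewrite subrr scale0r scaleN1r scale1r Eg0.
by move=> /(congr1 (fun x => (E v)^-1 * x)%g); rewrite mulg1 mulKg.
Qed.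
Lemma Eg_nat k v : E (k%:R *: v) = (E v ^+ k)%g.
Proof.
elim: k => [|k IH]; first by rewrite scale0r Eg0 expg0.
by rewrite -natr1 Eadd IH scale1r expgSr.
Qed.
Lemma word_prod_cat s1 s2 : word_prod (s1 ++ s2) = (word_prod s1 * word_prod s2)%g.
Proof. by elim: s1 => [|v s IH] /=; rewrite ?mul1g// IH mulgA. Qed.
Lemma word_prod_rev s : word_prod (rev [seq - v | v <- s]) = (word_prod s)^-1%g.
Proof.
elim: s => [|v s IH] /=; first by rewrite invg1.
by rewrite rev_cons -cats1 word_prod_cat IH /= mulg1 invgM Eg_opp.
Qed.
Lemma left_comm_rcons v0 vs v : left_comm v0 (rcons vs v) = [~ left_comm v0 vs, E v]%g.
Proof. by rewrite /left_comm -cats1 foldl_cat. Qed.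

Lemma comm1g x : [~ 1, x]%g = 1%g.
Proof. by rewrite commgE invg1 !mul1g mulVg. Qed.
Lemma commg1' x : [~ x, 1]%g = 1%g.
Proof. by rewrite commgE invg1 !mulg1 mulVg. Qed.
Lemma commMl x y z : [~ x * y, z]%g = ([~ x, z] ^ y * [~ y, z])%g.
Proof. by rewrite !commgE conjgE !invgM !mulgA !mulgK. Qed.
Lemma commMr x y z : [~ x, y * z]%g = ([~ x, z] * [~ x, y] ^ z)%g.
Proof. by rewrite !commgE conjgE !invgM !mulgA !mulgK. Qed.
Lemma commVl x y : [~ x^-1, y]%g = (([~ x, y] ^ x^-1)^-1)%g.
Proof. by rewrite !commgE conjgE !invgM !invgK !mulgA mulgK. Qed.
Lemma conj_comm x y : (x ^ y)%g = (x * [~ x, y])%g.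
Proof. by rewrite commgE conjgE !mulgA mulgV mul1g. Qed.

Variable u : 'rV[R]_n.
Definition dot v := \sum_i u 0 i * v 0 i.
Lemma dotD v w : dot (v + w) = dot v + dot w.
Proof. by rewrite /dot -big_split; apply: eq_bigr => i _; rewrite mxE mulrDr. Qed.
Lemma dotZ k v : dot (k *: v) = k * dot v.
Proof. by rewrite /dot mulr_sumr; apply: eq_bigr => i _; rewrite mxE mulrCA. Qed.
Lemma dotN v : dot (- v) = - dot v.
Proof. by rewrite -scaleN1r dotZ mulN1r. Qed.

(** Letters annihilated by [u] cost nothing; multiples of [u] commute with each other. Every vector
    is a sum of one of each kind. *)
Definition TT v := dot v = 0 \/ exists k, v = k *: u.
Lemma TT_scal k v : TT v -> TT (k *: v).
Proof.
by case=> [h|[l ->]]; [left; rewrite dotZ h mulr0|right; exists (k * l); rewrite scalerA].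
Qed.
Lemma TT_span v : exists v1 v2, [/\ TT v1, TT v2 & v = v1 + v2].
Proof.
have [d0|d0] := eqVneq (dot u) 0.
  have u0 : u = 0.
    apply/rowP => i; rewrite mxE; apply/eqP; rewrite -sqrf_eq0 expr2.
    apply/eqP; move: i (erefl true); apply: psumr_eq0P; last exact: d0.
    by move=> i _; rewrite -expr2 sqr_ge0.
  have dv w : dot w = 0 by rewrite /dot big1// => i _; rewrite u0 mxE mul0r.
  by exists v, 0; rewrite addr0; split=> //; left.
exists (v - (dot v / dot u) *: u), ((dot v / dot u) *: u); split.
- by left; rewrite dotD dotN dotZ divfK// subrr.
- by right; exists (dot v / dot u).
- by rewrite subrK.
Qed.

(** The lower central series, presented by left-normed commutators of at least [j] letters from
    [TT]. Normality and [Gam_comm] are derived from this presentation, which keeps the special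
    letters visible. *)
Inductive Gam (j : nat) : H -> Prop :=
| Gam1 : Gam j 1%g
| GamM x y : Gam j x -> Gam j y -> Gam j (x * y)%g
| GamV x : Gam j x -> Gam j x^-1%g
| Gaml v0 vs : TT v0 -> (forall v, v \in vs -> TT v) -> (j <= (size vs).+1)%N -> Gam j (left_comm v0 vs).

Lemma Gam_full x : Gam 1 x.
Proof.
have [s [sT <-]] := Efull TT_scal TT_span x.
elim: s sT => [|v s IH] sT; first exact: Gam1.
apply: GamM; last by apply: IH => w ws; apply: sT; rewrite inE ws orbT.
by apply: (@Gaml 1 v [::]) => //; apply: sT; rewrite inE eqxx.
Qed.

Lemma TT_rcons vs v : (forall w, w \in vs -> TT w) -> TT v -> forall w, w \in rcons vs v -> TT w.
Proof. by move=> Ts Tv w; rewrite mem_rcons inE => /orP[/eqP->|/Ts]. Qed.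

Lemma Gam_conjE j v x : TT v -> Gam j x -> Gam j (x ^ E v)%g.
Proof.
move=> Tv; elim=> {x} [|x y _ ? _ ?|x _ ?|v0 vs T0 Ts h].
- by rewrite conj1g; exact: Gam1.
- by rewrite conjMg; exact: GamM.
- by rewrite conjVg; exact: GamV.
rewrite conj_comm -left_comm_rcons; apply: GamM; first exact: Gaml.
by apply: Gaml => //; [exact: TT_rcons|rewrite size_rcons; exact: leqW].
Qed.

Lemma Gam_conj j x y : Gam j x -> Gam j (x ^ y)%g.
Proof.
have [s [sT <-]] := Efull TT_scal TT_span y.
elim: s x sT => [|v s IH] x sT Gx; first by rewrite conjg1.
rewrite /= conjgM; apply: IH; first by move=> w ws; apply: sT; rewrite inE ws orbT.
by apply: Gam_conjE => //; apply: sT; rewrite inE eqxx.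
Qed.

Lemma Gam_commE j v x : TT v -> Gam j x -> Gam j.+1 [~ x, E v]%g.
Proof.
move=> Tv; elim=> {x} [|x y _ ? _ ?|x _ ?|v0 vs T0 Ts h].
- by rewrite comm1g; exact: Gam1.
- by rewrite commMl; apply: GamM => //; exact: Gam_conj.
- by rewrite commVl; apply/GamV/Gam_conj.
by rewrite -left_comm_rcons; apply: Gaml => //; [exact: TT_rcons|rewrite size_rcons].
Qed.

Lemma Gam_comm j x y : Gam j x -> Gam j.+1 [~ x, y]%g.
Proof.
move=> Gx; have [s [sT <-]] := Efull TT_scal TT_span y.
elim: s sT => [|v s IH] sT; first by rewrite commg1'; exact: Gam1.
rewrite /= commMr; apply: GamM; first by apply: IH => w ws; apply: sT; rewrite inE ws orbT.
by apply: Gam_conj; apply: Gam_commE => //; apply: sT; rewrite inE eqxx.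
Qed.

Lemma GamX j x k : Gam j x -> Gam j (x ^+ k)%g.
Proof.
by move=> Gx; elim: k => [|k IH]; rewrite ?expg0 ?expgS; [exact: Gam1|exact: GamM].
Qed.

Definition eqG j x y := Gam j (x^-1 * y)%g.
Lemma eqGxx j x : eqG j x x. Proof. by rewrite /eqG mulVg; exact: Gam1. Qed.
Lemma eqG_sym j x y : eqG j x y -> eqG j y x.
Proof. by move=> /GamV; rewrite invgM invgK. Qed.
Lemma eqG_trans j x y z : eqG j x y -> eqG j y z -> eqG j x z.
Proof. by move=> h1 h2; have := GamM h1 h2; rewrite mulgA mulgK. Qed.
Lemma eqGM j x x' y y' : eqG j x x' -> eqG j y y' -> eqG j (x * y)%g (x' * y')%g.
Proof.
move=> h1 h2; have := GamM (Gam_conj y h1) h2.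
by rewrite /eqG conjgE invgM !mulgA mulgK.
Qed.
Lemma eqGX j x y k : eqG j x y -> eqG j (x ^+ k)%g (y ^+ k)%g.
Proof.
move=> h; elim: k => [|k IH]; rewrite ?expg0 ?expgS; first exact: eqGxx.
exact: eqGM.
Qed.
Lemma eqG_conj j x y : Gam j x -> eqG j.+1 (x ^ y)%g x.
Proof. by move=> Gx; apply: eqG_sym; rewrite /eqG conj_comm mulKg; exact: Gam_comm. Qed.

Lemma comm_mul_l i x1 x2 y : Gam i x1 -> eqG i.+2 [~ x1 * x2, y]%g ([~ x1, y] * [~ x2, y])%g.
Proof. by move=> G1; rewrite commMl; apply: eqGM; [apply/eqG_conj/Gam_comm|exact: eqGxx]. Qed.

Lemma comm_pow_l i x y m : Gam i x -> eqG i.+2 [~ x ^+ m, y]%g ([~ x, y] ^+ m)%g.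
Proof.
move=> Gx; elim: m => [|m IH]; first by rewrite !expg0 comm1g; exact: eqGxx.
rewrite !expgS; apply: eqG_trans (comm_mul_l _ _ Gx) _.
by apply: eqGM => //; exact: eqGxx.
Qed.

Lemma comm_pow_r i x y m : Gam i x -> eqG i.+2 [~ x, y ^+ m]%g ([~ x, y] ^+ m)%g.
Proof.
move=> Gx; elim: m => [|m IH]; first by rewrite !expg0 commg1'; exact: eqGxx.
rewrite expgSr expgS commMr; apply: eqGM; first exact: eqGxx.
by apply: eqG_trans IH; apply/eqG_conj/Gam_comm.
Qed.

Lemma comm_cong_l i x x' y : Gam i x -> eqG i.+1 x x' -> eqG i.+2 [~ x, y]%g [~ x', y]%g.
Proof.
move=> Gx h; have -> : x' = (x * (x^-1 * x'))%g by rewrite mulVKg.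
rewrite commMl -[X in eqG _ X]mulg1; apply: eqGM.
  by apply/eqG_sym/eqG_conj/Gam_comm.
by rewrite /eqG invg1 mul1g; exact: Gam_comm.
Qed.

(** Multilinearity modulo commutators with one more letter. Natural multiples suffice, because
    [E (k%:R *: v)] is a power of [E v] and no continuity is then needed. *)
Lemma lnc_multi v0 m0 (ps : seq ('rV[R]_n * nat)) : TT v0 -> (forall p, p \in ps -> TT p.1) ->
  eqG (size ps).+2 (left_comm (m0%:R *: v0) [seq p.2%:R *: p.1 | p <- ps])
    (left_comm v0 [seq p.1 | p <- ps] ^+ (m0 * \prod_(p <- ps) p.2))%g.
Proof.
move=> T0; elim/last_ind: ps => [|ps p IH] Ts.
  by rewrite big_nil muln1 /left_comm /= Eg_nat; exact: eqGxx.
have Ts' q : q \in ps -> TT q.1 by move=> qp; apply: Ts; rewrite mem_rcons inE qp orbT.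
have Tp : TT p.1 by apply: Ts; rewrite mem_rcons inE eqxx.
rewrite !map_rcons !left_comm_rcons size_rcons Eg_nat big_rcons mulnA.
have G1 : Gam (size ps).+1 (left_comm v0 [seq p.1 | p <- ps]).
  apply: Gaml => //; last by rewrite size_map.
  by move=> v /mapP[q qp ->]; exact: Ts'.
have G2 : Gam (size ps).+1 (left_comm (m0%:R *: v0) [seq p.2%:R *: p.1 | p <- ps]).
  apply: Gaml; [exact: TT_scal| |by rewrite size_map].
  by move=> v /mapP[q qp ->]; apply: TT_scal; exact: Ts'.
apply: (eqG_trans (comm_cong_l _ G2 (IH Ts'))).
apply: (eqG_trans (comm_pow_r _ _ (GamX _ G1))).
rewrite [X in eqG _ _ X]expgnA; apply: eqGX; exact: comm_pow_l.
Qed.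

Definition cost (s : seq 'rV[R]_n) := \sum_(v <- s) `|dot v|.
Lemma cost_cat s1 s2 : cost (s1 ++ s2) = cost s1 + cost s2. Proof. exact: big_cat. Qed.
Lemma cost_cons v s : cost (v :: s) = `|dot v| + cost s. Proof. exact: big_cons. Qed.
Lemma cost_rev s : cost (rev [seq - v | v <- s]) = cost s.
Proof.
rewrite /cost (perm_big _ (permEl (perm_rev _))) big_map.
by apply: eq_bigr => v _; rewrite dotN normrN.
Qed.

(** A different word may be used for each [e]; the letters are charged only for their component
    along [u]. *)
Definition cheap x := forall e, 0 < e -> exists s, word_prod s = x /\ cost s <= e.
Lemma cheap1 : cheap 1%g.
Proof. by move=> e e0; exists [::]; rewrite /cost big_nil ltW. Qed.
Lemma cheapM x y : cheap x -> cheap y -> cheap (x * y)%g.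
Proof.
move=> hx hy e e0; have e2 : 0 < e / 2 by rewrite divr_gt0.
have [s [<- hs]] := hx _ e2; have [t [<- ht]] := hy _ e2.
exists (s ++ t); rewrite word_prod_cat cost_cat; split=> //.
by rewrite [leRHS]splitr lerD.
Qed.
Lemma cheapV x : cheap x -> cheap x^-1%g.
Proof.
move=> hx e e0; have [s [<- hs]] := hx _ e0.
by exists (rev [seq - v | v <- s]); rewrite word_prod_rev cost_rev.
Qed.

(** The word that spells out a left-normed commutator $x^{-1}y^{-1}xy$ letter by letter, roughly
    doubling in length each time. *)
Definition Wd v0 vs := foldl (fun s v => rev [seq - w | w <- s] ++ (- v :: (s ++ [:: v]))) [:: v0] vs.
Lemma Wd_rcons v0 vs v : Wd v0 (rcons vs v) = rev [seq - w | w <- Wd v0 vs] ++ (- v :: (Wd v0 vs ++ [:: v])).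
Proof. by rewrite /Wd -cats1 foldl_cat. Qed.
Lemma word_prod_Wd v0 vs : word_prod (Wd v0 vs) = left_comm v0 vs.
Proof.
elim/last_ind: vs => [|vs v IH]; first by rewrite /= mulg1.
rewrite Wd_rcons left_comm_rcons word_prod_cat /= word_prod_cat word_prod_rev IH /= mulg1 Eg_opp.
by rewrite commgE !mulgA.
Qed.
Lemma cost_Wd v0 vs : cost (Wd v0 vs) <= 2 ^+ (size vs) * cost (v0 :: vs).
Proof.
elim/last_ind: vs => [|vs v IH]; first by rewrite mul1r.
have c1 : cost [:: v] = `|dot v| by rewrite /cost big_seq1.
have e1 : cost (Wd v0 (rcons vs v)) = cost (Wd v0 vs) + (`|dot v| + (cost (Wd v0 vs) + `|dot v|)).
  rewrite Wd_rcons cost_cat cost_rev cost_cons dotN normrN cost_cat.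
  by rewrite c1.
have e2 : cost (v0 :: rcons vs v) = cost (v0 :: vs) + `|dot v|.
  by rewrite -cats1 -cat_cons cost_cat c1.
rewrite e1 e2 size_rcons exprS mulrDr.
have h : `|dot v| <= 2 ^+ size vs * `|dot v|.
  by rewrite ler_peMl// exprn_ege1// ler1n.
move: IH h; rewrite -!mulrA; move: (cost _) (2 ^+ size vs * cost _) `|dot v| (2 ^+ size vs * `|dot v|) => *; lra.
Qed.

Lemma prod_if (P : pred 'rV[R]_n) a b s :
  (\prod_(v <- s) (if P v then a else b) = a ^ count P s * b ^ count (predC P) s)%N.
Proof.
elim: s => [|v s IH]; first by rewrite big_nil.
rewrite big_cons IH /=; case: (P v); rewrite /= ?add0n ?add1n expnS; [by rewrite mulnA|by rewrite mulnCA].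
Qed.

Lemma fold1 vs : foldl (fun g v => [~ g, E v]%g) 1%g vs = 1%g.
Proof. by elim: vs => //= v vs; rewrite comm1g. Qed.

(* Modulo longer commutators, iterated commutators are multilinear.  With a
   letters in the kernel of [u] and b along [u], dividing the latter by N^a and
   multiplying the former, which cost nothing, by N^b changes nothing. *)
Lemma lnc_cheap v0 vs : TT v0 -> (forall v, v \in vs -> TT v) -> (0 < size vs)%N ->
  (forall x, Gam (size vs).+2 x -> cheap x) -> cheap (left_comm v0 vs).
Proof.
move=> T0 Ts s0 IH; pose kp v := dot v == 0.
pose a := count kp (v0 :: vs); pose b := count (predC kp) (v0 :: vs).
(* Without a letter in the kernel of [u], the first two letters are multiples of [u] and commute, so
   the whole commutator is 1. *)
have [a0|a0] := posnP a.
  have hk v : v \in v0 :: vs -> exists k, v = k *: u.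
    move=> vin; have : ~~ kp v.
      apply/negP => kv; have : has kp (v0 :: vs) by apply/hasP; exists v.
      by rewrite has_count -/a a0.
    have Tv : TT v by move: vin; rewrite inE => /orP[/eqP->|/Ts].
    by case: Tv => // /eqP; rewrite /kp => ->.
  case: vs s0 hk {Ts IH a b a0} => // v1 vs _ hk.
  have [k0 e0] := hk v0 (mem_head _ _).
  have [|k1 e1] := hk v1; first by rewrite !inE eqxx orbT.
  have -> : left_comm v0 (v1 :: vs) = 1%g; last exact: cheap1.
  rewrite /left_comm /= (_ : [~ E v0, E v1]%g = 1%g) ?fold1// e0 e1 commgE.
  have cm : (E (k0 *: u) * E (k1 *: u) = E (k1 *: u) * E (k0 *: u))%g by rewrite -!Eadd addrC.
  by rewrite cm -invgM mulVg.
move=> e e0; have e2 : 0 < e / 2 by rewrite divr_gt0.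
pose K := 2 ^+ size vs * cost (v0 :: vs).
have K0 : 0 <= K by rewrite mulr_ge0 ?exprn_ge0// sumr_ge0.
(* Letters along [u] are divided by [N ^ a] with [a] positive; one factor [N] already brings the
   cost of the spelled-out commutator below [e / 2]. The other half pays for the correction of
   higher weight. *)
pose N := (Num.bound (K / (e / 2))).+1.
have N0 : (0 < N)%N by [].
have NK : K / N%:R <= e / 2.
  rewrite ler_pdivrMr ?ltr0n// mulrC -ler_pdivrMr//.
  apply/ltW; apply: lt_le_trans (archi_boundP _) _; first by rewrite divr_ge0// ltW.
  by rewrite ler_nat.
pose q := (N ^ a)%N; pose q' := (N ^ b)%N.
have q0 : q%:R != 0 :> R by rewrite pnatr_eq0 -lt0n expn_gt0.
pose bl v := if kp v then v else q%:R^-1 *: v.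
pose m v := if kp v then 1%N else q; pose m' v := if kp v then q' else 1%N.
have mE v : (m v)%:R *: bl v = v.
  by rewrite /m /bl; case: ifP => _; rewrite ?scale1r// scalerA divff// scale1r.
have Tb v : TT v -> TT (bl v) by rewrite /bl; case: ifP => // _; exact: TT_scal.
have lm := @lnc_multi (bl v0) _ [seq (bl v, _) | v <- vs] (Tb _ T0).
have l1 := @lnc_multi (bl v0) (m v0) [seq (bl v, m v) | v <- vs] (Tb _ T0).
have l2 := @lnc_multi (bl v0) (m' v0) [seq (bl v, m' v) | v <- vs] (Tb _ T0).
have hT (f : 'rV[R]_n -> nat) p : p \in [seq (bl v, f v) | v <- vs] -> TT p.1.
  by move=> /mapP[v vin ->]; apply: Tb; exact: Ts.
have {}l1 := l1 (hT m); have {}l2 := l2 (hT m'); clear lm.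
rewrite !size_map -!map_comp !big_map /= in l1 l2.
have p1 : (m v0 * \prod_(v <- vs) m v = q ^ b)%N.
  by rewrite -(big_cons _ _ v0 vs xpredT m) /= prod_if exp1n mul1n.
have p2 : (m' v0 * \prod_(v <- vs) m' v = q' ^ a)%N.
  by rewrite -(big_cons _ _ v0 vs xpredT m') /= prod_if exp1n muln1.
have pp : (q ^ b = q' ^ a)%N by rewrite /q /q' -!expnM mulnC.
rewrite p1 in l1; rewrite p2 -pp in l2.
have E1 : [seq ((fun p : 'rV[R]_n * nat => p.2%:R *: p.1) \o (fun v => (bl v, m v))) v | v <- vs] = vs.
  by rewrite -[RHS]map_id; apply: eq_map => v /=; exact: mE.
rewrite mE E1 in l1.
set w' := left_comm (_ *: _) _ in l2.
have hz : Gam (size vs).+2 (w'^-1 * left_comm v0 vs)%g.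
  apply: eqG_trans l2 _; apply: eqG_sym; exact: l1.
have [sz [Ez cz]] := IH _ hz _ e2.
exists (Wd ((m' v0)%:R *: bl v0) [seq ((fun p : 'rV[R]_n * nat => p.2%:R *: p.1) \o (fun v => (bl v, m' v))) v | v <- vs] ++ sz).
split; first by rewrite word_prod_cat word_prod_Wd Ez mulVKg.
rewrite cost_cat [leRHS]splitr lerD//; apply: (le_trans (cost_Wd _ _)); apply: le_trans NK.
rewrite size_map /K -mulrA ler_wpM2l ?exprn_ge0//.
have cc v : `|dot ((m' v)%:R *: bl v)| <= N%:R^-1 * `|dot v|.
  rewrite dotZ /m' /bl; case: ifP => [/eqP ->|_]; first by rewrite !mulr0 normr0 mulr0.
  rewrite mul1r dotZ normrM normfV normr_nat ler_wpM2r// lef_pV2 ?posrE ?ltr0n ?expn_gt0//.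
  by rewrite ler_nat -{1}[N]expn1 leq_exp2l.
rewrite mulrC /cost !big_cons big_map mulrDr; apply: lerD => //.
by rewrite mulr_sumr; apply: ler_sum => v _; exact: cc.
Qed.

(** Downward induction on the weight: beyond the nilpotency bound commutators are 1, and [lnc_cheap]
    leaves a correction of the next weight. Weight 1 is excluded, as a single letter along [u] has
    to be paid for. *)
Lemma Gam_cheap j x : (2 <= j)%N -> Gam j x -> cheap x.
Proof.
have [N hN] := Enilp.
suff h k : forall j x, (2 <= j)%N -> (N < j + k)%N -> Gam j x -> cheap x.
  by move=> j2; apply: (h N.+1) => //; rewrite addnS ltnS leq_addl.
elim: k => [|k IH] {}j {}x j2 hk.
  elim=> {x} [|x y _ ? _ ?|x _ ?|v0 vs T0 Ts h]; [exact: cheap1|exact: cheapM|exact: cheapV|].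
  rewrite hN; first exact: cheap1.
  by rewrite addn0 in hk; rewrite -ltnS; exact: leq_trans hk h.
elim=> {x} [|x y _ ? _ ?|x _ ?|v0 vs T0 Ts h]; [exact: cheap1|exact: cheapM|exact: cheapV|].
have IH' x : Gam j.+1 x -> cheap x by apply: IH; [exact: leqW|rewrite addSnnS].
move: h; rewrite leq_eqVlt => /orP[/eqP jE|h]; last by apply: IH'; exact: Gaml.
apply: lnc_cheap => //; first by rewrite -ltnS -jE.
by move=> x; rewrite -jE; exact: IH'.
Qed.

Lemma comm_cheap x y : cheap [~ x, y]%g.
Proof. by apply: (@Gam_cheap 2) => //; apply: Gam_comm; exact: Gam_full. Qed.
End Words.

Section CompactSeq.
Context {X : topologicalType}.
(** A finite subcover in the form of a list of parameters. [List.In] is used because [T] carries no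
    decidable equality. *)
Lemma compact_seq (K : set X) (T : Type) (P : X -> T -> Prop) : compact K ->
  (forall x, K x -> exists t, \forall x' \near x, P x' t) ->
  exists s : seq T, forall x, K x -> exists t, List.In t s /\ P x t.
Proof.
move=> /compact_near_coveringP cK h.
(* Lists ordered by inclusion: along this filter the near-covering form of compactness yields one
   list for all points. *)
pose F : set_system (seq T) := [set A | exists s0, forall s, (forall t, List.In t s0 -> List.In t s) -> A s].
have FF : Filter F.
  split.
  - by exists [::].
  - move=> A B [s hs] [s' hs']; exists (s ++ s') => t ht; split.
      by apply: hs => z zs; apply: ht; apply/List.in_app_iff; left.
    by apply: hs' => z zs; apply: ht; apply/List.in_app_iff; right.
  - by move=> A B AB [s hs]; exists s => t /hs/AB.
have [|s0 hs0] := cK (seq T) F (fun s x => exists t, List.In t s /\ P x t) FF.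
  move=> x /h[t ht]; exists ([set x' | P x' t], [set s | List.In t s]) => /=.
    by split=> //; exists [:: t] => s; apply; left.
  by move=> [x' s] /= [Px ts]; exists t.
by exists s0 => x Kx; exact: (hs0 s0 _ x Kx).
Qed.
End CompactSeq.

(** * Interface of horizontal exponentials *)

Section Package.
Context {R : realType} {G : carnotGroup R}.
Local Notation n := (carnot_dim G).

(** What the analysis uses of horizontal exponentials, free of charts. [D v] is the left-invariant
    field whose flow is right multiplication by [E (t *: v)]. *)
Record horizontal_exp (E : 'rV[R]_n -> G) (D : 'rV[R]_n -> operator G) : Prop := HorizontalExp {
  he_add : forall v s t, E ((s + t) *: v) = (E (s *: v) * E (t *: v))%g ;
  he_dil : forall r v, 0 < r -> carnot_dil r (E v) = E (r *: v) ;
  he_dilC : forall r1 r2 x, 0 < r1 -> 0 < r2 -> carnot_dil r1 (carnot_dil r2 x) = carnot_dil (r1 * r2) x :> G ;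
  he_dil1 : forall x, carnot_dil 1 x = x :> G ;
  he_small : forall e, 0 < e -> \forall y \near (1%g : G), exists s, word_prod E s = y /\ \sum_(v <- s) `|v| <= e ;
  he_full : forall x, exists s, word_prod E s = x ;
  he_dist : exists2 K, 0 <= K & forall x v, (carnot_dist x (x * E v)%g <= (K * `|v|)%:E)%E ;
  he_comm : forall x y u, cheap E u [~ x, y]%g ;
  he_cont : forall v, continuous (fun t : R => E (t *: v)) ;
  he_lin : forall k v w, D (k *: v + w) = k *: D v + D w ;
  he_smooth : forall v phi, smooth phi -> smooth (D v phi) ;
  he_deriv : forall v phi g (t : R), smooth phi ->
    is_derive t 1 (fun s => phi (g * E (s *: v))%g) (D v phi (g * E (t *: v))%g) }.

Lemma horizontal_exp_exists : exists E D, horizontal_exp E D.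
Proof.
have [c Ac dc] := @lie_cover R n G 1%g.
have [rho [C [Exp [rho0 C0 Eosg Eloc Euniq]]]] := exp_local Ac dc.
exists (E Ac dc Exp), (PI Ac dc); split.
- by move=> v s t; exact: E_add.
- by move=> r v r0; exact: (dil_E Ac dc rho0 C0 Eosg Eloc Euniq).
- by move=> r1 r2 x *; exact: (dil_comp Ac dc rho0 C0 Eosg Eloc Euniq).
- exact: (dil_id Ac dc rho0 C0 Eosg Eloc Euniq).
- move=> e e0; exact: (small_words Ac dc rho0 C0 Eosg Eloc Euniq e0).
- move=> x; have [|| s [_ <-]] := @HT_full _ _ _ Ac dc _ _ _ rho0 C0 Eosg Eloc Euniq (fun=> True) _ _ x; last by exists s.
  + by [].
  + by move=> v; exists v, 0; rewrite addr0.
- exact: (E_dist Ac dc rho0 C0 Eosg Eloc).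
- move=> x y u; apply: comm_cheap.
  + by move=> v s t; exact: E_add.
  + move=> T Tscal Tspan z; exact: (HT_full Ac dc rho0 C0 Eosg Eloc Euniq Tscal Tspan z).
  + exact: (nilp Ac dc rho0 C0 Eosg Eloc Euniq).
- move=> v; exact: (osg_cont Ac dc (E_osg Ac dc Eosg v) (E_tangent Ac dc rho0 C0 Eloc v)).
- exact: PI_lin.
- by move=> v phi sphi; have [[h _ _ _] _] := PI_lie Ac dc v; exact: h.
- move=> v phi g t sphi.
  exact: (osg_velocity g t (E_osg Ac dc Eosg v) (PI_lie Ac dc v) (E_tangent Ac dc rho0 C0 Eloc v) sphi).
Qed.

Variables (E : 'rV[R]_n -> G) (D : 'rV[R]_n -> operator G).
Hypothesis hE : horizontal_exp E D.

Lemma dot_bound (u v : 'rV[R]_n) : `|dot u v| <= n%:R * `|u| * `|v|.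
Proof.
apply: (le_trans (ler_norm_sum _ _ _)).
apply: (@le_trans _ _ (\sum_(i < n) `|u| * `|v|)).
  by apply: ler_sum => i _; rewrite normrM; apply: ler_pM => //; exact: coord_norm_le.
by rewrite sumr_const card_ord -[_ *+ n]mulr_natl mulrA.
Qed.

Lemma comm_sub_cheap c u : commutator_subgroup G c -> cheap E u c.
Proof.
move=> h; apply: (h (cheap E u)); split; last first.
  by move=> _ [x _ [y _ <-]]; exact: (he_comm hE).
split.
- exact: cheap1.
- by move=> x y; exact: cheapM.
- by move=> x; apply: cheapV; exact: (he_add hE).
Qed.

(** The cost of a fixed word is continuous in [u], so a word that is good at [u] with half the
    allowance serves a neighbourhood; the unit ball is compact. *)
Lemma words_unif c e : commutator_subgroup G c -> 0 < e -> exists F : seq (seq 'rV[R]_n),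
  forall u, `|u| <= 1 -> exists s, [/\ List.In s F, word_prod E s = c & cost u s <= e].
Proof.
move=> hc e0.
have cK : compact [set u : 'rV[R]_n | `|u| <= 1].
  apply: bounded_closed_compact.
    by exists 1; split=> // M M1 u /= /le_trans; apply; exact: ltW.
  have -> : [set u : 'rV[R]_n | `|u| <= 1] = (fun u : 'rV[R]_n => `|u|) @^-1` [set x : R | x <= 1] by [].
  by apply: closed_comp => [u _|]; [exact: norm_continuous|exact: closed_le].
have [|F hF] := @compact_seq _ _ (seq 'rV[R]_n) (fun u s => word_prod E s = c /\ cost u s <= e) cK.
  move=> u _; have e2 : 0 < e / 2 by rewrite divr_gt0.
  have [s [Es cs]] := comm_sub_cheap u hc e2; exists s.
  pose K := n%:R * \sum_(v <- s) `|v|.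
  have K0 : 0 <= K by rewrite mulr_ge0// sumr_ge0.
  have K1 : 0 < K + 1 by rewrite ltr_wpDl.
  apply/nbhs_ballP; exists (e / 2 / (K + 1)); first by rewrite /= divr_gt0.
  move=> u'; rewrite -ball_normE /= ltr_pdivlMr// => hu; split=> //.
  have : cost u' s <= cost u s + `|u - u'| * K.
    rewrite /K mulrCA mulrA mulr_sumr /cost -big_split /=; apply: ler_sum => v _.
    have -> : dot u' v = dot u v - dot (u - u') v.
      rewrite /dot -sumrB; apply: eq_bigr => i _; rewrite !mxE; ring.
    by apply: (le_trans (ler_normB _ _)); rewrite lerD2l; exact: dot_bound.
  move=> /le_trans; apply; rewrite [leRHS]splitr lerD//.
  by apply: le_trans (ltW hu); rewrite ler_wpM2l// lerDl.
by exists F => u /hF[s [sF [Es cs]]]; exists s.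
Qed.
End Package.

(** * Haar functional *)

Section Cc.
Context {R : realType} {n : nat} {G : lieGroupType R n}.
Implicit Types (f g h phi : G -> R) (x y w : G).

Definition Cc f := continuous f /\ exists2 K : set G, compact K & forall x, f x != 0 -> K x.

Lemma Cc_mull f g : Cc f -> continuous g -> Cc (fun x => f x * g x).
Proof.
move=> [cf [K cK hK]] cg; split.
  by move=> x; exact: (continuousM (cf x) (cg x)).
by exists K => // x; rewrite mulf_eq0 negb_or => /andP[/hK].
Qed.

Lemma Cc_add f g : Cc f -> Cc g -> Cc (fun x => f x + g x).
Proof.
move=> [cf [K cK hK]] [cg [L cL hL]]; split.
  by move=> x; exact: (continuousD (cf x) (cg x)).
exists (K `|` L); first exact: compactU.
move=> x; have [->|/hK] := eqVneq (f x) 0; last by left.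
by rewrite add0r => /hL; right.
Qed.

Lemma Cc_scale a f : Cc f -> Cc (fun x => a * f x).
Proof.
move=> [cf [K cK hK]]; split.
  by move=> x; exact: (continuousM (@cst_continuous _ _ a x) (cf x)).
by exists K => // x; rewrite mulf_eq0 negb_or => /andP[_ /hK].
Qed.

Lemma Cc_sub f g : Cc f -> Cc g -> Cc (fun x => f x - g x).
Proof.
move=> hf /(Cc_scale (-1)) /(Cc_add hf); congr Cc; apply/funext => x.
by rewrite mulN1r.
Qed.

Lemma Cc_comp f (u : R -> R) : Cc f -> continuous u -> u 0 = 0 -> Cc (u \o f).
Proof.
move=> [cf [K cK hK]] cu u0; split.
  by move=> x; apply: continuous_comp; [exact: cf|exact: cu].
by exists K => // x ux; apply: hK; apply: contra_neq ux => /= ->.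
Qed.

Lemma Cc_norm f : Cc f -> Cc (fun x => `|f x|).
Proof. by move=> hf; apply: (@Cc_comp f (fun t => `|t|)) => //; [exact: norm_continuous|rewrite normr0]. Qed.

Lemma Cc_transl f (g : G) : Cc f -> Cc (fun x => f (x * g)%g).
Proof.
move=> [cf [K cK hK]]; split.
  move=> x; apply: (@continuous_comp _ _ _ (fun x => x * g)%g f); [exact: mulR_cont|exact: cf].
exists ((fun x => x * g^-1)%g @` K).
  apply: continuous_compact => //; apply: continuous_subspaceT; exact: mulR_cont.
by move=> x /hK Kx; exists (x * g)%g => //; rewrite mulgK.
Qed.

Lemma Cc_bounded f : Cc f -> exists2 M, 0 <= M & forall x, `|f x| <= M.
Proof.
move=> [cf [K cK hK]].
have [|s hs] := @compact_seq G K R (fun x M => `|f x| <= M) cK.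
  move=> x _; exists (`|f x| + 1).
  have : \forall x' \near x, `|f x - f x'| < 1 by move/cvgrPdist_lt : (cf x); apply.
  apply: filterS => x' hx; have := ler_normB (f x) (f x - f x'); rewrite opprB addrC subrK.
  by move=> /le_trans; apply; rewrite lerD2l ltW.
have sm M : List.In M s -> M <= \sum_(t <- s) `|t|.
  elim: s {hs} => //= t s IH [->|/IH h]; rewrite big_cons.
    by apply: le_trans (ler_norm _) _; rewrite lerDl sumr_ge0.
  by apply: (le_trans h); rewrite lerDr.
exists (\sum_(t <- s) `|t|); first exact: sumr_ge0.
move=> x; have [->|/hK/hs[M [/sm Ms /le_trans]]] := eqVneq (f x) 0; last exact.
by rewrite normr0 sumr_ge0.
Qed.

(** Stated for an action so as to cover left and right translations. A point outside [K] may be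
    moved into it, so both [w] and its inverse have to be near 1. *)
Lemma unif_act (a : G * G -> G) f e : continuous a -> (forall x, a (1%g, x) = x) ->
  (forall w x, a (w^-1%g, a (w, x)) = x) -> Cc f -> 0 < e ->
  \forall w \near (1%g : G), forall x, `|f (a (w, x)) - f x| <= e.
Proof.
move=> ca a1 aV [cf [K cK hK]] e0.
have h1 : \forall w \near (1%g : G), K `<=` (fun x => `|f (a (w, x)) - f x| <= e).
  have /compact_near_coveringP cK' := cK.
  apply: (cK' G (nbhs (1%g : G)) (fun w x => `|f (a (w, x)) - f x| <= e) (nbhs_filter _)).
  move=> x _.
  have c1 : (fun p : G * G => f (a (p.2, p.1)) - f p.1) @ (x, 1%g) --> (0 : R).
    have -> : 0 = f (a ((x, 1%g : G).2, x)) - f x by rewrite /= a1 subrr.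
    apply: cvgB.
      apply: (@continuous_comp _ _ _ (fun p : G * G => (p.2, p.1)) (f \o a)).
        by apply: cvg_pair; [exact: cvg_snd|exact: cvg_fst].
      by apply: continuous_comp; [exact: ca|exact: cf].
    by apply: (cvg_comp (@fst G G) f); [exact: cvg_fst|exact: cf].
  move/cvgrPdist_le : c1 => /(_ _ e0).
  by apply: filterS => p /=; rewrite sub0r normrN.
have h2 : \forall w \near (1%g : G), K `<=` (fun x => `|f (a (w^-1%g, x)) - f x| <= e).
  have := @inv_cont R n G 1%g; rewrite /continuous_at invg1 => /(_ _ h1); exact.
near=> w; have k1 : K `<=` (fun x => `|f (a (w, x)) - f x| <= e) by near: w.
have k2 : K `<=` (fun x => `|f (a (w^-1%g, x)) - f x| <= e) by near: w.
move=> x; have [fx0|/hK/k1//] := eqVneq (f x) 0.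
have [fx1|/hK/k2] := eqVneq (f (a (w, x))) 0; first by rewrite fx0 fx1 subrr normr0 ltW.
by rewrite aV distrC.
Unshelve. all: by end_near. Qed.

Lemma unif_left f e : Cc f -> 0 < e -> \forall w \near (1%g : G), forall x, `|f (w * x)%g - f x| <= e.
Proof. by apply: (@unif_act (fun p => p.1 * p.2)%g); [exact: mul_cont|exact: mul1g|exact: mulKg]. Qed.

Lemma unif_right f e : Cc f -> 0 < e -> \forall w \near (1%g : G), forall x, `|f (x * w)%g - f x| <= e.
Proof.
apply: (@unif_act (fun p => p.2 * p.1)%g); [|exact: mulg1|by move=> w x; rewrite /= mulgK].
move=> p; apply: (@continuous_comp _ _ _ (fun p : G * G => (p.2, p.1)) (fun q : G * G => q.1 * q.2)%g).
  by apply: cvg_pair; [exact: cvg_snd|exact: cvg_fst].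
exact: mul_cont.
Qed.

Lemma bump_compact (K : set G) : compact K -> exists2 f, Cc f /\ (forall x, 0 <= f x) & forall x, K x -> 1 <= f x.
Proof.
move=> cK.
have [|s hs] := @compact_seq G K {f : G -> R | Cc f /\ (forall x, 0 <= f x)} (fun x p => sval p x = 1) cK.
  move=> x _; have [W [L [sW W01 W1 cL [_ W0]]]] := @bump_G R n G setT x openT I.
  have hW : Cc W /\ (forall x, 0 <= W x).
    split; last by move=> y; have /andP[] := W01 y.
    split; first exact: smooth_cont.
    by exists L => // y; apply: contraNP => /W0 ->.
  by exists (exist _ W hW).
elim: s K {cK} hs => [|[f hf] s IH] K hs.
  exists (fun=> 0); last by move=> x /hs[t []].
  by split=> //; split; [exact: cst_continuous|exists set0; [exact: compact0|move=> x; rewrite eqxx]].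
have [|g [cg g0] hg] := IH (K `&` [set x | f x != 1]).
  by move=> x [/hs[t [[<-|ts] h]]] /=; [rewrite /= in h; rewrite h eqxx|exists t].
exists (fun x => f x + g x).
  by split; [exact: Cc_add hf.1 cg|move=> x; rewrite addr_ge0// hf.2].
move=> x Kx; have [->|f1] := eqVneq (f x) 1; first by rewrite lerDl.
by apply: le_trans (hg x _) _; [split|rewrite lerDr hf.2].
Qed.
End Cc.

(** * Haar's covering indices *)

Section Cover.
Context {R : realType} {n : nat} {G : lieGroupType R n}.
Implicit Types (f g h phi : G -> R) (x y w : G) (s : seq (R * G)).

Definition Ccp f := Cc f /\ forall x, 0 <= f x.
Definition covers f phi s := all (fun p => 0 <= p.1) s /\ forall y, f y <= \sum_(p <- s) p.1 * phi (y * p.2)%g.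
Definition wt s : R := \sum_(p <- s) p.1.
(** Haar's index $(f:\varphi)$, subadditive in [f] and almost additive when the support of [phi]
    shrinks to 1. *)
Definition covering_number f phi := inf [set wt s | s in covers f phi].

Lemma wt_ge0 s : all (fun p => 0 <= p.1) s -> 0 <= wt s.
Proof. by move=> /allP h; rewrite /wt big_seq sumr_ge0// => p /h. Qed.

Lemma covers_exists f phi : Ccp f -> Ccp phi -> 0 < phi 1%g -> exists s, covers f phi s.
Proof.
move=> [cf f0] [cp p0] p1; have [M M0 hM] := Cc_bounded cf.
have [_ [K cK hK]] := cf.
pose m := phi 1%g / 2; have m0 : 0 < m by rewrite divr_gt0.
have [|s hs] := @compact_seq G K G (fun x t => m <= phi (x * t)%g) cK.
  move=> x _; exists x^-1%g.
  have : (fun y => phi (y * x^-1)%g) @ x --> phi 1%g.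
    rewrite -(mulgV x); apply: (@continuous_comp _ _ _ (fun y => y * x^-1)%g phi); [exact: mulR_cont|exact: cp.1].
  move/cvgrPdist_lt => /(_ _ m0); apply: filterS => y /= h.
  have := le_lt_trans (ler_norm _) h; rewrite /m; lra.
exists [seq (M / m, t) | t <- s]; split.
  by rewrite all_map; apply/allP => t _ /=; rewrite divr_ge0// ltW.
move=> y; rewrite big_map /=.
have nn t : 0 <= M / m * phi (y * t)%g by rewrite mulr_ge0// divr_ge0// ltW.
have [->|/hK/hs[t [ts ht]]] := eqVneq (f y) 0; first by rewrite sumr_ge0.
apply: (@le_trans _ _ (M / m * phi (y * t)%g)).
  apply: le_trans (ler_norm _) _; apply: le_trans (hM _) _.
  by rewrite mulrAC ler_pdivlMr// ler_wpM2l.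
elim: s ts {hs} => //= t' s IH [->|/IH h]; rewrite big_cons.
  by rewrite lerDl sumr_ge0.
by apply: (le_trans h); rewrite lerDr.
Qed.

Lemma covering_number_inf f phi : Ccp f -> Ccp phi -> 0 < phi 1%g -> has_inf [set wt s | s in covers f phi].
Proof.
move=> hf hp p1; split; first by have [s hs] := covers_exists hf hp p1; exists (wt s), s.
by exists 0 => _ [s [hs _] <-]; exact: wt_ge0.
Qed.

Lemma covering_number_le f phi s : Ccp f -> Ccp phi -> 0 < phi 1%g -> covers f phi s -> covering_number f phi <= wt s.
Proof. by move=> hf hp p1 hs; apply: ge_inf; [case: (covering_number_inf hf hp p1)|exists s]. Qed.

Lemma covering_number_approx f phi e : Ccp f -> Ccp phi -> 0 < phi 1%g -> 0 < e -> exists2 s, covers f phi s & wt s <= covering_number f phi + e.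
Proof.
move=> hf hp p1 e0; have [_ [s hs <-] h] := inf_adherent e0 (covering_number_inf hf hp p1).
by exists s => //; exact: ltW.
Qed.

Lemma covering_number_ge0 f phi : Ccp f -> Ccp phi -> 0 < phi 1%g -> 0 <= covering_number f phi.
Proof.
move=> hf hp p1; apply: lb_le_inf; first by case: (covering_number_inf hf hp p1).
by move=> _ [s [hs _] <-]; exact: wt_ge0.
Qed.

Lemma covering_number_gt0 f phi x : Ccp f -> Ccp phi -> 0 < phi 1%g -> 0 < f x -> 0 < covering_number f phi.
Proof.
move=> hf hp p1 fx; have [M M0 hM] := Cc_bounded hp.1.
have M1 : 0 < M + 1 by rewrite ltr_wpDl.
apply: (@lt_le_trans _ _ (f x / (M + 1))); first by rewrite divr_gt0.
apply: lb_le_inf; first by case: (covering_number_inf hf hp p1).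
move=> _ [s [hs hc] <-]; rewrite ler_pdivrMr//; apply: (le_trans (hc x)).
rewrite /wt mulr_suml big_seq [leRHS]big_seq; apply: ler_sum => p ps.
rewrite ler_wpM2l//; first by move/allP : hs; apply.
by apply: le_trans (ler_norm _) _; apply: le_trans (hM _) _; rewrite lerDl.
Qed.

Lemma Ccp_add f g : Ccp f -> Ccp g -> Ccp (fun x => f x + g x).
Proof. by move=> [cf f0] [cg g0]; split; [exact: Cc_add|move=> x; rewrite addr_ge0]. Qed.
Lemma Ccp_scale a f : 0 <= a -> Ccp f -> Ccp (fun x => a * f x).
Proof. by move=> a0 [cf f0]; split; [exact: Cc_scale|move=> x; rewrite mulr_ge0]. Qed.
Lemma Ccp_transl f (g : G) : Ccp f -> Ccp (fun x => f (x * g)%g).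
Proof. by move=> [cf f0]; split=> //; exact: Cc_transl. Qed.

Section Fix.
Variable phi : G -> R.
Hypotheses (hp : Ccp phi) (p1 : 0 < phi 1%g).

Lemma covering_number_mono f g : Ccp f -> Ccp g -> (forall x, f x <= g x) -> covering_number f phi <= covering_number g phi.
Proof.
move=> hf hg fg; apply/ler_addgt0Pr => e e0; have [s [h1 h2] hs] := covering_number_approx hg hp p1 e0.
apply: le_trans hs; apply: covering_number_le => //; split=> // y; exact: le_trans (fg y) (h2 y).
Qed.

Lemma covering_number_add f g : Ccp f -> Ccp g -> covering_number (fun x => f x + g x) phi <= covering_number f phi + covering_number g phi.
Proof.
move=> hf hg; apply/ler_addgt0Pr => e e0; have e2 : 0 < e / 2 by rewrite divr_gt0.
have [s [h1 h2] hs] := covering_number_approx hf hp p1 e2; have [t [k1 k2] ht] := covering_number_approx hg hp p1 e2.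
apply: (@le_trans _ _ (wt (s ++ t))).
  apply: covering_number_le => //; first exact: Ccp_add.
  split; first by rewrite all_cat h1.
  by move=> y; rewrite big_cat; exact: lerD.
by rewrite /wt big_cat [e]splitr addrACA; exact: lerD.
Qed.

Lemma covering_number_scale_le a f : 0 <= a -> Ccp f -> covering_number (fun x => a * f x) phi <= a * covering_number f phi.
Proof.
move=> a0 hf; apply/ler_addgt0Pr => e e0.
have a1 : 0 < a + 1 by rewrite ltr_wpDl.
have e2 : 0 < e / (a + 1) by rewrite divr_gt0.
have [s [h1 h2] hs] := covering_number_approx hf hp p1 e2.
apply: (@le_trans _ _ (wt [seq (a * p.1, p.2) | p <- s])).
  apply: covering_number_le => //; first exact: Ccp_scale.
  split; first by rewrite all_map; apply/allP => p ps /=; rewrite mulr_ge0//; move/allP : h1; apply.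
  move=> y; rewrite big_map /=; under eq_bigr do rewrite -mulrA.
  by rewrite -mulr_sumr ler_wpM2l.
rewrite /wt big_map /= -mulr_sumr -/(wt s); apply: (le_trans (ler_wpM2l a0 hs)).
rewrite mulrDr lerD2l mulrCA ler_piMr ?(ltW e0)// ler_pdivrMr// mul1r lerDl//.
Qed.

Lemma covering_number_scale a f : 0 < a -> Ccp f -> covering_number (fun x => a * f x) phi = a * covering_number f phi.
Proof.
move=> a0 hf; apply/eqP; rewrite eq_le covering_number_scale_le ?(ltW a0)//=.
have ai : 0 <= a^-1 by rewrite invr_ge0 ltW.
have := covering_number_scale_le ai (Ccp_scale (ltW a0) hf).
under [X in covering_number X]funext do rewrite mulrA mulVf ?gt_eqF// mul1r.
by rewrite -ler_pdivlMl.
Qed.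

Lemma covering_number_transl_le f (g : G) : Ccp f -> covering_number (fun x => f (x * g)%g) phi <= covering_number f phi.
Proof.
move=> hf; apply/ler_addgt0Pr => e e0; have [s [h1 h2] hs] := covering_number_approx hf hp p1 e0.
apply: le_trans hs; apply: (@le_trans _ _ (wt [seq (p.1, (g * p.2)%g) | p <- s])).
  apply: covering_number_le => //; first exact: Ccp_transl.
  split; first by rewrite all_map.
  move=> y; rewrite big_map /=; apply: (le_trans (h2 _)).
  by rewrite le_eqVlt; apply/orP; left; apply/eqP; apply: eq_bigr => p _; rewrite mulgA.
by rewrite /wt big_map.
Qed.

Lemma covering_number_transl f (g : G) : Ccp f -> covering_number (fun x => f (x * g)%g) phi = covering_number f phi.
Proof.
move=> hf; apply/eqP; rewrite eq_le covering_number_transl_le//=.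
have := covering_number_transl_le g^-1%g (Ccp_transl g hf).
by under [X in covering_number X]funext do rewrite mulgVK.
Qed.

(** Substituting a covering of [f0] into a covering of [f] by translates of [f0]. This bounds the
    index normalised by [f0] independently of [phi]. *)
Lemma covering_number_comp f f0 : Ccp f -> Ccp f0 -> 0 < f0 1%g -> covering_number f phi <= covering_number f f0 * covering_number f0 phi.
Proof.
move=> hf hf0 f01; set B := covering_number f0 phi; have B0 : 0 <= B by exact: covering_number_ge0.
have key s : all (fun p => 0 <= p.1) s -> Ccp (fun y => \sum_(p <- s) p.1 * f0 (y * p.2)%g) /\
    covering_number (fun y => \sum_(p <- s) p.1 * f0 (y * p.2)%g) phi <= wt s * B.
  elim: s => [_|p s IH /= /andP[p0 /IH[c1 c2]]].
    under [X in Ccp X]funext do rewrite big_nil -(mul0r (f0 1%g)).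
    under [X in covering_number X]funext do rewrite big_nil -(mul0r (f0 1%g)).
    have z : (fun _ : G => 0 * f0 1%g) = (fun x => 0 * f0 x) by apply/funext => x; rewrite !mul0r.
    rewrite z; split; first exact: Ccp_scale.
    by have := covering_number_scale_le (lexx 0) hf0; rewrite mul0r /wt big_nil mul0r.
  under [X in Ccp X]funext do rewrite big_cons.
  under [X in covering_number X]funext do rewrite big_cons.
  have cp := Ccp_scale p0 (Ccp_transl p.2 hf0).
  split; first exact: Ccp_add.
  rewrite /wt big_cons mulrDl; apply: (le_trans (covering_number_add cp c1)); apply: lerD => //.
  apply: (le_trans (covering_number_scale_le p0 (Ccp_transl p.2 hf0))).
  by rewrite covering_number_transl.
apply/ler_addgt0Pr => e e0; have B1 : 0 < B + 1 by rewrite ltr_wpDl.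
have e2 : 0 < e / (B + 1) by rewrite divr_gt0.
have [s [h1 h2] hs] := covering_number_approx hf hf0 f01 e2.
have [c1 c2] := key _ h1.
apply: (le_trans (covering_number_mono hf c1 h2)); apply: (le_trans c2); apply: (le_trans (ler_wpM2r B0 hs)).
rewrite mulrDl lerD2l mulrAC -mulrA ler_piMr ?(ltW e0)// ler_pdivrMr// mul1r lerDl//.
Qed.
End Fix.

Lemma Cc_ratio f1 f (K : set G) d : Ccp f1 -> Ccp f -> compact K -> (forall x, f1 x != 0 -> K x) -> 0 < d ->
  (forall x, K x -> d <= f x) -> Cc (fun x => f1 x / f x).
Proof.
move=> [c1 p1] [cf pf] cK hK d0 hd; split; last first.
  by exists K => // x; rewrite mulf_eq0 negb_or => /andP[/hK].
have clK : closed K by apply: compact_closed => //; exact: lie_hausdorff.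
move=> x; have [Kx|nKx] := pselect (K x).
  have fx : f x != 0 by rewrite gt_eqF// (lt_le_trans d0)// hd.
  exact: (continuousM (c1.1 x) (continuousV fx (cf.1 x))).
have h : \forall y \near x, f1 y / f y = 0.
  have : nbhs x (~` K) by apply: open_nbhs_nbhs; split=> //; exact: closed_openC.
  apply: filterS => y nK; have [->|/hK//] := eqVneq (f1 y) 0; first by rewrite mul0r.
rewrite /continuous_at (nbhs_singleton h).
apply/cvgrPdist_le => e e0; apply: filterS h => y ->.
by rewrite subrr normr0 ltW.
Qed.

Lemma almost_add_arith (F S T Z t d B B' e : R) : F <= S + d * T -> S <= B * Z -> T <= B' * Z -> 0 <= Z ->
  t <= 2^-1 -> t * B <= e / 4 -> d * B' <= e / 4 -> 0 <= T -> 0 <= S -> 0 <= t -> 0 <= d -> 0 <= B -> 0 <= B' ->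
  (1 + 2 * t) * F <= S + e * Z.
Proof.
move=> b1 b2 b3 z0 e1 e2 e3 q1 q2 t0 d0 B0 B'0.
have r1 : (1 + 2 * t) * F <= (1 + 2 * t) * (S + d * T) by rewrite ler_wpM2l// addr_ge0// mulr_ge0.
apply: (le_trans r1).
have r2 : t * S <= t * (B * Z) by rewrite ler_wpM2l.
have r3 : d * T <= d * (B' * Z) by rewrite ler_wpM2l.
have r4 : t * B * Z <= e / 4 * Z by rewrite ler_wpM2r.
have r5 : d * B' * Z <= e / 4 * Z by rewrite ler_wpM2r.
have r6 : 2 * t * (d * T) <= d * T by rewrite ler_piMl ?mulr_ge0//; lra.
have -> : (1 + 2 * t) * (S + d * T) = S + 2 * (t * S) + d * T + 2 * t * (d * T) by ring.
have r7 : t * S <= e / 4 * Z by apply: le_trans r2 _; rewrite mulrA.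
have r8 : d * T <= e / 4 * Z by apply: le_trans r3 _; rewrite mulrA.
have -> : e * Z = 4 * (e / 4 * Z) by field.
by move: r6 r7 r8; move: (2 * t * (d * T)) (t * S) (d * T) (e / 4 * Z) => *; lra.
Qed.

(** A cover of $f = f_1 + f_2 + d f'$ is divided between $f_1$ and $f_2$ in the proportions $f_i/f$
    taken at the centres [p.2^-1]. The summand $d f'$ keeps the denominator away from 0 on the
    supports, so the ratios are uniformly continuous; [V] controls their oscillation over the
    support of [phi]. *)
Lemma covering_number_almost_add f1 f2 f0 e : Ccp f1 -> Ccp f2 -> Ccp f0 -> 0 < f0 1%g -> 0 < e ->
  exists2 V : set G, nbhs 1%g V & forall phi, Ccp phi -> 0 < phi 1%g -> (forall y, phi y != 0 -> V y) ->
    covering_number f1 phi + covering_number f2 phi <= covering_number (fun x => f1 x + f2 x) phi + e * covering_number f0 phi.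
Proof.
move=> h1 h2 h0 f01 e0.
have [[_ [K1 cK1 hK1]] p1] := h1; have [[_ [K2 cK2 hK2]] p2] := h2.
have cK := compactU cK1 cK2.
have [f' hf' f'1] := bump_compact cK.
have h12 := Ccp_add h1 h2.
set B := covering_number (fun x => f1 x + f2 x) f0; set B' := covering_number f' f0.
have B0 : 0 <= B by exact: covering_number_ge0.
have B'0 : 0 <= B' by exact: covering_number_ge0.
pose d := e / (4 * (B' + 1)); pose eta := Num.min 2^-1 (e / (4 * (B + 1))).
have d0 : 0 < d by rewrite divr_gt0// mulr_gt0// ltr_wpDl.
have eta0 : 0 < eta by rewrite lt_min invr_gt0 ltr0n divr_gt0// mulr_gt0// ltr_wpDl.
pose f x := f1 x + f2 x + d * f' x.
have hf : Ccp f by apply: Ccp_add => //; apply: Ccp_scale => //; exact: ltW.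
have fd x : (K1 `|` K2) x -> d <= f x.
  move=> Kx; apply: (@le_trans _ _ (d * f' x)).
    by rewrite ler_peMr ?(ltW d0)//; exact: f'1.
  by rewrite lerDr; exact: h12.2.
have c1 : Cc (fun x => f1 x / f x) by apply: (Cc_ratio h1 hf cK _ d0 fd) => x /hK1; left.
have c2 : Cc (fun x => f2 x / f x) by apply: (Cc_ratio h2 hf cK _ d0 fd) => x /hK2; right.
exists [set w | (forall x, `|f1 (w * x)%g / f (w * x)%g - f1 x / f x| <= eta) /\
  forall x, `|f2 (w * x)%g / f (w * x)%g - f2 x / f x| <= eta].
  by apply: filterI; [exact: unif_left c1 eta0|exact: unif_left c2 eta0].
move=> phi hp pp hV.
have fi x : f1 x <= f x /\ f2 x <= f x.
  have q : 0 <= d * f' x by rewrite mulr_ge0 ?(ltW d0)//; exact: hf'.2.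
  by rewrite /f; split; [rewrite -addrA lerDl addr_ge0|rewrite [f1 x + _]addrC -addrA lerDl addr_ge0].
have cover g s : Ccp g -> (forall x, g x <= f x) -> (forall w x, phi w != 0 -> `|g (w * x)%g / f (w * x)%g - g x / f x| <= eta) ->
    covers f phi s -> covers g phi [seq (p.1 * (g (p.2^-1)%g / f (p.2^-1)%g + eta), p.2) | p <- s].
  move=> [cg g0] gf hg [s1 s2]; split.
    rewrite all_map; apply/allP => p ps /=; rewrite mulr_ge0//; first by move/allP : s1; apply.
    by rewrite addr_ge0 ?(ltW eta0)// divr_ge0//; exact: hf.2.
  move=> y; rewrite big_map /=.
  have E : g y = f y * (g y / f y).
    have [fy|fy] := eqVneq (f y) 0; last by rewrite mulrC divfK.
    by rewrite fy mul0r; apply/eqP; rewrite eq_le g0 andbT -fy.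
  have q0 : 0 <= g y / f y by rewrite divr_ge0//; exact: hf.2.
  rewrite E; apply: (le_trans (ler_wpM2r q0 (s2 y))).
  rewrite mulr_suml big_seq [leRHS]big_seq; apply: ler_sum => p ps.
  rewrite mulrAC; have p0 : 0 <= p.1 by move/allP : s1; apply.
  have [->|py] := eqVneq (phi (y * p.2)%g) 0; first by rewrite !mulr0.
  rewrite ler_wpM2r//; first exact: hp.2.
  rewrite ler_wpM2l//; have := hg _ (p.2^-1)%g py; rewrite mulgK => /(le_trans (ler_norm _)).
  by rewrite lerBlDr addrC.
have main : covering_number f1 phi + covering_number f2 phi <= (1 + 2 * eta) * covering_number f phi.
  apply/ler_addgt0Pr => e' e'0; have e3 : 0 < e' / 2 by rewrite divr_gt0.
  have [s hs ws] := covering_number_approx hf hp pp e3.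
  have k1 := cover f1 s h1 (fun x => (fi x).1) (fun w x pw => (hV w pw).1 x) hs.
  have k2 := cover f2 s h2 (fun x => (fi x).2) (fun w x pw => (hV w pw).2 x) hs.
  have := lerD (covering_number_le h1 hp pp k1) (covering_number_le h2 hp pp k2); move/le_trans; apply.
  apply: (@le_trans _ _ ((1 + 2 * eta) * wt s)).
    rewrite /wt !big_map -big_split mulr_sumr /= big_seq [leRHS]big_seq; apply: ler_sum => p ps.
    rewrite -mulrDr mulrC ler_wpM2r//; first by move/allP : hs.1; apply.
    set x := (p.2^-1)%g.
    have : f1 x / f x + f2 x / f x <= 1.
      rewrite -mulrDl; have [->|fx] := eqVneq (f x) 0; first by rewrite invr0 mulr0.
      have fx0 : 0 < f x by rewrite lt_neqAle eq_sym fx; exact: hf.2.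
      rewrite ler_pdivrMr// mul1r /f lerDl mulr_ge0 ?(ltW d0)//; exact: hf'.2.
    by move: (_ / _) (_ / _) => z1 z2; lra.
  have q : 0 <= 1 + 2 * eta by rewrite addr_ge0// mulr_ge0// ltW.
  apply: (le_trans (ler_wpM2l q ws)); rewrite mulrDr lerD2l.
  have z : 2 * eta <= 1.
    by rewrite mulrC -ler_pdivlMr// mul1r /eta ge_min lexx.
  apply: (@le_trans _ _ (2 * (e' / 2))); last by rewrite mulrC divfK.
  by rewrite ler_wpM2r ?(ltW e3)//; apply: le_trans (lerD (lexx 1) z) _.
apply: (le_trans main).
have b1 : covering_number f phi <= covering_number (fun x => f1 x + f2 x) phi + d * covering_number f' phi.
  apply: (le_trans (covering_number_add hp pp h12 (Ccp_scale (ltW d0) hf'))); rewrite lerD2l.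
  exact: (covering_number_scale_le hp pp (ltW d0) hf').
have b2 := covering_number_comp hp pp h12 h0 f01; have b3 := covering_number_comp hp pp hf' h0 f01; rewrite -/B -/B' in b2 b3.
have z0 : 0 <= covering_number f0 phi by exact: covering_number_ge0.
have e1 : eta <= 2^-1 by rewrite ge_min lexx.
have hq (X : R) : 0 <= X -> e / (4 * (X + 1)) * X <= e / 4.
  move=> X0; have X1 : 0 < X + 1 by rewrite ltr_wpDl.
  have -> : e / (4 * (X + 1)) * X = e / 4 * (X / (X + 1)) by field; rewrite gt_eqF.
  by rewrite ler_piMr ?divr_ge0 ?(ltW e0)// ler_pdivrMr// mul1r lerDl.
have e2 : eta * B <= e / 4.
  have : eta <= e / (4 * (B + 1)) by rewrite ge_min lexx orbT.
  by move=> /(ler_wpM2r B0) /le_trans; apply; exact: hq.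
have e3 : d * B' <= e / 4 by exact: hq.
have q1 : 0 <= covering_number f' phi by exact: covering_number_ge0.
have q2 : 0 <= covering_number (fun x => f1 x + f2 x) phi by exact: covering_number_ge0.
exact: (almost_add_arith b1 b2 b3 z0 e1 e2 e3 q1 q2 (ltW eta0) (ltW d0) B0 B'0).
Qed.
End Cover.

Section Ultra.
Context {R : realType} {T : Type} {U : set_system T} {UU : UltraFilter U}.
Lemma ultra_lim (u : T -> R) (a b : R) : (\forall t \near U, a <= u t <= b) ->
  exists l, a <= l <= b /\ forall e, 0 < e -> \forall t \near U, `|l - u t| <= e.
Proof.
move=> hu; have PU : ProperFilter U by exact: ultra_proper.
have hu' : (u @ U) [set` `[a, b]] by apply: filterS hu => t; rewrite /= in_itv.
have [l [lab hl]] := @segment_compact R a b (u @ U) _ hu'.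
exists l; split; first by move: lab; rewrite /= in_itv.
move=> e e0; have [//|h] := in_ultra_setVsetC [set t | `|l - u t| <= e] UU.
have nb : nbhs l (ball l e) by exact: nbhsx_ballx.
have [_ [[t ht <-]]] := hl _ _ (filterS (fun t ht => ex_intro2 _ _ t ht erefl) h : (u @ U) (u @` ~` [set t | `|l - u t| <= e])) nb.
by rewrite -ball_normE /= => /ltW.
Qed.
End Ultra.

Section Haar.
Context {R : realType} {n : nat} {G : lieGroupType R n}.
Implicit Types (f g h phi : G -> R).

Definition small_bump (V : set G) phi := [/\ Ccp phi, 0 < phi 1%g & forall y, phi y != 0 -> V y].

Lemma small_bump_filter : ProperFilter [set A : set (G -> R) | exists2 V : set G, nbhs 1%g V & forall phi, small_bump V phi -> A phi].
Proof.
apply: Build_ProperFilter_ex.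
  move=> A [V nV hA]; move: nV; rewrite nbhsE => -[V0 [oO O1] OV].
  have [W [K [sW W01 W1 cK [KO W0]]]] := @bump_G R n G V0 1%g oO O1.
  exists W; apply: hA; split.
  - split; last by move=> x; have /andP[] := W01 x.
    split; first exact: smooth_cont.
    by exists K => // y; apply: contraNP => /W0 ->.
  - by rewrite (nbhs_singleton W1).
  - move=> y Wy; apply: OV; apply: KO; apply: contrapT => /W0 h.
    by rewrite h eqxx in Wy.
split.
- by exists setT => //; exact: filterT.
- move=> A B [V nV hA] [V' nV' hB]; exists (V `&` V'); first exact: filterI.
  by move=> phi [c p s]; split; [apply: hA|apply: hB]; split=> // y /s[].
- by move=> A B AB [V nV hA]; exists V => // phi /hA/AB.
Qed.

(** The normalised indices stay in a bounded interval by [covering_number_comp]. An ultrafilter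
    finer than shrinking supports gives limits for all [f] at once, and almost additivity turns into
    additivity. *)
Lemma haar_pos : exists L : (G -> R) -> R, [/\
  forall f, Ccp f -> 0 <= L f,
  forall f g, Ccp f -> Ccp g -> L (fun x => f x + g x) = L f + L g,
  forall a f, 0 <= a -> Ccp f -> L (fun x => a * f x) = a * L f,
  forall f (g : G), Ccp f -> L (fun x => f (x * g)%g) = L f &
  forall f x, Ccp f -> 0 < f x -> 0 < L f].
Proof.
have [U [UU FU]] := ultraFilterLemma small_bump_filter.
have PU : ProperFilter U by exact: ultra_proper.
have [f0 hf0 f01] : exists2 f0 : G -> R, Ccp f0 & 0 < f0 1%g.
  have [W [K [sW W01 W1 cK [KO W0]]]] := @bump_G R n G setT 1%g openT I.
  exists W; last by rewrite (nbhs_singleton W1).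
  split; last by move=> x; have /andP[] := W01 x.
  split; first exact: smooth_cont.
  by exists K => // y; apply: contraNP => /W0 ->.
have UG V : nbhs 1%g V -> \forall phi \near U, small_bump V phi.
  by move=> nV; apply: FU; exists V.
pose I f phi := covering_number f phi / covering_number f0 phi.
have c0 phi : small_bump setT phi -> 0 < covering_number f0 phi by move=> [c p _]; exact: (covering_number_gt0 hf0 c p f01).
have nT : nbhs (1%g : G) setT by exact: filterT.
have UT := UG setT nT.
have Lex f : exists l, Ccp f -> 0 <= l /\ forall e, 0 < e -> \forall phi \near U, `|l - I f phi| <= e.
  have [hf|nf] := pselect (Ccp f); last by exists 0.
  have [|l [/andP[l0 _] hl]] := @ultra_lim R _ U UU (I f) 0 (covering_number f f0); last by exists l.
  apply: filterS UT => phi gp; have [cp pp _] := gp.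
  rewrite divr_ge0 ?(ltW (c0 _ gp)) ?covering_number_ge0//= ler_pdivrMr ?c0//.
  exact: covering_number_comp.
have [L hL] := choice Lex.
have appr f e : Ccp f -> 0 < e -> \forall phi \near U, `|L f - I f phi| <= e.
  by move=> hf; exact: (hL f hf).2.
exists L; split.
- by move=> f /hL[].
- move=> f g hf hg; have hfg := Ccp_add hf hg.
  apply/eqP; rewrite eq_le; apply/andP; split; apply/ler_addgt0Pr => e e0.
    have e4 : 0 < e / 4 by rewrite divr_gt0.
    have [phi [gp [a1 [a2 a3]]]] := filter_ex (filterI UT (filterI (appr _ _ hf e4) (filterI (appr _ _ hg e4) (appr _ _ hfg e4)))).
    have [cp pp _] := gp; have p0 := c0 _ gp.
    have : I (fun x => f x + g x) phi <= I f phi + I g phi.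
      by rewrite -mulrDl ler_pM2r ?invr_gt0//; exact: covering_number_add.
    move: a1 a2 a3; rewrite !ler_norml.
    move: (L f) (L g) (L _) (I f phi) (I g phi) (I _ phi) => z1 z2 z3 z4 z5 z6.
    by move=> /andP[h1 h2] /andP[h3 h4] /andP[h5 h6] h7; lra.
  have e4 : 0 < e / 4 by rewrite divr_gt0.
  have [V nV hV] := covering_number_almost_add hf hg hf0 f01 e4.
  have [phi [gp [a1 [a2 a3]]]] := filter_ex (filterI (UG V nV) (filterI (appr _ _ hf e4) (filterI (appr _ _ hg e4) (appr _ _ hfg e4)))).
  have [cp pp sp] := gp; have p0 : 0 < covering_number f0 phi by apply: c0; split.
  have : I f phi + I g phi <= I (fun x => f x + g x) phi + e / 4.
    by rewrite /I -mulrDl ler_pdivrMr// mulrDl divfK ?gt_eqF//; exact: hV.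
  move: a1 a2 a3; rewrite !ler_norml.
  move: (L f) (L g) (L _) (I f phi) (I g phi) (I _ phi) => z1 z2 z3 z4 z5 z6.
  by move=> /andP[h1 h2] /andP[h3 h4] /andP[h5 h6] h7; lra.
- move=> a f a0 hf; have [->|an] := eqVneq a 0.
    rewrite mul0r; apply/eqP; rewrite eq_le; apply/andP; split; last exact: (hL _ (Ccp_scale (lexx 0) hf)).1.
    apply/ler_addgt0Pr => e e0; rewrite add0r.
    have [phi [gp a1]] := filter_ex (filterI UT (appr _ _ (Ccp_scale (lexx 0) hf) e0)).
    have [cp pp _] := gp; have p0 := c0 _ gp.
    have q := covering_number_scale_le cp pp (lexx 0) hf; rewrite mul0r in q.
    have q2 : I (fun x => 0 * f x) phi <= 0 by rewrite mulr_le0_ge0// invr_ge0 ltW.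
    move: a1; rewrite ler_norml => /andP[_]; rewrite lerBlDr => /le_trans; apply.
    by rewrite gerDl.
  have ap : 0 < a by rewrite lt_neqAle eq_sym an.
  apply/eqP; rewrite -subr_eq0 -normr_le0; apply/ler_addgt0Pr => e e0; rewrite add0r.
  have e2 : 0 < e / 2 by rewrite divr_gt0.
  have e3 : 0 < e / 2 / a by rewrite divr_gt0.
  have [phi [gp [a1 a2]]] := filter_ex (filterI UT (filterI (appr _ _ (Ccp_scale a0 hf) e2) (appr _ _ hf e3))).
  have [cp pp _] := gp.
  have E : I (fun x => a * f x) phi = a * I f phi by rewrite /I covering_number_scale// mulrA.
  have -> : L (fun x => a * f x) - a * L f = (L (fun x => a * f x) - I (fun x => a * f x) phi) - a * (L f - I f phi).
    by rewrite E; ring.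
  apply: (le_trans (ler_normB _ _)); rewrite [leRHS]splitr lerD// normrM ger0_norm// mulrC.
  by rewrite -ler_pdivlMr.
- move=> f g hf; apply/eqP; rewrite -subr_eq0 -normr_le0; apply/ler_addgt0Pr => e e0; rewrite add0r.
  have e2 : 0 < e / 2 by rewrite divr_gt0.
  have [phi [gp [a1 a2]]] := filter_ex (filterI UT (filterI (appr _ _ (Ccp_transl g hf) e2) (appr _ _ hf e2))).
  have [cp pp _] := gp.
  have E : I (fun x => f (x * g)%g) phi = I f phi by rewrite /I covering_number_transl.
  have -> : L (fun x => f (x * g)%g) - L f = (L (fun x => f (x * g)%g) - I (fun x => f (x * g)%g) phi) - (L f - I f phi).
    by rewrite E; ring.
  by apply: (le_trans (ler_normB _ _)); rewrite [leRHS]splitr lerD.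
(* A translate of [f] that is positive at 1 covers [f0] with finite weight; this bounds the index of
   [f] from below. *)
- move=> f x hf fx; pose f' y := f (y * x)%g.
  have hf' : Ccp f' by exact: Ccp_transl.
  have f'1 : 0 < f' 1%g by rewrite /f' mul1g.
  have B0 : 0 < covering_number f0 f' by exact: (covering_number_gt0 hf0 hf' f'1 f01).
  have e0 : 0 < (covering_number f0 f')^-1 / 2 by rewrite divr_gt0// invr_gt0.
  have [phi [gp a1]] := filter_ex (filterI UT (appr _ _ hf e0)).
  have [cp pp _] := gp; have p0 := c0 _ gp.
  have q : (covering_number f0 f')^-1 <= I f phi.
    rewrite /I ler_pdivlMr// mulrC ler_pdivrMr//.
    by have := covering_number_comp cp pp hf0 hf' f'1; rewrite /f' (covering_number_transl cp pp _ hf) mulrC.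
  move: a1; rewrite ler_norml => /andP[a1 _].
  have B1 : 0 < (covering_number f0 f')^-1 by rewrite invr_gt0.
  move: a1 q B1; move: (L f) (I f phi) (covering_number f0 f')^-1 => *; lra.
Qed.

Definition fpos f x := Num.max (f x) 0.
Definition fneg f x := Num.max (- f x) 0.
Lemma fpos_neg f x : f x = fpos f x - fneg f x.
Proof.
rewrite /fpos /fneg; case: (leP 0 (f x)) => h.
  by rewrite (max_idPr _) ?oppr_le0// subr0.
by rewrite (max_idPl _) ?oppr_ge0 ?ltW// sub0r opprK.
Qed.
Lemma Ccp_fpos f : Cc f -> Ccp (fpos f).
Proof.
move=> hf; split; last by move=> x; rewrite /fpos le_max lexx orbT.
apply: (@Cc_comp _ _ _ f (fun t => Num.max t 0)) => //; last by rewrite maxxx.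
by move=> t; apply: continuous_max; [exact: cvg_id|exact: cvg_cst].
Qed.
Lemma Ccp_fneg f : Cc f -> Ccp (fneg f).
Proof.
move=> hf; have := Ccp_fpos (Cc_scale (-1) hf); congr Ccp.
by apply/funext => x; rewrite /fpos /fneg mulN1r.
Qed.

(** Right invariance moves right translations, the flows of left-invariant fields, from the
    integrated function onto the weight. *)
Record haar (L : (G -> R) -> R) : Prop := Haar {
  haar_lin : forall a f g, Cc f -> Cc g -> L (fun x => a * f x + g x) = a * L f + L g ;
  haar_ge0 : forall f, Ccp f -> 0 <= L f ;
  haar_inv : forall f (g : G), Cc f -> L (fun x => f (x * g)%g) = L f ;
  haar_gt0 : forall f x, Ccp f -> 0 < f x -> 0 < L f }.

Lemma haar_exists : exists L, haar L.
Proof.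
have [L [L0 LD LZ LT Lp]] := haar_pos.
pose M f := L (fpos f) - L (fneg f).
(* The value does not depend on how [f] is written as a difference of nonnegative functions;
   linearity follows from this. *)
have key f g h : Ccp g -> Ccp h -> (forall x, f x = g x - h x) -> Cc f -> M f = L g - L h.
  move=> hg hh fE hf; have hp := Ccp_fpos hf; have hn := Ccp_fneg hf.
  apply/eqP; rewrite subr_eq addrAC eq_sym subr_eq -LD// -LD//; apply/eqP; congr L.
  by apply/funext => x; have := fpos_neg f x; rewrite fE; move: (g x) (h x) (fpos f x) (fneg f x) => *; lra.
have MP f : Ccp f -> M f = L f.
  move=> hf; have h0 := Ccp_scale (lexx 0) hf.
  rewrite (@key f f (fun x => 0 * f x)) ?LZ// ?mul0r ?subr0//; first by move=> x; rewrite mul0r subr0.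
  exact: hf.1.
have MD f g : Cc f -> Cc g -> M (fun x => f x + g x) = M f + M g.
  move=> hf hg; have fp := Ccp_fpos hf; have fn := Ccp_fneg hf; have gp := Ccp_fpos hg; have gn := Ccp_fneg hg.
  rewrite (@key _ (fun x => fpos f x + fpos g x) (fun x => fneg f x + fneg g x)).
  - by rewrite !LD// /M; ring.
  - exact: Ccp_add.
  - exact: Ccp_add.
  - by move=> x; rewrite {1}(fpos_neg f) {1}(fpos_neg g); ring.
  - exact: Cc_add.
have MZ a f : Cc f -> M (fun x => a * f x) = a * M f.
  move=> hf; have fp := Ccp_fpos hf; have fn := Ccp_fneg hf.
  have [a0|a0] := leP 0 a.
    rewrite (@key _ (fun x => a * fpos f x) (fun x => a * fneg f x)).
    - by rewrite !LZ// /M mulrBr.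
    - exact: Ccp_scale.
    - exact: Ccp_scale.
    - by move=> x; rewrite {1}(fpos_neg f); ring.
    - exact: Cc_scale.
  have a1 : 0 <= - a by rewrite oppr_ge0 ltW.
  rewrite (@key _ (fun x => - a * fneg f x) (fun x => - a * fpos f x)).
  - by rewrite !LZ// /M; ring.
  - exact: Ccp_scale.
  - exact: Ccp_scale.
  - by move=> x; rewrite {1}(fpos_neg f); ring.
  - exact: Cc_scale.
exists M; split.
- by move=> a f g hf hg; rewrite MD ?MZ//; exact: Cc_scale.
- by move=> f hf; rewrite MP//; exact: L0.
- move=> f g hf; rewrite /M -(LT (fpos f) g (Ccp_fpos hf)) -(LT (fneg f) g (Ccp_fneg hf)).
  by [].
- by move=> f x hf fx; rewrite MP//; exact: Lp fx.
Qed.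
End Haar.

(** * Integrals over subsets of the unit interval *)

Section L1facts.
Context {R : realType}.
Local Notation mu := (@lebesgue01 R).
Local Notation T := (measurableTypeR R).
Implicit Types (A B C : set T) (f g h : L1 R).

Lemma L1_measurable f : measurable_fun [set: T] (f : T -> R).
Proof. exact: (@measurable_funPT _ _ _ _ (repr (LebesgueSpace.sort f))). Qed.

Lemma L1_int A f : measurable A -> mu.-integrable A (EFin \o (f : T -> R)).
Proof.
move=> mA; apply: (@integrableS _ _ _ _ [set: T]) => //.
apply/integrableP; split; first by apply/measurable_EFinP; exact: L1_measurable.
have := @Lebesgue_finite _ _ _ _ _ _ f; rewrite /finite_norm Lnorm1.
by [].
Qed.

Definition IA A f : R := \int[mu]_(x in A) (f : T -> R) x.
Definition dA A f g : R := \int[mu]_(x in A) `|(f : T -> R) x - (g : T -> R) x|.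

Lemma L1_intB A f g : measurable A -> mu.-integrable A (EFin \o (fun x => (f : T -> R) x - (g : T -> R) x)).
Proof. by move=> mA; apply: (integrableB mA (L1_int f mA) (L1_int g mA)). Qed.

Lemma L1_intN A f g : measurable A -> mu.-integrable A (EFin \o (fun x => `|(f : T -> R) x - (g : T -> R) x|)).
Proof. by move=> mA; exact: (integrable_abse (L1_intB f g mA)). Qed.

Lemma dA_T f g : L1_dist f g = dA setT f g.
Proof. by rewrite /L1_dist Lnorm1 /dA /Rintegral; congr fine; apply: eq_integral. Qed.

Lemma dA_ge0 A f g : 0 <= dA A f g.
Proof. by apply: Rintegral_ge0. Qed.

Lemma dA_sym A f g : dA A f g = dA A g f.
Proof. by rewrite /dA /Rintegral; congr fine; apply: eq_integral => x _; rewrite distrC. Qed.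

Lemma dA_refl A f : measurable A -> dA A f f = 0.
Proof.
move=> mA; rewrite /dA /Rintegral; under eq_integral do rewrite subrr normr0.
by rewrite integral0.
Qed.

Lemma dA_tri A f g h : measurable A -> dA A f h <= dA A f g + dA A g h.
Proof.
move=> mA; rewrite /dA -RintegralD//; [|exact: L1_intN|exact: L1_intN].
apply: le_Rintegral => //; first exact: L1_intN.
  by apply: (integrableD mA (L1_intN f g mA) (L1_intN g h mA)).
by move=> x _; exact: ler_distD.
Qed.

Definition part A B C := [/\ measurable A, measurable B, measurable C, A = B `|` C & B `&` C = set0].

Lemma part_disj B C : B `&` C = set0 -> [disjoint B & C].
Proof. by move=> h; apply/disj_setPS; rewrite h. Qed.

Lemma dA_part A B C f g : part A B C -> dA A f g = dA B f g + dA C f g.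
Proof.
move=> [mA mB mC e d]; rewrite /dA e Rintegral_setU//; last exact: part_disj.
by rewrite -e; exact: L1_intN.
Qed.

Lemma IA_part A B C f : part A B C -> IA A f = IA B f + IA C f.
Proof.
move=> [mA mB mC e d]; rewrite /IA e Rintegral_setU//; last exact: part_disj.
by rewrite -e; exact: L1_int.
Qed.

Lemma IA_sub A f g : measurable A -> IA A f - IA A g = \int[mu]_(x in A) ((f : T -> R) x - (g : T -> R) x).
Proof. by move=> mA; rewrite RintegralB//; exact: L1_int. Qed.

Lemma IA_dist A f g : measurable A -> `|IA A f - IA A g| <= dA A f g.
Proof. by move=> mA; rewrite IA_sub//; apply: le_normr_Rintegral => //; exact: L1_intB. Qed.

Lemma dA_le A f g : measurable A -> dA A f g <= dA setT f g.
Proof.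
move=> mA; have p : part setT A (~` A).
  split => //; [exact: measurableC|by rewrite setUv|by rewrite setICr].
by rewrite (dA_part _ _ p) lerDl dA_ge0.
Qed.

Lemma dA_split A f g : measurable A -> exists B C, part A B C /\
  dA A f g = (IA B g - IA B f) - (IA C g - IA C f).
Proof.
move=> mA; pose S : set T := [set x | (f : T -> R) x <= (g : T -> R) x].
have mS : measurable S.
  have := measurable_fun_ler (L1_measurable f) (L1_measurable g).
  move=> /(_ measurableT [set true] I); rewrite setTI; congr measurable.
exists (A `&` S), (A `&` ~` S).
have p : part A (A `&` S) (A `&` ~` S).
  split=> //.
  - exact: measurableI.
  - by apply: measurableI => //; exact: measurableC.
  - by rewrite -setIUr setUv setIT.
  - by rewrite setIACA setICr setI0.
split=> //; have [_ mB mC _ _] := p.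
rewrite (dA_part _ _ p) !IA_sub//; congr (_ + _).
  rewrite /dA /Rintegral; congr fine; apply: eq_integral => x; rewrite inE => -[_ Sx].
  by rewrite distrC ger0_norm// subr_ge0.
rewrite -IA_sub// opprB IA_sub//.
rewrite /dA /Rintegral; congr fine; apply: eq_integral => x; rewrite inE => -[_ /negP Sx].
by rewrite ger0_norm// subr_ge0 ltW// ltNge.
Qed.
End L1facts.

(* The abstract form of [I A y = \int_A F y] and [d A y z = \int_A |F y - F z|]
   for measurable [A]; [pt A B C] says that [A] is the disjoint union of [B] and
   [C], and [mf_split] comes from the sign of [F y - F z]. *)
Record measured_family (R : realType) (T Y : Type) (ms : set T -> Prop) (pt : set T -> set T -> set T -> Prop)
    (I : set T -> Y -> R) (d : set T -> Y -> Y -> R) : Prop := MeasuredFamily {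
  mf_T : ms setT ;
  mf_pt : forall A B C, pt A B C -> [/\ ms A, ms B & ms C] ;
  mf_ge0 : forall A x y, 0 <= d A x y ;
  mf_sym : forall A x y, d A x y = d A y x ;
  mf_refl : forall A x, ms A -> d A x x = 0 ;
  mf_tri : forall A x y z, ms A -> d A x z <= d A x y + d A y z ;
  mf_dpt : forall A B C x y, pt A B C -> d A x y = d B x y + d C x y ;
  mf_Ipt : forall A B C x, pt A B C -> I A x = I B x + I C x ;
  mf_dist : forall A x y, ms A -> `|I A x - I A y| <= d A x y ;
  mf_le : forall A x y, ms A -> d A x y <= d setT x y ;
  mf_split : forall A x y, ms A -> exists B C, pt A B C /\ d A x y = (I B y - I B x) - (I C y - I C x) }.

Lemma measured_family_L1 (R : realType) (Y : Type) (F : Y -> L1 R) :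
  measured_family (@measurable _ (measurableTypeR R)) part (fun A y => IA A (F y)) (fun A x y => dA A (F x) (F y)).
Proof.
split=> //.
- by move=> A B C [].
- by move=> A x y; exact: dA_ge0.
- by move=> A x y; exact: dA_sym.
- by move=> A x; exact: dA_refl.
- by move=> A x y z; exact: dA_tri.
- by move=> A B C x y; exact: dA_part.
- by move=> A B C x; exact: IA_part.
- by move=> A x y; exact: IA_dist.
- by move=> A x y; exact: dA_le.
- by move=> A x y; exact: dA_split.
Qed.

(** * Derivatives of averages *)

Section ListSum.
Context {R : realType} {X : Type}.
Implicit Types (l : seq X) (f g : X -> R).

Lemma sum_In_le l f g : (forall p, List.In p l -> f p <= g p) -> \sum_(p <- l) f p <= \sum_(p <- l) g p.
Proof.
elim: l => [|p l IH] h; first by rewrite !big_nil.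
rewrite !big_cons; apply: lerD; first by apply: h; left.
by apply: IH => q ql; apply: h; right.
Qed.

Lemma sum_In_eq l f g : (forall p, List.In p l -> f p = g p) -> \sum_(p <- l) f p = \sum_(p <- l) g p.
Proof. by move=> h; apply/eqP; rewrite eq_le !sum_In_le// => p /h ->. Qed.

Lemma sum_In_ge0 l f : (forall p, List.In p l -> 0 <= f p) -> 0 <= \sum_(p <- l) f p.
Proof. by move=> h; have := @sum_In_le l (fun=> 0) f h; rewrite big1_eq. Qed.
End ListSum.

Section HaarLemmas.
Context {R : realType} {n : nat} {G : lieGroupType R n}.
Implicit Types (f g : G -> R).
Variable L : (G -> R) -> R.
Hypothesis hL : haar L.

Lemma Cc0 f : Cc f -> Cc (fun _ : G => 0 : R).
Proof. by move=> hf; have := Cc_scale 0 hf; congr Cc; apply/funext => x; rewrite mul0r. Qed.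

Lemma haar0 f : Cc f -> L (fun _ => 0) = 0.
Proof.
move=> hf; have h := haar_lin hL 1 (Cc0 hf) (Cc0 hf); move: h; rewrite mul1r.
have -> : (fun x : G => 0 + 0 : R) = (fun=> 0) by apply/funext => x; rewrite addr0.
by move: (L _) => z h; lra.
Qed.

Lemma haarD f g : Cc f -> Cc g -> L (fun x => f x + g x) = L f + L g.
Proof.
by move=> hf hg; have := haar_lin hL 1 hf hg; rewrite mul1r => <-; congr L; apply/funext => x; rewrite mul1r.
Qed.

Lemma haarZ a f : Cc f -> L (fun x => a * f x) = a * L f.
Proof.
move=> hf; have := haar_lin hL a hf (Cc0 hf); rewrite (haar0 hf) addr0 => <-.
by congr L; apply/funext => x; rewrite addr0.
Qed.

Lemma haarB f g : Cc f -> Cc g -> L (fun x => f x - g x) = L f - L g.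
Proof.
move=> hf hg; have := haarD hf (Cc_scale (-1) hg); rewrite haarZ// mulN1r => <-.
by congr L; apply/funext => x; rewrite mulN1r.
Qed.

Lemma haar_le f g : Cc f -> Cc g -> (forall x, f x <= g x) -> L f <= L g.
Proof.
move=> hf hg fg; rewrite -subr_ge0 -haarB//; apply: (haar_ge0 hL); split.
  exact: Cc_sub.
by move=> x; rewrite subr_ge0.
Qed.

Lemma haar_norm f : Cc f -> `|L f| <= L (fun x => `|f x|).
Proof.
move=> hf; have hn := Cc_norm hf; rewrite ler_norml; apply/andP; split.
  have := haar_le (Cc_scale (-1) hn) hf; rewrite haarZ// mulN1r; apply=> x.
  by rewrite mulN1r lerNl -normrN ler_norm.
by apply: haar_le => // x; exact: ler_norm.
Qed.

Lemma Cc_list (X : Type) (l : seq X) (F : X -> G -> R) f : Cc f -> (forall p, List.In p l -> Cc (F p)) ->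
  Cc (fun x => \sum_(p <- l) F p x).
Proof.
move=> hf; elim: l => [|p l IH] h.
  by have := Cc0 hf; congr Cc; apply/funext => x; rewrite big_nil.
have h1 : Cc (F p) by apply: h; left.
have h2 : Cc (fun x => \sum_(p <- l) F p x) by apply: IH => q ql; apply: h; right.
by have := Cc_add h1 h2; congr Cc; apply/funext => x; rewrite big_cons.
Qed.

Lemma haar_list (X : Type) (l : seq X) (F : X -> G -> R) f : Cc f -> (forall p, List.In p l -> Cc (F p)) ->
  L (fun x => \sum_(p <- l) F p x) = \sum_(p <- l) L (F p).
Proof.
move=> hf; elim: l => [|p l IH] h.
  by rewrite big_nil; apply: etrans (haar0 hf); congr L; apply/funext => x; rewrite big_nil.
have hl q : List.In q l -> Cc (F q) by move=> ql; apply: h; right.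
have h1 : Cc (F p) by apply: h; left.
rewrite big_cons -IH// -(haarD h1 (Cc_list hf hl)).
by congr L; apply/funext => x; rewrite big_cons.
Qed.
End HaarLemmas.

Section PseudoMetric.
Context {R : realType} {n : nat} {G : lieGroupType R n}.
Lemma near_transl (P : G -> G -> Prop) x : (\forall w \near (1%g : G), forall x, P x (x * w)%g) -> \forall y \near x, P x y.
Proof.
move=> h; have c : continuous (fun y : G => (x^-1 * y)%g) by exact: mulL_cont.
have h1 : \forall w \near (x^-1 * x)%g, forall x, P x (x * w)%g by rewrite mulVg.
have h2 := c x _ h1.
near=> y; have : forall z, P z (z * (x^-1 * y))%g by near: y.
by move=> /(_ x); rewrite mulVKg.
Unshelve. all: by end_near.
Qed.

Variable D : G -> G -> R.
Hypothesis Dsym : forall x y, D x y = D y x.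
Hypothesis Dtri : forall x y z, D x z <= D x y + D y z.
Hypothesis Dsmall : forall e, 0 < e -> \forall w \near (1%g : G), forall x, D x (x * w)%g <= e.

Lemma pm_near x e : 0 < e -> \forall y \near x, D x y <= e.
Proof. by move=> /Dsmall; exact: (@near_transl (fun x y => D x y <= e)). Qed.

Lemma pm_quad x y x' y' : `|D x y - D x' y'| <= D x x' + D y y'.
Proof.
have t1 := Dtri x x' y; have t2 := Dtri x' y' y.
have t3 := Dtri x' x y'; have t4 := Dtri x y y'.
move: t1 t2 t3 t4; rewrite (Dsym y' y) (Dsym x' x).
move: (D x y) (D x' y') (D x x') (D y y') (D x' y) (D x y') => *.
rewrite ler_norml; apply/andP; split; lra.
Qed.

Lemma pm_cont (f g : G -> G) : continuous f -> continuous g -> continuous (fun x => D (f x) (g x)).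
Proof.
move=> cf cg x; apply/(@cvgrPdist_le R _ _ (nbhs x) (nbhs_filter x)) => e e0.
have e2 : 0 < e / 2 by rewrite divr_gt0.
have h1 := cf x _ (pm_near (f x) e2); have h2 := cg x _ (pm_near (g x) e2).
near=> y.
have b1 : D (f x) (f y) <= e / 2 by near: y.
have b2 : D (g x) (g y) <= e / 2 by near: y.
by apply: (le_trans (pm_quad _ _ _ _)); rewrite [leRHS]splitr lerD.
Unshelve. all: by end_near.
Qed.
End PseudoMetric.

(** * Dense sequences and Baire category *)

Section Dense.
Context {R : realType} {n : nat} {G : lieGroupType R n}.
Implicit Types (O V : set G).

Lemma dense_seq : exists g_ : nat -> G, forall O, open O -> O !=set0 -> exists k, O (g_ k).
Proof.
have [B cB [_ hB]] := @lie_second_countable R n G.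
have /countable_injP[f finj] := cB.
exists (fun k => xget 1%g [set x | exists b, [/\ B b, f b = k & b x]]) => O oO [x Ox].
have [b [Bb bx] bO] := hB x _ (open_nbhs_nbhs (conj oO Ox)).
exists (f b); case: xgetP => [y -> [b' [Bb' fb' b'y]]|/(_ x) []]; last by exists b.
have e : b' = b by apply: finj => //; rewrite inE.
by rewrite e in b'y; exact: bO.
Qed.

Lemma dense_zero (g_ : nat -> G) (h : G -> R) : (forall O, open O -> O !=set0 -> exists k, O (g_ k)) ->
  continuous h -> (forall k, h (g_ k) = 0) -> forall x, h x = 0.
Proof.
move=> hg ch h0 x; apply/eqP/negPn/negP => nz.
have oO : open (h @^-1` [set y | y != 0]).
  by apply: open_comp => [y _|]; [exact: ch|exact: open_neq].
by have [|k /=] := hg _ oO; [exists x|rewrite h0 eqxx].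
Qed.

Lemma compact_nbhd V (x : G) : open V -> V x -> exists C : set G, [/\ compact C, C `<=` V & nbhs x C].
Proof.
move=> oV Vx; have [W [C [_ _ W1 cC [CV W0]]]] := bump_G oV Vx; exists C; split=> //.
near=> y; apply: contrapT => nC; have : W y = 1 by near: y.
by rewrite W0// => /eqP; rewrite eq_sym oner_eq0.
Unshelve. all: by end_near.
Qed.

(** Local compactness plays the role of completeness: the nested sets are interiors of compact sets,
    and a cluster point of chosen points lies in all of them. *)
Lemma lie_baire (A : nat -> set G) : (forall k, open (A k)) ->
  (forall k O, open O -> O !=set0 -> (O `&` A k) !=set0) -> exists z, forall k, A k z.
Proof.
move=> oA dA; pose P := {V : set G | open V /\ V !=set0}.
have /choice[f hf] : forall p : nat * P, exists V : P, exists2 C : set G, compact C & sval V `<=` C /\ C `<=` sval p.2 `&` A p.1.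
  move=> [k [V [oV V0]]] /=; have [x [Vx Ax]] := dA k V oV V0.
  have [C [cC CV nC]] := compact_nbhd (openI oV (oA k)) (conj Vx Ax).
  have hV : open (interior C) /\ interior C !=set0 by split; [exact: open_interior|exists x].
  by exists (exist _ (interior C) hV), C => //=; split=> //; exact: interior_subset.
have hT : open [set: G] /\ [set: G] !=set0 by split; [exact: openT|exists 1%g].
pose V := nat_rect (fun _ => P) (exist _ setT hT) (fun k v => f (k, v)).
have /choice[C hC] : forall k, exists C : set G, [/\ compact C, sval (V k.+1) `<=` C & C `<=` sval (V k) `&` A k].
  by move=> k; have [C cC [h1 h2]] := hf (k, V k); exists C.
have /choice[x hx] : forall k, exists x, sval (V k) x by move=> k; have [_ [x Vx]] := svalP (V k); exists x.
have Vle k m : sval (V (k + m)%N) `<=` sval (V k).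
  elim: m => [|m IH]; first by rewrite addn0.
  by have [_ h1 h2] := hC (k + m)%N; rewrite addnS => y /h1/h2[/IH].
have xC k : \forall m \near \oo, C k (x m).
  exists k.+1 => // m /= km; have [_ h1 _] := hC k; apply: h1; apply: (Vle k.+1 (m - k.+1)%N).
  by rewrite subnKC.
have [c0 _ _] := hC 0%N.
have [|z [_ hz]] := c0 (x @ \oo) _; first exact: xC.
exists z => k; have [ck _ h2] := hC k; apply: (h2 z _).2.
have clC : closed (C k) by apply: compact_closed => //; exact: (@lie_hausdorff R n G).
by apply: clC => B nB; exact: (hz (C k) B (xC k) nB).
Qed.

Lemma mul_cont2 (T : topologicalType) (a b : T -> G) : continuous a -> continuous b -> continuous (fun t => a t * b t)%g.
Proof.
move=> ca cb t; apply: (@continuous_comp _ _ _ (fun t => (a t, b t)) (fun p : G * G => p.1 * p.2)%g); last exact: mul_cont.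
by apply: cvg_pair; [exact: ca|exact: cb].
Qed.

Lemma inv_cont2 (T : topologicalType) (a : T -> G) : continuous a -> continuous (fun t => (a t)^-1)%g.
Proof. by move=> ca t; apply: (@continuous_comp _ _ _ a (fun x => x^-1)%g); [exact: ca|exact: inv_cont]. Qed.

Lemma comm_cont (T : topologicalType) (a b : T -> G) : continuous a -> continuous b -> continuous (fun t => [~ a t, b t])%g.
Proof.
move=> ca cb; have -> : (fun t => [~ a t, b t])%g = (fun t => (a t)^-1 * ((b t)^-1 * (a t * b t)))%g.
  by apply/funext => t; rewrite commgEl conjgE.
by apply: mul_cont2; [exact: inv_cont2|apply: mul_cont2; [exact: inv_cont2|exact: mul_cont2]].
Qed.
End Dense.

Section Fam.
Context {R : realType} {G : carnotGroup R}.
Local Notation n := (carnot_dim G).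
Variables (E : 'rV[R]_n -> G) (D : 'rV[R]_n -> operator G).
Hypothesis hE : horizontal_exp E D.
Variables (L : (G -> R) -> R).
Hypothesis hL : haar L.
Variables (T : Type) (ms : set T -> Prop) (pt : set T -> set T -> set T -> Prop).
Variables (I : set T -> G -> R) (d : set T -> G -> G -> R).
Hypothesis mf : measured_family ms pt I d.
Variable K : R.
Hypothesis K0 : 0 <= K.
Hypothesis Kd : forall x v, d setT x (x * E v)%g <= K * `|v|.
Implicit Types (A B C : set T) (W U : G -> R) (v : 'rV[R]_n).

Lemma he0 v : E (0 *: v) = 1%g.
Proof. by rewrite scale0r; exact: (Eg0 (he_add hE)). Qed.

Lemma heN (t : R) v : E ((- t) *: v) = (E (t *: v))^-1%g.
Proof. by rewrite scaleNr; exact: (Eg_opp (he_add hE)). Qed.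

Lemma d_word x s : d setT x (x * word_prod E s)%g <= K * \sum_(v <- s) `|v|.
Proof.
elim: s x => [|v s IH] x.
  by rewrite big_nil mulr0 /= mulg1 (mf_refl mf)//; exact: (mf_T mf).
rewrite big_cons mulrDr /= mulgA; apply: le_trans (mf_tri mf _ (x * E v)%g _ (mf_T mf)) _.
by apply: lerD.
Qed.

Lemma d_small e : 0 < e -> \forall w \near (1%g : G), forall x, d setT x (x * w)%g <= e.
Proof.
move=> e0; have K1 : 0 < K + 1 by rewrite ltr_wpDl.
have eK : 0 < e / (K + 1) by rewrite divr_gt0.
have hs := he_small hE eK.
near=> w => x; have [s [<- hw]] : exists s, word_prod E s = w /\ \sum_(v <- s) `|v| <= e / (K + 1) by near: w.
apply: (le_trans (d_word x s)); apply: (@le_trans _ _ (K * (e / (K + 1)))); first exact: ler_wpM2l.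
by rewrite mulrA ler_pdivrMr// mulrC ler_wpM2l ?(ltW e0)// lerDl.
Unshelve. all: by end_near.
Qed.

Lemma d_near x e : 0 < e -> \forall y \near x, d setT x y <= e.
Proof. exact: (pm_near d_small). Qed.

Lemma d_cont A (f g : G -> G) : ms A -> continuous f -> continuous g -> continuous (fun x => d A (f x) (g x)).
Proof.
move=> mA; apply: pm_cont.
- exact: (mf_sym mf).
- by move=> x y z; exact: (mf_tri mf).
- move=> e /d_small h; near=> w => x; apply: le_trans (mf_le mf _ _ mA) _.
  have : forall x, d setT x (x * w)%g <= e by near: w.
  exact.
Unshelve. all: by end_near.
Qed.

Lemma I_cont A (f : G -> G) : ms A -> continuous f -> continuous (fun x => I A (f x)).
Proof.
move=> mA cf x; apply/(@cvgrPdist_le R _ _ (nbhs x) (nbhs_filter x)) => e e0.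
have h := cf x _ (d_near (f x) e0).
near=> y; have : d setT (f x) (f y) <= e by near: y.
by apply: le_trans; apply: le_trans (mf_le mf _ _ mA); exact: (mf_dist mf).
Unshelve. all: by end_near.
Qed.

Lemma dR_cont A (g : G) : ms A -> continuous (fun x : G => d A x (x * g)%g).
Proof. by move=> mA; apply: (@d_cont A id (fun x => x * g)%g) => //; [move=> x; exact: cvg_id|exact: mulR_cont]. Qed.

Lemma IR_cont A (g : G) : ms A -> continuous (fun x : G => I A (x * g)%g).
Proof. by move=> mA; apply: I_cont => //; exact: mulR_cont. Qed.

Lemma I1_cont A : ms A -> continuous (fun x : G => I A x).
Proof. by move=> mA; apply: (@I_cont A id) => // x; exact: cvg_id. Qed.

Lemma d_line A x (r : R) v : ms A -> 0 <= r -> d A x (x * E (r *: v))%g <= K * `|v| * r.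
Proof.
move=> mA r0; apply: le_trans (mf_le mf _ _ mA) _; apply: le_trans (Kd _ _) _.
by rewrite normrZ ger0_norm// [r * _]mulrC mulrA.
Qed.

Lemma mvt_flow W v x (h : R) : smooth W -> exists2 s, `|s| <= `|h| &
  W (x * E (h *: v))%g - W x = h * D v W (x * E (s *: v))%g.
Proof.
move=> sW; pose f (t : R) := W (x * E (t *: v))%g; pose f' (t : R) := D v W (x * E (t *: v))%g.
have hd (t : R) : is_derive t 1 f (f' t) by exact: (he_deriv hE).
have hc (a b : R) : {within `[a, b], continuous f}.
  by apply: derivable_within_continuous => t _; have [] := hd t.
have f0 : W x = f 0 by rewrite /f he0 mulg1.
have [h0|h0|->] := ltgtP h 0; last 1 first.
- by exists 0; rewrite ?normr0// f0 subrr mul0r.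
- have [s sI e] := MVT h0 (fun t _ => hd t) (hc _ _).
  move: sI; rewrite in_itv /= => /andP[s1 s2]; exists s; first by rewrite !ltr0_norm// lerN2 ltW.
  by rewrite f0 -/(f h) -opprB e sub0r mulrN opprK mulrC.
have [s sI e] := MVT h0 (fun t _ => hd t) (hc _ _).
move: sI; rewrite in_itv /= => /andP[s1 s2]; exists s; first by rewrite !gtr0_norm// ltW.
by rewrite f0 -/(f h) e subr0 mulrC.
Qed.

Lemma norm_approx (a b c e : R) : `|a| <= c -> `|a - b| <= e -> `|b| <= c + e.
Proof.
move=> h1 h2; have -> : b = a - (a - b) by ring.
by apply: le_trans (ler_normB _ _) _; exact: lerD.
Qed.

Lemma Cc_D W v : smooth W -> Cc W -> Cc (D v W).
Proof.
move=> sW [cW [S cS hS]]; split; first exact: (smooth_cont (he_smooth hE v sW)).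
exists S => // x; apply: contra_neqP => nS.
have oS : open (~` S) by apply: closed_openC; apply: compact_closed => //; exact: (@lie_hausdorff R n G).
have hd := he_deriv hE v x 0 sW; move: hd; rewrite he0 mulg1 => hd.
have cE : (fun t : R => (x * E (t *: v))%g) @ (0 : R) --> x.
  have := @continuous_comp _ _ _ (fun t : R => E (t *: v)) (fun y => x * y)%g 0 (@he_cont _ _ _ _ hE v 0) (@mulL_cont _ _ _ x (E (0 *: v))).
  by rewrite /prop_for /continuous_at /= he0 mulg1.
have nb : \forall t \near (0 : R), ~ S (x * E (t *: v))%g.
  exact: (cE _ (open_nbhs_nbhs (conj oS nS))).
have hz : \forall t \near (0 : R), W (x * E (t *: v))%g = (cst 0 : R -> R) t.
  near=> t; have h : ~ S (x * E (t *: v))%g by near: t.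
  by apply/eqP/negPn/negP => /hS.
have [_ <-] := hd.
by rewrite (near_eq_derive _ hz) ?oner_neq0// derive_cst.
Unshelve. all: by end_near.
Qed.

(** One compact set for all times up to 1, so that a single cut-off dominates the errors. *)
Lemma flow_supp W v : Cc W -> exists2 S : set G, compact S & forall x (t : R), `|t| <= 1 -> W (x * E (t *: v))%g != 0 -> S x.
Proof.
move=> [_ [S cS hS]].
exists ((fun p : G * R => (p.1 * E (- p.2 *: v))%g) @` (S `*` [set` `[(-1 : R), 1]])).
  apply: continuous_compact; last by apply: compact_setX => //; exact: segment_compact.
  apply: continuous_subspaceT => p.
  have cE : {for p, continuous (fun p : G * R => E (- p.2 *: v))}.
    apply: (@continuous_comp _ _ _ (fun p : G * R => - p.2) (fun t => E (t *: v))); last exact: (he_cont hE).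
    by apply: continuousN; exact: cvg_snd.
  by apply: (@continuous_comp _ _ _ (fun p : G * R => (p.1, E (- p.2 *: v))) (fun p : G * G => p.1 * p.2)%g);
    [apply: cvg_pair => //=; exact: cvg_fst|exact: mul_cont].
move=> x t t1 /hS h; exists ((x * E (t *: v))%g, t).
  by split=> //=; rewrite in_itv /= -ler_norml.
by rewrite /= heN mulgK.
Qed.

(* The derivative along [v] of [I A], as a distribution tested against [W]. *)
Definition flux A W v : R := - L (fun x => D v W x * I A x).

(** Invariance of [L] moves the translation from [I A], which is merely continuous, to the smooth
    weight, where the mean value theorem applies; uniform continuity of [D v W] makes the error
    uniform. *)
Lemma flow_deriv A W v : ms A -> smooth W -> Cc W -> forall e, 0 < e -> exists2 r0, 0 < r0 & forall h, `|h| < r0 ->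
  `|L (fun x => W x * I A (x * E (h *: v))%g) - L (fun x => W x * I A x) - h * flux A W v| <= e * `|h|.
Proof.
move=> mA sW CW e e0.
have [S cS hS] := flow_supp v (Cc_D v sW CW).
have [chi [Cchi chi0] chi1] := bump_compact cS.
have cI := I1_cont mA.
have CI : Cc (fun x => chi x * `|I A x|) by apply: Cc_mull => // x; apply: (continuous_comp (cI x)); exact: norm_continuous.
pose M := L (fun x => chi x * `|I A x|).
have M0 : 0 <= M by apply: (haar_ge0 hL); split=> // x; rewrite mulr_ge0.
have M1 : 0 < M + 1 by rewrite ltr_wpDl.
have eM : 0 < e / (M + 1) by rewrite divr_gt0.
have hu := unif_right (Cc_D v sW CW) eM.
have cE : (fun t : R => E (t *: v)) @ (0 : R) --> (1%g : G) by have := @he_cont _ _ _ _ hE v 0; rewrite /continuous_at he0.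
have /nbhs_ballP[r1 /= r10 hr1] := cE _ hu.
exists (Num.min r1 1); first by rewrite lt_min r10 ltr01.
move=> h; rewrite lt_min => /andP[h1 h2].
pose W' (x : G) := W (x * E (- h *: v))%g.
have CW' : Cc W' by exact: Cc_transl.
have CWI : Cc (fun x => W x * I A (x * E (h *: v))%g) by apply: Cc_mull => //; exact: IR_cont.
have CDI : Cc (fun x => D v W x * I A x) by apply: Cc_mull => //; exact: Cc_D.
have C1 : Cc (fun x => W' x * I A x) by exact: Cc_mull.
have C2 : Cc (fun x => W x * I A x) by exact: Cc_mull.
have C3 := Cc_sub C1 C2; have C4 := Cc_add C3 (Cc_scale h CDI).
have -> : L (fun x => W x * I A (x * E (h *: v))%g) = L (fun x => W' x * I A x).
  rewrite -(haar_inv hL (E (- h *: v)) CWI); congr L; apply/funext => x.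
  by rewrite /W' -mulgA heN mulVg mulg1.
rewrite /flux mulrN opprK -haarZ// -haarB// -(haarD hL C3 (Cc_scale h CDI)).
apply: (le_trans (haar_norm hL C4)).
apply: (@le_trans _ _ (L (fun x => e / (M + 1) * `|h| * (chi x * `|I A x|)))); last first.
  rewrite haarZ// -/M mulrAC ler_wpM2r// mulrAC ler_pdivrMr//.
  by rewrite ler_wpM2l ?(ltW e0)// lerDl.
apply: haar_le => //; [exact: Cc_norm|exact: Cc_scale|].
move=> x; have [s sh es] := mvt_flow v x (- h) sW.
have -> : W' x * I A x - W x * I A x + h * (D v W x * I A x) = h * (D v W x - D v W (x * E (s *: v))%g) * I A x.
  by rewrite -mulrBl {1}/W' es; ring.
rewrite !normrM [leRHS]mulrA ler_wpM2r// [leRHS]mulrAC [leRHS]mulrC ler_wpM2l//.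
move: sh; rewrite normrN => sh.
have s1 : `|s| < r1 by exact: le_lt_trans h1.
have b1 : `|D v W (x * E (s *: v))%g - D v W x| <= e / (M + 1).
  by apply: hr1; rewrite -ball_normE /= sub0r normrN.
have [x0|x0] := pselect (S x).
  by rewrite distrC; apply: le_trans b1 _; rewrite -[leLHS]mulr1 ler_wpM2l ?(ltW eM)// chi1.
have -> : D v W x = 0.
  apply/eqP/negPn/negP => nz; apply: x0; apply: (hS x 0); rewrite ?normr0 ?ler01//.
  by rewrite he0 mulg1.
have -> : D v W (x * E (s *: v))%g = 0.
  apply/eqP/negPn/negP => nz; apply: x0; apply: (hS x s) => //.
  by apply: ltW; apply: le_lt_trans h2.
by rewrite subr0 normr0 mulr_ge0 ?(ltW eM).
Qed.

Lemma flow_is_derive A W v (s : R) : ms A -> smooth W -> Cc W ->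
  is_derive s 1 (fun t : R => L (fun x => W x * I A (x * E (t *: v))%g)) (flux A (fun x => W (x * E (- s *: v))%g) v).
Proof.
move=> mA sW CW; pose U (x : G) := W (x * E (- s *: v))%g.
have sU : smooth U by exact: smooth_R.
have CU : Cc U by exact: Cc_transl.
have tr (t : R) : L (fun x => W x * I A (x * E ((s + t) *: v))%g) = L (fun x => U x * I A (x * E (t *: v))%g).
  have CWI : Cc (fun x => W x * I A (x * E ((s + t) *: v))%g) by apply: Cc_mull => //; exact: IR_cont.
  rewrite -(haar_inv hL (E (- s *: v)) CWI); congr L; apply/funext => x.
  by rewrite /U (he_add hE) heN !mulgA mulgVK.
apply/is_deriveP => e e0; have [r0 r00 h] := flow_deriv v mA sU CU e0.
exists r0 => // t /h; rewrite tr -[X in L (fun x => W x * I A (x * E (X *: v))%g)]addr0 tr.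
have -> : (fun x => U x * I A (x * E (0 *: v))%g) = (fun x => U x * I A x) by apply/funext => x; rewrite he0 mulg1.
by [].
Qed.

(** Bounds the derivative by averaged distances at scale [h]; [flow_rate_le] goes in the opposite
    direction. *)
Lemma flux_bound A U v : ms A -> smooth U -> Cc U -> forall e, 0 < e -> exists2 r0, 0 < r0 & forall h, 0 < h < r0 ->
  h * `|flux A U v| <= L (fun x => `|U x| * d A x (x * E (h *: v))%g) + e * h.
Proof.
move=> mA sU CU e e0; have [r0 r00 hr] := flow_deriv v mA sU CU e0.
exists r0 => // h /andP[h0 h1]; have := hr h; rewrite (gtr0_norm h0) => /(_ h1).
have C1 : Cc (fun x => U x * I A (x * E (h *: v))%g) by apply: Cc_mull => //; exact: IR_cont.
have C2 : Cc (fun x => U x * I A x) by apply: Cc_mull => //; exact: I1_cont.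
have C3 : Cc (fun x => `|U x| * d A x (x * E (h *: v))%g) by apply: Cc_mull; [exact: Cc_norm|exact: dR_cont].
have C4 := Cc_sub C1 C2.
have : `|L (fun x => U x * I A (x * E (h *: v))%g) - L (fun x => U x * I A x)| <= L (fun x => `|U x| * d A x (x * E (h *: v))%g).
  rewrite -haarB//; apply: (le_trans (haar_norm hL C4)); apply: haar_le => //; first exact: Cc_norm.
  by move=> x; rewrite -mulrBr normrM ler_wpM2l// distrC; exact: (mf_dist mf).
have -> : h * `|flux A U v| = `|h * flux A U v| by rewrite normrM (gtr0_norm h0).
exact: norm_approx.
Qed.

Lemma flux_lin A W (k : R) v w : ms A -> smooth W -> Cc W -> flux A W (k *: v + w) = k * flux A W v + flux A W w.
Proof.
move=> mA sW CW; have C1 u : Cc (fun x => D u W x * I A x) by apply: Cc_mull; [exact: Cc_D|exact: I1_cont].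
rewrite /flux mulrN -opprD -(haar_lin hL k (C1 v) (C1 w)); congr (- L _); apply/funext => x.
by rewrite (he_lin hE) mulrA -mulrDl.
Qed.

Lemma flux0 A W : ms A -> smooth W -> Cc W -> flux A W 0 = 0.
Proof.
move=> mA sW CW; have := flux_lin 1 0 0 mA sW CW; rewrite scale1r addr0 mul1r.
by move/eqP; rewrite -subr_eq subrr eq_sym => /eqP.
Qed.

(** The value $m(A,W)$ of the vector-valued derivative, in coordinates. *)
Definition flux_vec A W : 'rV[R]_n := \row_i flux A W (delta_mx 0 i).

Lemma flux_dot A W v : ms A -> smooth W -> Cc W -> flux A W v = dot (flux_vec A W) v.
Proof.
move=> mA sW CW; rewrite {1}[v]row_sum_delta /dot.
have -> : \sum_i flux_vec A W 0 i * v 0 i = \sum_i v 0 i * flux A W (delta_mx 0 i).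
  by apply: eq_bigr => i _; rewrite mxE mulrC.
elim: (index_enum _) => [|i s IH]; first by rewrite !big_nil flux0.
by rewrite !big_cons flux_lin// IH.
Qed.

(** * Refinements of a set and a weight *)

Definition test_weight W := smooth W /\ Ccp W.

Lemma test_weight_add W U : test_weight W -> test_weight U -> test_weight (fun x => W x + U x).
Proof. by move=> [sW cW] [sU cU]; split; [exact: smooth_add|exact: Ccp_add]. Qed.

Lemma test_weight_mul W (chi : G -> R) : test_weight W -> smooth chi -> (forall x, 0 <= chi x) -> test_weight (fun x => W x * chi x).
Proof.
move=> [sW [cW W0]] sc c0; split; first exact: smooth_mul.
by split; [apply: Cc_mull => //; exact: smooth_cont|move=> x; rewrite mulr_ge0].
Qed.

Lemma test_weight_0 W : test_weight W -> test_weight (fun _ => 0).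
Proof.
move=> hW; have := test_weight_mul hW (smooth_cst 0) (fun _ => lexx 0).
by congr test_weight; apply/funext => x; rewrite mulr0.
Qed.

(** The instances of interest are fluxes and averaged distances to a right translate. Quantifying
    over all such functionals lets one refinement carry both. *)
Definition biadditive (Psi : set T -> (G -> R) -> R) :=
  (forall A B C W, pt A B C -> test_weight W -> Psi A W = Psi B W + Psi C W) /\
  (forall A W U, ms A -> test_weight W -> test_weight U -> Psi A (fun x => W x + U x) = Psi A W + Psi A U).

(* A decomposition of (A, W) into pieces, as far as biadditive functionals can
   tell. *)
Definition refinement A W (l : seq (set T * (G -> R))) :=
  (forall p, List.In p l -> ms p.1 /\ test_weight p.2) /\
  forall Psi, biadditive Psi -> Psi A W = \sum_(p <- l) Psi p.1 p.2.

Lemma refinement_self A W : ms A -> test_weight W -> refinement A W [:: (A, W)].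
Proof. by move=> mA hW; split=> [p [<-|//]|Psi _] //; rewrite big_seq1. Qed.

(** [Forall2] remembers which pieces come from which element, so that estimates made piece by piece
    can be added up. *)
Lemma refinement_flatten A W l (P : seq (set T * (G -> R)) -> set T * (G -> R) -> Prop) : refinement A W l ->
  (forall p, List.In p l -> exists2 l', refinement p.1 p.2 l' & P l' p) ->
  exists2 ll : seq (seq (set T * (G -> R))), refinement A W (flatten ll) & List.Forall2 P ll l.
Proof.
move=> [h1 h2] hl.
have [ll [i1 i2 i3]] : exists ll : seq (seq (set T * (G -> R))), [/\ List.Forall2 P ll l,
    forall p, List.In p (flatten ll) -> ms p.1 /\ test_weight p.2 &
    forall Psi, biadditive Psi -> \sum_(p <- l) Psi p.1 p.2 = \sum_(p <- flatten ll) Psi p.1 p.2].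
  elim: l hl {h1 h2} => [|p l IH] hl.
    by exists [::]; split=> //= Psi _; rewrite !big_nil.
  have [ll [i1 i2 i3]] := IH (fun q ql => hl q (or_intror ql)).
  have [l' [r1 r2] Pl'] := hl p (or_introl erefl).
  exists (l' :: ll); split.
  - by constructor.
  - by move=> q /= /List.in_app_iff[/r1|/i2].
  - by move=> Psi hP; rewrite big_cons /= big_cat /= -i3// -r2.
by exists ll => //; split=> // Psi hP; rewrite h2// i3.
Qed.

Lemma biadditive_d g : biadditive (fun A W => L (fun x => W x * d A x (x * g)%g)).
Proof.
have C1 A W : ms A -> test_weight W -> Cc (fun x => W x * d A x (x * g)%g).
  by move=> mA [_ [cW _]]; apply: Cc_mull => //; exact: dR_cont.
split=> [A B C W p hW|A W U mA hW hU].
  have [mA mB mC] := mf_pt mf p.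
  rewrite -(haarD hL (C1 B W mB hW) (C1 C W mC hW)); congr L; apply/funext => x.
  by rewrite (mf_dpt mf _ _ p) mulrDr.
by rewrite -(haarD hL (C1 A W mA hW) (C1 A U mA hU)); congr L; apply/funext => x; rewrite mulrDl.
Qed.

Lemma D_lin (a : R) W U v : smooth W -> smooth U -> D v (fun x => a * W x + U x) = (fun x => a * D v W x + D v U x).
Proof.
move=> sW sU; apply/funext => x.
have h1 := he_deriv hE v x 0 sW; have h2 := he_deriv hE v x 0 sU.
have h3 := he_deriv hE v x 0 (smooth_add (smooth_scale a sW) sU).
have [_ e1] := is_deriveD (is_deriveZ a h1) h2; have [_ e2] := h3.
by rewrite -[in LHS](mulg1 x) -[in RHS](mulg1 x) -(he0 v) -e2 -[RHS]e1.
Qed.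

Lemma D_add W U v : smooth W -> smooth U -> D v (fun x => W x + U x) = (fun x => D v W x + D v U x).
Proof.
move=> sW sU; have := D_lin 1 v sW sU.
have -> : (fun x => 1 * W x + U x) = (fun x => W x + U x) by apply/funext => x; rewrite mul1r.
by move=> ->; apply/funext => x; rewrite mul1r.
Qed.

Lemma flux_linW A (a : R) W U v : ms A -> smooth W -> Cc W -> smooth U -> Cc U ->
  flux A (fun x => a * W x + U x) v = a * flux A W v + flux A U v.
Proof.
move=> mA sW CW sU CU.
have C1 V : smooth V -> Cc V -> Cc (fun x => D v V x * I A x).
  by move=> sV CV; apply: Cc_mull; [exact: Cc_D|exact: I1_cont].
rewrite /flux mulrN -opprD -(haar_lin hL a (C1 W sW CW) (C1 U sU CU)); congr (- L _); apply/funext => x.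
by rewrite D_lin// mulrDl mulrA.
Qed.

Lemma biadditive_flux v : biadditive (fun A W => flux A W v).
Proof.
have C1 A W : ms A -> test_weight W -> Cc (fun x => D v W x * I A x).
  by move=> mA [sW [cW _]]; apply: Cc_mull; [exact: Cc_D|exact: I1_cont].
split=> [A B C W p hW|A W U mA hW hU]; rewrite /flux -opprD; congr (- _).
  have [mA mB mC] := mf_pt mf p.
  rewrite -(haarD hL (C1 B W mB hW) (C1 C W mC hW)); congr L; apply/funext => x.
  by rewrite (mf_Ipt mf _ p) mulrDr.
rewrite -(haarD hL (C1 A W mA hW) (C1 A U mA hU)); congr L; apply/funext => x.
by rewrite D_add ?mulrDl; [|have [] := hW|have [] := hU].
Qed.

(** At a common small [h] the finite sum is bounded by averaged distances; dividing by [h] leaves an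
    arbitrarily small error. The weights may change sign here, hence the absolute value of [p.2]. *)
Lemma flux_sum_bound (l : seq (set T * (G -> R))) M v :
  (forall p, List.In p l -> [/\ ms p.1, smooth p.2 & Cc p.2]) ->
  (forall h, 0 < h < 1 -> \sum_(p <- l) L (fun x => `|p.2 x| * d p.1 x (x * E (h *: v))%g) <= M * h) ->
  \sum_(p <- l) `|flux p.1 p.2 v| <= M.
Proof.
move=> hl hM.
have key e : 0 < e -> exists2 r0, 0 < r0 & forall h, 0 < h < r0 -> h * \sum_(p <- l) `|flux p.1 p.2 v| <=
    \sum_(p <- l) L (fun x => `|p.2 x| * d p.1 x (x * E (h *: v))%g) + (size l)%:R * (e * h).
  move=> e0; elim: l hl {hM} => [|p l IH] hl.
    by exists 1 => // h _; rewrite !big_nil mulr0 mul0r addr0.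
  have [r0 r00 hr] := IH (fun q ql => hl q (or_intror ql)).
  have [mA sU CU] := hl p (or_introl erefl); have [r1 r10 hr1] := flux_bound v mA sU CU e0.
  exists (Num.min r0 r1); first by rewrite lt_min r00.
  move=> h /andP[h0]; rewrite lt_min => /andP[h1 h2].
  have a1 := hr h; rewrite h0 h1 in a1; have a2 := hr1 h; rewrite h0 h2 in a2.
  rewrite !big_cons mulrDr -[(size _)%:R]natr1 mulrDl mul1r [X in _ <= _ + X]addrC addrACA.
  by apply: lerD; [exact: a2|exact: a1].
apply/ler_addgt0Pr => e e0.
have s0 : (0 : R) < (size l).+1%:R by rewrite ltr0n.
have e1 : 0 < e / (size l).+1%:R by rewrite divr_gt0.
have [r0 r00 hr] := key _ e1.
pose h := Num.min r0 1 / 2.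
have m0 : 0 < Num.min r0 1 by rewrite lt_min r00 ltr01.
have h0 : 0 < h by rewrite divr_gt0.
have hm : h < Num.min r0 1 by rewrite ltr_pdivrMr// ltr_pMr// ltr1n.
move: hm; rewrite lt_min => /andP[h1 h2].
have a1 := hr h; rewrite h0 h1 in a1; have a2 := hM h; rewrite h0 h2 in a2.
have a3 := le_trans (a1 isT) (lerD (a2 isT) (lexx _)).
rewrite -(ler_pM2l h0); apply: (le_trans a3).
rewrite mulrDr [M * h]mulrC lerD2l.
have q1 : (size l)%:R / (size l).+1%:R <= 1 :> R by rewrite ler_pdivrMr// mul1r ler_nat.
have -> : (size l)%:R * (e / (size l).+1%:R * h) = (size l)%:R / (size l).+1%:R * (h * e) by ring.
by apply: ler_piMl => //; rewrite mulr_ge0// ?(ltW h0)// (ltW e0).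
Qed.

(** The products $\chi_i\prod_{j<i}(1-\chi_j)$, whose sum $1 - \prod_i(1-\chi_i)$ is at most 1, and
    is 1 wherever some $\chi_i$ is 1. *)
Fixpoint disjointify (s : seq (G * (G -> R))) :=
  if s is p :: s' then p :: [seq (q.1, fun x => (1 - p.2 x) * q.2 x) | q <- disjointify s'] else [::].

Lemma disjointify_sum s x : 1 - \sum_(q <- disjointify s) q.2 x = \prod_(q <- s) (1 - q.2 x).
Proof.
elim: s => [|p s IH] /=; first by rewrite !big_nil subr0.
rewrite !big_cons big_map /= -mulr_sumr -IH; ring.
Qed.

Definition bump_good (Q : G -> G -> Prop) (p : G * (G -> R)) :=
  [/\ smooth p.2, forall x, 0 <= p.2 x <= 1 & forall x, p.2 x != 0 -> Q p.1 x].

Lemma disjointify_ok Q s : (forall p, List.In p s -> bump_good Q p) -> forall p, List.In p (disjointify s) -> bump_good Q p.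
Proof.
elim: s => [|p s IH] // h q /= [<-|]; first by apply: h; left.
move=> /List.in_map_iff[q' [<- q'l]].
have [s1 b1 _] := h p (or_introl erefl).
have [s2 b2 Q2] := IH (fun r rl => h r (or_intror rl)) q' q'l.
split=> /=.
- apply: smooth_mul => //; apply: smooth_add; first exact: smooth_cst.
  exact: smooth_opp.
- move=> x; have /andP[p0 p1] := b1 x; have /andP[q0 q1] := b2 x.
  have p2 : 0 <= 1 - p.2 x by rewrite subr_ge0.
  by rewrite mulr_ge0//= mulr_ile1// lerBlDr lerDl.
- by move=> x; rewrite mulf_eq0 negb_or => /andP[_]; exact: Q2.
Qed.

Lemma partition_unity (S : set G) Q : compact S -> (forall x, S x -> \forall y \near x, Q x y) ->
  exists s, [/\ forall p, List.In p s -> bump_good Q p, forall x, \sum_(p <- s) p.2 x <= 1 &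
    forall x, S x -> \sum_(p <- s) p.2 x = 1].
Proof.
move=> cS hQ.
have [|s0 hs0] := @compact_seq G S {p : G * (G -> R) | bump_good Q p} (fun x p => (sval p).2 x = 1) cS.
  move=> x Sx; have [V [oV Vx] VQ] : exists2 B, open_nbhs x B & B `<=` Q x.
    by have := hQ x Sx; rewrite /prop_near1 nbhsE.
  have [W [C [sW W01 Wx cC [CV W0]]]] := bump_G oV Vx.
  have g : bump_good Q (x, W).
    by split=> //= y yW; apply: VQ; apply: CV; apply: contrapT => /W0 w0; rewrite w0 eqxx in yW.
  by exists (exist _ (x, W) g).
pose s := [seq sval p | p <- s0].
have gs p : List.In p s -> bump_good Q p by move=> /List.in_map_iff[p' [<- _]]; exact: (svalP p').
have pr x : 0 <= \prod_(q <- s) (1 - q.2 x).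
  elim: s gs => [|p s IH] gs; first by rewrite big_nil.
  rewrite big_cons mulr_ge0//; last by apply: IH => q ql; apply: gs; right.
  by have [_ /(_ x) /andP[_ b] _] := gs p (or_introl erefl); rewrite subr_ge0.
exists (disjointify s); split.
- exact: disjointify_ok.
- by move=> x; rewrite -subr_ge0 disjointify_sum.
- move=> x /hs0[t [tl t1]]; apply/eqP; rewrite eq_sym -subr_eq0 disjointify_sum.
  rewrite /s; elim: s0 tl {hs0 s gs pr} => [|p s0 IH] //= [->|tl]; rewrite big_cons; first by rewrite t1 subrr mul0r.
  by move: (IH tl) => /eqP ->; rewrite mulr0.
Qed.

(** An upper bound on the limit superior of $r^{-1}$ times the averaged displacement. *)
Definition rate_le A W (phi : R -> G) b := forall eta : R, 0 < eta -> exists2 r0, 0 < r0 & forall r, 0 < r < r0 ->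
  L (fun x => W x * d A x (x * phi r)%g) <= r * (b + eta).

Lemma wd_Cc A W g : ms A -> Cc W -> Cc (fun x => W x * d A x (x * g)%g).
Proof. by move=> mA cW; apply: Cc_mull => //; exact: dR_cont. Qed.

(** Uniform continuity alone is not enough, as [L] need not have finite total mass: [chi] dominates
    the indicator of the region swept by the support under small translations. *)
Lemma transl_small W e : Cc W -> 0 < e -> \forall w \near (1%g : G), L (fun x => `|W (x * w)%g - W x|) <= e.
Proof.
move=> CW e0; have [CWc [S cS hS]] := CW.
have [V cV nV] : exists2 V : set G, compact V & nbhs (1%g : G) V.
  by have [C [cC _ nC]] := compact_nbhd openT (Logic.I : setT (1%g : G)); exists C.
have [chi [Cchi chi0] chi1] : exists2 chi : G -> R, Cc chi /\ (forall x, 0 <= chi x) &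
    forall x, (exists2 w, V w & S (x * w)%g) -> 1 <= chi x.
  have [|chi h1 h2] := @bump_compact R n G ((fun p : G * G => (p.1 * p.2^-1)%g) @` (S `*` V)).
    apply: continuous_compact; last exact: compact_setX.
    apply: continuous_subspaceT => p.
    have cE : {for p, continuous (fun p : G * G => p.2^-1%g)}.
      apply: (@continuous_comp _ _ _ (fun p : G * G => p.2) (fun t => t^-1)%g); last exact: inv_cont.
      exact: cvg_snd.
    by apply: (@continuous_comp _ _ _ (fun p : G * G => (p.1, p.2^-1%g)) (fun p : G * G => p.1 * p.2)%g);
      [apply: cvg_pair => //=; exact: cvg_fst|exact: mul_cont].
  exists chi => // x [w Vw Sw]; apply: h2; exists ((x * w)%g, w) => //=.
  by rewrite mulgK.
have M0 : 0 <= L chi by exact: (haar_ge0 hL).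
have M1 : 0 < L chi + 1 by rewrite ltr_wpDl.
have eM : 0 < e / (L chi + 1) by rewrite divr_gt0.
have hu := unif_right CW eM.
have V1 : V 1%g by exact: nbhs_singleton.
near=> w.
have hw : forall x, `|W (x * w)%g - W x| <= e / (L chi + 1) by near: w.
have Vw : V w by near: w.
apply: (@le_trans _ _ (L (fun x => e / (L chi + 1) * chi x))); last first.
  by rewrite haarZ// mulrAC ler_pdivrMr// ler_wpM2l ?(ltW e0)// lerDl.
have CWw := Cc_transl w CW.
apply: haar_le => //; [by apply: Cc_norm; exact: Cc_sub|exact: Cc_scale|move=> x].
have [h|h] := pselect (exists2 w, V w & S (x * w)%g).
  by apply: le_trans (hw x) _; rewrite -[leLHS]mulr1 ler_wpM2l ?(ltW eM)// chi1.
have -> : W x = 0.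
  by apply/eqP/negPn/negP => /hS Sx; apply: h; exists 1%g => //; rewrite mulg1.
have -> : W (x * w)%g = 0 by apply/eqP/negPn/negP => /hS Sx; apply: h; exists w.
by rewrite subr0 normr0 mulr_ge0 ?(ltW eM).
Unshelve. all: by end_near.
Qed.

(* A single application of the mean value theorem to the whole sum, so that all
   the pieces are differentiated at the same time [s]. *)
Lemma flow_mvt (l : seq (set T * (G -> R))) v (r : R) : 0 < r -> (forall p, List.In p l -> [/\ ms p.1, smooth p.2 & Cc p.2]) ->
  exists2 s, 0 < s < r & \sum_(p <- l) L (fun x => p.2 x * (I p.1 (x * E (r *: v))%g - I p.1 x)) =
    r * \sum_(p <- l) flux p.1 (fun x => p.2 (x * E (- s *: v))%g) v.
Proof.
move=> r0 hl.
pose h (t : R) := \sum_(p <- l) L (fun x => p.2 x * I p.1 (x * E (t *: v))%g).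
pose h' (t : R) := \sum_(p <- l) flux p.1 (fun x => p.2 (x * E (- t *: v))%g) v.
have hd (t : R) : is_derive t 1 h (h' t).
  rewrite /h /h'; elim: l hl {h h'} => [|p l IH] hl.
    have -> : (fun t : R => \sum_(p <- [::]) L (fun x => p.2 x * I p.1 (x * E (t *: v))%g)) = cst 0.
      by apply/funext => y; rewrite big_nil.
    by rewrite big_nil; exact: is_derive_cst.
  have [mA sW cW] := hl p (or_introl erefl).
  have h1 := flow_is_derive v t mA sW cW; have h2 := IH (fun q ql => hl q (or_intror ql)).
  have := is_deriveD h1 h2; rewrite big_cons; congr (is_derive _ _ _ _).
  by apply/funext => y; rewrite big_cons.
have hc : {within `[0, r], continuous h}.
  by apply: derivable_within_continuous => t _; have [] := hd t.
have [s sI e] := MVT r0 (fun t _ => hd t) hc.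
move: sI; rewrite in_itv /= => s0; exists s => //.
rewrite -/(h' s) mulrC -[r in RHS]subr0 -e /h -sumrB; apply: sum_In_eq => p /hl[mA sW cW].
rewrite -haarB//; try by apply: Cc_mull => //; exact: IR_cont.
by congr L; apply/funext => x; rewrite he0 mulg1 mulrBr.
Qed.

Lemma In_flatten_map (X Y : Type) (f : X -> seq Y) (s : seq X) q :
  List.In q (flatten [seq f p | p <- s]) -> exists2 p, List.In p s & List.In q (f p).
Proof.
elim: s => [|p s IH] //= /List.in_app_iff[h|/IH[p' ps h]]; first by exists p => //; left.
by exists p' => //; right.
Qed.

Lemma biadditive_list (X : Type) (s : seq X) (F : X -> G -> R) Psi A W0 : biadditive Psi -> ms A -> test_weight W0 ->
  (forall p, List.In p s -> test_weight (F p)) -> test_weight (fun x => \sum_(p <- s) F p x) /\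
  Psi A (fun x => \sum_(p <- s) F p x) = \sum_(p <- s) Psi A (F p).
Proof.
move=> hP mA hW0; have h0 := test_weight_0 hW0.
elim: s => [|p s IH] hF.
  have -> : (fun x => \sum_(p <- [::]) F p x) = (fun _ => 0) by apply/funext => x; rewrite big_nil.
  split=> //; rewrite big_nil; have := hP.2 A _ _ mA h0 h0.
  have -> : (fun x : G => 0 + 0 : R) = (fun=> 0) by apply/funext => x; rewrite addr0.
  by move: (Psi _ _) => z h; lra.
have [w e] := IH (fun q ql => hF q (or_intror ql)); have wp := hF p (or_introl erefl).
have -> : (fun x => \sum_(q <- p :: s) F q x) = (fun x => F p x + \sum_(q <- s) F q x).
  by apply/funext => x; rewrite big_cons.
by split; [exact: test_weight_add|rewrite hP.2// e big_cons].
Qed.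

(** The splitting is exact at [c]. Passing to a point within [k] costs [k] in each of two distances
    and four averages, hence [6 * k]. *)
Lemma split_bound A B C c x (g : G) (k : R) : pt A B C ->
  d A c (c * g)%g = (I B (c * g)%g - I B c) - (I C (c * g)%g - I C c) ->
  d setT c x <= k -> d setT (c * g)%g (x * g)%g <= k ->
  d A x (x * g)%g <= (I B (x * g)%g - I B x) - (I C (x * g)%g - I C x) + 6 * k.
Proof.
move=> p e h1 h2; have [mA mB mC] := mf_pt mf p.
have t1 := mf_tri mf x c (x * g)%g mA; have t2 := mf_tri mf c (c * g)%g (x * g)%g mA.
have ab M y z : ms M -> d setT y z <= k -> I M y - I M z <= k /\ I M z - I M y <= k.
  move=> mM hk; have := le_trans (mf_dist mf y z mM) (le_trans (mf_le mf y z mM) hk).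
  by rewrite ler_norml => /andP[]; move: (I M y) (I M z) => a b; split; lra.
have a1 := le_trans (mf_le mf _ _ mA) h1; have a2 := le_trans (mf_le mf _ _ mA) h2.
have [b1 b1'] := ab B _ _ mB h1; have [b2 b2'] := ab B _ _ mB h2.
have [c1 c1'] := ab C _ _ mC h1; have [c2 c2'] := ab C _ _ mC h2.
move: t1 t2 a1 a2 b1 b1' b2 b2' c1 c1' c2 c2'; rewrite e (mf_sym mf A x c).
move: (d A x (x * g)%g) (d A c x) (d A (c * g)%g (x * g)%g) (d A c (x * g)%g).
move: (I B (x * g)%g) (I B (c * g)%g) (I B x) (I B c) (I C (x * g)%g) (I C (c * g)%g) (I C x) (I C c).
move=> *; lra.
Qed.

Lemma flux_split_bound A W U v : ms A -> smooth W -> Cc W -> smooth U -> Cc U ->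
  `|flux A U v| <= `|flux A W v| + `|flux A (fun x => U x - W x) v|.
Proof.
move=> mA sW CW sU CU.
have -> : (fun x => U x - W x) = (fun x => -1 * W x + U x) by apply/funext => x; rewrite mulN1r addrC.
rewrite flux_linW// mulN1r; have -> : flux A U v = flux A W v + (- flux A W v + flux A U v) by ring.
by apply: (le_trans (ler_normD _ _)); rewrite addKr.
Qed.

(* Locally constant sign sets: near each [y], split [A] by the sign of
   [F (y * E (r *: v)) - F y], and glue with a partition of unity finer than
   the scale [r]. *)
Lemma flow_rate_le A W v b : ms A -> test_weight W -> (forall l, refinement A W l -> \sum_(p <- l) `|flux p.1 p.2 v| <= b) ->
  rate_le A W (fun r => E (r *: v)) b.
Proof.
move=> mA hW hb eta eta0; have [sW [CW W0]] := hW.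
pose M := K * `|v|; have M0 : 0 <= M by rewrite mulr_ge0.
have M1 : 0 < M + 1 by rewrite ltr_wpDl.
have LW0 : 0 <= L W by exact: (haar_ge0 hL).
have LW1 : 0 < 6 * (L W + 1) by rewrite mulr_gt0// ltr_wpDl.
have eta2 : 0 < eta / 2 by rewrite divr_gt0.
have e10 : 0 < eta / 2 / (M + 1) by rewrite divr_gt0.
have [S cS hS] := flow_supp v CW.
have cE : (fun t : R => E (t *: v)) @ (0 : R) --> (1%g : G) by have := @he_cont _ _ _ _ hE v 0; rewrite /continuous_at he0.
have /nbhs_ballP[r1 /= r10 hr1] := cE _ (transl_small CW e10).
exists (Num.min r1 1); first by rewrite lt_min r10 ltr01.
move=> r /andP[r0]; rewrite lt_min => /andP[rr1 rl1].
(* Chosen so that the total splitting error [6 * k * L W] is at most [r * (eta / 2)]. *)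
pose k := r * (eta / 2) / (6 * (L W + 1)).
have k0 : 0 < k by rewrite divr_gt0// mulr_gt0.
pose Er := E (r *: v).
pose Q c y := d setT c y <= k /\ d setT (c * Er)%g (y * Er)%g <= k.
have [|s [gs s1 sS]] := @partition_unity S Q cS.
  move=> x _; have n1 := d_near x k0; have enorm := @mulR_cont _ _ _ Er x _ (d_near (x * Er)%g k0).
  near=> y; split; near: y; [exact: n1|exact: enorm].
have /choice[BC hBC] : forall c, exists BC : set T * set T, pt A BC.1 BC.2 /\
    d A c (c * Er)%g = (I BC.1 (c * Er)%g - I BC.1 c) - (I BC.2 (c * Er)%g - I BC.2 c).
  by move=> c; have [B [C h]] := mf_split mf c (c * Er)%g mA; exists (B, C).
pose Bf p := (BC p).1; pose Cf p := (BC p).2.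
have mB c : ms (Bf c) by have [/(mf_pt mf)[]] := hBC c.
have mC c : ms (Cf c) by have [/(mf_pt mf)[]] := hBC c.
have ptc c : pt A (Bf c) (Cf c) by have [] := hBC c.
pose Wc (p : G * (G -> R)) x := W x * p.2 x.
have hWc p : List.In p s -> test_weight (Wc p).
  by move=> /gs[s2 p01 _]; apply: test_weight_mul => // x; have /andP[] := p01 x.
have CWc p : List.In p s -> Cc (Wc p) by move=> /hWc[_ []].
have sWc p : List.In p s -> smooth (Wc p) by move=> /hWc[].
have WE x : W x = \sum_(p <- s) Wc p x.
  rewrite -mulr_sumr; have [->|Wx] := eqVneq (W x) 0; first by rewrite mul0r.
  by rewrite sS ?mulr1//; apply: (hS x 0); rewrite ?normr0 ?ler01// he0 mulg1.
(* The minus sign of the halves [Cf] is put into the weight, so that a single sum over [l1]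
   represents the averaged distance. *)
pose l1 := flatten [seq [:: (Bf p.1, Wc p); (Cf p.1, fun x => -1 * Wc p x)] | p <- s].
have hl1 q : List.In q l1 -> [/\ ms q.1, smooth q.2 & Cc q.2].
  move=> qh; have [p ps /= [<-|[<-|[]]]] := In_flatten_map qh; split=> //=; [exact: sWc|exact: CWc|apply: smooth_scale; exact: sWc|apply: Cc_scale; exact: CWc].
have step1 : L (fun x => W x * d A x (x * Er)%g) <= \sum_(p <- l1) L (fun x => p.2 x * (I p.1 (x * Er)%g - I p.1 x)) + 6 * k * L W.
  have -> : L (fun x => W x * d A x (x * Er)%g) = \sum_(p <- s) L (fun x => Wc p x * d A x (x * Er)%g).
    rewrite -(@haar_list _ _ _ L hL _ _ _ W CW); last by move=> p ps; apply: wd_Cc => //; exact: CWc.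
    by congr L; apply/funext => x; rewrite {1}WE mulr_suml.
  have -> : L W = \sum_(p <- s) L (Wc p).
    by rewrite -(@haar_list _ _ _ L hL _ _ _ W CW)//; congr L; apply/funext => x.
  rewrite /l1 big_flatten big_map /= mulr_sumr -big_split /=; apply: sum_In_le => p ps.
  have [s2 p01 pQ] := gs p ps; have CW1 := CWc p ps.
  rewrite big_cons big_seq1 /=.
  have cI A' : ms A' -> continuous (fun x => I A' (x * Er)%g - I A' x).
    by move=> mA' x; apply: continuousB; [exact: IR_cont|exact: I1_cont].
  have C1 := Cc_mull CW1 (cI _ (mB p.1)); have C2 := Cc_mull (Cc_scale (-1) CW1) (cI _ (mC p.1)).
  rewrite -haarZ// -haarD// -haarD//; last exact: Cc_scale; last exact: Cc_add.
  apply: haar_le => //; [exact: wd_Cc|apply: Cc_add; [exact: Cc_add|exact: Cc_scale]|move=> x].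
  have -> : Wc p x * (I (Bf p.1) (x * Er)%g - I (Bf p.1) x) + -1 * Wc p x * (I (Cf p.1) (x * Er)%g - I (Cf p.1) x) + 6 * k * Wc p x
    = Wc p x * ((I (Bf p.1) (x * Er)%g - I (Bf p.1) x) - (I (Cf p.1) (x * Er)%g - I (Cf p.1) x) + 6 * k) by ring.
  have [z|nz] := eqVneq (p.2 x) 0; first by rewrite /Wc z mulr0 !mul0r.
  have [q1 q2] := pQ x nz; have [_ eA] := hBC p.1.
  apply: ler_wpM2l; first by have [_ [_ h]] := hWc p ps; exact: h.
  exact: (split_bound (ptc p.1) eA q1 q2).
have [t /andP[t0 tr] et] := flow_mvt v r0 hl1.
rewrite et in step1.
pose g := E (- t *: v).
have t1 : `|t| <= 1 by rewrite gtr0_norm// ltW// (lt_trans tr).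
(* After the flow all weights are evaluated at [x * g]. In [l2] only the partition functions are
   translated, not [W], which makes it a refinement of [(A, W)]; [l3] carries the difference, small
   because [W] moves little in mean. *)
pose l2 := flatten [seq [:: (Bf p.1, fun x => W x * p.2 (x * g)%g); (Cf p.1, fun x => W x * p.2 (x * g)%g)] | p <- s].
pose dW x := W (x * g)%g - W x.
pose l3 := flatten [seq [:: (Bf p.1, fun x => dW x * p.2 (x * g)%g); (Cf p.1, fun x => dW x * p.2 (x * g)%g)] | p <- s].
have Wtg p : List.In p s -> test_weight (fun x => W x * p.2 (x * g)%g).
  move=> /gs[s2 p01 _]; apply: test_weight_mul => //; first exact: smooth_R.
  by move=> x; have /andP[] := p01 (x * g)%g.
have sdW : smooth dW by apply: smooth_add; [exact: smooth_R|exact: smooth_opp].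
have CdW : Cc dW by apply: Cc_sub => //; exact: Cc_transl.
have sp p : List.In p s -> smooth (fun x => p.2 (x * g)%g) by move=> /gs[s2 _ _]; exact: smooth_R.
have sdp p : List.In p s -> smooth (fun x => dW x * p.2 (x * g)%g) by move=> ps; apply: smooth_mul => //; exact: sp.
have Cdp p : List.In p s -> Cc (fun x => dW x * p.2 (x * g)%g).
  by move=> ps; apply: Cc_mull => //; exact: (smooth_cont (sp p ps)).
have r2 : refinement A W l2.
  split=> [q qh|Psi hP].
    by have [p ps /= [<-|[<-|[]]]] := In_flatten_map qh; split=> //=; exact: Wtg.
  have [_ e] := biadditive_list hP mA hW Wtg.
  have -> : W = (fun x => \sum_(p <- s) W x * p.2 (x * g)%g).
    apply/funext => x; rewrite -mulr_sumr; have [->|Wx] := eqVneq (W x) 0; first by rewrite mul0r.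
    by rewrite sS ?mulr1//; apply: (hS _ t) => //; rewrite -mulgA /g heN mulVg mulg1.
  rewrite e /l2 big_flatten big_map; apply: sum_In_eq => p ps.
  by rewrite big_cons big_seq1 /=; apply: hP.1 => //; exact: Wtg.
have b3 : \sum_(p <- l3) `|flux p.1 p.2 v| <= M * (eta / 2 / (M + 1)).
  apply: flux_sum_bound.
    move=> q qh; have [p ps /= [<-|[<-|[]]]] := In_flatten_map qh; split=> //=; [exact: sdp|exact: Cdp|exact: sdp|exact: Cdp].
  move=> h /andP[h0 h1].
  have CN := Cc_norm CdW.
  have CNp p : List.In p s -> Cc (fun x => `|dW x| * p.2 (x * g)%g).
    by move=> ps; apply: Cc_mull => //; exact: (smooth_cont (sp p ps)).
  apply: (@le_trans _ _ (M * h * \sum_(p <- s) L (fun x => `|dW x| * p.2 (x * g)%g))).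
    rewrite /l3 big_flatten big_map mulr_sumr; apply: sum_In_le => p ps.
    have Cabs := Cc_norm (Cdp p ps); have [_ p01 _] := gs p ps.
    rewrite big_cons big_seq1 /= -haarD//; try exact: wd_Cc.
    have CNs := CNp p ps; rewrite -haarZ//; apply: haar_le => //.
    - by apply: Cc_add; exact: wd_Cc.
    - exact: Cc_scale.
    - move=> x; rewrite -mulrDr -(mf_dpt mf _ _ (ptc p.1)) normrM.
      have /andP[p0 _] := p01 (x * g)%g; rewrite (ger0_norm p0) [leRHS]mulrC ler_wpM2l//.
        by rewrite mulr_ge0.
      by rewrite /M; apply: d_line => //; exact: ltW.
  rewrite -(@haar_list _ _ _ L hL _ _ _ W CW CNp) mulrAC [leRHS]mulrC -[leRHS]mulrC ler_wpM2r ?(ltW h0)//.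
  rewrite ler_wpM2l//; apply: (@le_trans _ _ (L (fun x => `|dW x|))).
    apply: haar_le => //; first exact: (Cc_list CW CNp).
    by move=> x; rewrite -mulr_sumr ler_piMr.
  by apply: hr1; rewrite -ball_normE /= sub0r normrN normrN gtr0_norm// (lt_trans tr).
have b2 := hb l2 r2.
have key : \sum_(p <- l1) flux p.1 (fun x => p.2 (x * g)%g) v <= \sum_(p <- l2) `|flux p.1 p.2 v| + \sum_(p <- l3) `|flux p.1 p.2 v|.
  rewrite /l1 /l2 /l3 !big_flatten !big_map -big_split /=; apply: sum_In_le => p ps.
  rewrite !big_cons !big_nil !addr0 /= addrACA.
  have sU : smooth (fun x => Wc p (x * g)%g) by apply: smooth_R; exact: sWc.
  have CU : Cc (fun x => Wc p (x * g)%g) by apply: Cc_transl; exact: CWc.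
  have [s2 [C2 _]] := Wtg p ps.
  have e : (fun x => dW x * p.2 (x * g)%g) = (fun x => Wc p (x * g)%g - W x * p.2 (x * g)%g).
    by apply/funext => x; rewrite mulrBl.
  rewrite e; apply: lerD.
    by apply: (le_trans (ler_norm _)); exact: flux_split_bound.
  have -> : (fun x => -1 * Wc p (x * g)%g) = (fun x => -1 * Wc p (x * g)%g + (fun=> 0) x).
    by apply/funext => x; rewrite addr0.
  rewrite flux_linW//; [|exact: smooth_cst|exact: (Cc0 CW)].
  have -> : flux (Cf p.1) (fun=> 0) v = 0.
    have := flux_linW 1 v (mC p.1) (smooth_cst 0) (Cc0 CW) (smooth_cst 0) (Cc0 CW).
    have -> : (fun _ : G => 1 * 0 + 0 : R) = (fun=> 0) by apply/funext => x; rewrite mulr0 addr0.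
    by rewrite mul1r => /eqP; rewrite -subr_eq subrr eq_sym => /eqP.
  by rewrite addr0 mulN1r; apply: le_trans (flux_split_bound v (mC p.1) s2 C2 sU CU); rewrite -normrN ler_norm.
have b4 : M * (eta / 2 / (M + 1)) <= eta / 2.
  by rewrite mulrA ler_pdivrMr// mulrC ler_wpM2l ?(ltW eta2)// lerDl.
have b5 : 6 * k * L W <= r * (eta / 2).
  rewrite /k; have -> : 6 * (r * (eta / 2) / (6 * (L W + 1))) * L W = r * (eta / 2) * (6 * L W) / (6 * (L W + 1)) by ring.
  rewrite ler_pdivrMr// ler_wpM2l// ?mulr_ge0 ?(ltW r0) ?(ltW eta2) ?(ltW eta0)//.
  by rewrite ler_wpM2l// lerDl.
apply: (le_trans step1).
have h1 := le_trans key (lerD b2 (le_trans b3 b4)).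
have h2 : r * \sum_(p <- l1) flux p.1 (fun x => p.2 (x * g)%g) v <= r * (b + eta / 2) by rewrite ler_wpM2l ?(ltW r0).
apply: (le_trans (lerD h2 b5)).
by rewrite -mulrDr -addrA -splitr.
Unshelve. all: by end_near.
Qed.

Lemma rate_le_mono A W phi b b' : b <= b' -> rate_le A W phi b -> rate_le A W phi b'.
Proof.
move=> bb h eta /h[r0 r00 hr]; exists r0 => // r rr; apply: (le_trans (hr r rr)).
by move: rr => /andP[/ltW r1 _]; rewrite ler_wpM2l// lerD2r.
Qed.

Lemma rate_le_ref A W l phi (b : set T * (G -> R) -> R) : refinement A W l ->
  (forall p, List.In p l -> rate_le p.1 p.2 phi (b p)) -> rate_le A W phi (\sum_(p <- l) b p).
Proof.
move=> [_ h2] hl eta eta0.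
have key e : 0 < e -> exists2 r0, 0 < r0 & forall r, 0 < r < r0 ->
    \sum_(p <- l) L (fun x => p.2 x * d p.1 x (x * phi r)%g) <= r * (\sum_(p <- l) b p + (size l)%:R * e).
  move=> e0; elim: l hl {h2} => [|p l IH] hl.
    by exists 1 => // r _; rewrite !big_nil mul0r addr0 mulr0.
  have [r0 r00 hr] := IH (fun q ql => hl q (or_intror ql)); have [r1 r10 hr1] := hl p (or_introl erefl) e e0.
  exists (Num.min r0 r1); first by rewrite lt_min r00.
  move=> r /andP[r2]; rewrite lt_min => /andP[r3 r4].
  have a1 := hr r; rewrite r2 r3 in a1; have a2 := hr1 r; rewrite r2 r4 in a2.
  rewrite !big_cons /= -[(size l).+1%:R]natr1 mulrDl mul1r [(size l)%:R * e + e]addrC addrACA mulrDr.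
  by apply: lerD; [exact: a2|exact: a1].
have s0 : (0 : R) < (size l).+1%:R by rewrite ltr0n.
have e1 : 0 < eta / (size l).+1%:R by rewrite divr_gt0.
have [r0 r00 hr] := key _ e1; exists r0 => // r rr.
rewrite (h2 _ (biadditive_d (phi r))); apply: (le_trans (hr r rr)); move: rr => /andP[/ltW r1 _].
rewrite ler_wpM2l// lerD2l mulrA ler_pdivrMr// mulrC ler_wpM2l ?(ltW eta0)//.
by rewrite ler_nat.
Qed.

(** The translation by [psi r], which tends to 1, is moved onto the weight. [W] changes little in
    mean while the displacement is at most [M * r], so the rate is the same. *)
Lemma rate_le_shift A W (psi phi : R -> G) (b M : R) : ms A -> test_weight W -> 0 <= M ->
  (forall V : set G, nbhs 1%g V -> exists2 r0, 0 < r0 & forall r, 0 < r < r0 -> V (psi r)) ->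
  (forall r x, 0 < r -> d A x (x * phi r)%g <= M * r) -> rate_le A W phi b ->
  forall eta, 0 < eta -> exists2 r0, 0 < r0 & forall r, 0 < r < r0 ->
    L (fun x => W x * d A (x * psi r)%g (x * (psi r * phi r))%g) <= r * (b + eta).
Proof.
move=> mA [sW [CW W0]] M0 hpsi hphi hb eta eta0; have eta2 : 0 < eta / 2 by rewrite divr_gt0.
have M1 : 0 < M + 1 by rewrite ltr_wpDl.
have e10 : 0 < eta / 2 / (M + 1) by rewrite divr_gt0.
have [r1 r10 h1] := hb _ eta2.
have [r2 r20 h2] : exists2 r0, 0 < r0 & forall r, 0 < r < r0 -> L (fun x => `|W (x * (psi r)^-1)%g - W x|) <= eta / 2 / (M + 1).
  apply: (hpsi (fun w => L (fun x => `|W (x * w^-1)%g - W x|) <= eta / 2 / (M + 1))).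
  have nb : nbhs (1^-1 : G)%g (fun w => L (fun x => `|W (x * w)%g - W x|) <= eta / 2 / (M + 1)).
    by rewrite invg1; exact: transl_small.
  exact: (@inv_cont _ _ G 1%g _ nb).
exists (Num.min r1 r2); first by rewrite lt_min r10.
move=> r /andP[r0]; rewrite lt_min => /andP[rr1 rr2].
have a1 := h1 r; rewrite r0 rr1 in a1; have a2 := h2 r; rewrite r0 rr2 in a2.
move: (hphi r ^~ r0) a1 a2; move: (psi r) (phi r) => g P dP a1 a2.
have C3 : Cc (fun x => W x * d A (x * g)%g (x * (g * P))%g).
  by apply: Cc_mull => //; apply: d_cont => //; exact: mulR_cont.
have C2 := wd_Cc P mA CW.
have CN := Cc_norm (Cc_sub (Cc_transl g^-1%g CW) CW).
apply: (@le_trans _ _ (L (fun x => W x * d A x (x * P)%g) + M * r * L (fun x => `|W (x * g^-1)%g - W x|))).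
  rewrite -(haar_inv hL g^-1%g C3) -haarZ// -haarD//; last exact: Cc_scale.
  apply: haar_le => //; [exact: (Cc_transl g^-1%g C3)|by apply: Cc_add => //; exact: Cc_scale|move=> x].
  rewrite mulgVK !mulgA mulgVK.
  have -> : W (x * g^-1)%g * d A x (x * P)%g = W x * d A x (x * P)%g + (W (x * g^-1)%g - W x) * d A x (x * P)%g by ring.
  rewrite lerD2l; apply: (le_trans (ler_norm _)); rewrite normrM mulrC.
  by apply: ler_wpM2r => //; rewrite ger0_norm//; exact: (mf_ge0 mf).
have e4 : M * r * L (fun x => `|W (x * g^-1)%g - W x|) <= r * (eta / 2).
  rewrite [M * r]mulrC -mulrA ler_wpM2l ?(ltW r0)//.
  apply: (@le_trans _ _ (M * (eta / 2 / (M + 1)))); first by apply: ler_wpM2l => //; exact: a2.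
  by rewrite mulrA ler_pdivrMr// mulrC ler_wpM2l ?(ltW eta2)// lerDl.
by apply: (le_trans (lerD (a1 isT) e4)); rewrite -mulrDr -addrA -splitr.
Qed.

Lemma E_near v (V : set G) : nbhs 1%g V -> exists2 r0, 0 < r0 & forall r, 0 < r < r0 -> V (E (r *: v)).
Proof.
have cE : (fun t : R => E (t *: v)) @ (0 : R) --> (1%g : G) by have := @he_cont _ _ _ _ hE v 0; rewrite /continuous_at he0.
move=> /cE /nbhs_ballP[r /= r0 h]; exists r => // t /andP[t0 tr]; apply: h.
by rewrite -ball_normE /= sub0r normrN gtr0_norm.
Qed.

(** Triangle inequality along the letters; the tail of the word starts from a point displaced by its
    first letter, which [rate_le_shift] corrects. *)
Lemma rate_le_word A W s (b : 'rV[R]_n -> R) : ms A -> test_weight W -> (forall v, rate_le A W (fun r => E (r *: v)) (b v)) ->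
  rate_le A W (fun r => word_prod E [seq r *: v | v <- s]) (\sum_(v <- s) b v).
Proof.
move=> mA hW hb; have [sW [CW W0]] := hW; elim: s => [|v s IH].
  move=> eta eta0; exists 1 => // r /andP[r0 _] /=; rewrite big_nil add0r.
  have -> : (fun x => W x * d A x (x * 1)%g) = (fun=> 0) by apply/funext => x; rewrite mulg1 (mf_refl mf)// mulr0.
  by rewrite (haar0 hL CW) mulr_ge0 ?(ltW r0) ?(ltW eta0).
move=> eta eta0; have eta2 : 0 < eta / 2 by rewrite divr_gt0.
have M0 : 0 <= K * \sum_(v <- s) `|v| by rewrite mulr_ge0// sumr_ge0.
have [|r1 r10 h1] := rate_le_shift mA hW M0 (E_near v) _ IH eta2.
  move=> r x r0; apply: (le_trans (mf_le mf _ _ mA)); apply: (le_trans (d_word _ _)).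
  rewrite big_map -mulrA ler_wpM2l// mulrC mulr_sumr; apply: ler_sum => w _.
  by rewrite normrZ gtr0_norm.
have [r2 r20 h2] := hb v _ eta2.
exists (Num.min r1 r2); first by rewrite lt_min r10.
move=> r /andP[r0]; rewrite lt_min => /andP[rr1 rr2].
have a1 := h1 r; rewrite r0 rr1 in a1; have a2 := h2 r; rewrite r0 rr2 in a2.
pose P := word_prod E [seq r *: v | v <- s].
have C1 := wd_Cc (E (r *: v)) mA CW.
have C3 : Cc (fun x => W x * d A (x * E (r *: v))%g (x * (E (r *: v) * P))%g).
  by apply: Cc_mull => //; apply: d_cont => //; exact: mulR_cont.
apply: (@le_trans _ _ (L (fun x => W x * d A x (x * E (r *: v))%g) + L (fun x => W x * d A (x * E (r *: v))%g (x * (E (r *: v) * P))%g))).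
  rewrite -haarD//; apply: haar_le => //; [exact: wd_Cc|exact: Cc_add|].
  by move=> x; rewrite -mulrDr ler_wpM2l//; exact: (mf_tri mf).
apply: (le_trans (lerD (a2 isT) (a1 isT))); rewrite big_cons -mulrDr ler_wpM2l ?(ltW r0)//.
by move: (b v) (\sum_(w <- s) b w) => x y; lra.
Qed.

(** Euclidean rather than sup norm: a nearly maximal [dot a u] must force [a] to be nearly parallel
    to [u]. *)
Definition enorm (a : 'rV[R]_n) := Num.sqrt (dot a a).

Lemma dot_ge0 (a : 'rV[R]_n) : 0 <= dot a a.
Proof. by apply: sumr_ge0 => i _; rewrite -expr2 sqr_ge0. Qed.
Lemma dotC (a b : 'rV[R]_n) : dot a b = dot b a.
Proof. by apply: eq_bigr => i _; rewrite mulrC. Qed.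
Lemma enorm_ge0 a : 0 <= enorm a. Proof. exact: sqrtr_ge0. Qed.
Lemma enorm_sq a : enorm a ^+ 2 = dot a a. Proof. by rewrite sqr_sqrtr ?dot_ge0. Qed.

Lemma enorm_le (a : 'rV[R]_n) : enorm a <= \sum_i `|a 0 i|.
Proof.
have S0 : 0 <= \sum_i `|a 0 i| by rewrite sumr_ge0.
rewrite -(@ler_sqr _ (enorm a)) ?nnegrE ?enorm_ge0// enorm_sq expr2 mulr_suml; apply: ler_sum => i _.
have -> : a 0 i * a 0 i = `|a 0 i| * `|a 0 i| by rewrite -!expr2 real_normK// num_real.
by rewrite ler_wpM2l// (bigD1 i)//= lerDl sumr_ge0.
Qed.

Lemma coord_enorm (a : 'rV[R]_n) i : `|a 0 i| <= enorm a.
Proof.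
rewrite -(@ler_sqr _ `|a 0 i|) ?nnegrE ?enorm_ge0// enorm_sq /dot (bigD1 i)//= real_normK ?num_real// expr2 lerDl.
by apply: sumr_ge0 => j _; rewrite -expr2 sqr_ge0.
Qed.

Lemma dotDr (a b c : 'rV[R]_n) (k : R) : dot c (k *: a + b) = k * dot c a + dot c b.
Proof. rewrite mulr_sumr -big_split /=; apply: eq_bigr => i _; rewrite !mxE; ring. Qed.
Lemma dotDl (a b c : 'rV[R]_n) (k : R) : dot (k *: a + b) c = k * dot a c + dot b c.
Proof. by rewrite dotC dotDr !(dotC c). Qed.

Lemma cauchy_schwarz (a b : 'rV[R]_n) : `|dot a b| <= enorm a * enorm b.
Proof.
rewrite -ler_sqr ?nnegrE ?mulr_ge0 ?enorm_ge0// exprMn !enorm_sq real_normK ?num_real//.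
have h k : 0 <= k ^+ 2 * dot b b + 2 * k * dot a b + dot a a.
  by have := dot_ge0 (k *: b + a); rewrite dotDl !dotDr (dotC b a); congr (0 <= _); ring.
have := dot_ge0 b; rewrite le_eqVlt => /orP[/eqP e|b0].
  have ab : dot a b = 0.
    apply/eqP/negPn/negP => nz; have := h (- (dot a a + 1) / (2 * dot a b)); rewrite -e mulr0 add0r.
    have -> : 2 * (- (dot a a + 1) / (2 * dot a b)) * dot a b = - (dot a a + 1) by field.
    by move: (dot a a) => z; lra.
  by rewrite ab -e mulr0 expr2 mulr0.
have := h (- dot a b / dot b b).
have -> : (- dot a b / dot b b) ^+ 2 * dot b b + 2 * (- dot a b / dot b b) * dot a b + dot a a = dot a a - dot a b ^+ 2 / dot b b.
  by field; rewrite gt_eqF.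
by rewrite subr_ge0 ler_pdivrMr.
Qed.

(** For $b = a - \langle a,u\rangle u$ one has $|b|^2 \le 2|a|(|a| - \langle a,u\rangle)$. The
    arithmetic-geometric mean inequality with parameter [t] makes the bound linear in $|a|$ and in
    the defect $|a| - \langle a,u\rangle$, so that it can be summed over pieces. *)
Lemma dot_dir (a u v : 'rV[R]_n) t : dot u u <= 1 -> 0 < t ->
  `|dot a v| <= `|dot u v| * enorm a + enorm v * (t * enorm a + (enorm a - dot a u) / (2 * t)).
Proof.
move=> u1 t0; have nu : enorm u <= 1.
  by rewrite -(@ler_sqr _ (enorm u)) ?nnegrE ?enorm_ge0// enorm_sq expr1n.
have au : `|dot a u| <= enorm a.
  by apply: (le_trans (cauchy_schwarz a u)); rewrite -[leRHS]mulr1 ler_wpM2l ?enorm_ge0.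
pose b := (- dot a u) *: u + a.
have av : dot a v = dot a u * dot u v + dot b v by rewrite /b dotDl; ring.
have d0 : 0 <= enorm a - dot a u by rewrite subr_ge0; exact: le_trans (ler_norm _) au.
have bb : enorm b <= t * enorm a + (enorm a - dot a u) / (2 * t).
  have q0 : 0 <= (enorm a - dot a u) / (2 * t) by rewrite divr_ge0// mulr_ge0 ?(ltW t0).
  have q1 : 0 <= t * enorm a by rewrite mulr_ge0 ?enorm_ge0 ?(ltW t0).
  rewrite -(@ler_sqr _ (enorm b)) ?nnegrE ?enorm_ge0 ?addr_ge0// enorm_sq.
  apply: (@le_trans _ _ ((enorm a - dot a u) * (enorm a + dot a u))).
    have -> : dot b b = enorm a ^+ 2 - 2 * dot a u ^+ 2 + dot a u ^+ 2 * dot u u.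
      by rewrite enorm_sq /b dotDl !dotDr (dotC u a); ring.
    have := ler_wpM2l (sqr_ge0 (dot a u)) u1; rewrite mulr1.
    have -> : (enorm a - dot a u) * (enorm a + dot a u) = enorm a ^+ 2 - dot a u ^+ 2 by ring.
    move: (dot a u ^+ 2 * dot u u) (dot a u ^+ 2) (enorm a ^+ 2) => *; lra.
  apply: (@le_trans _ _ ((enorm a - dot a u) * (2 * enorm a))).
    rewrite ler_wpM2l//; have := le_trans (ler_norm _) au; move: (dot a u) (enorm a) => *; lra.
  have -> : (enorm a - dot a u) * (2 * enorm a) = 4 * ((t * enorm a) * ((enorm a - dot a u) / (2 * t))) by field; rewrite gt_eqF.
  have := sqr_ge0 (t * enorm a - (enorm a - dot a u) / (2 * t)).
  move: (t * enorm a) ((enorm a - dot a u) / (2 * t)) => x y; rewrite -subr_ge0 => h; rewrite -subr_ge0.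
  by move: h; congr (_ <= _); ring.
rewrite av; apply: (le_trans (ler_normD _ _)); apply: lerD.
  by rewrite normrM mulrC ler_wpM2l.
apply: (le_trans (cauchy_schwarz b v)); rewrite mulrC ler_wpM2l ?enorm_ge0//.
Qed.

Lemma refinement_bound A W l v : ms A -> test_weight W -> refinement A W l -> \sum_(p <- l) `|flux p.1 p.2 v| <= K * `|v| * L W.
Proof.
move=> mA [sW [CW W0]] [r1 r2]; apply: flux_sum_bound => [p /r1[mp [sp [Cp _]]]//|h /andP[h0 _]].
have -> : \sum_(p <- l) L (fun x => `|p.2 x| * d p.1 x (x * E (h *: v))%g) = L (fun x => W x * d A x (x * E (h *: v))%g).
  rewrite (r2 _ (biadditive_d (E (h *: v)))); apply: sum_In_eq => p /r1[_ [_ [_ p0]]].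
  by congr L; apply/funext => x; rewrite ger0_norm.
rewrite mulrAC -haarZ//; apply: haar_le => //; [exact: wd_Cc|exact: Cc_scale|move=> x].
by rewrite [leRHS]mulrC ler_wpM2l// d_line// ltW.
Qed.

Definition variation (l : seq (set T * (G -> R))) := \sum_(p <- l) enorm (flux_vec p.1 p.2).
(** The total variation of $m$ on [(A, W)], finite by the Lipschitz bound. *)
Definition max_variation A W := sup [set variation l | l in refinement A W].

Lemma variation_ub A W l : ms A -> test_weight W -> refinement A W l -> variation l <= \sum_i K * `|delta_mx 0 i : 'rV[R]_n| * L W.
Proof.
move=> mA hW hl; apply: (@le_trans _ _ (\sum_(p <- l) \sum_i `|flux p.1 p.2 (delta_mx 0 i)|)).
  by apply: ler_sum => p _; apply: (le_trans (enorm_le _)); apply: ler_sum => i _; rewrite mxE.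
rewrite exchange_big /=; apply: ler_sum => i _; exact: (refinement_bound (delta_mx 0 i) mA hW hl).
Qed.

Lemma has_max_variation A W : ms A -> test_weight W -> has_sup [set variation l | l in refinement A W].
Proof.
move=> mA hW; split; first by exists (variation [:: (A, W)]); exists [:: (A, W)] => //; exact: refinement_self.
by exists (\sum_i K * `|delta_mx 0 i : 'rV[R]_n| * L W) => _ [l hl <-]; exact: variation_ub hl.
Qed.

Lemma max_variation_ge A W l : ms A -> test_weight W -> refinement A W l -> variation l <= max_variation A W.
Proof. by move=> mA hW hl; apply: (ub_le_sup (has_max_variation mA hW).2); exists l. Qed.

Lemma max_variation_near A W e : ms A -> test_weight W -> 0 < e -> exists2 l, refinement A W l & max_variation A W - e <= variation l.
Proof. by move=> mA hW e0; have [_ [l hl <-] h] := sup_adherent e0 (has_max_variation mA hW); exists l => //; exact: ltW. Qed.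

(** Almost optimal refinements of the pieces combine to a refinement of the whole. *)
Lemma max_variation_super A W l : ms A -> test_weight W -> refinement A W l -> \sum_(p <- l) max_variation p.1 p.2 <= max_variation A W.
Proof.
move=> mA hW hl; apply/ler_addgt0Pr => e e0.
have s0 : (0 : R) < (size l).+1%:R by rewrite ltr0n.
have e1 : 0 < e / (size l).+1%:R by rewrite divr_gt0.
have [|ll rl h] := @refinement_flatten A W l (fun l' p => max_variation p.1 p.2 - e / (size l).+1%:R <= variation l') hl.
  by move=> p pl; have [mp hp] := hl.1 p pl; exact: max_variation_near.
have h1 : \sum_(p <- l) (max_variation p.1 p.2 - e / (size l).+1%:R) <= variation (flatten ll).
  rewrite /variation big_flatten /=; move: h; move: (e / _) => e'; elim => [|l' p ll' l'' hp _ IH]; first by rewrite !big_nil.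
  by rewrite !big_cons; apply: lerD.
have h2 := le_trans h1 (max_variation_ge mA hW rl).
rewrite sumrB big_const_seq count_predT iter_addr_0 lerBlDr in h2; apply: (le_trans h2).
rewrite lerD2l -[_ *+ size l]mulr_natr mulrAC ler_pdivrMr// ler_wpM2l ?(ltW e0)//.
by rewrite ler_nat.
Qed.

Lemma max_variation_enorm A W : ms A -> test_weight W -> enorm (flux_vec A W) <= max_variation A W.
Proof. by move=> mA hW; have := max_variation_ge mA hW (refinement_self mA hW); rewrite /variation big_seq1. Qed.

(** As the inverse of 0 is 0, a piece with vanishing derivative gets direction 0; [dir_le1] and
    [dot_self_dir] cover this case. *)
Definition dir (a : 'rV[R]_n) := (enorm a)^-1 *: a.

Lemma dotZl (k : R) (a b : 'rV[R]_n) : dot (k *: a) b = k * dot a b.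
Proof. by rewrite dotC dotZ (dotC b). Qed.

Lemma dir_le1 a : dot (dir a) (dir a) <= 1.
Proof.
rewrite /dir dotZ dotZl -enorm_sq; have [->|nz] := eqVneq (enorm a) 0; first by rewrite invr0 mul0r ler01.
by have -> : (enorm a)^-1 * ((enorm a)^-1 * enorm a ^+ 2) = 1 by field.
Qed.

Lemma dot_self_dir a : dot a (dir a) = enorm a.
Proof.
rewrite /dir dotZ -enorm_sq; have [->|nz] := eqVneq (enorm a) 0; first by rewrite invr0 mul0r.
by field.
Qed.

(* If [dir (flux_vec A W)] nearly realises the total variation of (A, W), then
   the pieces of any refinement point in nearly the same direction. *)
Lemma refinement_dir_bound A W l v t : ms A -> test_weight W -> refinement A W l -> 0 < t ->
  \sum_(p <- l) `|flux p.1 p.2 v| <= `|dot (dir (flux_vec A W)) v| * max_variation A W + enorm v * (t * max_variation A W + (max_variation A W - enorm (flux_vec A W)) / (2 * t)).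
Proof.
move=> mA hW hl t0; set u := dir _; have JE := max_variation_ge mA hW hl.
have hm p : List.In p l -> flux p.1 p.2 v = dot (flux_vec p.1 p.2) v.
  by move=> /hl.1[mp [sp [Cp _]]]; exact: flux_dot.
have hu : \sum_(p <- l) dot (flux_vec p.1 p.2) u = enorm (flux_vec A W).
  have [sW [CW _]] := hW.
  rewrite -(dot_self_dir (flux_vec A W)) -flux_dot// (hl.2 _ (biadditive_flux u)); apply: sum_In_eq => p /hl.1[mp [sp [Cp _]]].
  by rewrite flux_dot.
apply: (@le_trans _ _ (\sum_(p <- l) (`|dot u v| * enorm (flux_vec p.1 p.2) + enorm v * (t * enorm (flux_vec p.1 p.2) + (enorm (flux_vec p.1 p.2) - dot (flux_vec p.1 p.2) u) / (2 * t))))).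
  by apply: sum_In_le => p /hm ->; apply: dot_dir => //; exact: dir_le1.
rewrite big_split /= -!mulr_sumr big_split /= -mulr_sumr -mulr_suml sumrB hu -/(variation l).
have t2 : 0 < (2 * t)^-1 by rewrite invr_gt0 mulr_gt0.
by rewrite lerD ?ler_wpM2l ?enorm_ge0 ?lerD ?ler_wpM2l ?(ltW t0) ?ler_wpM2r ?(ltW t2) ?lerB.
Qed.

Lemma dil_word_prod (r : R) s : 0 < r -> carnot_dil r (word_prod E s) = word_prod E [seq r *: v | v <- s] :> G.
Proof.
move=> r0; have [[hm _] _] := @carnot_dilP R G r r0.
elim: s => [|v s IH] /=; last by rewrite hm (he_dil hE v r0) IH.
by have := hm 1%g 1%g; rewrite mulg1 => /(congr1 (fun x => (carnot_dil r 1)^-1 * x)%g); rewrite mulKg mulVg => <-.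
Qed.

(** Two losses per word: its cost in the direction of the piece, and its length times the failure of
    that direction to realise the variation. *)
Lemma word_rate_le A W s t : ms A -> test_weight W -> 0 < t ->
  rate_le A W (fun r => carnot_dil r (word_prod E s)) (cost (dir (flux_vec A W)) s * max_variation A W +
    (\sum_(v <- s) enorm v) * (t * max_variation A W + (max_variation A W - enorm (flux_vec A W)) / (2 * t))).
Proof.
move=> mA hW t0 eta eta0.
have [|r0 r00 h] := @rate_le_word A W s (fun v => `|dot (dir (flux_vec A W)) v| * max_variation A W + enorm v * (t * max_variation A W + (max_variation A W - enorm (flux_vec A W)) / (2 * t))) mA hW _ eta eta0.
  by move=> v; apply: flow_rate_le => // l hl; exact: refinement_dir_bound.
exists r0 => // r rr; have := h r rr; rewrite big_split /= -!mulr_suml -/(cost _ _).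
by move: rr => /andP[rp _]; rewrite dil_word_prod.
Qed.

(** Order of choices: the admissible cost, the list [F], the bound [M] on the lengths of its words,
    [t], and last the defect of the cut. [F] has to be finite before [t] is fixed, because the
    directions of the pieces, and with them the words used, depend on the cut. Each source of error
    receives [eta / 4]. *)
Theorem comm_rate_le c W : commutator_subgroup G c -> test_weight W -> rate_le setT W (fun r => carnot_dil r c) 0.
Proof.
move=> hc hW eta eta0; have mT := mf_T mf.
have eta4 : 0 < eta / 4 by rewrite divr_gt0.
have J0 : 0 <= max_variation setT W := le_trans (enorm_ge0 _) (max_variation_enorm mT hW).
have J1 : 0 < max_variation setT W + 1 by rewrite ltr_wpDl.
have e20 : 0 < eta / 4 / (max_variation setT W + 1) by rewrite divr_gt0.
have [F hF] := words_unif hE hc e20.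
pose N s := \sum_(v <- s) enorm v; pose M := \sum_(s <- F) N s.
have N0 s : 0 <= N s by apply: sumr_ge0 => v _; exact: enorm_ge0.
have M0 : 0 <= M by exact: sumr_ge0.
have M1 : 0 < M + 1 by rewrite ltr_wpDl.
have NM s : List.In s F -> N s <= M.
  rewrite /M; elim: F {hF M M0 M1} => [|s' F IH] //= [->|/IH h]; rewrite big_cons; first by rewrite lerDl sumr_ge0.
  by apply: (le_trans h); rewrite lerDr.
pose t := eta / 4 / ((M + 1) * (max_variation setT W + 1)).
have t0 : 0 < t by rewrite divr_gt0// mulr_gt0.
have e10 : 0 < eta / 4 * (2 * t) / (M + 1) by rewrite divr_gt0// mulr_gt0// mulr_gt0.
have [l hl hJ] := max_variation_near mT hW e10.
pose gap (p : set T * (G -> R)) := max_variation p.1 p.2 - enorm (flux_vec p.1 p.2).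
pose b p := eta / 4 / (max_variation setT W + 1) * max_variation p.1 p.2 + M * (t * max_variation p.1 p.2 + gap p / (2 * t)).
have t2 : 0 < (2 * t)^-1 by rewrite invr_gt0 mulr_gt0.
have hb p : List.In p l -> rate_le p.1 p.2 (fun r => carnot_dil r c) (b p).
  move=> /hl.1[mp hp]; have g0 : 0 <= gap p by rewrite subr_ge0; exact: max_variation_enorm.
  have Jp : 0 <= max_variation p.1 p.2 := le_trans (enorm_ge0 _) (max_variation_enorm mp hp).
  have [|s [sF <- cs]] := hF (dir (flux_vec p.1 p.2)).
    apply: rV_norm_le => // i; apply: (le_trans (coord_enorm _ _)).
    by rewrite -(@ler_sqr _ (enorm _)) ?nnegrE ?enorm_ge0// enorm_sq expr1n dir_le1.
  apply: rate_le_mono (word_rate_le s mp hp t0); apply: lerD; first exact: ler_wpM2r.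
  apply: ler_wpM2r; last exact: NM.
  by apply: addr_ge0; apply: mulr_ge0 => //; exact: ltW.
have := rate_le_ref hl hb; move=> /(_ _ eta4)[r0 r00 h]; exists r0 => // r rr.
apply: (le_trans (h r rr)); move: rr => /andP[/ltW r1 _]; rewrite ler_wpM2l//.
have hS := max_variation_super mT hW hl.
have hg : \sum_(p <- l) gap p <= eta / 4 * (2 * t) / (M + 1).
  rewrite /gap sumrB -/(variation l) lerBlDr; apply: (le_trans hS).
  by rewrite -lerBlDl.
rewrite /b big_split /= -!mulr_sumr big_split /= -mulr_sumr -mulr_suml.
have b1 : eta / 4 / (max_variation setT W + 1) * \sum_(p <- l) max_variation p.1 p.2 <= eta / 4.
  rewrite mulrAC ler_pdivrMr// ler_wpM2l ?(ltW eta4)//.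
  by apply: (le_trans hS); rewrite lerDl.
have b2 : M * (t * \sum_(p <- l) max_variation p.1 p.2) <= eta / 4.
  apply: (@le_trans _ _ ((M + 1) * (t * (max_variation setT W + 1)))).
    apply: ler_pM => //; [by rewrite mulr_ge0 ?(ltW t0)//; apply: sum_In_ge0 => p /hl.1[mp hp]; exact: le_trans (enorm_ge0 _) (max_variation_enorm mp hp)|by rewrite lerDl|].
    by apply: ler_wpM2l; [exact: ltW|apply: (le_trans hS); rewrite lerDl].
  rewrite /t; have -> : (M + 1) * (eta / 4 / ((M + 1) * (max_variation setT W + 1)) * (max_variation setT W + 1)) = eta / 4 by field; rewrite !gt_eqF.
  by [].
have b3 : M * ((\sum_(p <- l) gap p) / (2 * t)) <= eta / 4.
  apply: (@le_trans _ _ (M * (eta / 4 * (2 * t) / (M + 1) / (2 * t)))).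
    by rewrite ler_wpM2l// ler_wpM2r ?(ltW t2).
  have -> : M * (eta / 4 * (2 * t) / (M + 1) / (2 * t)) = M / (M + 1) * (eta / 4) by field; rewrite !gt_eqF.
  by rewrite ler_piMl ?(ltW eta4)// ler_pdivrMr// mul1r lerDl.
rewrite add0r mulrDr; move: b1 b2 b3; move: (_ * \sum_(p <- l) max_variation p.1 p.2) (M * (t * _)) (M * (_ / _)) => x y z *; lra.
Qed.

(** * Blowups at generic points *)

(** On words the dilation scales the letters, so $r \mapsto \delta_r g$ extends continuously to $r =
    0$ with value 1. *)
Lemma dil_near g (V : set G) : nbhs 1%g V -> exists2 r0, 0 < r0 & forall r, 0 < r < r0 -> V (carnot_dil r g).
Proof.
have [s <-] := he_full hE g => nV.
have c : continuous (fun r : R => word_prod E [seq r *: v | v <- s]).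
  elim: s => [|v s IH] /=; first by move=> r; exact: cvg_cst.
  by apply: mul_cont2 => //; exact: (he_cont hE).
have P0 : word_prod E [seq 0 *: v | v <- s] = 1%g.
  by elim: s {nV c} => [|v s IH] //=; rewrite he0 mul1g.
have := c 0; rewrite /continuous_at P0 => /(_ _ nV)/nbhs_ballP[r /= r0 h].
exists r => // t /andP[t0 tr]; rewrite dil_word_prod//; apply: h.
by rewrite -ball_normE /= sub0r normrN gtr0_norm.
Qed.

Lemma dil_d r x s : 0 < r -> d setT x (x * carnot_dil r (word_prod E s))%g <= K * (\sum_(v <- s) `|v|) * r.
Proof.
move=> r0; rewrite dil_word_prod//; apply: (le_trans (d_word _ _)).
rewrite big_map -mulrA ler_wpM2l// mulrC mulr_sumr; apply: ler_sum => v _.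
by rewrite normrZ gtr0_norm.
Qed.

(** Otherwise the sum would be at least [r / (k + 1)] throughout [O], against a bump weight living
    there; but each of its [k] terms has average $o(r)$. The base points [tg l] occur because the
    blowup is tested at many points. *)
Lemma dense_step (tg tc : nat -> G) (k : nat) (O : set G) : (forall l, commutator_subgroup G (tc l)) -> open O -> O !=set0 ->
  exists2 z, O z & exists2 r, 0 < r < k.+1%:R^-1 &
    \sum_(l < k) d setT (z * carnot_dil r (tg l))%g (z * (carnot_dil r (tg l) * carnot_dil r (tc l)))%g < r / k.+1%:R.
Proof.
move=> htc oO [x0 Ox0]; have [W [S [sW W01 W1 cS [SO WS]]]] := bump_G oO Ox0.
have W0 x : 0 <= W x by have /andP[] := W01 x.
have CW : Cc W.
  split; first exact: smooth_cont.
  by exists S => // x; apply: contra_neqP => /WS.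
have hW : test_weight W by split.
have LW : 0 < L W by apply: (haar_gt0 hL (x := x0)) => //; rewrite (nbhs_singleton W1) ltr01.
have k0 : (0 : R) < k.+1%:R by rewrite ltr0n.
(* One factor [k.+1] matches the bound to be contradicted, the other beats the number [k] of
   terms. *)
pose eta := L W / k.+1%:R / k.+1%:R; have eta0 : 0 < eta by rewrite !divr_gt0.
have mT := mf_T mf.
have /choice[r_ hr_] : forall l : 'I_k, exists r0, 0 < r0 /\ forall r, 0 < r < r0 ->
    L (fun x => W x * d setT (x * carnot_dil r (tg l))%g (x * (carnot_dil r (tg l) * carnot_dil r (tc l)))%g) <= r * eta.
  move=> l; have [s es] := he_full hE (tc l).
  have M0 : 0 <= K * \sum_(v <- s) `|v| by rewrite mulr_ge0// sumr_ge0.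
  have [|r0 r00 h] := rate_le_shift mT hW M0 (dil_near (tg l)) _ (comm_rate_le (htc l) hW) eta0.
    by move=> r x rr; rewrite -es; exact: dil_d.
  by exists r0; split=> // r /h; rewrite add0r.
have [r1 r10 hr1] := fin_min (fun l => (hr_ l).1).
have k1 : 0 < k.+1%:R^-1 :> R by rewrite invr_gt0.
pose r := Num.min r1 k.+1%:R^-1 / 2.
have m0 : 0 < Num.min r1 k.+1%:R^-1 by rewrite lt_min r10.
have r0 : 0 < r by rewrite divr_gt0.
have : r < Num.min r1 k.+1%:R^-1 by rewrite ltr_pdivrMr// ltr_pMr// ltr1n.
rewrite lt_min => /andP[rr1 rk].
pose S' z := \sum_(l < k) d setT (z * carnot_dil r (tg l))%g (z * (carnot_dil r (tg l) * carnot_dil r (tc l)))%g.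
apply: contrapT => hno.
have big z : O z -> r / k.+1%:R <= S' z.
  by move=> Oz; rewrite leNgt; apply/negP => h; apply: hno; exists z => //; exists r => //; rewrite r0 rk.
have Cd l : Cc (fun x => W x * d setT (x * carnot_dil r (tg l))%g (x * (carnot_dil r (tg l) * carnot_dil r (tc l)))%g).
  by apply: Cc_mull => //; apply: d_cont => //; exact: mulR_cont.
have e1 : L (fun x => W x * S' x) <= k%:R * (r * eta).
  have -> : (fun x => W x * S' x) = (fun x => \sum_(l <- index_enum 'I_k) W x * d setT (x * carnot_dil r (tg l))%g (x * (carnot_dil r (tg l) * carnot_dil r (tc l)))%g).
    by apply/funext => x; rewrite /S' mulr_sumr.
  rewrite (@haar_list _ _ _ L hL _ _ _ W CW); last by move=> l _; exact: Cd.
  apply: (@le_trans _ _ (\sum_(l < k) r * eta)); last by rewrite sumr_const card_ord mulr_natl.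
  apply: ler_sum => l _; apply: (hr_ l).2; rewrite r0.
  by apply: lt_le_trans rr1 _; exact: hr1.
have e2 : r / k.+1%:R * L W <= L (fun x => W x * S' x).
  rewrite -haarZ//; apply: haar_le => //; first exact: Cc_scale.
    have -> : (fun x => W x * S' x) = (fun x => \sum_(l <- index_enum 'I_k) W x * d setT (x * carnot_dil r (tg l))%g (x * (carnot_dil r (tg l) * carnot_dil r (tc l)))%g).
      by apply/funext => x; rewrite /S' mulr_sumr.
    by apply: (Cc_list CW) => l _; exact: Cd.
  move=> x; have [Sx|Sx] := pselect (S x); last by rewrite WS// mulr0 mul0r.
  by rewrite mulrC ler_wpM2l// big//; exact: SO.
have := le_trans e2 e1.
have -> : k%:R * (r * eta) = k%:R / k.+1%:R * (r / k.+1%:R * L W) by rewrite /eta; ring.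
rewrite -[leLHS]mul1r ler_pM2r; last by rewrite !mulr_gt0.
by rewrite ler_pdivlMr// mul1r ler_nat ltnn.
Qed.

(** For each [k] the good points form an open set, the inequality being strict, and a dense one by
    [dense_step]. *)
Lemma good_point (tg tc : nat -> G) : (forall l, commutator_subgroup G (tc l)) -> exists z, forall k : nat,
  exists2 r : R, 0 < r < k.+1%:R^-1 & forall l, (l < k)%N -> rescaled z r (d setT) (tg l) (tg l * tc l)%g <= k.+1%:R^-1.
Proof.
move=> htc; have mT := mf_T mf.
pose A (k : nat) := [set z : G | exists2 r : R, 0 < r < k.+1%:R^-1 &
    \sum_(l < k) d setT (z * carnot_dil r (tg l))%g (z * (carnot_dil r (tg l) * carnot_dil r (tc l)))%g < r / k.+1%:R].
have [||z hz] := @lie_baire R n G A.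
- move=> k; rewrite openE => z [r rk hs].
  have c : continuous (fun z : G => \sum_(l < k) d setT (z * carnot_dil r (tg l))%g (z * (carnot_dil r (tg l) * carnot_dil r (tc l)))%g).
    elim: (index_enum _) => [|l s IH].
      rewrite (_ : (fun _ => _) = fun=> 0); first by move=> x; exact: cvg_cst.
      by apply/funext => x; rewrite big_nil.
    rewrite (_ : (fun _ => _) = fun x => d setT (x * carnot_dil r (tg l))%g (x * (carnot_dil r (tg l) * carnot_dil r (tc l)))%g + \sum_(l <- s) d setT (x * carnot_dil r (tg l))%g (x * (carnot_dil r (tg l) * carnot_dil r (tc l)))%g).
      move=> x; apply: cvgD; last exact: IH.
      by apply: (@d_cont setT (fun x => x * carnot_dil r (tg l))%g (fun x => x * (carnot_dil r (tg l) * carnot_dil r (tc l)))%g) => //; exact: mulR_cont.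
    by apply/funext => x; rewrite big_cons.
  have h := c z _ (open_nbhs_nbhs (conj (@open_lt R (r / k.+1%:R)) hs)).
  by near=> y; exists r => //; near: y; exact: h.
- by move=> k O oO O0; have [z Oz hz] := dense_step tg k htc oO O0; exists z.
exists z => k; have [r rk hs] := hz k; exists r => // l lk; have /andP[r0 _] := rk.
have [[hm _] _] := @carnot_dilP R G r r0.
rewrite /rescaled hm ler_pdivrMl//; apply: le_trans (ltW hs).
by rewrite (bigD1 (Ordinal lk))//= lerDl sumr_ge0// => i _; exact: (mf_ge0 mf).
Unshelve. all: by end_near.
Qed.

Lemma blowup_exists : exists z rho, blowup_metric z (d setT) rho /\
  forall x y c, commutator_subgroup G c -> rho x (y * c)%g = rho x y.
Proof.
have mT := mf_T mf.
have [g_ hg] := @dense_seq R n G.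
pose tau l : nat * nat * nat := odflt (0%N, 0%N, 0%N) (unpickle l).
pose tg l := g_ (tau l).1.1; pose tc l := [~ g_ (tau l).1.2, g_ (tau l).2]%g.
have htc l : commutator_subgroup G (tc l).
  by move=> S [_ hS]; apply: hS; exists (g_ (tau l).1.2) => //; exists (g_ (tau l).2).
have [z hz] := good_point tg htc.
have /choice[r_ hr_] : forall k : nat, exists r : R, 0 < r < k.+1%:R^-1 /\
    forall l, (l < k)%N -> rescaled z r (d setT) (tg l) (tg l * tc l)%g <= k.+1%:R^-1.
  by move=> k; have [r rk h] := hz k; exists r.
have r0 k : 0 < r_ k by have [/andP[]] := hr_ k.
have r1 k : r_ k < k.+1%:R^-1 by have [/andP[]] := hr_ k.
pose De k := rescaled z (r_ k) (d setT).
have rV k : 0 <= (r_ k)^-1 by rewrite invr_ge0 ltW.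
have De0 k x : De k x x = 0 by rewrite /De /rescaled (mf_refl mf) ?mulr0.
have De_ge0 k x y : 0 <= De k x y by rewrite mulr_ge0//; exact: (mf_ge0 mf).
have De_sym k x y : De k x y = De k y x by rewrite /De /rescaled (mf_sym mf).
have De_tri k x y w : De k x w <= De k x y + De k y w.
  by rewrite /De /rescaled -mulrDr ler_wpM2l//; exact: (mf_tri mf).
have De_word k x s : De k x (x * word_prod E s)%g <= K * \sum_(v <- s) `|v|.
  have [[hm _] _] := @carnot_dilP R G (r_ k) (r0 k).
  by rewrite /De /rescaled hm mulgA ler_pdivrMl// mulrC; exact: dil_d.
(* Along an ultrafilter all rescaled distances converge at once; a genuine sequence of scales is
   extracted only at the end. *)
have [U [UU FU]] := ultraFilterLemma (@eventually_filter).
have PU : ProperFilter U by exact: ultra_proper.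
have /choice[rh hrh] : forall p : G * G, exists l : R, forall e, 0 < e -> \forall k \near U, `|l - De k p.1 p.2| <= e.
  move=> [x y] /=; have [s es] := he_full hE (x^-1 * y)%g.
  have [|l [_ hl]] := @ultra_lim R nat U UU (fun k => De k x y) 0 (K * \sum_(v <- s) `|v|); last by exists l.
  by apply: filterE => k; rewrite De_ge0 /= -[y](mulVKg x) -es.
pose rho x y := rh (x, y).
have hrho x y e : 0 < e -> \forall k \near U, `|rho x y - De k x y| <= e by exact: hrh.
have lim_le x y b : (forall e, 0 < e -> \forall k \near U, De k x y <= b + e) -> rho x y <= b.
  move=> h; apply/ler_addgt0Pr => e e0; have e2 : 0 < e / 2 by rewrite divr_gt0.
  have h1 := h _ e2; have h2 := hrho x y _ e2.
  have [k []] : exists k, De k x y <= b + e / 2 /\ `|rho x y - De k x y| <= e / 2.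
    by apply: (@filter_ex _ U); apply: filterI.
  by rewrite ler_norml => a1 /andP[_ a2]; move: a1 a2; move: (De _ _ _) (rho _ _) => u v; lra.
have lim_ge x y b : (forall e, 0 < e -> \forall k \near U, b <= De k x y + e) -> b <= rho x y.
  move=> h; apply/ler_addgt0Pr => e e0; have e2 : 0 < e / 2 by rewrite divr_gt0.
  have h1 := h _ e2; have h2 := hrho x y _ e2.
  have [k []] : exists k, b <= De k x y + e / 2 /\ `|rho x y - De k x y| <= e / 2.
    by apply: (@filter_ex _ U); apply: filterI.
  by rewrite ler_norml => a1 /andP[a2 _]; move: a1 a2; move: (De _ _ _) (rho _ _) => u v; lra.
have rho_ge0 x y : 0 <= rho x y.
  by apply: lim_ge => e e0; apply: filterE => k; rewrite addr_ge0// ltW.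
have rho0 x : rho x x = 0.
  apply/eqP; rewrite eq_le rho_ge0 andbT; apply: lim_le => e e0; apply: filterE => k.
  by rewrite De0 add0r ltW.
have near_le x y e : 0 < e -> \forall k \near U, De k x y <= rho x y + e.
  move=> /(hrho x y) h; near=> k; have : `|rho x y - De k x y| <= e by near: k.
  by rewrite ler_norml => /andP[+ _]; move: (rho _ _) (De _ _ _) => u v; lra.
have rho_sym_le x y : rho x y <= rho y x.
  by apply: lim_le => e /(near_le y x) h; near=> k; rewrite De_sym; near: k.
have rho_sym x y : rho x y = rho y x by apply/eqP; rewrite eq_le !rho_sym_le.
have rho_tri x y w : rho x w <= rho x y + rho y w.
  apply: lim_le => e e0; have e2 : 0 < e / 2 by rewrite divr_gt0.
  have h1 := near_le x y _ e2; have h2 := near_le y w _ e2.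
  near=> k; have a1 : De k x y <= rho x y + e / 2 by near: k.
  have a2 : De k y w <= rho y w + e / 2 by near: k.
  apply: (le_trans (De_tri k x y w)); apply: (le_trans (lerD a1 a2)).
  by rewrite addrACA -splitr.
have rho_word x s : rho x (x * word_prod E s)%g <= K * \sum_(v <- s) `|v|.
  by apply: lim_le => e e0; apply: filterE => k; apply: (le_trans (De_word k x s)); rewrite lerDl ltW.
(* Equicontinuity: the bound along words scales exactly with the dilation, so the modulus is the
   same for all [k]. *)
have small e : 0 < e -> \forall w \near (1%g : G), forall x, (forall k, De k x (x * w)%g <= e) /\ rho x (x * w)%g <= e.
  move=> e0; have K1 : 0 < K + 1 by rewrite ltr_wpDl.
  have eK : 0 < e / (K + 1) by rewrite divr_gt0.
  have hs := he_small hE eK.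
  near=> w => x; have [s [<- hw]] : exists s, word_prod E s = w /\ \sum_(v <- s) `|v| <= e / (K + 1) by near: w.
  have b : K * \sum_(v <- s) `|v| <= e.
    apply: (@le_trans _ _ (K * (e / (K + 1)))); first exact: ler_wpM2l.
    by rewrite mulrA ler_pdivrMr// mulrC ler_wpM2l ?(ltW e0)// lerDl.
  by split=> [k|]; apply: le_trans b.
have rho_cont (a b : G -> G) : continuous a -> continuous b -> continuous (fun x => rho (a x) (b x)).
  apply: pm_cont => // e /small h.
  near=> w => x; have : forall x, (forall k, De k x (x * w)%g <= e) /\ rho x (x * w)%g <= e by near: w.
  by case/(_ x).
have U_ge m : \forall k \near U, (m <= k)%N by apply: FU; exists m.
have U_inv (e : R) : 0 < e -> \forall k \near U, k.+1%:R^-1 <= e.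
  move=> e0; apply: FU; have := near_infty_natSinv_lt (PosNum e0).
  by move=> h; near=> k; apply: ltW; near: k.
have rho_test i j k : rho (g_ i) (g_ i * [~ g_ j, g_ k])%g = 0.
  apply/eqP; rewrite eq_le rho_ge0 andbT; apply: lim_le => e /U_inv h.
  have h' := U_ge (pickle (i, j, k)).+1.
  near=> m; rewrite add0r.
  have m1 : (pickle (i, j, k) < m)%N by near: m.
  have m2 : m.+1%:R^-1 <= e by near: m.
  have [_ /(_ _ m1)] := hr_ m; rewrite /tg /tc /tau pickleK /= => /le_trans; exact.
(* Continuity extends the vanishing from the dense sequence, one variable at a time. *)
have rho_comm x y w : rho x (x * [~ y, w])%g = 0.
  have c1 (a : G) : continuous (fun _ : G => a) by move=> t; exact: cvg_cst.
  have ci : continuous (fun t : G => t) by move=> t; exact: cvg_id.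
  move: x; apply: (dense_zero hg); first by apply: rho_cont => //; apply: mul_cont2 => //; apply: comm_cont.
  move=> i; move: y; apply: (dense_zero hg); first by apply: rho_cont => //; apply: mul_cont2 => //; apply: comm_cont.
  move=> j; move: w; apply: (dense_zero hg); first by apply: rho_cont => //; apply: mul_cont2 => //; apply: comm_cont.
  by move=> k; exact: rho_test.
(* The quantifier over all [y] makes these elements [c] a subgroup: products and inverses are
   handled by changing the base point. *)
have rho_inv c : commutator_subgroup G c -> forall y, rho y (y * c)%g = 0.
  move=> hc; apply: (hc [set c | forall y, rho y (y * c)%g = 0]); split; last by move=> _ [a _ [b _ <-]].
  split=> /=.
  - by move=> y; rewrite mulg1.
  - move=> a b ha hb y; apply/eqP; rewrite eq_le rho_ge0 andbT; apply: (le_trans (rho_tri _ (y * a)%g _)).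
    by rewrite ha mulgA hb addr0.
  - by move=> a ha y; rewrite rho_sym -{2}[y](mulgVK a) ha.
exists z, rho; split; last first.
  move=> x y c hc; have h := rho_inv c hc y; apply/eqP; rewrite eq_le; apply/andP; split.
    by apply: (le_trans (rho_tri _ y _)); rewrite h addr0.
  by apply: (le_trans (rho_tri _ (y * c)%g _)); rewrite (rho_sym _ y) h addr0.
split; first by split.
(* From an index [k0] this selects one of smaller scale at which the limit is attained up to
   [1 / (j + 1)] on the first [j] dense points. Iteration yields decreasing scales. *)
have /choice[f hf] : forall p : nat * nat, exists k, [/\ r_ k < r_ p.2, r_ k < p.1.+1%:R^-1 &
    forall a b, (a < p.1)%N -> (b < p.1)%N -> `|rho (g_ a) (g_ b) - De k (g_ a) (g_ b)| <= p.1.+1%:R^-1].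
  move=> [j k0] /=; have j0 : 0 < j.+1%:R^-1 :> R by rewrite invr_gt0.
  have m0 : 0 < Num.min (r_ k0) j.+1%:R^-1 / 2 by rewrite divr_gt0// lt_min r0.
  have h1 := U_inv _ m0.
  have h2 : \forall k \near U, forall p : 'I_j * 'I_j, `|rho (g_ p.1) (g_ p.2) - De k (g_ p.1) (g_ p.2)| <= j.+1%:R^-1.
    by apply: filter_forall => p; exact: hrho.
  have [k [q1 q2]] : exists k, k.+1%:R^-1 <= Num.min (r_ k0) j.+1%:R^-1 / 2 /\ forall p : 'I_j * 'I_j, `|rho (g_ p.1) (g_ p.2) - De k (g_ p.1) (g_ p.2)| <= j.+1%:R^-1.
    by apply: (@filter_ex _ U); apply: filterI.
  have : r_ k < Num.min (r_ k0) j.+1%:R^-1.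
    by apply: lt_le_trans (r1 k) _; apply: (le_trans q1); rewrite ler_pdivrMr// ler_peMr ?ler1n// ltW// lt_min r0.
  rewrite lt_min => /andP[s1 s2]; exists k; split=> // a b aj bj; exact: (q2 (Ordinal aj, Ordinal bj)).
pose kap := nat_rect (fun _ => nat) (f (0%N, 0%N)) (fun j k => f (j.+1, k)).
have kapP j : r_ (kap j) < j.+1%:R^-1 /\ forall a b, (a < j)%N -> (b < j)%N ->
    `|rho (g_ a) (g_ b) - De (kap j) (g_ a) (g_ b)| <= j.+1%:R^-1.
  by case: j => [|j]; [have [] := hf (0%N, 0%N)|have [] := hf (j.+1, kap j)].
exists (fun j => r_ (kap j)); split.
- by move=> j.
- by apply/decreasing_seqP => j; have [] := hf (j.+1, kap j).
- apply/cvgrPdist_le => e e0; have h := near_infty_natSinv_lt (PosNum e0).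
  near=> j; rewrite sub0r normrN gtr0_norm//; apply: (le_trans (ltW (kapP j).1)).
  by apply: ltW; near: j.
move=> [p1 p2].
have [C1 [cC1 _ nC1]] := compact_nbhd openT (Logic.I : setT p1).
have [C2 [cC2 _ nC2]] := compact_nbhd openT (Logic.I : setT p2).
exists (C1 `*` C2); first by exists (C1, C2).
move=> P /uniform_nbhs[En [entE subP]].
have [e /= e0 hEn] : exists2 e : R, 0 < e & forall x y : R, ball x e y -> En (x, y).
  by move: entE; rewrite -entourage_from_ballE => -[e /= e0 h]; exists e => // x y xy; exact: (h (x, y)).
(* Each of two points is replaced by a dense one at cost [2 * (e / 10)], in the limit and in the
   rescaled metric; with one error of convergence this makes [9 * (e / 10)]. *)
have e10 : 0 < e / 10 by rewrite divr_gt0.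
have cover (C : set G) : compact C -> exists s : seq nat, forall y, C y -> exists a, List.In a s /\
    ((forall k, De k y (g_ a) <= 2 * (e / 10)) /\ rho y (g_ a) <= 2 * (e / 10)).
  move=> cC; apply: (compact_seq cC) => y _.
  have hn := @near_transl _ _ _ (fun y w => (forall k, De k y w <= e / 10) /\ rho y w <= e / 10) y (small _ e10).
  have [V [oV Vy] hV] : exists2 B, open_nbhs y B & B `<=` [set w | (forall k, De k y w <= e / 10) /\ rho y w <= e / 10].
    by move: hn; rewrite /prop_near1 nbhsE.
  have [|a Va] := hg V oV; first by exists y.
  have [ha1 ha2] := hV _ Va; exists a; near=> w.
  have [hw1 hw2] : (forall k, De k y w <= e / 10) /\ rho y w <= e / 10 by near: w.
  have two : e / 10 + e / 10 = 2 * (e / 10) by ring.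
  rewrite -two; split=> [k|].
    by apply: (le_trans (De_tri k w y _)); rewrite De_sym lerD.
  by apply: (le_trans (rho_tri w y _)); rewrite rho_sym lerD.
have [s1 hs1] := cover _ cC1; have [s2 hs2] := cover _ cC2.
have bnd (s : seq nat) : exists J, forall a, List.In a s -> (a < J)%N.
  elim: s => [|b s [J hJ]]; first by exists 0%N.
  by exists (maxn b.+1 J) => a /= [<-|/hJ h]; rewrite leq_max ?leqnn// h orbT.
have [J1 hJ1] := bnd s1; have [J2 hJ2] := bnd s2.
have hinv := near_infty_natSinv_lt (PosNum e10).
near=> j; apply: subP => -[y w] [/= /hs1[a [/hJ1 aJ [a1 a2]]] /hs2[b [/hJ2 bJ [b1 b2]]]]; apply: hEn.
have jJ1 : (J1 <= j)%N by near: j; exists J1.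
have jJ2 : (J2 <= j)%N by near: j; exists J2.
have jinv : j.+1%:R^-1 < e / 10 by near: j.
have := (kapP j).2 a b (leq_trans aJ jJ1) (leq_trans bJ jJ2).
move=> /le_trans /(_ (ltW jinv)) k3; rewrite -ball_normE /= -/(De (kap j) y w).
have a1' k : De k (g_ a) y <= 2 * (e / 10) by rewrite De_sym.
have b1' k : De k (g_ b) w <= 2 * (e / 10) by rewrite De_sym.
have l1 := le_trans (pm_quad (De_sym (kap j)) (De_tri (kap j)) (g_ a) (g_ b) y w) (lerD (a1' (kap j)) (b1' (kap j))).
have l2 := le_trans (pm_quad rho_sym rho_tri y w (g_ a) (g_ b)) (lerD a2 b2).
have l3 := le_trans (ler_distD (De (kap j) (g_ a) (g_ b)) _ _) (lerD k3 l1).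
apply: (le_lt_trans (ler_distD (rho (g_ a) (g_ b)) _ _)); apply: (le_lt_trans (lerD l2 l3)).
rewrite [ltLHS](_ : _ = 9 * (e / 10)); last by ring.
by rewrite mulrA ltr_pdivrMr// mulrC ltr_pM2l// ltr_nat.
Unshelve. all: by end_near.
Qed.
End Fam.

Theorem theorem1p4 (R : realType) (G : carnotGroup R) :
  exists k : nat, forall f : G -> L1 R, carnot_lipschitz f ->
  exists rho : G -> G -> R,
    iterated_blowup_metric k (pullback_metric f) rho /\
    forall x y z : G, commutator_subgroup G z -> rho x (y * z)%g = rho x y.
Proof.
exists 1%N => f [Lf Lf0 hf].
have [E [D hE]] := @horizontal_exp_exists R G; have [L hL] := @haar_exists R _ G.
have [K K0 hK] := he_dist hE.
(* The Carnot metric enters the argument only through this bound along horizontal exponentials. *)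
have Kd x v : dA setT (f x) (f (x * E v)%g) <= Lf * K * `|v|.
  rewrite -dA_T -lee_fin; apply: (le_trans (hf _ _)).
  by rewrite -mulrA EFinM lee_wpmul2l// lee_fin.
have mf := measured_family_L1 f.
have [z [rho [hrho hinv]]] := blowup_exists hE hL mf (mulr_ge0 Lf0 K0) Kd.
have de : pullback_metric f = (fun x y => dA setT (f x) (f y)).
  by apply/funext => x; apply/funext => y; rewrite /pullback_metric dA_T.
have mT := mf_T mf.
exists rho; split=> //; exists (fun i => if i is 0%N then pullback_metric f else rho); split=> //.
- move=> [_|i _]; last by have [] := hrho.
  rewrite de; split=> [x|x y|x y|x y w].
  + exact: (mf_refl mf).
  + exact: (mf_ge0 mf).
  + exact: (mf_sym mf).
  + exact: (mf_tri mf).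
- by case=> // _; exists z; rewrite de.
Qed.
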